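(* Let ${\rm M}^{\rm spl}_I$ be the splitting model over $O_F$ for signature $(n-1,1)$ and strongly non-special $I=\{\ell\}$, $\tau:{\rm M}^{\rm spl}_I\to{\rm M}^\wedge_I$ the forgetful morphism, and $*$ the worst point, as defined in the context. The fiber $\tau^{-1}( * )$ is a smooth irreducible component of the special fiber of ${\rm M}^{\rm spl}_I$ and is a projective space of dimension $n-1$ over $k$. The blow-up ${\rm M}^{\rm bl}_I$ of ${\rm M}^{\rm spl}_I$ along $\tau^{-1}( * )$ is regular and has special fiber a divisor with normal crossings. In fact, ${\rm M}^{\rm bl}_I$ is covered by open subschemes which are smooth over ${\rm Spec}(O_F[u,x,y]/(uxy-2\pi))$.
   Context: Let $F_0$ be a complete discretely valued field with ring of integers $O_{F_0}$, perfect residue field $k$ of characteristic $\ne2$ and uniformizer $\pi_0$; $F/F_0$ a ramified quadratic extension with uniformizer $\pi$, $\pi^2=\pi_0$, ring of integers $O_F$, and $a\mapsto\bar a$ the nontrivial element of ${\rm Gal}(F/F_0)$. Let $V$ be an $F$-vector space of dimension $n>3$ with an $F/F_0$-hermitian form $\phi$ which is split: there is a basis $e_1,\dots,e_n$ with $\phi(ae_i,be_{n+1-j})=\bar ab\,\delta_{i,j}$ for $a,b\in F$. Put $(x,y)=\frac12{\rm Tr}_{F/F_0}(\phi(x,y))$. For $0\le i\le n-1$ let $\Lambda_i={\rm span}_{O_F}\{\pi^{-1}e_1,\dots,\pi^{-1}e_i,e_{i+1},\dots,e_n\}$. Let $m=\lfloor n/2\rfloor$ and let $I=\{\ell\}$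 be strongly non-special: $0\le\ell\le m$, with $\ell\ne0,m-1,m$ if $n=2m$, and $\ell\ne0,m$ if $n=2m+1$. The form $(\,,\,)$ induces a perfect pairing $\Lambda_{n-\ell}\times\Lambda_\ell\to O_{F_0}$. Let $t$ denote multiplication by $\pi\in O_F$ on the lattices. For an $O_F$-scheme $S$, $\Lambda_j\otimes\mathcal O_S$ means $\Lambda_j\otimes_{O_{F_0}}\mathcal O_S$, on which $\pi$ acts through $\mathcal O_S$. ${\rm M}^{\rm naive}_I$ is the projective $O_F$-scheme whose $S$-points are pairs of $O_F\otimes\mathcal O_S$-submodules $\mathcal F_\ell\subset\Lambda_\ell\otimes\mathcal O_S$, $\mathcal F_{n-\ell}\subset\Lambda_{n-\ell}\otimes\mathcal O_S$ such that (1) both are Zariski locally $\mathcal O_S$-direct summands of rank $n$; (2) the maps induced by $\Lambda_\ell\subset\Lambda_{n-\ell}\subset\pi^{-1}\Lambda_\ell$ restrict to $\mathcal F_\ell\to\mathcal F_{n-\ell}\to\pi^{-1}\mathcal F_\ell$; (3) $\mathcal F_{n-\ell}$ is the orthogonal complement of $\mathcal F_\ell$ under $(\,,\,)$; (4) $t$ has characteristic polynomial $(T+\pi)^{n-1}(T-\pi)$ on $\mathcal F_\ell$ and on $\mathcal F_{n-\ell}$. ${\rm M}^\wedge_I\subset{\rm M}^{\rm naive}_I$ is the closed subscheme where moreover $\wedge^n(t-\pi\mid\mathcal F_\kappa)=0$ and $\wedge^2(t+\pi\mid\mathcal F_\kappa)=0$ for $\kappa=\ell,n-\ell$. The splitting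 model ${\rm M}^{\rm spl}_I$ is the projective $O_F$-scheme whose $S$-points are triples $(\mathcal F_\ell,\mathcal F_{n-\ell},\mathcal G_{n-\ell})$ with $(\mathcal F_\ell,\mathcal F_{n-\ell})\in{\rm M}^\wedge_I(S)$ and $\mathcal G_{n-\ell}\subset\mathcal F_{n-\ell}$ Zariski locally an $\mathcal O_S$-direct summand of rank $1$ such that $(t+\pi)\mathcal F_{n-\ell}\subset\mathcal G_{n-\ell}$ and $(t-\pi)\mathcal G_{n-\ell}=0$. The morphism $\tau$ is $(\mathcal F_\ell,\mathcal F_{n-\ell},\mathcal G_{n-\ell})\mapsto(\mathcal F_\ell,\mathcal F_{n-\ell})$. The worst point $*$ is the $k$-point $(t\Lambda_\ell\otimes k,t\Lambda_{n-\ell}\otimes k)$ (images of $t$) of the special fiber of ${\rm M}^\wedge_I$. *)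

(* Defs.v *)
From HB Require Import structures.
From mathcomp Require Import all_boot all_order all_algebra all_field.
From mathcomp Require Import boolp classical_sets.
From mathcomp Require Import mpoly.

Set Implicit Arguments.
Unset Strict Implicit.
Unset Printing Implicit Defensive.

Import Order.TTheory GRing.Theory Num.Theory.

Local Open Scope classical_set_scope.
Local Open Scope ring_scope.

(* Schemes over a commutative ring O are handled through their functors of    *)
(* points on commutative O-algebras (Demazure-Gabriel): a scheme is a Zariski *)
(* sheaf covered by affine open subfunctors.  Test algebras are nonzero       *)
(* rings; this loses nothing, since a sheaf is a point on the zero ring.      *)

Definition invertible (A : comNzRingType) (a : A) : Prop := exists b, a * b = 1.

Definition nonzerodivisor (A : comNzRingType) (a : A) : Prop :=
  forall b, a * b = 0 -> b = 0.

Definition is_field (A : comNzRingType) : Prop :=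
  forall a : A, a != 0 -> invertible a.

Definition is_ideal (A : comNzRingType) (I : set A) : Prop :=
  [/\ I 0, forall a b, I a -> I b -> I (a + b) & forall a b, I b -> I (a * b)].

Definition ideal_span (A : comNzRingType) (X : set A) : set A :=
  smallest (@is_ideal A) X.

Definition is_prime (A : comNzRingType) (p : set A) : Prop :=
  [/\ is_ideal p, ~ p 1 & forall a b, p (a * b) -> p a \/ p b].

Definition noetherian (A : comNzRingType) : Prop :=
  forall I : set A, is_ideal I -> exists s : seq A, I = ideal_span [set` s].

Definition is_local (A : comNzRingType) : Prop :=
  is_ideal [set a : A | ~ invertible a].

Definition has_prime_chain (A : comNzRingType) (d : nat) : Prop :=
  exists p : nat -> set A,
    (forall i, (i <= d)%N -> is_prime (p i)) /\
    (forall i, (i < d)%N -> p i `<=` p i.+1 /\ ~ p i.+1 `<=` p i).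

Definition krull_dim_eq (A : comNzRingType) (d : nat) : Prop :=
  has_prime_chain A d /\ ~ has_prime_chain A d.+1.

Definition regular_system (A : comNzRingType) (s : seq A) : Prop :=
  [set a : A | ~ invertible a] = ideal_span [set` s] /\ krull_dim_eq A (size s).

Definition regular_local (A : comNzRingType) : Prop :=
  [/\ noetherian A, is_local A & exists s : seq A, regular_system s].

Definition is_localization_at (A L : comNzRingType) (p : set A)
    (g : {rmorphism A -> L}) : Prop :=
  [/\ forall a, ~ p a -> invertible (g a),
      forall x, exists a s, ~ p s /\ x * g s = g a
    & forall a, g a = 0 -> exists2 s, ~ p s & s * a = 0].

Definition regular_ring (A : comNzRingType) : Prop :=
  noetherian A /\
  forall p : set A, is_prime p ->
    exists (L : comNzRingType) (g : {rmorphism A -> L}),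
      is_localization_at p g /\ regular_local L.

Record calg (O : comNzRingType) := Calg {
  calg_ring :> comNzRingType;
  calg_str : {rmorphism O -> calg_ring} }.

Record ahom (O : comNzRingType) (A B : calg O) := AHom {
  ahom_fun :> A -> B;
  ahom_zmod : zmod_morphism ahom_fun;
  ahom_monoid : monoid_morphism ahom_fun;
  ahom_str : forall a, ahom_fun (calg_str A a) = calg_str B a }.

HB.instance Definition _ O A B (f : @ahom O A B) :=
  GRing.isZmodMorphism.Build A B (ahom_fun f) (ahom_zmod f).
HB.instance Definition _ O A B (f : @ahom O A B) :=
  GRing.isMonoidMorphism.Build A B (ahom_fun f) (ahom_monoid f).

Lemma ahom_eq O (A B : calg O) (f g : ahom A B) : f =1 g -> f = g.
Proof.
case: f g => [f f1 f2 f3] [g g1 g2 g3] /= /funext efg.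
by case: _ / efg in g1 g2 g3 *; congr AHom; apply: Prop_irrelevance.
Qed.

Definition ahom_id O (A : calg O) : ahom A A.
Proof. by exists id. Defined.

Definition ahom_comp O (A B C : calg O) (g : ahom B C) (f : ahom A B) : ahom A C.
Proof.
exists (g \o f) => [x y|| a] /=.
- by rewrite !rmorphB.
- by split => [|x y] /=; rewrite ?rmorph1 ?rmorphM.
- by rewrite !ahom_str.
Defined.

Definition as_alg O (A B : calg O) (f : ahom A B) : calg A := @Calg A B f.

Definition restr (O k : comNzRingType) (h : {rmorphism O -> k}) (R : calg k) :
  calg O := @Calg O R (calg_str R \o h).

Definition restr_hom (O k : comNzRingType) (h : {rmorphism O -> k})
  (R S : calg k) (f : ahom R S) : ahom (restr h R) (restr h S).
Proof.
apply: (@AHom O (restr h R) (restr h S) (ahom_fun f) (ahom_zmod f) (ahom_monoid f)).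
by move=> a; rewrite /= ahom_str.
Defined.

(* B = A[X_0, ..., X_(m-1)] / (rels) *)
Definition presents (A : comNzRingType) (B : calg A) (m : nat)
    (rels : seq ({mpoly A[m]})) : Prop :=
  exists b : 'I_m -> B,
    (forall y, exists p, mmap (calg_str B) b p = y) /\
    (forall p, mmap (calg_str B) b p = 0 <-> ideal_span [set` rels] p).

Definition finitely_presented (A : comNzRingType) (B : calg A) : Prop :=
  exists m rels, @presents A B m rels.

Definition square_zero_ext (A : comNzRingType) (C D : calg A) (p : ahom C D) :
    Prop :=
  (forall d, exists c, p c = d) /\
  (forall x y, p x = 0 -> p y = 0 -> x * y = 0).

Definition smooth_alg (A : comNzRingType) (B : calg A) : Prop :=
  finitely_presented B /\
  forall (C D : calg A) (p : ahom C D), square_zero_ext p ->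
    forall v : ahom B D, exists w : ahom B C, ahom_comp p w = v.

Definition etale_alg (A : comNzRingType) (B : calg A) : Prop :=
  finitely_presented B /\
  forall (C D : calg A) (p : ahom C D), square_zero_ext p ->
    forall v : ahom B D, exists! w : ahom B C, ahom_comp p w = v.

Record functor (O : comNzRingType) := Functor {
  pts :> calg O -> Type;
  fmap : forall R S : calg O, ahom R S -> pts R -> pts S;
  fmap_id : forall R (x : pts R), fmap (ahom_id R) x = x;
  fmap_comp : forall R S T (g : ahom S T) (f : ahom R S) (x : pts R),
    fmap (ahom_comp g f) x = fmap g (fmap f x) }.

Record morphism O (X Y : functor O) := Morphism {
  mor_fun :> forall R, X R -> Y R;
  mor_nat : forall R S (g : ahom R S) (x : X R),
    mor_fun (fmap g x) = fmap g (mor_fun x) }.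

Record subfunctor O (X : functor O) := Subfunctor {
  smem :> forall R, X R -> Prop;
  smem_fmap : forall R S (g : ahom R S) (x : X R), smem x -> smem (fmap g x) }.

Definition isomorphic O (X Y : functor O) : Prop :=
  exists (f : morphism X Y) (g : morphism Y X),
    (forall R (x : X R), g R (f R x) = x) /\ (forall R (y : Y R), f R (g R y) = y).

Definition Spec O (A : calg O) : functor O.
Proof.
refine (@Functor O (fun R => ahom A R) (fun R S g f => ahom_comp g f) _ _).
- by move=> R x; apply: ahom_eq.
- by move=> R S T g f x; apply: ahom_eq.
Defined.

Definition sub_functor O (X : functor O) (U : subfunctor X) : functor O.
Proof.
refine (@Functor O (fun R => {x : X R | U R x})
  (fun R S g x => exist _ (fmap g (sval x)) (smem_fmap g (svalP x))) _ _).
- by move=> R [x Ux]; apply: eq_exist; rewrite fmap_id.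
- by move=> R S T g f [x Ux]; apply: eq_exist; rewrite fmap_comp.
Defined.

Definition preim O (X Y : functor O) (f : morphism X Y) (Z : subfunctor Y) :
  subfunctor X.
Proof.
exists (fun R x => Z R (f R x)) => R S g x Zx.
by rewrite mor_nat; apply: smem_fmap.
Defined.

Definition prod_functor O (X Y : functor O) : functor O.
Proof.
refine (@Functor O (fun R => (X R * Y R)%type)
  (fun R S g x => (fmap g x.1, fmap g x.2)) _ _).
- by move=> R [x y] /=; rewrite !fmap_id.
- by move=> R S T g f [x y] /=; rewrite !fmap_comp.
Defined.

Definition base_change (O k : comNzRingType) (h : {rmorphism O -> k})
  (X : functor O) : functor k.
Proof.
refine (@Functor k (fun R => X (restr h R)) (fun R S g => fmap (restr_hom h g)) _ _).
- move=> R x; rewrite -[RHS]fmap_id; congr fmap; exact: ahom_eq.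
- move=> R S T g f x; rewrite -fmap_comp; congr fmap; exact: ahom_eq.
Defined.

Definition base_change_sub (O k : comNzRingType) (h : {rmorphism O -> k})
  (X : functor O) (Z : subfunctor X) : subfunctor (base_change h X).
Proof.
by exists (fun (R : calg k) (x : X (restr h R)) => Z (restr h R) x) => R S g x;
  apply: smem_fmap.
Defined.

(* The fiber of f over a K-valued point y, as a subfunctor of the source: the *)
(* points mapping to the image of y : Spec K -> Y.                            *)
Definition fiber O (X Y : functor O) (f : morphism X Y) (K : calg O) (y : Y K) :
  subfunctor X.
Proof.
exists (fun R x => exists h : ahom K R, f R x = fmap h y) => R S g x [h fx].
by exists (ahom_comp g h); rewrite mor_nat fx fmap_comp.
Defined.

Definition is_open O (X : functor O) (U : subfunctor X) : Prop :=
  forall R (x : X R), exists I : set R, is_ideal I /\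
    forall S (g : ahom R S), U S (fmap g x) <-> ideal_span (g @` I) 1.

(* The pullback of Z to Spec A, along u : Spec A -> X, is V(I). *)
Definition cuts_out O (X : functor O) (Z : subfunctor X) (A : calg O) (u : X A)
    (I : set A) : Prop :=
  is_ideal I /\
  forall S (g : ahom A S), Z S (fmap g u) <-> (forall a, I a -> g a = 0).

Definition is_closed O (X : functor O) (Z : subfunctor X) : Prop :=
  forall R (x : X R), exists I : set R, cuts_out Z x I.

Definition affine_open O (X : functor O) (A : calg O) (u : X A) : Prop :=
  (forall R (f g : ahom A R), fmap f u = fmap g u -> f = g) /\
  exists2 U : subfunctor X, is_open U
    & forall R (x : X R), U R x <-> exists f : ahom A R, fmap f u = x.

(* Every point of |X| lying on D has an affine open neighbourhood satisfying  *)
(* P; P also gets the morphism A -> L defining the point.                     *)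
Definition locally_at O (X : functor O) (D : forall R, X R -> Prop)
    (P : forall A (u : X A) (L : calg O), ahom A L -> Prop) : Prop :=
  forall L (x : X L), is_field L -> D L x ->
    exists A (u : X A) (f : ahom A L),
      [/\ affine_open u, fmap f u = x & P A u L f].

Definition locally_on O (X : functor O) (P : forall A, X A -> Prop) : Prop :=
  locally_at (fun R (_ : X R) => True) (fun A u _ _ => P A u).

(* The sheaf condition for a Zariski covering of Spec R by the D(f), f \in s: *)
(* a compatible family of local sections is a family on the sieve of the      *)
(* R-algebras over which some f becomes invertible.                           *)
Definition is_sheaf O (X : functor O) : Prop :=
  forall (R : calg O) (s : seq R), ideal_span [set` s] 1 ->
  let cov S (g : ahom R S) := exists2 f, f \in s & invertible (g f) in
  forall sec : (forall S (g : ahom R S), cov S g -> X S),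
    (forall S T (g : ahom R S) (h : ahom S T) cg chg,
       fmap h (sec S g cg) = sec T (ahom_comp h g) chg) ->
    exists! x : X R, forall S g cg, fmap g x = sec S g cg.

Definition is_scheme O (X : functor O) : Prop :=
  is_sheaf X /\ locally_on (fun A (_ : X A) => True).

Definition morphism_locally O (X Y : functor O)
    (P : forall B : comNzRingType, calg B -> Prop) (f : morphism X Y) : Prop :=
  locally_on (fun A (u : X A) => exists B (w : Y B) (h : ahom B A),
    [/\ affine_open w, f A u = fmap h w & P B (as_alg h)]).

Definition smooth_morphism O (X Y : functor O) (f : morphism X Y) : Prop :=
  morphism_locally smooth_alg f.

Definition etale_morphism O (X Y : functor O) (f : morphism X Y) : Prop :=
  morphism_locally etale_alg f.

Definition smooth_over_base O (X : functor O) : Prop :=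
  is_scheme X /\ locally_on (fun A (_ : X A) => smooth_alg A).

Definition regular_scheme O (X : functor O) : Prop :=
  is_scheme X /\ locally_on (fun A (_ : X A) => regular_ring A).

Definition locally_noetherian O (X : functor O) : Prop :=
  is_scheme X /\ locally_on (fun A (_ : X A) => noetherian A).

Definition effective_cartier O (X : functor O) (Z : subfunctor X) : Prop :=
  locally_on (fun A (u : X A) =>
    exists2 d : A, nonzerodivisor d & cuts_out Z u (ideal_span [set d])).

(* D is a strict normal crossings divisor on X: at each of its points the     *)
(* local ring of X is regular and D is x_1 ... x_r = 0, r >= 1, for some      *)
(* regular system of parameters x_1, ..., x_d.                                *)
Definition strict_normal_crossings O (X : functor O) (D : subfunctor X) : Prop :=
  [/\ locally_noetherian X, effective_cartier D
    & locally_at D (fun A u K f =>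
        noetherian A /\
        exists (I : set A) (L : comNzRingType) (g : {rmorphism A -> L})
               (s : seq L) (r : nat),
          [/\ cuts_out D u I,
              is_localization_at [set a | f a = 0] g,
              regular_local L,
              regular_system s
            & (0 < r <= size s)%N /\
              ideal_span (g @` I) = ideal_span [set \prod_(x <- take r s) x]])].

Definition normal_crossings O (X : functor O) (D : subfunctor X) : Prop :=
  [/\ locally_noetherian X, effective_cartier D
    & forall L (x : X L), is_field L -> D L x ->
        exists (U : functor O) (f : morphism U X),
          [/\ etale_morphism f,
              exists (L' : calg O) (h : ahom L L') (z : U L'),
                is_field L' /\ f L' z = fmap h x
            & strict_normal_crossings (preim f D)]].

(* The special fiber X x Spec(O / pi) as a closed subscheme of X. *)
Definition vanishing O (X : functor O) (a : O) : subfunctor X.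
Proof.
exists (fun R (_ : X R) => calg_str R a = 0) => R S g _ ra0.
by rewrite -(ahom_str g) ra0 rmorph0.
Defined.

(* |Z1| and |Z2| meet / |Z1| is contained in |Z2| inside |X|. *)
Definition meets O (X : functor O) (Z1 Z2 : forall R, X R -> Prop) : Prop :=
  exists L (x : X L), [/\ is_field L, Z1 L x & Z2 L x].

Definition sub_support O (X : functor O) (Z1 Z2 : subfunctor X) : Prop :=
  forall L (x : X L), is_field L -> Z1 L x -> Z2 L x.

Definition irreducible_sub O (X : functor O) (Z : subfunctor X) : Prop :=
  meets Z Z /\
  forall U1 U2 : subfunctor X, is_open U1 -> is_open U2 ->
    meets U1 Z -> meets U2 Z -> meets (fun R x => U1 R x /\ U2 R x) Z.

Definition irreducible_component O (X : functor O) (Z : subfunctor X) : Prop :=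
  [/\ is_closed Z, irreducible_sub Z
    & forall Z' : subfunctor X, is_closed Z' -> irreducible_sub Z' ->
        sub_support Z Z' -> sub_support Z' Z].

(* The blow-up is the terminal scheme over X on which Z becomes an effective  *)
(* Cartier divisor.                                                           *)
Definition is_blowup O (X : functor O) (Z : subfunctor X) (X' : functor O)
    (b : morphism X' X) : Prop :=
  [/\ is_scheme X', effective_cartier (preim b Z)
    & forall (Y : functor O) (f : morphism Y X),
        is_scheme Y -> effective_cartier (preim f Z) ->
        exists g : morphism Y X',
          (forall R (y : Y R), b R (g R y) = f R y) /\
          (forall g' : morphism Y X',
             (forall R (y : Y R), b R (g' R y) = f R y) ->
             forall R (y : Y R), g' R y = g R y)].

Definition submodule (R : comNzRingType) N (M : set 'rV[R]_N) : Prop :=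
  M 0 /\ forall a x y, M x -> M y -> M (a *: x + y).

(* The image of S (x)_R M in S^N. *)
Definition ext O (R S : calg O) (g : ahom R S) N (M : set 'rV[R]_N) :
  set 'rV[S]_N := smallest (@submodule S N) (map_mx g @` M).

Lemma submodule_ext O (R S : calg O) (g : ahom R S) N (M : set 'rV[R]_N) :
  submodule (ext g M).
Proof.
split=> [K [[]//]|a x y Mx My K [sK MK]]; case: (sK) => _; apply.
  exact: Mx. exact: My.
Qed.

Lemma ext_in O (R S : calg O) (g : ahom R S) N (M : set 'rV[R]_N) x :
  M x -> ext g M (map_mx g x).
Proof. by move=> Mx K [_]; apply; exists x. Qed.

Lemma ext_ind O (R S : calg O) (g : ahom R S) N (M : set 'rV[R]_N)
    (K : set 'rV[S]_N) :
  submodule K -> (forall x, M x -> K (map_mx g x)) -> ext g M `<=` K.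
Proof. by move=> sK MK y; apply; split=> // _ [x Mx <-]; apply: MK. Qed.

Lemma submodule_preim (R S : comNzRingType) N P (K : set 'rV[S]_P)
    (f : {rmorphism R -> S}) (h : 'rV[R]_N -> 'rV[S]_P) :
  submodule K -> h 0 = 0 -> (forall a x y, h (a *: x + y) = f a *: h x + h y) ->
  submodule [set x | K (h x)].
Proof.
move=> [K0 KD] h0 hD; split=> [|a x y Kx Ky] /=; first by rewrite h0.
by rewrite hD; apply: KD.
Qed.

Lemma ext_id O (R : calg O) N (M : set 'rV[R]_N) :
  submodule M -> ext (ahom_id R) M = M.
Proof.
move=> sM; rewrite eqEsubset; split.
  by apply: ext_ind => // x; rewrite map_mx_id.
by move=> x Mx; have := @ext_in _ _ _ (ahom_id R) _ _ _ Mx; rewrite map_mx_id.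
Qed.

Lemma ext_comp O (R S T : calg O) (g : ahom S T) (f : ahom R S) N
    (M : set 'rV[R]_N) : ext (ahom_comp g f) M = ext g (ext f M).
Proof.
have mxE x : map_mx (ahom_comp g f) x = map_mx g (map_mx f x) :> 'rV[T]_N.
  by apply/rowP=> i; rewrite !mxE.
rewrite eqEsubset; split; apply: ext_ind => [|x]; try exact: submodule_ext.
  by move=> Mx; rewrite mxE; do 2!apply: ext_in.
move: x; apply: ext_ind => [|x Mx]; last by rewrite /= -mxE; apply: ext_in.
apply: (@submodule_preim _ _ _ _ _ g) => [||a x y]; first exact: submodule_ext.
  by rewrite map_mx0.
by rewrite map_mxD map_mxZ.
Qed.

Definition submods O (N : nat) : functor O.
Proof.
refine (@Functor O (fun R => {M : set 'rV[R]_N | submodule M})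
  (fun R S g M => exist _ (ext g (sval M)) (submodule_ext g (sval M))) _ _).
- by move=> R [M sM]; apply: eq_exist; apply: ext_id.
- by move=> R S T g f [M sM]; apply: eq_exist; apply: ext_comp.
Defined.

Definition zariski_locally O (R : calg O) (P : forall S, ahom R S -> Prop) : Prop :=
  exists2 s : seq R, ideal_span [set` s] 1
    & forall f, f \in s -> forall S (g : ahom R S), invertible (g f) -> P S g.

(* The rows of A form a basis of M. *)
Definition is_frame (R : comNzRingType) N r (A : 'M[R]_(r, N)) (M : set 'rV[R]_N) :
    Prop :=
  (forall a : 'rV_r, a *m A = 0 -> a = 0) /\ M = [set a *m A | a in setT].

Definition free_summand (R : comNzRingType) N r (G M : set 'rV[R]_N) : Prop :=
  (exists A : 'M_(r, N), is_frame A G) /\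
  exists K : set 'rV_N, [/\ submodule K, forall x, G x -> K x -> x = 0
    & M = [set x + y | x in G & y in K]].

(* Zariski locally a direct summand of M, free of rank r. *)
Definition loc_summand O (R : calg O) N r (G M : set 'rV[R]_N) : Prop :=
  zariski_locally (fun S (g : ahom R S) => free_summand r (ext g G) (ext g M)).

Lemma zariski_locally_fmap O (R R' : calg O) (h : ahom R R')
    (P : forall S, ahom R S -> Prop) (P' : forall S, ahom R' S -> Prop) :
  (forall S (g : ahom R' S), P S (ahom_comp g h) -> P' S g) ->
  zariski_locally P -> zariski_locally P'.
Proof.
move=> PP' [s s1 sP]; exists (map h s); last first.
  move=> _ /mapP[f fs ->] S g gf; by apply: PP'; apply: (sP f fs).
move=> J [[J0 JD JM] sJ]; rewrite -(rmorph1 h).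
apply: (s1 [set a | J (h a)]); split=> /=.
  split=> [|a b Ja Jb|a b Jb] /=; rewrite ?rmorph0 ?rmorphD ?rmorphM //.
    exact: JD.
  exact: JM.
by move=> a /= /(map_f h) /sJ.
Qed.

Lemma loc_summand_ext O (R R' : calg O) (h : ahom R R') N r
    (G M : set 'rV[R]_N) :
  loc_summand r G M -> loc_summand r (ext h G) (ext h M).
Proof.
by apply: (@zariski_locally_fmap _ _ _ h) => S g; rewrite !(ext_comp g h).
Qed.

Lemma ext_setT O (R S : calg O) (g : ahom R S) N :
  ext g (@setT 'rV[R]_N) = setT.
Proof.
rewrite eqEsubset; split=> // x _ K [[K0 KD] gK].
rewrite (row_sum_delta x); elim/big_ind: _ => // [y z Ky Kz|i _].
  by rewrite -[y]scale1r; apply: KD.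
rewrite -[_ *: _]addr0; apply: KD => //; apply: gK.
by exists (delta_mx 0 i) => //; rewrite map_delta_mx.
Qed.

(* P^m: the lines in R^(m+1). *)
Definition projective_space O (m : nat) : functor O.
Proof.
refine (sub_functor (@Subfunctor O (submods O m.+1)
  (fun R L => loc_summand 1 (sval L) setT) _)).
by move=> R S g L /(loc_summand_ext g); rewrite ext_setT.
Defined.

(* P holds for the matrix, in any local frame of M (i.e. in any frame of M    *)
(* after a base change), of the endomorphism x |-> x *m T of M.               *)
Definition frame_cond O (R : calg O) N r (T : forall S : calg O, 'M[S]_N)
    (P : forall S : calg O, 'M[S]_r -> Prop) (M : set 'rV[R]_N) : Prop :=
  forall S (g : ahom R S) (A : 'M[S]_(r, N)) (C : 'M[S]_r),
    is_frame A (ext g M) -> A *m T S = C *m A -> P S C.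

(* The r-th exterior power of C, whose entries are the r x r minors of C,     *)
(* vanishes.                                                                  *)
Definition wedge_zero (R : comNzRingType) r n (C : 'M[R]_n) : Prop :=
  forall f g : 'I_r -> 'I_n, \det (mxsub f g C) = 0.

(* A complete discretely valued field; the value of val at 0 is irrelevant. *)
Record cdvField := CDVField {
  cdv_field :> fieldType;
  cdv_val : cdv_field -> int;
  cdv_valM : forall x y, x != 0 -> y != 0 ->
    cdv_val (x * y) = cdv_val x + cdv_val y;
  cdv_valD : forall x y, x != 0 -> y != 0 -> x + y != 0 ->
    Order.min (cdv_val x) (cdv_val y) <= cdv_val (x + y);
  cdv_val1 : exists2 x, x != 0 & cdv_val x = 1;
  cdv_complete : forall u : nat -> cdv_field,
    let small N x := x != 0 -> (N : int) <= cdv_val x in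
    (forall N, exists M, forall i j, (M <= i)%N -> (M <= j)%N ->
       small N (u i - u j)) ->
    exists l, forall N, exists M, forall i, (M <= i)%N -> small N (u i - l) }.

Definition val_ring (K : cdvField) : {pred K} :=
  fun x => (x == 0) || (0 <= cdv_val x).
Arguments val_ring : clear implicits.

Lemma cdv_val_1 (K : cdvField) : cdv_val (1 : cdv_field K) = 0.
Proof.
have := cdv_valM (oner_neq0 K) (oner_neq0 K).
by rewrite mulr1 -[LHS]addr0 => /addrI.
Qed.

Lemma cdv_val_N1 (K : cdvField) : cdv_val (-1 : cdv_field K) = 0.
Proof.
have n1 : (-1 : K) != 0 by rewrite oppr_eq0 oner_neq0.
have := cdv_valM n1 n1; rewrite mulrNN mulr1 cdv_val_1 => /esym/eqP.
by rewrite -mulr2n mulrn_eq0 /= => /eqP.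
Qed.

Lemma val_ring_subring (K : cdvField) : subring_closed (val_ring K).
Proof.
split; first by rewrite /val_ring unfold_in cdv_val_1 lexx orbT.
  move=> x y; rewrite !unfold_in => /orP[/eqP->|x0] /orP[/eqP->|y0].
  - by rewrite subr0 eqxx.
  - rewrite sub0r oppr_eq0; have [//|yn0] := eqVneq y 0.
    by rewrite -mulN1r cdv_valM ?oppr_eq0 ?oner_neq0 // cdv_val_N1 add0r.
  - by rewrite subr0 x0 orbT.
  have [->|xn0] := eqVneq x 0.
    rewrite sub0r oppr_eq0; have [//|yn0] := eqVneq y 0.
    by rewrite -mulN1r cdv_valM ?oppr_eq0 ?oner_neq0 // cdv_val_N1 add0r.
  have [->|yn0] := eqVneq y 0; first by rewrite subr0 x0 orbT.
  have [//|xyn0] /= := eqVneq (x - y) 0.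
  have Nyn0 : - y != 0 by rewrite oppr_eq0.
  apply: le_trans (cdv_valD xn0 Nyn0 xyn0).
  by rewrite le_min x0 -mulN1r cdv_valM ?oppr_eq0 ?oner_neq0 // cdv_val_N1 add0r.
move=> x y; rewrite !unfold_in => /orP[/eqP->|x0] /orP[/eqP->|y0];
  rewrite ?mul0r ?mulr0 ?eqxx //.
have [->|xn0] := eqVneq x 0; first by rewrite mul0r eqxx.
have [->|yn0] := eqVneq y 0; first by rewrite mulr0 eqxx.
by rewrite cdv_valM // addr_ge0 ?orbT.
Qed.

HB.instance Definition _ (K : cdvField) :=
  GRing.isSubringClosed.Build K (val_ring K) (@val_ring_subring K).

Definition integers0 (K : cdvField) := {x : K | x \in val_ring K}.
HB.instance Definition _ (K : cdvField) := SubChoice.on (integers0 K).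
HB.instance Definition _ (K : cdvField) :=
  [SubChoice_isSubComNzRing of integers0 K by <:].

(* O_F, the integral closure of O_F0 in F. *)
Definition int_closure (K : cdvField) (F : fieldExtType K) : {pred F} :=
  fun x => `[< integralOver (in_alg F \o val : integers0 K -> F) x >].
Arguments int_closure : clear implicits.

Lemma int_closure_subring (K : cdvField) (F : fieldExtType K) :
  subring_closed (int_closure K F).
Proof.
split; first by rewrite unfold_in; apply/asboolP; apply: integral1.
- move=> x y; rewrite !unfold_in => /asboolP ix /asboolP iy; apply/asboolP.
  exact: integral_sub.
- move=> x y; rewrite !unfold_in => /asboolP ix /asboolP iy; apply/asboolP.
  exact: integral_mul.
Qed.

HB.instance Definition _ (K : cdvField) (F : fieldExtType K) :=
  GRing.isSubringClosed.Build F (int_closure K F) (@int_closure_subring K F).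

Definition integers (K : cdvField) (F : fieldExtType K) :=
  {x : F | x \in int_closure K F}.
HB.instance Definition _ (K : cdvField) (F : fieldExtType K) :=
  SubChoice.on (integers F).
HB.instance Definition _ (K : cdvField) (F : fieldExtType K) :=
  [SubChoice_isSubComNzRing of integers F by <:].

Fact emb_subproof (K : cdvField) (F : fieldExtType K) (a : integers0 K) :
  (val a)%:A \in int_closure K F.
Proof.
rewrite unfold_in; apply/asboolP.
exact: (integral_id (in_alg F \o val : {rmorphism integers0 K -> F}) a).
Qed.

Definition emb (K : cdvField) (F : fieldExtType K) (a : integers0 K) :
  integers F := exist _ (val a)%:A (emb_subproof F a).
Arguments emb {K} F.

Record unitary_datum := UnitaryDatum {
  ud_F0 : cdvField;
  ud_pi0 : integers0 ud_F0;
  pi0_unif : val ud_pi0 != 0 /\ cdv_val (val ud_pi0) = 1;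
  (* the residue field, both of O_F0 and of O_F *)
  ud_k : fieldType;
  ud_res0 : {rmorphism integers0 ud_F0 -> ud_k};
  res0_surj : forall c, exists a, ud_res0 a = c;
  res0_ker : forall a, ud_res0 a = 0 <-> exists b, a = ud_pi0 * b;
  k_perfect : forall p, p \in [pchar ud_k] -> forall c : ud_k, exists d, d ^+ p = c;
  k_char : 2%N \notin [pchar ud_k];
  ud_F : fieldExtType ud_F0;
  F_quadratic : \dim {: ud_F} = 2%N;
  ud_pi : integers ud_F;
  pi_sqr : ud_pi ^+ 2 = emb ud_F ud_pi0;
  ud_res : {rmorphism integers ud_F -> ud_k};
  res_emb : forall a, ud_res (emb ud_F a) = ud_res0 a;
  res_pi : ud_res ud_pi = 0;
  ud_conj : {lrmorphism ud_F -> ud_F};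
  conj_nontriv : exists x, ud_conj x != x;
  ud_V : vectType ud_F;
  ud_n : nat;
  n_gt3 : (3 < ud_n)%N;
  ud_phi : ud_V -> ud_V -> ud_F;
  phiDl : forall x x' y, ud_phi (x + x') y = ud_phi x y + ud_phi x' y;
  phiDr : forall x y y', ud_phi x (y + y') = ud_phi x y + ud_phi x y';
  phiZ : forall a b x y, ud_phi (a *: x) (b *: y) = ud_conj a * b * ud_phi x y;
  phi_herm : forall x y, ud_phi y x = ud_conj (ud_phi x y);
  ud_e : ud_n.-tuple ud_V;
  e_basis : basis_of fullv ud_e;
  e_split : forall (a b : ud_F) (i j : 'I_ud_n),
    ud_phi (a *: tnth ud_e i) (b *: tnth ud_e (rev_ord j)) = ud_conj a * b * (i == j)%:R;
  ud_l : nat;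
  (* I = {ell} is strongly non-special *)
  l_le : (ud_l <= ud_n./2)%N;
  l_neq0 : ud_l <> 0;
  l_neqm : ud_l <> ud_n./2;
  l_neqm1 : ~~ odd ud_n -> ud_l <> ud_n./2.-1 }.

Definition OF (D : unitary_datum) : comNzRingType := integers (ud_F D).

Definition residue_alg (D : unitary_datum) : calg (OF D) := @Calg (OF D) (ud_k D) (ud_res D).

(* Lambda_j is the O_F-span of pi^-1 e_1, ..., pi^-1 e_j, e_(j+1), ..., e_n.  *)
Definition lattice_basis (D : unitary_datum) (j : nat) (i : 'I_(ud_n D)) : ud_V D :=
  (if (i < j)%N then (val (ud_pi D))^-1 else 1) *: tnth (ud_e D) i.

(* As O_F = O_F0 + pi O_F0, the vectors b_i and pi b_i, for (b_i) the basis   *)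
(* above, form an O_F0-basis of Lambda_j; Lambda_j (x)_O_F0 R is identified   *)
(* with the row vectors R^(n + n) through this basis.                         *)
Definition latB (D : unitary_datum) (j : nat) (i : 'I_(ud_n D + ud_n D)) : ud_V D :=
  match split i with
  | inl a => lattice_basis j a
  | inr a => val (ud_pi D) *: lattice_basis j a
  end.

(* M is the matrix, acting on row vectors of coordinates, of the map f from   *)
(* the lattice with O_F0-basis B to the one with O_F0-basis B'.               *)
Definition is_mx_of (D : unitary_datum) p q (B : 'I_p -> ud_V D) (B' : 'I_q -> ud_V D)
    (f : ud_V D -> ud_V D) (M : 'M[integers0 (ud_F0 D)]_(p, q)) : Prop :=
  forall i, f (B i) = \sum_j val (emb (ud_F D) (M i j)) *: B' j.

Definition mx_of (D : unitary_datum) p q (B : 'I_p -> ud_V D) (B' : 'I_q -> ud_V D)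
    (f : ud_V D -> ud_V D) : 'M[integers0 (ud_F0 D)]_(p, q) :=
  xget 0 [set M | is_mx_of B B' f M].

(* (x, y) = 1/2 Tr_(F/F0) (phi(x, y)), which lies in F0. *)
Definition pairing (D : unitary_datum) (x y : ud_V D) : ud_F D :=
  2^-1 * (ud_phi x y + ud_conj D (ud_phi x y)).

Definition is_gram (D : unitary_datum) p q (B : 'I_p -> ud_V D) (B' : 'I_q -> ud_V D)
    (M : 'M[integers0 (ud_F0 D)]_(p, q)) : Prop :=
  forall i j, pairing (B i) (B' j) = val (emb (ud_F D) (M i j)).

Definition gram (D : unitary_datum) p q (B : 'I_p -> ud_V D) (B' : 'I_q -> ud_V D) :
  'M[integers0 (ud_F0 D)]_(p, q) := xget 0 [set M | is_gram B B' M].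

(* The integral matrices specified by is_mx_of and is_gram exist for all the  *)
(* maps and pairings used below.                                              *)
Lemma mx_ofP (D : unitary_datum) p q (B : 'I_p -> ud_V D) (B' : 'I_q -> ud_V D)
    (f : ud_V D -> ud_V D) :
  (forall i, exists (a : integers0 (ud_F0 D)) j,
     f (B i) = val (emb (ud_F D) a) *: B' j) ->
  is_mx_of B B' f (mx_of B B' f).
Proof.
move=> /fin_all_exists[a /fin_all_exists[s fB]]; apply: xgetPex.
exists (\matrix_(i, j) if j == s i then a i else 0) => i.
rewrite (bigD1 (s i)) //= mxE eqxx big1 ?addr0 ?fB // => j /negPf js.
by rewrite mxE js /= !scale0r.
Qed.

Lemma gramP (D : unitary_datum) p q (B : 'I_p -> ud_V D) (B' : 'I_q -> ud_V D) :
  (forall i j, exists a, pairing (B i) (B' j) = val (emb (ud_F D) a)) ->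
  is_gram B B' (gram B B').
Proof.
move=> aP; apply: xgetPex.
have /fin_all_exists[a aE] i := fin_all_exists (aP i).
by exists (\matrix_(i, j) a i j) => i j; rewrite mxE aE.
Qed.

Lemma val_pi_sqr (D : unitary_datum) :
  val (ud_pi D) * val (ud_pi D) = val (emb (ud_F D) (ud_pi0 D)).
Proof. by rewrite -(pi_sqr D) expr2. Qed.

Lemma val_pi_neq0 (D : unitary_datum) : val (ud_pi D) != 0.
Proof.
apply: contraNneq (proj1 (pi0_unif D)) => p0; have := val_pi_sqr D.
by rewrite p0 mul0r => /esym/eqP; rewrite scaler_eq0 oner_eq0 orbF.
Qed.

Lemma latB_l (D : unitary_datum) j (i : 'I_(ud_n D)) :
  latB j (lshift _ i) = lattice_basis j i.
Proof. by rewrite /latB -[lshift _ i]/(unsplit (inl i)) unsplitK. Qed.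

Lemma latB_r (D : unitary_datum) j (i : 'I_(ud_n D)) :
  latB j (rshift _ i) = val (ud_pi D) *: lattice_basis j i.
Proof. by rewrite /latB -[rshift _ i]/(unsplit (inr i)) unsplitK. Qed.

Lemma tP (D : unitary_datum) j :
  let f x := val (ud_pi D) *: x in
  is_mx_of (@latB D j) (@latB D j) f (mx_of (@latB D j) (@latB D j) f).
Proof.
apply: mx_ofP => i; case: (split_ordP i) => {i} i ->.
  by exists 1, (rshift _ i); rewrite latB_l latB_r /= scale1r scale1r.
exists (ud_pi0 D), (lshift _ i); rewrite latB_l latB_r scalerA.
by rewrite val_pi_sqr.
Qed.

Lemma l_le_subn (D : unitary_datum) : (ud_l D <= ud_n D - ud_l D)%N.
Proof.
have := l_le D; rewrite geq_half_double -addnn => lln.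
by rewrite leq_subRL // (leq_trans _ lln) ?leq_addr.
Qed.

Lemma val_emb1 (D : unitary_datum) : val (emb (ud_F D) 1) = 1.
Proof. exact: scale1r. Qed.

Lemma incl_upP (D : unitary_datum) :
  let B := @latB D (ud_l D) in let B' := @latB D (ud_n D - ud_l D) in
  is_mx_of B B' id (mx_of B B' id).
Proof.
have ln := l_le_subn D; have p0 := val_pi_neq0 D.
apply: mx_ofP => i; case: (split_ordP i) => {i} i ->; rewrite ?latB_l ?latB_r;
  rewrite /lattice_basis; case: ltnP => li.
- exists 1, (lshift _ i).
  by rewrite latB_l /lattice_basis (leq_trans li ln) val_emb1 scale1r.
- have [lni|lni] := ltnP i (ud_n D - ud_l D).
    exists 1, (rshift _ i).
    by rewrite latB_r /lattice_basis lni val_emb1 !scale1r scalerA mulfV ?scale1r.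
  exists 1, (lshift _ i).
  by rewrite latB_l /lattice_basis ltnNge lni val_emb1 !scale1r.
- exists 1, (rshift _ i).
  by rewrite latB_r /lattice_basis (leq_trans li ln) val_emb1 scale1r.
have [lni|lni] := ltnP i (ud_n D - ud_l D).
  exists (ud_pi0 D), (lshift _ i); rewrite latB_l /lattice_basis lni.
  by rewrite -val_pi_sqr !scalerA mulfK // mulr1.
exists 1, (rshift _ i).
by rewrite latB_r /lattice_basis ltnNge lni val_emb1 !scale1r.
Qed.

Lemma incl_downP (D : unitary_datum) :
  let B := @latB D (ud_n D - ud_l D) in
  let B' i := (val (ud_pi D))^-1 *: @latB D (ud_l D) i in
  is_mx_of B B' id (mx_of B B' id).
Proof.
have ln := l_le_subn D; have p0 := val_pi_neq0 D.
apply: mx_ofP => i; case: (split_ordP i) => {i} i ->; rewrite ?latB_l ?latB_r;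
  rewrite /lattice_basis; case: ltnP => lni.
- have [li|li] := ltnP i (ud_l D).
    exists 1, (rshift _ i); rewrite latB_r /lattice_basis li val_emb1 scale1r.
    by rewrite !scalerA mulVf ?mul1r.
  exists 1, (lshift _ i).
  by rewrite latB_l /lattice_basis ltnNge li val_emb1 !scale1r.
- exists 1, (rshift _ i); rewrite latB_r /lattice_basis ltnNge (leq_trans ln lni).
  by rewrite val_emb1 !scale1r scalerA mulVf ?scale1r.
- have [li|li] := ltnP i (ud_l D).
    exists (ud_pi0 D), (lshift _ i); rewrite latB_l /lattice_basis li.
    by rewrite -val_pi_sqr !scalerA ?mulrA mulfK ?mulfV.
  exists 1, (rshift _ i); rewrite latB_r /lattice_basis ltnNge li val_emb1.
  by rewrite !scale1r !scalerA mulfV // mulVf.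
exists (ud_pi0 D), (lshift _ i); rewrite latB_l /lattice_basis ltnNge.
by rewrite (leq_trans ln lni) -val_pi_sqr !scale1r scalerA mulfK.
Qed.

Lemma pi_notin (D : unitary_datum) (a : ud_F0 D) : val (ud_pi D) != a%:A.
Proof.
apply/eqP=> pa; have aa : a * a = val (ud_pi0 D).
  apply: (fmorph_inj (in_alg (ud_F D))); rewrite rmorphM /= -pa.
  exact: val_pi_sqr.
have [p0 v1] := pi0_unif D.
have a0 : a != 0 by apply: contraNneq p0 => a0; rewrite -aa a0 mul0r.
have /(congr1 (fun z : int => odd `|z|%N)) := cdv_valM a0 a0.
by rewrite aa v1 -mulr2n -mulr_natr abszM oddM andbF.
Qed.

Lemma conj_pi (D : unitary_datum) : ud_conj D (val (ud_pi D)) = - val (ud_pi D).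
Proof.
set p := val (ud_pi D).
have : ud_conj D p ^+ 2 == p ^+ 2.
  by rewrite expr2 -rmorphM /= val_pi_sqr /p expr2 val_pi_sqr /= rmorph_alg.
rewrite eqf_sqr => /orP[/eqP cp|/eqP//].
have [x] := conj_nontriv D; case/eqP.
have fr : free [:: (1 : ud_F D); p].
  rewrite free_cons seq1_free val_pi_neq0 andbT span_seq1.
  apply/negP=> /vlineP[a pa].
  have a0 : a != 0 by apply: contraTneq (oner_neq0 (ud_F D)) => a0; rewrite pa a0 scale0r eqxx.
  have /eqP[] := pi_notin a^-1.
  by rewrite pa scalerA mulVf // scale1r.
have : x \in span [:: (1 : ud_F D); p].
  have /eqP -> : span [:: (1 : ud_F D); p] == fullv; last exact: memvf.
  by rewrite eqEdim subvf (eqnP fr) F_quadratic.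
rewrite span_cons span_seq1 => /memv_addP[_ /vlineP[a ->] [_ /vlineP[b ->] ->]].
by rewrite rmorphD /= !linearZ /= rmorph1 cp.
Qed.

Lemma pairing_gramP (D : unitary_datum) :
  let B := @latB D (ud_n D - ud_l D) in let B' := @latB D (ud_l D) in
  is_gram B B' (gram B B').
Proof.
have ln := l_le_subn D; have p0 := val_pi_neq0 D; have cp := conj_pi D.
have two : (2 : ud_F D) != 0.
  have : (2 : ud_k D) != 0 by have := k_char D; rewrite inE /=.
  apply: contraNneq => two; rewrite -(rmorph_nat (ud_res D)).
  by rewrite (_ : 2%:R = 0) ?rmorph0 //; apply: val_inj.
set p := val (ud_pi D) in p0 cp.
have cpV : ud_conj D p^-1 = - p^-1 by rewrite fmorphV -invrN -cp.
have pairE (c c' : ud_F D) i j : let z := ud_conj D c * c' in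
    (i = rev_ord j -> [\/ z = 1, z = -1 | ud_conj D z = - z]) ->
    exists a, pairing (c *: tnth (ud_e D) i) (c' *: tnth (ud_e D) j) =
              val (emb (ud_F D) a).
  move=> z; rewrite /pairing -{2 3}[j]rev_ordK e_split -/z.
  have [ij /(_ ij)|_ _] := eqVneq; last first.
    by exists 0; rewrite mulr0 rmorph0 addr0 mulr0 /= scale0r.
  rewrite mulr1; case=> [->|->|->].
  - by exists 1; rewrite val_emb1 rmorph1 mulVf.
  - exists (-1); rewrite rmorphN1 -opprD mulrN mulVf //=.
    by rewrite scaleN1r.
  - by exists 0; rewrite subrr mulr0 /= scale0r.
have revl (i j : 'I_(ud_n D)) : i = rev_ord j ->
    (i < ud_n D - ud_l D)%N = ~~ (j < ud_l D)%N.
  by move=> ->; rewrite /= ltn_sub2lE ?ltn_ord // ltnS leqNgt.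
apply: gramP => i j.
case: (split_ordP i) => {i} i ->; case: (split_ordP j) => {j} j ->;
  rewrite ?latB_l ?latB_r /lattice_basis ?scalerA -/p; apply: pairE => /revl ->;
  clearbody p; case: (j < ud_l D)%N;
  rewrite /= ?(mul1r, mulr1, rmorph1, cp, cpV, mulNr, mulVf p0, mulfV p0, rmorphN);
  rewrite /= ?cp ?cpV; by [apply: Or31|apply: Or32|apply: Or33].
Qed.

Definition mxR (D : unitary_datum) (R : calg (OF D)) p q
  (M : 'M[integers0 (ud_F0 D)]_(p, q)) : 'M[R]_(p, q) :=
  map_mx (calg_str R \o emb (ud_F D)) M.

(* Multiplication by t = pi on Lambda_j (x) R. *)
Definition tR (D : unitary_datum) (j : nat) (R : calg (OF D)) :
  'M[R]_(ud_n D + ud_n D) :=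
  mxR R (mx_of (latB j) (latB j) (fun x => val (ud_pi D) *: x)).

(* The map induced by Lambda_l \subset Lambda_(n-l). *)
Definition incl_up (D : unitary_datum) (R : calg (OF D)) : 'M[R]_(ud_n D + ud_n D) :=
  mxR R (mx_of (latB (ud_l D)) (latB (ud_n D - ud_l D)) id).

(* The map induced by Lambda_(n-l) \subset pi^-1 Lambda_l, using on           *)
(* pi^-1 Lambda_l the basis which is pi^-1 times that of Lambda_l.            *)
Definition incl_down (D : unitary_datum) (R : calg (OF D)) : 'M[R]_(ud_n D + ud_n D) :=
  mxR R (mx_of (latB (ud_n D - ud_l D))
               (fun i => (val (ud_pi D))^-1 *: latB (ud_l D) i) id).

Definition pairR (D : unitary_datum) (R : calg (OF D)) : 'M[R]_(ud_n D + ud_n D) :=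
  mxR R (gram (latB (ud_n D - ud_l D)) (latB (ud_l D))).

(* The orthogonal complement in Lambda_(n-l) (x) R of a subset of             *)
(* Lambda_l (x) R.                                                            *)
Definition orthogonal (D : unitary_datum) (R : calg (OF D))
    (M : set 'rV[R]_(ud_n D + ud_n D)) : set 'rV[R]_(ud_n D + ud_n D) :=
  [set y | forall x, M x -> y *m pairR R *m x^T = 0].

Definition piR (D : unitary_datum) (R : calg (OF D)) : R := calg_str R (ud_pi D).

Lemma mxR_ext (D : unitary_datum) (R S : calg (OF D)) (g : ahom R S) p q
    (M : 'M[integers0 (ud_F0 D)]_(p, q)) : map_mx g (mxR R M) = mxR S M.
Proof. by apply/matrixP=> i j; rewrite !mxE /= ahom_str. Qed.

Lemma ext_mulmx (O : comNzRingType) (R S : calg O) (g : ahom R S) N P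
    (A : 'M[R]_(N, P)) (M : set 'rV[R]_N) (M' : set 'rV[R]_P) :
  (forall x, M x -> M' (x *m A)) ->
  forall x, ext g M x -> ext g M' (x *m map_mx g A).
Proof.
move=> MM' x; move: x; apply: ext_ind => [|x Mx]; last first.
  by rewrite /= -map_mxM; apply: ext_in; apply: MM'.
apply: (@submodule_preim _ _ _ _ _ idfun) => [||a x y].
- exact: submodule_ext.
- by rewrite mul0mx.
- by rewrite mulmxDl scalemxAl.
Qed.

(* A pair of submodules (F_l, F_(n-l)). *)
Definition pairs (D : unitary_datum) : functor (OF D) :=
  prod_functor (submods (OF D) (ud_n D + ud_n D)) (submods (OF D) (ud_n D + ud_n D)).

(* That Fnl is the orthogonal complement of Fl is required after every base   *)
(* change S of R, in particular over R; since Fl is locally a direct summand, *)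
(* the formation of the complement commutes with base change.                 *)
Definition naive_cond (D : unitary_datum) (R : calg (OF D))
    (Fl Fnl : set 'rV[R]_(ud_n D + ud_n D)) : Prop :=
  let Nchar S (C : 'M[calg_ring S]_(ud_n D)) :=
    char_poly C = ('X + (piR S)%:P) ^+ (ud_n D).-1 * ('X - (piR S)%:P) in
  [/\ (* O_F = O_F0[pi], so O_F (x) R-submodules are R[t]-submodules *)
      (forall x, Fl x -> Fl (x *m tR (ud_l D) R)) /\
      (forall x, Fnl x -> Fnl (x *m tR (ud_n D - ud_l D) R)),
      loc_summand (ud_n D) Fl setT /\ loc_summand (ud_n D) Fnl setT,
      (forall x, Fl x -> Fnl (x *m incl_up R)) /\
      (forall x, Fnl x -> Fl (x *m incl_down R)),
      forall S (g : ahom R S), ext g Fnl = orthogonal (ext g Fl)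
    & frame_cond (tR (ud_l D)) Nchar Fl /\ frame_cond (tR (ud_n D - ud_l D)) Nchar Fnl].

Definition wedge_cond (D : unitary_datum) (R : calg (OF D))
    (Fl Fnl : set 'rV[R]_(ud_n D + ud_n D)) : Prop :=
  let W S (C : 'M[calg_ring S]_(ud_n D)) :=
    wedge_zero (ud_n D) (C - (piR S)%:M) /\ wedge_zero 2%N (C + (piR S)%:M) in
  frame_cond (tR (ud_l D)) W Fl /\ frame_cond (tR (ud_n D - ud_l D)) W Fnl.

Lemma frame_cond_ext (D : unitary_datum) (R S : calg (OF D)) (g : ahom R S) N r
    (T : forall S : calg (OF D), 'M[S]_N)
    (P : forall S : calg (OF D), 'M[S]_r -> Prop) (M : set 'rV[R]_N) :
  frame_cond T P M -> frame_cond T P (ext g M).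
Proof. by move=> PM S' h A C; rewrite -(ext_comp h g) => /PM; apply. Qed.

Lemma naive_cond_ext (D : unitary_datum) (R S : calg (OF D)) (g : ahom R S)
    (Fl Fnl : set 'rV[R]_(ud_n D + ud_n D)) :
  naive_cond Fl Fnl -> naive_cond (ext g Fl) (ext g Fnl).
Proof.
case=> [[tl tn] [sl sn] [lu ld] ort [cl cn]]; split.
- by rewrite /tR /incl_up /incl_down -!(mxR_ext g); split; apply: ext_mulmx.
- by rewrite -(ext_setT g); split; apply: loc_summand_ext.
- by rewrite /tR /incl_up /incl_down -!(mxR_ext g); split; apply: ext_mulmx.
- by move=> S' h; rewrite -!(ext_comp h g).
- by split; apply: frame_cond_ext.
Qed.

(* The functors of points of M^naive and M^wedge, as subfunctors of pairs. *)
Definition Mnaive_sub (D : unitary_datum) : subfunctor (pairs D).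
Proof.
exists (fun R x => naive_cond (sval x.1) (sval x.2)) => R S g x.
exact: naive_cond_ext.
Defined.

Definition Mwedge_sub (D : unitary_datum) : subfunctor (pairs D).
Proof.
exists (fun R x => Mnaive_sub D R x /\ wedge_cond (sval x.1) (sval x.2)).
move=> R S g x [nx [wl wn]]; split; first exact: smem_fmap.
by split; apply: frame_cond_ext.
Defined.

Definition Mwedge (D : unitary_datum) : functor (OF D) := sub_functor (Mwedge_sub D).

Definition splitting_cond (D : unitary_datum) (R : calg (OF D))
    (Fnl G : set 'rV[R]_(ud_n D + ud_n D)) : Prop :=
  [/\ G `<=` Fnl,
      loc_summand 1 G Fnl,
      forall x, Fnl x -> G (x *m tR (ud_n D - ud_l D) R + piR R *: x)
    & forall x, G x -> x *m tR (ud_n D - ud_l D) R - piR R *: x = 0].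

(* The functor of points of M^spl, as a subfunctor of triples                 *)
(* ((F_l, F_(n-l)), G_(n-l)).                                                 *)
Definition Mspl_sub (D : unitary_datum) :
  subfunctor (prod_functor (pairs D) (submods (OF D) (ud_n D + ud_n D))).
Proof.
exists (fun R x => Mwedge_sub D R x.1 /\ splitting_cond (sval x.1.2) (sval x.2)).
move=> R S g [x [G sG]] [wx [/= GF ls tF tG]].
split; first exact: (@smem_fmap _ _ (Mwedge_sub D) _ _ g x).
split=> /=.
- apply: ext_ind => [|y Gy]; first exact: submodule_ext.
  by apply: ext_in; apply: GF.
- exact: loc_summand_ext.
- move=> y Fy; have := @ext_mulmx _ _ _ g _ _
    (tR (ud_n D - ud_l D) R + (piR R)%:M) (sval x.2) G _ y Fy.
  rewrite map_mxD map_scalar_mx /tR mxR_ext /piR /= ahom_str mulmxDr mul_mx_scalar.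
  by apply=> z Fz; rewrite mulmxDr mul_mx_scalar; apply: tF.
- have K0 : submodule [set y : 'rV[S]_(ud_n D + ud_n D) |
      y *m tR (ud_n D - ud_l D) S - piR S *: y = 0].
    split=> [|a y z /= y0 z0] /=; first by rewrite mul0mx scaler0 subr0.
    rewrite mulmxDl -scalemxAl scalerDr scalerA [piR S * a]mulrC -scalerA opprD addrACA.
    by rewrite -scalerBr y0 z0 scaler0 addr0.
  move=> y; move: y; apply: ext_ind => // y /tG /(congr1 (map_mx g)).
  by rewrite map_mxB map_mxM map_mxZ map_mx0 /tR mxR_ext /piR /= ahom_str.
Defined.

Definition Mspl (D : unitary_datum) : functor (OF D) := sub_functor (Mspl_sub D).

Definition tau (D : unitary_datum) : morphism (Mspl D) (Mwedge D).
Proof.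
exists (fun R x => exist _ (sval x).1 (proj1 (svalP x))) => R S g x.
exact: eq_exist.
Defined.

(* The k-point (t Lambda_l (x) k, t Lambda_(n-l) (x) k). *)
Definition is_worst (D : unitary_datum) (x : Mwedge D (residue_alg D)) : Prop :=
  let R := residue_alg D in
  sval (sval x).1 = [set y *m tR (ud_l D) R | y in setT] /\
  sval (sval x).2 = [set y *m tR (ud_n D - ud_l D) R | y in setT].

Definition covered_by_smooth_over O (X Y : functor O) : Prop :=
  forall L (x : X L), is_field L ->
    exists U : subfunctor X, [/\ is_open U, U L x
      & exists h : morphism (sub_functor U) Y, smooth_morphism h].

Definition uxy_rel (D : unitary_datum) : {mpoly (OF D)[3]} :=
  \prod_(i < 3) 'X_i - (2 * ud_pi D)%:MP.

(* Main.v *)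
From HB Require Import structures.
From mathcomp Require Import all_boot all_order all_algebra all_field.
From mathcomp Require Import boolp classical_sets.
From mathcomp Require Import mpoly ring_quotient generic_quotient ring zify.
Require Import Defs.

(** The splitting model is described by Zariski-local data [g, lam, h]: [G] is
   spanned by [(pi g, g)], and [F_(n-l)] (resp. [F_l]) is the kernel of one
   linear functional on the preimage under [t + pi] of the line spanned by
   [(pi g, g)] (resp. [(pi h, h)]); the two transition maps turn into linear
   relations between [g], [lam] and [h]. The fiber over the worst point is
   [h = 0], a projective space with homogeneous coordinates [g]. Its blow-up
   adjoins the line spanned by [w] with [h = mu w]. In terms of the vector [q]
   formed by the middle coordinates of [w] and the outer coordinates of [g] the
   equations become [nu gam = pi] and [2 gam lam + mu Q(q) = 0], where [Q] is a
   split nondegenerate quadratic form in the middle coordinates. Normalizing [q]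
   against an isotropic vector solves for one coordinate of [q] as a function
   of [Q(q)], and the blow-up is covered by open subschemes of affine spaces
   over [uxy = 2 pi]. The regularity of that hypersurface, and of polynomial
   rings over it, is derived from the height theorem for noetherian rings. *)

Set Implicit Arguments.
Unset Strict Implicit.
Unset Printing Implicit Defensive.

Import Order.TTheory GRing.Theory Num.Theory.

Local Open Scope classical_set_scope.
Local Open Scope ring_scope.

(** * Ideals, quotients and localizations *)

(** As [t - pi] kills [G], a generator of [G] has the form [(pi g, g)]; the inclusion of
    [(t + pi) F_(n-l)] in [G] puts [F_(n-l)] into a module of rank [n + 1], where one functional
    [(lam, h)] cuts it out. Orthogonality then determines [F_l], with [g] and [h] exchanging roles.
    Where [lam = 1], the two equations give [2 pi = (- Q(q)) mu nu]: this is the origin of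
    [uxy = 2 pi]. Where [lam] vanishes, [mu] is a unit and only [nu gam = pi] is left; where the
    middle part of [w] vanishes, [gam] is a unit as well. There the missing factors of [uxy] are
    supplied by units chosen as coordinates. Two obstacles shape the rest. Generators of the lines
    exist only locally and up to units, so every chart fixes a normalization and its coordinates are
    glued by uniqueness. Nonzerodivisors do not survive base change, so the universal property of
    the blow-up is verified on Cartier charts and glued. Strong non-speciality enters through sizes:
    some coordinate is outer, and at least three are in the middle, enough for the isotropic vectors
    used to normalize. *)

Section Ideals.
Variable A : comNzRingType.
Implicit Types (I J p q : set A) (X : set A) (a b c : A) (s : seq A).

Lemma ideal_0 I : is_ideal I -> I 0. Proof. by case. Qed.
Lemma idealD I a b : is_ideal I -> I a -> I b -> I (a + b).
Proof. by case=> _ + _; apply. Qed.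
Lemma idealM_l I a b : is_ideal I -> I b -> I (a * b).
Proof. by case=> _ _; apply. Qed.
Lemma idealM_r I a b : is_ideal I -> I a -> I (a * b).
Proof. by rewrite mulrC => iI; apply: idealM_l. Qed.
Lemma idealN I a : is_ideal I -> I a -> I (- a).
Proof. by move=> iI Ia; rewrite -mulN1r; apply: idealM_l. Qed.
Lemma idealB I a b : is_ideal I -> I a -> I b -> I (a - b).
Proof. by move=> iI Ia Ib; apply: idealD => //; apply: idealN. Qed.
Lemma ideal_sum I (K : Type) (r : seq K) (P : pred K) (F : K -> A) :
  is_ideal I -> (forall i, P i -> I (F i)) -> I (\sum_(i <- r | P i) F i).
Proof.
move=> iI FI; elim/big_ind: _ => //; first exact: ideal_0.
by move=> x y; apply: idealD.
Qed.

Lemma span_ideal X : is_ideal (ideal_span X).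
Proof.
split=> [K [[]//]|a b Xa Xb K KX|a b Xb K KX].
  by apply: (idealD KX.1); [apply: Xa|apply: Xb].
by apply: (idealM_l a KX.1); apply: Xb.
Qed.

Lemma span_sub X : X `<=` ideal_span X.
Proof. by move=> a Xa K [_]; apply. Qed.

Lemma span_min X I : is_ideal I -> X `<=` I -> ideal_span X `<=` I.
Proof. by move=> iI XI a; apply. Qed.

Lemma span_mono X Y : X `<=` Y -> ideal_span X `<=` ideal_span Y.
Proof.
by move=> XY; apply: span_min; [exact: span_ideal|move=> a /XY /span_sub].
Qed.

Lemma span1P a b : ideal_span [set a] b <-> exists c, b = c * a.
Proof.
split=> [|[c ->]]; last by apply: (idealM_l _ (span_ideal _)); exact: span_sub.
move: b; apply: span_min => [|_ -> /=]; last by exists 1; rewrite mul1r.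
split=> /= [|a1 b1 [c ->] [d ->]|a1 b1 [c ->]].
- by exists 0; rewrite mul0r.
- by exists (c + d); rewrite mulrDl.
- by exists (a1 * c); rewrite mulrA.
Qed.

Lemma ideal_span_nil a : ideal_span [set` [::]] a <-> a = 0.
Proof.
split=> [|->]; last exact: ideal_0 (span_ideal _).
move: a; apply: span_min => //; split=> /= [//|a b -> ->|a b ->].
  by rewrite addr0.
by rewrite mulr0.
Qed.

Lemma ideal_span_cons a s b :
  ideal_span [set` a :: s] b <-> exists c d, ideal_span [set` s] d /\ b = c * a + d.
Proof.
split=> [|[c [d [sd ->]]]]; last first.
  apply: (idealD (span_ideal _)).
    by apply: (idealM_l _ (span_ideal _)); apply: span_sub; rewrite /= mem_head.
  by move: sd; apply: span_mono => x /= xs; rewrite inE xs orbT.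
have iS := span_ideal [set` s].
move: b; apply: span_min.
  split=> [|_ _ [c [d [sd ->]]] [c' [d' [sd' ->]]]|e _ [c [d [sd ->]]]].
  - by exists 0, 0; rewrite mul0r addr0; split=> //; apply: (ideal_0 iS).
  - exists (c + c'), (d + d'); rewrite mulrDl addrACA; split=> //.
    exact: (idealD iS).
  - exists (e * c), (e * d); rewrite mulrDr mulrA; split=> //.
    exact: (idealM_l _ iS).
move=> b; rewrite /= inE => /orP[/eqP->|bs].
  by exists 1, 0; rewrite mul1r addr0; split=> //; apply: (ideal_0 iS).
by exists 0, b; rewrite mul0r add0r; split=> //; apply: span_sub.
Qed.

Lemma span_seqP s b : ideal_span [set` s] b <->
  exists c : 'I_(size s) -> A, b = \sum_i c i * s`_i.
Proof.
split=> [|[c ->]]; last first.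
  apply: (ideal_sum _ (span_ideal _)) => i _.
  by apply: (idealM_l _ (span_ideal _)); apply: span_sub; rewrite /= mem_nth.
elim: s b => [|a s IH] b.
  by move=> /ideal_span_nil ->; exists (fun=> 0); rewrite big_ord0.
move=> /ideal_span_cons[c [d [/IH[e ->] ->]]].
exists (fun i => if unlift ord0 i is Some j then e j else c).
rewrite big_ord_recl unlift_none; congr (_ + _).
by apply: eq_bigr => i _; rewrite liftK.
Qed.

Lemma colon_ideal I b : is_ideal I -> is_ideal [set a | I (a * b)].
Proof.
move=> iI; split=> /= [|a c Ia Ic|a c Ic]; first by rewrite mul0r; apply: ideal_0.
  by rewrite mulrDl; apply: idealD.
by rewrite -mulrA; apply: idealM_l.
Qed.

Lemma span_fin X a : ideal_span X a ->
  exists2 s : seq A, (forall b, b \in s -> X b) & ideal_span [set` s] a.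
Proof.
move: a; apply: span_min; last first.
  move=> a Xa; exists [:: a] => [b|]; first by rewrite inE => /eqP->.
  by apply: span_sub; rewrite /= inE.
split=> [|a b [s sX sa] [t tX tb]|a b [s sX sb]].
- by exists [::] => //; apply: ideal_0 (span_ideal _).
- exists (s ++ t) => [c|]; first by rewrite mem_cat => /orP[/sX|/tX].
  apply: (idealD (span_ideal _)).
    by move: sa; apply: span_mono => c /= cs; rewrite mem_cat cs.
  by move: tb; apply: span_mono => c /= cs; rewrite mem_cat cs orbT.
- by exists s => //; apply: (idealM_l _ (span_ideal _)).
Qed.

Lemma unit_span I a : is_ideal I -> invertible a -> I a -> I 1.
Proof. by move=> iI [b ab1] Ia; rewrite -ab1; apply: idealM_r. Qed.

Lemma prime_ideal p : is_prime p -> is_ideal p. Proof. by case. Qed.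
Lemma primeM p a b : is_prime p -> ~ p a -> ~ p b -> ~ p (a * b).
Proof. by case=> _ _ pM na nb /pM[]. Qed.
Lemma primeX p a n : is_prime p -> p (a ^+ n) -> p a.
Proof.
case=> ip p1 pM; elim: n => [|n IH]; first by rewrite expr0 => /p1.
by rewrite exprS => /pM[].
Qed.
Lemma primeXn p a n : is_prime p -> ~ p a -> ~ p (a ^+ n).
Proof. by move=> pp na /(primeX pp). Qed.
Lemma prime_unit p a : is_prime p -> invertible a -> ~ p a.
Proof. by case=> ip p1 _ ua /(unit_span ip ua). Qed.

Lemma invertibleM a b : invertible a -> invertible b -> invertible (a * b).
Proof. by case=> c ac [d bd]; exists (c * d); rewrite mulrACA ac bd mulr1. Qed.
Lemma invertible1 : invertible (1 : A). Proof. by exists 1; rewrite mulr1. Qed.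
Lemma invertibleMl a b : invertible (a * b) -> invertible a.
Proof. by case=> c abc; exists (b * c); rewrite mulrA. Qed.
Lemma invertibleX a n : invertible a -> invertible (a ^+ n).
Proof. by case=> b ab; exists (b ^+ n); rewrite -exprMn ab expr1n. Qed.

Definition mult_set (S : set A) := S 1 /\ forall a b, S a -> S b -> S (a * b).

(** Zorn's lemma gives [M] maximal among the ideals containing [I] and disjoint from [S]. If [M]
    contains neither [a] nor [b], then [M + (a)] and [M + (b)] both meet [S]; the product of the two
    elements found lies in [S], and in [M] as soon as [a * b] does. *)
Lemma prime_disjoint (S : set A) I : mult_set S -> is_ideal I ->
  (forall a, I a -> ~ S a) ->
  exists p, [/\ is_prime p, I `<=` p & forall a, p a -> ~ S a].
Proof.
move=> [S1 SM] iI IS.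
pose T := {J : set A | [/\ is_ideal J, I `<=` J & forall a, J a -> ~ S a]}.
pose mk J (h : [/\ is_ideal J, I `<=` J & forall a, J a -> ~ S a]) : T := exist _ J h.
pose leT (J K : T) : bool := `[< sval J `<=` sval K >].
have [||||[M [iM IM MS]] maxM] := @Zorn T leT.
- by move=> J; apply/asboolP.
- by move=> J K L /asboolP JK /asboolP KL; apply/asboolP=> a /JK /KL.
- move=> [J jP] [K kP] /asboolP JK /asboolP KJ; apply: eq_exist => /=.
  by rewrite eqEsubset.
- move=> C Ctot; have [[J0 CJ0]|C0] := pselect (exists J : T, C J); last first.
    exists (mk I (And3 iI (@subset_refl _ I) IS)) => J CJ.
    by case: C0; exists J.
  have uP : [/\ is_ideal (\bigcup_(J in C) sval (J : T)), I `<=` \bigcup_(J in C) sval (J : T)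
      & forall a, (\bigcup_(J in C) sval (J : T)) a -> ~ S a].
    split.
    + split=> [|a b [J CJ Ja] [K CK Kb]|a b [J CJ Jb]].
      * by exists J0 => //; case: (svalP J0) => /ideal_0.
      * have [/asboolP JK|/asboolP KJ] := Ctot _ _ CJ CK.
          by exists K => //; case: (svalP K) => iK _ _; apply: (idealD iK) => //; apply: JK.
        by exists J => //; case: (svalP J) => iJ _ _; apply: (idealD iJ) => //; apply: KJ.
      * by exists J => //; case: (svalP J) => iJ _ _; apply: (idealM_l _ iJ).
    + by move=> a Ia; exists J0 => //; case: (svalP J0) => _ + _; apply.
    + by move=> a [J CJ Ja]; case: (svalP J) => _ _; apply.
  by exists (mk _ uP) => J CJ; apply/asboolP => a Ja; exists J.
exists M; split=> //; split=> // [M1|a b Mab]; first exact: MS M1 S1.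
apply: contrapT => /not_orP[na nb].
have grow c : ~ M c -> exists m d, M m /\ S (m + d * c).
  move=> nc; apply: contrapT => noS.
  have kP : [/\ is_ideal [set x | exists m d, M m /\ x = m + d * c],
      I `<=` [set x | exists m d, M m /\ x = m + d * c]
      & forall x, [set x | exists m d, M m /\ x = m + d * c] x -> ~ S x].
    split.
    + split=> /= [|_ _ [m [d [Mm ->]]] [m' [d' [Mm' ->]]]|e _ [m [d [Mm ->]]]].
      * by exists 0, 0; rewrite mul0r addr0; split=> //; apply: ideal_0.
      * exists (m + m'), (d + d'); rewrite mulrDl addrACA; split=> //.
        exact: idealD.
      * exists (e * m), (e * d); rewrite mulrDr mulrA; split=> //.
        exact: idealM_l.
    + by move=> x Ix; exists x, 0; rewrite mul0r addr0; split=> //; apply: (IM).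
    + by move=> _ [m [d [Mm ->]]] Sx; apply: noS; exists m, d.
  have /maxM/(congr1 sval)/= kM :
      leT (mk M (And3 iM IM MS)) (mk _ kP).
    by apply/asboolP=> x Mx /=; exists x, 0; rewrite mul0r addr0.
  apply: nc; rewrite -kM; exists 0, 1; rewrite mul1r add0r; split=> //.
  exact: ideal_0.
have [m [d [Mm Sm]]] := grow _ na; have [m' [d' [Mm' Sm']]] := grow _ nb.
apply: (MS _ _ (SM _ _ Sm Sm')).
rewrite (_ : _ * _ = (m' + d' * b) * m + d * a * m' + d * d' * (a * b)); last by ring.
by apply: idealD => //; [apply: idealD => //|]; apply: idealM_l.
Qed.

Lemma mult1 : mult_set [set 1].
Proof. by split=> // a b -> ->; rewrite mulr1. Qed.

Lemma prime_above I : is_ideal I -> ~ I 1 -> exists2 p, is_prime p & I `<=` p.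
Proof.
move=> iI nI1; have [|p [pp Ip _]] := @prime_disjoint [set 1] I mult1 iI.
  by move=> a Ia /= a1; apply: nI1; rewrite -a1.
by exists p.
Qed.

Lemma prime_mult p : is_prime p -> mult_set [set a | ~ p a].
Proof. by move=> pp; split; [case: pp|move=> a b; apply: primeM]. Qed.

Lemma pow_mult a : mult_set [set b | exists n, b = a ^+ n].
Proof.
by split=> [|_ _ [n ->] [m ->]] /=; [exists 0|exists (n + m)%N; rewrite exprD].
Qed.

End Ideals.

Lemma preim_ideal (A B : comNzRingType) (f : {rmorphism A -> B}) (I : set B) :
  is_ideal I -> is_ideal (f @^-1` I).
Proof.
move=> iI; split=> /= [|a b|a b]; rewrite /preimage /=.
- by rewrite rmorph0; apply: ideal_0.
- by rewrite rmorphD; apply: idealD.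
- by rewrite rmorphM; apply: idealM_l.
Qed.

Lemma preim_prime (A B : comNzRingType) (f : {rmorphism A -> B}) (p : set B) :
  is_prime p -> is_prime (f @^-1` p).
Proof.
move=> [ip p1 pM]; split; rewrite /preimage /=; first exact: preim_ideal.
  by rewrite rmorph1.
by move=> a b; rewrite rmorphM => /pM.
Qed.

Lemma rmorph_inv (A B : comNzRingType) (f : {rmorphism A -> B}) a :
  invertible a -> invertible (f a).
Proof. by case=> b ab; exists (f b); rewrite -rmorphM ab rmorph1. Qed.

Lemma span_image (A B : comNzRingType) (f : {rmorphism A -> B}) (X : set A) a :
  ideal_span X a -> ideal_span (f @` X) (f a).
Proof.
move=> Xa; apply: (@span_min _ X (f @^-1` ideal_span (f @` X))) => //.
  exact/preim_ideal/span_ideal.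
by move=> x Xx; apply: span_sub; exists x.
Qed.

Lemma span_image_span (A B : comNzRingType) (f : {rmorphism A -> B}) (X : set A) :
  ideal_span (f @` ideal_span X) = ideal_span (f @` X).
Proof.
rewrite eqEsubset; split; apply: span_min; try exact: span_ideal.
  by move=> _ [a Xa <-]; apply: span_image.
by move=> _ [a Xa <-]; apply: span_sub; exists a => //; apply: span_sub.
Qed.

Section Quotient.
Variables (A : comNzRingType) (I : set A).
Hypotheses (iI : is_ideal I) (nI1 : ~ I 1).

Definition qpred : {pred A} := fun a => `[< I a >].

Fact qpred_closed : idealr_closed qpred.
Proof.
split.
- by rewrite unfold_in; apply/asboolP; apply: ideal_0.
- by rewrite unfold_in; apply/asboolP.
- move=> a u v; rewrite !unfold_in => /asboolP Iu /asboolP Iv; apply/asboolP.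
  by apply: idealD => //; apply: idealM_l.
Qed.

HB.instance Definition _ := isIdealr.Build A qpred qpred_closed.

Definition qring : comNzRingType := {ideal_quot qpred}.

Lemma quotient_exists : exists (B : comNzRingType) (f : {rmorphism A -> B}),
  (forall b, exists a, f a = b) /\ (forall a, f a = 0 <-> I a).
Proof.
pose f : {rmorphism A -> qring} := \pi_({ideal_quot qpred})%qT.
exists qring, f; split=> [b|a].
  by exists (repr (b : {ideal_quot qpred})); apply: reprK.
rewrite -[X in _ = X](rmorph0 f).
split=> [/eqP|Ia]; last apply/eqP.
  by rewrite -Quotient.idealrBE subr0 unfold_in => /asboolP.
by rewrite -Quotient.idealrBE subr0 unfold_in; apply/asboolP.
Qed.

End Quotient.

Lemma quotient_lift (A B C : comNzRingType) (f : {rmorphism A -> B})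
    (h : {rmorphism A -> C}) :
  (forall b, exists a, f a = b) -> (forall a, f a = 0 -> h a = 0) ->
  exists g : {rmorphism B -> C}, forall a, g (f a) = h a.
Proof.
move=> fs fh; have [r fr] := choice fs.
have hr a : h (r (f a)) = h a.
  by apply/eqP; rewrite -subr_eq0 -rmorphB fh // rmorphB fr subrr.
have gB : zmod_morphism (h \o r).
  by move=> x y; rewrite /= -rmorphB -[RHS]hr rmorphB !fr.
have gM : monoid_morphism (h \o r).
  split=> [|x y] /=; first by rewrite -(rmorph1 f) hr rmorph1.
  by rewrite -rmorphM -[RHS]hr rmorphM !fr.
pose g : {rmorphism B -> C} := HB.pack (h \o r)
  (GRing.isZmodMorphism.Build _ _ _ gB) (GRing.isMonoidMorphism.Build _ _ _ gM).
by exists g.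
Qed.

Section Localization.
Variables (A : comNzRingType) (S : set A).
Hypotheses (mS : mult_set S) (S0 : ~ S 0).

Definition lpair : Type := {classic A * {s : A | S s}}.
Implicit Types x y z : lpair.
Let S1 : S 1 := mS.1.
Let SM a b (Sa : S a) (Sb : S b) : S (a * b) := mS.2 a b Sa Sb.
HB.instance Definition _ := Choice.on lpair.

Definition mkl a s (h : S s) : lpair := (a, exist _ s h).
Definition num x : A := x.1.
Definition den x : A := sval x.2.
Let denS x : S (den x). Proof. exact: (svalP x.2). Qed.

(** The extra factor [u] makes the relation transitive even if [S] contains zero divisors. *)
Definition lequiv x y : bool :=
  `[< exists2 u, S u & u * (num x * den y) = u * (num y * den x) >].

Fact lequiv_equiv : equiv_class_of lequiv.
Proof.
split=> [x|x y|y x z].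
- by apply/asboolP; exists 1.
- by apply/asboolP/asboolP=> -[u Su E]; exists u.
- move=> /asboolP[u Su xy] /asboolP[v Sv yz]; apply/asboolP.
  exists (u * v * den y); first by do 2?apply: SM.
  transitivity (u * (num x * den y) * v * den z); first by ring.
  rewrite xy; transitivity (v * (num y * den z) * u * den x); first by ring.
  by rewrite yz; ring.
Qed.

Canonical lequiv_rel := EquivRelPack lequiv_equiv.

Definition lring : Type := {eq_quot lequiv}%qT.
HB.instance Definition _ : EqQuotient lpair lequiv lring := EqQuotient.on lring.
HB.instance Definition _ := Choice.on lring.

Let pi x : lring := \pi_({eq_quot lequiv}%qT)%qT x.
Let piP x y : pi x = pi y <->
  exists2 u, S u & u * (num x * den y) = u * (num y * den x).
Proof.
split=> [/eqmodP/asboolP//|h]; apply/eqmodP; exact/asboolP.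
Qed.
Let rep (a : lring) : lpair := repr a.
Let repK a : pi (rep a) = a. Proof. exact: reprK. Qed.

Definition ladd0 x y := mkl (num x * den y + num y * den x) (SM (denS x) (denS y)).
Definition lmul0 x y := mkl (num x * num y) (SM (denS x) (denS y)).
Definition lopp0 x := mkl (- num x) (denS x).

Let add0_mod x x' y y' : pi x = pi x' -> pi y = pi y' ->
  pi (ladd0 x y) = pi (ladd0 x' y').
Proof.
move=> /piP[u Su xx] /piP[v Sv yy]; apply/piP; exists (u * v); first exact: SM.
rewrite /ladd0 /num /den /=.
transitivity (u * (num x * den x') * (v * den y * den y')
  + v * (num y * den y') * (u * den x * den x')); first by rewrite /num /den; ring.
by rewrite xx yy /num /den; ring.
Qed.

Let mul0_mod x x' y y' : pi x = pi x' -> pi y = pi y' ->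
  pi (lmul0 x y) = pi (lmul0 x' y').
Proof.
move=> /piP[u Su xx] /piP[v Sv yy]; apply/piP; exists (u * v); first exact: SM.
rewrite /lmul0 /num /den /=.
transitivity (u * (num x * den x') * (v * (num y * den y')));
  first by rewrite /num /den; ring.
by rewrite xx yy /num /den; ring.
Qed.

Let opp0_mod x x' : pi x = pi x' -> pi (lopp0 x) = pi (lopp0 x').
Proof.
move=> /piP[u Su xx]; apply/piP; exists u => //; rewrite /lopp0 /num /den /=.
by rewrite !mulNr !mulrN; congr (- _).
Qed.

Definition ladd (a b : lring) : lring := pi (ladd0 (rep a) (rep b)).
Definition lmul (a b : lring) : lring := pi (lmul0 (rep a) (rep b)).
Definition lopp (a : lring) : lring := pi (lopp0 (rep a)).
Definition lcst a : lring := pi (mkl a S1).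

Let laddE x y : ladd (pi x) (pi y) = pi (ladd0 x y).
Proof. by apply: add0_mod; rewrite repK. Qed.
Let lmulE x y : lmul (pi x) (pi y) = pi (lmul0 x y).
Proof. by apply: mul0_mod; rewrite repK. Qed.
Let loppE x : lopp (pi x) = pi (lopp0 x).
Proof. by apply: opp0_mod; rewrite repK. Qed.

Let lring_ind (P : lring -> Prop) : (forall x, P (pi x)) -> forall a, P a.
Proof. by move=> Pp a; rewrite -(repK a). Qed.

Let pi_eq x y : num x * den y = num y * den x -> pi x = pi y.
Proof. by move=> E; apply/piP; exists 1; rewrite ?E. Qed.

Ltac lsolve := rewrite /lcst; do ?rewrite ?laddE ?lmulE ?loppE; apply: pi_eq;
  rewrite /ladd0 /lmul0 /lopp0 /num /den /=; ring.

Fact laddA : associative ladd.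
Proof.
by move=> a b c; elim/lring_ind: a => a; elim/lring_ind: b => b;
  elim/lring_ind: c => c; lsolve.
Qed.
Fact laddC : commutative ladd.
Proof. by move=> a b; elim/lring_ind: a => a; elim/lring_ind: b => b; lsolve. Qed.
Fact ladd0r : left_id (lcst 0) ladd.
Proof. by move=> a; elim/lring_ind: a => a; lsolve. Qed.
Fact laddN : left_inverse (lcst 0) lopp ladd.
Proof.
move=> a; elim/lring_ind: a => a; rewrite loppE laddE /lcst; apply: pi_eq.
by rewrite /ladd0 /lopp0 /num /den /= mulNr addNr !mul0r.
Qed.
HB.instance Definition _ := GRing.isZmodule.Build lring laddA laddC ladd0r laddN.

Fact lmulA : associative lmul.
Proof.
by move=> a b c; elim/lring_ind: a => a; elim/lring_ind: b => b;
  elim/lring_ind: c => c; lsolve.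
Qed.
Fact lmulC : commutative lmul.
Proof. by move=> a b; elim/lring_ind: a => a; elim/lring_ind: b => b; lsolve. Qed.
Fact lmul1 : left_id (lcst 1) lmul.
Proof. by move=> a; elim/lring_ind: a => a; lsolve. Qed.
Fact lmulD : left_distributive lmul ladd.
Proof.
move=> a b c; elim/lring_ind: a => a; elim/lring_ind: b => b.
elim/lring_ind: c => c; rewrite [ladd (pi a) _]laddE !lmulE laddE; lsolve.
Qed.
Fact l1neq0 : lcst 1 != lcst 0.
Proof.
apply/eqP=> /piP[u Su]; rewrite /num /den /= !mulr1 mulr0 => u0.
by apply: S0; rewrite -u0.
Qed.
HB.instance Definition _ := GRing.Zmodule_isComNzRing.Build lring
  lmulA lmulC lmul1 lmulD l1neq0.

Fact lcst_zmod : zmod_morphism lcst.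
Proof.
move=> a b; rewrite -[RHS]/(ladd (lcst a) (lopp (lcst b))) /lcst loppE laddE.
by apply: pi_eq; rewrite /ladd0 /lopp0 /num /den /= !mulr1.
Qed.
Fact lcst_monoid : monoid_morphism lcst.
Proof.
by split=> // a b; rewrite -[RHS]/(lmul (lcst a) (lcst b)); lsolve.
Qed.

Lemma localization_exists : exists (L : comNzRingType) (g : {rmorphism A -> L}),
  [/\ forall s, S s -> invertible (g s),
      forall x : L, exists a s, S s /\ x * g s = g a
    & forall a, g a = 0 -> exists2 s, S s & s * a = 0].
Proof.
pose g : {rmorphism A -> lring} := HB.pack lcst
  (GRing.isZmodMorphism.Build _ _ _ lcst_zmod)
  (GRing.isMonoidMorphism.Build _ _ _ lcst_monoid).
exists lring, g; split=> [s Ss|x|a].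
- exists (pi (mkl 1 Ss)); rewrite -[LHS]/(lmul (lcst s) (pi (mkl 1 Ss))).
  rewrite -[RHS]/(lcst 1); lsolve.
- elim/lring_ind: x => x; exists (num x), (den x); split; first exact: denS.
  rewrite -[LHS]/(lmul (pi x) (lcst (den x))) -[RHS]/(lcst (num x)); lsolve.
- move=> /piP[u Su]; rewrite /num /den /= mulr1 mul0r mulr0 => ua.
  by exists u.
Qed.

End Localization.

(** [is_localization_at] is the case of the complement of a prime; the powers of one element are the
    other case that occurs. *)
Definition loc_spec (A L : comNzRingType) (S : set A) (g : {rmorphism A -> L}) :=
  [/\ forall s, S s -> invertible (g s),
      forall x, exists a s, S s /\ x * g s = g a
    & forall a, g a = 0 -> exists2 s, S s & s * a = 0].

Lemma inv_cancel (A : comNzRingType) (u a b : A) :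
  invertible u -> u * a = u * b -> a = b.
Proof.
by case=> v uv E; rewrite -[a]mul1r -uv mulrAC E mulrAC uv mul1r.
Qed.

Lemma inv_cancelr (A : comNzRingType) (u a b : A) :
  invertible u -> a * u = b * u -> a = b.
Proof. by rewrite ![_ * u]mulrC; apply: inv_cancel. Qed.

Section LocTheory.
Variables (A L : comNzRingType) (S : set A) (g : {rmorphism A -> L}).
Hypotheses (mS : mult_set S) (gS : loc_spec S g).

Lemma loc_lift (R : comNzRingType) (h : {rmorphism A -> R}) :
  (forall s, S s -> invertible (h s)) ->
  exists f : {rmorphism L -> R}, forall a, f (g a) = h a.
Proof.
move=> hS; have [gu gs g0] := gS.
have hx x : exists y, forall a s, S s -> x * g s = g a -> y * h s = h a.
  have [a [s [Ss xs]]] := gs x; have [t st] := hS _ Ss.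
  exists (h a * t) => b s' Ss' xs'.
  have /g0[u Su uE] : g (a * s' - b * s) = 0.
    by rewrite rmorphB !rmorphM -xs -xs' mulrAC subrr.
  have /eqP : h u * (h a * h s' - h b * h s) = 0.
    by rewrite -!rmorphM -rmorphB -rmorphM uE rmorph0.
  rewrite mulrBr subr_eq0 => /eqP/(inv_cancel (hS _ Su)) E.
  by rewrite mulrAC E -mulrA st mulr1.
have [f fP] := choice hx.
have fE x y b s : S s -> x * g s = g b -> y * h s = h b -> f x = y.
  by move=> Ss xb yb; apply: (inv_cancelr (hS _ Ss)); rewrite (fP _ _ _ Ss xb).
have fB : zmod_morphism f.
  move=> x y; have [a [s [Ss xs]]] := gs x; have [b [t [St yt]]] := gs y.
  apply: (@fE _ _ (a * t - b * s) (s * t)); first exact: mS.2.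
    by rewrite rmorphB !rmorphM -xs -yt; ring.
  by rewrite rmorphB !rmorphM -(fP _ _ _ Ss xs) -(fP _ _ _ St yt); ring.
have fM : monoid_morphism f.
  split=> [|x y].
    by apply: (@fE _ _ 1 1); rewrite ?rmorph1 ?mulr1 //; apply: mS.1.
  have [a [s [Ss xs]]] := gs x; have [b [t [St yt]]] := gs y.
  apply: (@fE _ _ (a * b) (s * t)); first exact: mS.2.
    by rewrite !rmorphM -xs -yt; ring.
  by rewrite !rmorphM -(fP _ _ _ Ss xs) -(fP _ _ _ St yt); ring.
pose f' : {rmorphism L -> R} := HB.pack f
  (GRing.isZmodMorphism.Build _ _ _ fB) (GRing.isMonoidMorphism.Build _ _ _ fM).
exists f' => a; apply: (@fE _ _ a 1); first exact: mS.1.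
  by rewrite rmorph1 mulr1.
by rewrite rmorph1 mulr1.
Qed.

Lemma loc_epi (R : comNzRingType) (f1 f2 : {rmorphism L -> R}) :
  (forall a, f1 (g a) = f2 (g a)) -> f1 =1 f2.
Proof.
move=> f12 x; have [gu gs _] := gS; have [a [s [Ss xs]]] := gs x.
apply: (inv_cancelr (rmorph_inv f1 (gu _ Ss))).
by rewrite {2}f12 -!rmorphM xs.
Qed.

Lemma loc_num x : exists a u, invertible u /\ g a = x * u.
Proof.
have [gu gs _] := gS; have [a [s [Ss xs]]] := gs x.
by exists a, (g s); split=> //; apply: gu.
Qed.

Lemma loc_ideal (I : set L) : is_ideal I -> I = ideal_span (g @` (g @^-1` I)).
Proof.
move=> iI; rewrite eqEsubset; split; last first.
  by apply: span_min => // _ [a Ia <-].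
move=> x Ix; have [a [u [[v uv] ax]]] := loc_num x.
rewrite -[x]mulr1 -uv mulrA -ax mulrC.
apply: (idealM_l _ (span_ideal _)); apply: span_sub; exists a => //.
by rewrite /preimage /= ax; apply: (idealM_r _ iI).
Qed.

Lemma loc_spanP (I : set A) a : is_ideal I ->
  ideal_span (g @` I) (g a) <-> exists2 s, S s & I (s * a).
Proof.
move=> iI; have [gu gs g0] := gS; split=> [|[s Ss Isa]]; last first.
  have [t st] := gu _ Ss.
  rewrite -[g a]mul1r -st mulrAC -rmorphM mulrC.
  by apply: (idealM_l _ (span_ideal _)); apply: span_sub; exists (s * a).
have : ideal_span (g @` I) `<=`
    [set x | exists a s, [/\ S s, I a & x * g s = g a]].
  apply: span_min => [|_ [b Ib <-]]; last first.
    by exists b, 1; rewrite rmorph1 mulr1; split=> //; apply: mS.1.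
  split=> [|x y [b [s [Ss Ib xs]]] [c [t [St Ic yt]]]|x y [c [t [St Ic yt]]]].
  - exists 0, 1; rewrite rmorph0 mul0r; split=> //; first exact: mS.1.
    exact: ideal_0.
  - exists (b * t + c * s), (s * t); split; first exact: mS.2.
      by apply: idealD => //; apply: idealM_r.
    by rewrite rmorphD !rmorphM -xs -yt; ring.
  - have [b [s [Ss xs]]] := gs x.
    exists (b * c), (s * t); split; first exact: mS.2.
      exact: idealM_l.
    by rewrite !rmorphM -xs -yt; ring.
move=> /[apply] -[b [s [Ss Ib]]]; rewrite -rmorphM => /eqP.
rewrite -subr_eq0 -rmorphB => /eqP/g0[u Su /eqP].
rewrite mulrBr subr_eq0 => /eqP E; exists (u * s); first exact: mS.2.
by rewrite -mulrA [s * a]mulrC E; apply: idealM_l.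
Qed.

Lemma loc_noetherian : noetherian A -> noetherian L.
Proof.
move=> nA I iI; have [s sE] := nA _ (preim_ideal g iI).
exists (map g s); rewrite [LHS](loc_ideal iI) sE span_image_span.
congr ideal_span; rewrite eqEsubset; split=> [_ [a /= as_ <-]|_ /mapP[a as_ ->]].
  exact: map_f.
by exists a.
Qed.

Lemma loc_prime (p : set A) : is_prime p -> (forall a, p a -> ~ S a) ->
  is_prime (ideal_span (g @` p)) /\ forall a, ideal_span (g @` p) (g a) <-> p a.
Proof.
move=> pp pS; have ip := prime_ideal pp; have [gu gs g0] := gS.
have pE a : ideal_span (g @` p) (g a) <-> p a.
  rewrite loc_spanP //; split=> [[s Ss]|pa]; last first.
    by exists 1; rewrite ?mul1r //; apply: mS.1.
  by case: pp => _ _ pM /pM[/pS|].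
split=> //; split; first exact: span_ideal.
  by rewrite -(rmorph1 g) pE; case: pp.
have iP := span_ideal (g @` p).
have unitE x u : invertible u -> ideal_span (g @` p) (x * u) -> ideal_span (g @` p) x.
  by case=> v uv Px; rewrite -[x]mulr1 -uv mulrA; apply: (idealM_r _ iP).
move=> x y; have [a [u [uu ax]]] := loc_num x; have [b [v [uv bx]]] := loc_num y.
move=> Pxy; have /pE : ideal_span (g @` p) (g (a * b)).
  by rewrite rmorphM ax bx mulrACA; apply: (idealM_r _ iP).
case: pp => _ _ pM /pM[/pE|/pE]; rewrite ?ax ?bx => /unitE P.
  by left; apply: P.
by right; apply: P.
Qed.

End LocTheory.

Section LocPrime.
Variables (A : comNzRingType) (p : set A).
Hypothesis pp : is_prime p.

Lemma locp_exists : exists (L : comNzRingType) (g : {rmorphism A -> L}),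
  loc_spec [set a | ~ p a] g.
Proof.
apply: localization_exists; first exact: prime_mult.
by apply; apply: ideal_0; apply: prime_ideal.
Qed.

Variables (L : comNzRingType) (g : {rmorphism A -> L}).
Hypothesis gp : loc_spec [set a | ~ p a] g.

Lemma locp_unit a : invertible (g a) <-> ~ p a.
Proof.
have [P1 PE] := loc_prime (prime_mult pp) gp pp (fun a pa na => na pa).
split=> [ua /PE pa|]; last by case: gp => + _ _; apply.
by case: P1 => iP P1 _; apply: P1; apply: unit_span iP ua pa.
Qed.

Lemma locp_nonunits : [set x : L | ~ invertible x] = ideal_span (g @` p).
Proof.
have [P1 PE] := loc_prime (prime_mult pp) gp pp (fun a pa na => na pa).
rewrite eqEsubset; split=> x /=; last first.
  by move=> Px ux; case: P1 => iP P1 _; apply: P1; apply: unit_span iP ux Px.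
have [a [u [uu ax]]] := loc_num gp x => nx.
have pa : p a.
  apply: contrapT => /locp_unit; rewrite ax => ux; apply: nx.
  exact: invertibleMl ux.
have [v uv] := uu; rewrite -[x]mulr1 -uv mulrA -ax mulrC.
by apply: (idealM_l _ (span_ideal _)); apply: span_sub; exists a.
Qed.

Lemma locp_local : is_local L.
Proof. by rewrite /is_local locp_nonunits; apply: span_ideal. Qed.

End LocPrime.

Definition domain (A : comNzRingType) := is_prime [set (0 : A)].

(** The fraction field is the localization at the prime [0], whose nonunits form the ideal generated
    by the image of [0]. *)
Lemma domain_fraction (A : comNzRingType) : domain A ->
  exists (K : fieldType) (f : {rmorphism A -> K}), forall a, f a = 0 -> a = 0.
Proof.
move=> dA; have [L [g gp]] := locp_exists dA.
have Lu (x : L) : x != 0 -> invertible x.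
  move=> x0; apply: contrapT => nx.
  have : [set x : L | ~ invertible x] x by [].
  rewrite (locp_nonunits dA gp) => X.
  have := span_min _ _ X => /(_ [set 0]) /=; move: x0 => /eqP + H; apply; apply: H.
    by case: (prime_ideal dA); split=> //= [a b -> ->|a b ->];
       rewrite ?addr0 ?mulr0.
  by move=> _ [_ -> <-]; rewrite /= rmorph0.
have [inv invP] : exists inv : L -> L, forall x, (x != 0 -> inv x * x = 1) /\ inv 0 = 0.
  have H (x : L) : exists y, (x != 0 -> y * x = 1) /\ (x = 0 -> y = 0).
    have [->|/Lu[y xy]] := eqVneq x 0; first by exists 0; rewrite ?eqxx.
    by exists y; rewrite mulrC; split=> // x0; move: xy; rewrite x0 mul0r => /eqP;
      rewrite eq_sym oner_eq0.
  have [inv invP] := choice H; exists inv => x.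
  by split; [case: (invP x)|case: (invP 0) => _ ->].
pose M := GRing.ComNzRing_isField.Build L (fun x => (invP x).1) (invP 0).2.
pose K : fieldType := HB.pack L M.
exists K, (g : {rmorphism A -> K}) => a ga.
have [_ _ g0] := gp; have [s /= s0 sa] := g0 _ ga.
have [_ _ /(_ s a sa)[]//] := dA.
Qed.

Lemma prime_quotient (A : comNzRingType) (p : set A) : is_prime p ->
  exists (B : comNzRingType) (f : {rmorphism A -> B}),
    [/\ domain B, forall b, exists a, f a = b & forall a, f a = 0 <-> p a].
Proof.
move=> [ip p1 pM]; have [B [f [fs f0]]] := quotient_exists ip p1.
exists B, f; split=> //; split=> /=.
- by split=> //= [a b -> ->|a b ->]; rewrite ?addr0 ?mulr0.
- exact/eqP/oner_neq0.
- move=> a b; have [a' <-] := fs a; have [b' <-] := fs b.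
  by rewrite -rmorphM => /f0/pM[]/f0; [left|right].
Qed.

Lemma residue_field (A : comNzRingType) (p : set A) : is_prime p ->
  exists (K : fieldType) (f : {rmorphism A -> K}), forall a, f a = 0 <-> p a.
Proof.
move=> /prime_quotient[B [f [dB _ fp]]].
have [K [h h0]] := domain_fraction dB.
exists K, (h \o f : {rmorphism A -> K}) => a; rewrite -fp /=.
by split=> [/h0//|->]; rewrite rmorph0.
Qed.

Lemma field_isf (K : fieldType) : is_field K.
Proof. by move=> a a0; exists a^-1; rewrite mulfV. Qed.

Lemma isf_kernel (A L : comNzRingType) (f : {rmorphism A -> L}) :
  is_field L -> is_prime [set a | f a = 0].
Proof.
move=> fL; apply: (@preim_prime _ _ f [set 0]); split=> /=.
- by split=> //= [a b -> ->|a b ->]; rewrite ?addr0 ?mulr0.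
- exact/eqP/oner_neq0.
- move=> a b ab; have [->|/fL ua] := eqVneq a 0; [by left|right].
  by apply: (inv_cancel ua); rewrite ab mulr0.
Qed.

(** * Noetherian rings and Krull's height theorem *)

(** Without a maximal member, choice would produce a strictly increasing sequence in [F]; its union
    is an ideal with finitely many generators, all of which already occur at one stage. *)
Lemma noetherian_max (A : comNzRingType) (F : set (set A)) :
  noetherian A -> (forall I, F I -> is_ideal I) -> (exists I, F I) ->
  exists2 M, F M & forall I, F I -> M `<=` I -> I `<=` M.
Proof.
move=> nA iF [I0 FI0]; apply: contrapT => noM.
pose T := {I : set A | F I}.
have next (I : T) : exists J : T, sval I `<=` sval J /\ ~ sval J `<=` sval I.
  apply: contrapT => noJ; apply: noM; exists (sval I); first exact: svalP.
  move=> J FJ IJ; apply: contrapT => JI.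
  by apply: noJ; exists (exist _ J FJ).
have [f fP] := choice next.
pose u n := iter n f (exist _ I0 FI0 : T).
have u_mono m n : (m <= n)%N -> sval (u m) `<=` sval (u n).
  elim: n => [|n IH]; first by rewrite leqn0 => /eqP->.
  rewrite leq_eqVlt => /orP[/eqP->//|/IH um].
  by apply: (subset_trans um); case: (fP (u n)).
have iu n : is_ideal (sval (u n)) by apply: iF; apply: svalP.
pose U := [set a | exists n, sval (u n) a].
have iU : is_ideal U.
  split=> [|a b [m ma] [n nb]|a b [n nb]].
  - by exists 0; apply: (ideal_0 (iu 0)).
  - exists (maxn m n); apply: (idealD (iu _)).
      by apply: (u_mono m) => //; apply: leq_maxl.
    by apply: (u_mono n) => //; apply: leq_maxr.
  - by exists n; apply: (idealM_l _ (iu n)).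
have [s sE] := nA U iU.
have [N sN] : exists N, forall a, a \in s -> sval (u N) a.
  have : forall a, a \in s -> U a by move=> a as_; rewrite sE; apply: span_sub.
  elim: (s) => [|a t IH] tU; first by exists 0.
  have [|N tN] := IH; first by move=> b bt; apply: tU; rewrite inE bt orbT.
  have [M aM] := tU a (mem_head _ _).
  exists (maxn M N) => b; rewrite inE => /orP[/eqP->|/tN bN].
    by apply: u_mono aM; apply: leq_maxl.
  by apply: u_mono bN; apply: leq_maxr.
have [_ []] := fP (u N); apply: subset_trans (span_min (iu N) sN).
by rewrite -sE => a uNa; exists N.+1.
Qed.

Section HilbertBasis.
Variables (A : comNzRingType) (I : set {poly A}).
Hypotheses (nA : noetherian A) (iI : is_ideal I).

Let J d := [set a : A | exists f, [/\ I f, (size f <= d.+1)%N & f`_d = a]].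

Let iJ d : is_ideal (J d).
Proof.
split=> [|_ _ [f [If sf <-]] [g [Ig sg <-]]|a _ [f [If sf <-]]].
- by exists 0; rewrite size_poly0 coef0; split=> //; apply: (ideal_0 iI).
- exists (f + g); rewrite coefD; split; [exact: (idealD iI)| |by []].
  by apply: leq_trans (size_polyD _ _) _; rewrite geq_max sf.
- exists (a%:P * f); rewrite coefCM; split; [exact: (idealM_l _ iI)| |by []].
  by rewrite mul_polyC (leq_trans (size_scale_leq _ _)).
Qed.

Let J_mono d e : (d <= e)%N -> J d `<=` J e.
Proof.
move=> de _ [f [If sf <-]]; exists ('X^(e - d) * f); split.
- exact: (idealM_l _ iI).
- apply: leq_trans (size_polyMleq _ _) _; rewrite size_polyXn /=.
  by rewrite -(leq_add2l (e - d)) addnS subnK in sf.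
- by rewrite coefXnM ltnNge leq_subr /= subKn.
Qed.

Let lifts d : exists t : seq {poly A},
  (forall f, f \in t -> I f /\ (size f <= d.+1)%N) /\
  forall a, J d a -> ideal_span [set` map (fun f : {poly A} => f`_d) t] a.
Proof.
have [s sE] := nA (iJ d).
have [t [tI ts]] : exists t : seq {poly A},
    (forall f, f \in t -> I f /\ (size f <= d.+1)%N) /\
    map (fun f : {poly A} => f`_d) t = s.
  have : forall a, a \in s -> J d a by move=> a as_; rewrite sE; apply: span_sub.
  elim: (s) => [|a r IH] rJ; first by exists [::].
  have [|t [tI tr]] := IH; first by move=> b br; apply: rJ; rewrite inE br orbT.
  have [f [If sf fa]] := rJ a (mem_head _ _).
  exists (f :: t); split=> [g|]; last by rewrite /= fa tr.
  by rewrite inE => /orP[/eqP->//|/tI].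
by exists t; split=> // a; rewrite sE ts.
Qed.

(** The ideals [J d] of coefficients in degree [d] increase with [d] and are constant from some [N]
    on. Lifts of generators of [J 0], ..., [J N] generate [I], since combinations of them cancel the
    leading term of any element of [I]. *)
Lemma hilbert_ideal : exists s : seq {poly A}, I = ideal_span [set` s].
Proof.
have [t /all_and2[tI tJ]] := choice lifts.
pose U := [set a | exists d, J d a].
have iU : is_ideal U.
  split=> [|a b [m ma] [n nb]|a b [n nb]].
  - by exists 0; apply: (ideal_0 (iJ 0)).
  - exists (maxn m n); apply: (idealD (iJ _)).
      by apply: (@J_mono m) => //; apply: leq_maxl.
    by apply: (@J_mono n) => //; apply: leq_maxr.
  - by exists n; apply: (idealM_l _ (iJ n)).
have [s sE] := nA iU.
have [N sN] : exists N, forall a, a \in s -> J N a.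
  have : forall a, a \in s -> U a by move=> a as_; rewrite sE; apply: span_sub.
  elim: (s) => [|a r IH] rU; first by exists 0.
  have [|N rN] := IH; first by move=> b br; apply: rU; rewrite inE br orbT.
  have [M aM] := rU a (mem_head _ _).
  exists (maxn M N) => b; rewrite inE => /orP[/eqP->|/rN bN].
    by apply: J_mono aM; apply: leq_maxl.
  by apply: J_mono bN; apply: leq_maxr.
have UN : U `<=` J N by rewrite sE; apply: span_min.
pose r := flatten [seq t d | d <- iota 0 N.+1]; exists r.
have tr d f : (d <= N)%N -> f \in t d -> f \in r.
  move=> dN ft; apply/flattenP; exists (t d) => //.
  by apply: map_f; rewrite mem_iota add0n.
have iS := span_ideal [set` r].
rewrite eqEsubset; split; last first.
  apply: span_min => // f /= /flattenP[_ /mapP[d _ ->] /tI[]//].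
move=> f; have [n] := ubnP (size f); elim: n f => // n IH f fn If.
have [->|f0] := eqVneq f 0; first exact: (ideal_0 iS).
have sf : size f = (size f).-1.+1 by rewrite prednK // size_poly_gt0.
set d := (size f).-1 in sf.
(* In degrees above [N] the lifts attached to [N] suffice, after multiplication by a power of
   ['X]. *)
pose e := minn d N.
have : J e f`_d.
  rewrite /e; have [dN|Nd] := leqP d N; first by exists f; rewrite sf.
  by apply: UN; exists d, f; rewrite sf.
move=> /tJ/span_seqP[c fd].
rewrite size_map in c fd.
pose h := \sum_(i < size (t e)) c i *: 'X^(d - e) * (t e)`_i.
have eN : (e <= N)%N by apply: geq_minr.
have ed : (e <= d)%N by apply: geq_minl.
have Sh : ideal_span [set` r] h.
  apply: (ideal_sum _ iS) => i _; apply: (idealM_l _ iS); apply: span_sub => /=.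
  by apply: tr (mem_nth _ _).
have Ih : I h.
  move: h Sh; apply: span_min => // g /= /flattenP[_ /mapP[k _ ->] /tI[]//].
rewrite -(subrK h f); apply: (idealD iS) => //; apply: IH; last exact: idealB.
rewrite ltnS in fn; apply: leq_trans fn; rewrite sf ltnS.
have hs : (size h <= d.+1)%N.
  apply: leq_trans (size_sum _ _ _) _; apply/bigmax_leqP => i _.
  rewrite -scalerAl; apply: leq_trans (size_scale_leq _ _) _.
  apply: leq_trans (size_polyMleq _ _) _; rewrite size_polyXn /=.
  have [_ si] := tI _ _ (mem_nth 0 (ltn_ord i)).
  by apply: leq_trans (leq_add (leqnn _) si) _; rewrite addnS subnK.
have hd : h`_d = f`_d.
  rewrite fd coef_sum; apply: eq_bigr => i _.
  rewrite -scalerAl coefZ coefXnM ltnNge leq_subr /= subKn //.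
  by rewrite (nth_map 0).
apply/leq_sizeP => k; rewrite leq_eqVlt => /orP[/eqP<-|dk].
  by rewrite coefB hd subrr.
by rewrite coefB !nth_default ?subrr // ?sf // (leq_trans hs).
Qed.

End HilbertBasis.

Lemma hilbert_basis (A : comNzRingType) : noetherian A -> noetherian {poly A}.
Proof. by move=> nA I iI; apply: hilbert_ideal. Qed.

Lemma surj_noetherian (A B : comNzRingType) (f : {rmorphism A -> B}) :
  (forall b, exists a, f a = b) -> noetherian A -> noetherian B.
Proof.
move=> fs nA I iI; have [s sE] := nA _ (preim_ideal f iI).
exists (map f s); have -> : [set` map f s] = f @` [set` s].
  rewrite eqEsubset; split=> [_ /mapP[a as_ ->]|_ [a /= as_ <-]].
    by exists a.
  exact: map_f.
rewrite -span_image_span -sE eqEsubset; split=> [b Ib|].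
  by have [a fa] := fs b; apply: span_sub; exists a; rewrite /preimage /= ?fa.
by apply: span_min => // _ [a Ia <-].
Qed.

Section PrincipalIdealTheorem.
Variable L : comNzRingType.
Hypotheses (nL : noetherian L) (lL : is_local L).
Implicit Types (I J K p q : set L).

Let dcc K := forall J : nat -> set L,
  (forall n, is_ideal (J n)) -> (forall n, J n.+1 `<=` J n) ->
  (forall n, K `<=` J n) -> exists N, forall n, (N <= n)%N -> J n `<=` J n.+1.

(* The quotient has an element annihilated by the maximal ideal, so that      *)
(* Noetherian induction on K reduces to the simple module it generates.       *)
Lemma local_dcc I : is_ideal I ->
  (forall p, is_prime p -> I `<=` p -> forall a, ~ invertible a -> p a) -> dcc I.
Proof.
move=> iI pI; apply: contrapT => nI.
have [] := @noetherian_max L [set K | [/\ is_ideal K, I `<=` K & ~ dcc K]] nL.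
- by move=> K [].
- by exists I; split.
move=> K [iK IK ndK] maxK.
have K1 : ~ K 1.
  move=> K1; apply: ndK => J iJ _ KJ; exists 0%N => n _ a _.
  by rewrite -[a]mulr1; apply: idealM_l => //; apply: KJ.
have [] := @noetherian_max L [set C | exists2 a, ~ K a & C = [set b | K (b * a)]] nL.
- by move=> _ [a _ ->]; apply: colon_ideal.
- by exists [set b | K (b * 1)]; exists 1.
move=> _ [a Ka ->] maxC.
(* The colon ideal of [a] is maximal among the colon ideals of elements outside [K], hence prime; it
   contains [I], so by hypothesis it contains every nonunit. *)
have ma b : ~ invertible b -> K (b * a).
  apply: (pI [set b | K (b * a)]) => [|c /IK Kc]; last exact: idealM_r.
  split=> [||d c]; rewrite /= ?mul1r //; first exact: colon_ideal.
  move=> Kdc; have [Kc|Kc] := pselect (K (c * a)); [by right|left].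
  have /= := maxC _ (ex_intro2 _ _ (c * a) Kc erefl); apply=> /=.
    by move=> e Ke; rewrite /= mulrCA; apply: idealM_l.
  by rewrite /= mulrA.
pose Ka' := [set b | exists c d, K c /\ b = c + d * a].
have iKa : is_ideal Ka'.
  split=> [|_ _ [c [d [Kc ->]]] [c' [d' [Kc' ->]]]|e _ [c [d [Kc ->]]]].
  - by exists 0, 0; rewrite mul0r addr0; split=> //; apply: ideal_0.
  - by exists (c + c'), (d + d'); rewrite mulrDl addrACA; split=> //; apply: idealD.
  - by exists (e * c), (e * d); rewrite mulrDr mulrA; split=> //; apply: idealM_l.
have KKa : K `<=` Ka' by move=> b Kb; exists b, 0; rewrite mul0r addr0.
have dKa : dcc Ka'.
  apply: contrapT => nd; apply: Ka; apply: (maxK Ka') => //.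
    by split=> // b /IK /KKa.
  by exists 0, 1; rewrite mul1r add0r; split=> //; apply: ideal_0.
apply: ndK => J iJ decJ KJ.
have decJ' m n : (m <= n)%N -> J n `<=` J m.
  elim: n => [|n IH]; first by rewrite leqn0 => /eqP->.
  by rewrite leq_eqVlt => /orP[/eqP->//|/IH]; apply: subset_trans (decJ n).
(* If every [J n] contains [a], the chain lies over [Ka']. Otherwise no [J n] contains [a] from [N1]
   on, so in a decomposition [c + d * a] with [d * a] in [J n] the factor [d] is not a unit and
   [d * a] lies in [K]. *)
have [aJ|/existsNP[N1 aN1]] := pselect (forall n, J n a).
  apply: dKa => // n _ [c [d [Kc ->]]].
  by apply: (idealD (iJ n)); [apply: KJ|apply: (idealM_l _ (iJ n))].
pose Ja n := [set b | exists c d, J n c /\ b = c + d * a].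
have iJa n : is_ideal (Ja n).
  split=> [|_ _ [c [d [Kc ->]]] [c' [d' [Kc' ->]]]|e _ [c [d [Kc ->]]]].
  - by exists 0, 0; rewrite mul0r addr0; split=> //; apply: (ideal_0 (iJ n)).
  - exists (c + c'), (d + d'); rewrite mulrDl addrACA; split=> //.
    exact: (idealD (iJ n)).
  - exists (e * c), (e * d); rewrite mulrDr mulrA; split=> //.
    exact: (idealM_l _ (iJ n)).
have [||N2 N2P] := dKa Ja iJa.
- by move=> n _ [c [d [Jc ->]]]; exists c, d; split=> //; apply: decJ.
- by move=> n _ [c [d [Kc ->]]]; exists c, d; split=> //; apply: KJ.
exists (maxn N1 N2) => n; rewrite geq_max => /andP[N1n N2n] b Jb.
have [|c [d [Jc bE]]] := N2P n N2n b.
  by exists b, 0; rewrite mul0r addr0.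
rewrite bE; apply: (idealD (iJ n.+1)) => //; apply: KJ; apply: ma => -[e de].
apply: aN1; apply: (decJ' _ _ N1n).
rewrite -[a]mul1r -de mulrAC mulrC; apply: (idealM_l _ (iJ n)).
have -> : d * a = b - c by rewrite bE addrAC subrr add0r.
exact: (idealB (iJ n) Jb (decJ n c Jc)).
Qed.

Lemma local_sub1 (x y : L) : ~ invertible x -> invertible (1 - x * y).
Proof.
move=> nx; apply: contrapT => nxy; apply: (_ : ~ invertible (1 : L)).
  rewrite -(subrK (x * y) 1); apply: (idealD lL) => //.
  exact: (idealM_r _ lL).
exact: invertible1.
Qed.

(** Nakayama's lemma for the module generated by [s] modulo [N]. One generator at a time is
    eliminated: its coefficient [1 - x * c] in its own relation is a unit. *)
Lemma nakayama (N : set L) (x : L) (s : seq L) : is_ideal N -> ~ invertible x ->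
  (forall a, a \in s -> exists2 b, ideal_span [set` s] b & N (a - x * b)) ->
  forall a, a \in s -> N a.
Proof.
move=> iN nx; elim: s => [|a s IH] sN; first by [].
have iS := span_ideal [set` s].
have [d sd ad] : exists2 d, ideal_span [set` s] d & N (a - x * d).
  have [b /ideal_span_cons[c [d [sd ->]]] ab] := sN a (mem_head _ _).
  have [u uP] := local_sub1 c nx; exists (u * d); first exact: (idealM_l _ iS).
  rewrite (_ : _ - _ = u * (a - x * (c * a + d))); first exact: idealM_l.
  transitivity ((1 - x * c) * u * a - x * (u * d)); first by rewrite uP mul1r.
  by ring.
have sNs b : b \in s -> N b.
  apply: IH => e es; have [|f /ideal_span_cons[c [g [sg ->]]] ef] := sN e.
    by rewrite inE es orbT.
  exists (c * x * d + g); first by apply: (idealD iS) => //; apply: (idealM_l _ iS).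
  rewrite (_ : _ - _ = e - x * (c * a + g) + x * c * (a - x * d)); last by ring.
  by apply: idealD => //; apply: idealM_l.
move=> b; rewrite inE => /orP[/eqP->|/sNs//].
rewrite -(subrK (x * d) a); apply: idealD => //; apply: idealM_l => //.
by move: d sd {ad}; apply: span_min.
Qed.

(* The symbolic powers of (y) in L/q' at q, intersected with L/(x), stabilise *)
(* by the descending chain condition. *)
Lemma principal_ideal_theorem q' q (x y : L) : is_prime q' -> is_prime q -> q' `<=` q ->
  q y -> ~ q' y -> ~ q x -> ~ invertible x ->
  ~ (forall p, is_prime p -> q' `<=` p -> p x -> forall a, ~ invertible a -> p a).
Proof.
move=> pq' pq q'q qy q'y qx nx px.
have iq' := prime_ideal pq'; have iq := prime_ideal pq.
(* [S n] is the symbolic power: the contraction of [(y ^+ n)] from the localization of [L / q'] at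
   [q]. Below, [J n] is [S n + (x)]. *)
pose S n := [set a | exists t c, ~ q t /\ q' (t * a - c * y ^+ n)].
have iS n : is_ideal (S n).
  split=> [|a b [t [c [qt q'a]]] [u [d [qu q'b]]]|e a [t [c [qt q'a]]]].
  - exists 1, 0; rewrite mulr0 mul0r subrr; split; last exact: ideal_0.
    by case: pq.
  - exists (t * u), (c * u + d * t); split; first exact: primeM.
    rewrite (_ : _ - _ = u * (t * a - c * y ^+ n) + t * (u * b - d * y ^+ n));
      last by ring.
    by apply: idealD => //; apply: idealM_l.
  - exists t, (e * c); split=> //.
    rewrite (_ : _ - _ = e * (t * a - c * y ^+ n)); last by ring.
    exact: idealM_l.
have decS n : S n.+1 `<=` S n.
  by move=> a [t [c [qt q'a]]]; exists t, (c * y); rewrite -mulrA -exprS.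
have q'S n : q' `<=` S n.
  move=> a q'a; exists 1, 0; rewrite mul0r subr0 mul1r; split=> //.
  by case: pq.
pose J n := [set a | exists b c, S n b /\ a = b + c * x].
have iJ n : is_ideal (J n).
  split=> [|_ _ [c [d [Kc ->]]] [c' [d' [Kc' ->]]]|e _ [c [d [Kc ->]]]].
  - by exists 0, 0; rewrite mul0r addr0; split=> //; apply: (ideal_0 (iS n)).
  - exists (c + c'), (d + d'); rewrite mulrDl addrACA; split=> //.
    exact: (idealD (iS n)).
  - exists (e * c), (e * d); rewrite mulrDr mulrA; split=> //.
    exact: (idealM_l _ (iS n)).
pose I := [set a | exists b c, q' b /\ a = b + c * x].
have iI : is_ideal I.
  split=> [|_ _ [c [d [Kc ->]]] [c' [d' [Kc' ->]]]|e _ [c [d [Kc ->]]]].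
  - by exists 0, 0; rewrite mul0r addr0; split=> //; apply: ideal_0.
  - by exists (c + c'), (d + d'); rewrite mulrDl addrACA; split=> //; apply: idealD.
  - by exists (e * c), (e * d); rewrite mulrDr mulrA; split=> //; apply: idealM_l.
have [|||N NP] := local_dcc iI _ iJ.
- move=> p pp Ip; apply: px => // [a q'a|]; apply: Ip.
    by exists a, 0; rewrite mul0r addr0.
  by exists 0, 1; rewrite mul1r add0r; split=> //; apply: ideal_0.
- by move=> n _ [b [c [Sb ->]]]; exists b, c; split=> //; apply: decS.
- by move=> n _ [b [c [q'b ->]]]; exists b, c; split=> //; apply: q'S.
have [s sE] := nL (iS N).
(* Stability of [J] writes [a] in [S N] as [b + c * x] with [b] in [S N.+1]. Then [c * x] is in
   [S N], and so is [c] because [x] is not in [q]: Nakayama's lemma applies. *)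
have SN : S N `<=` S N.+1.
  rewrite {1}sE; apply: span_min; first exact: iS.
  apply: (nakayama (iS N.+1) nx) => a as_.
  have Sa : S N a by rewrite sE; apply: span_sub.
  have [|b [c [Sb aE]]] := NP N (leqnn _) a.
    by exists a, 0; rewrite mul0r addr0.
  exists c; last by rewrite aE mulrC addrK.
  rewrite -sE; have [t [e [qt]]] : S N (c * x).
    have -> : c * x = a - b by rewrite aE addrAC subrr add0r.
    exact: (idealB (iS N) Sa (decS N b Sb)).
  move=> q'e; exists (t * x), e; split; first exact: primeM.
  by rewrite -mulrA [x * c]mulrC.
(* This gives [(t - c * y) * y ^+ N] in [q'] with [t] outside [q]. As [y] is not in [q'], [t] is
   congruent to [c * y] modulo [q'], hence lies in [q]: a contradiction. *)
have [|t [c [qt]]] := SN (y ^+ N).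
  exists 1, 1; rewrite subrr; split; last exact: ideal_0.
  by case: pq.
rewrite exprS mulrA -mulrBl.
case: (pq') => _ _ /[apply] -[q't|/(primeX pq')//].
apply: qt; rewrite -(subrK (c * y) t); apply: idealD => //; first exact: q'q.
exact: idealM_l.
Qed.

End PrincipalIdealTheorem.

Lemma rad_pow (A : comNzRingType) (I : set A) a : is_ideal I ->
  (forall p, is_prime p -> I `<=` p -> p a) -> exists n, I (a ^+ n).
Proof.
move=> iI pa; apply: contrapT => no.
have [b Ib [n bn]|p [pp Ip pS]] := prime_disjoint (pow_mult a) iI.
  by apply: no; exists n; rewrite -bn.
by apply: (pS _ (pa _ pp Ip)); exists 1%N; rewrite expr1.
Qed.

Lemma chain_mono (A : comNzRingType) (P : nat -> set A) d :
  (forall i, (i < d)%N -> P i `<=` P i.+1 /\ ~ P i.+1 `<=` P i) ->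
  forall i j, (i <= j <= d)%N -> P i `<=` P j.
Proof.
move=> Ps i; elim=> [|j IH]; first by rewrite leqn0 => /andP[/eqP-> _].
move=> /andP[ij jd]; move: ij; rewrite leq_eqVlt => /orP[/eqP->//|ij].
apply: (subset_trans (IH _)); first by rewrite -ltnS ij ltnW.
by case: (Ps j jd).
Qed.

Lemma locp_chain (A L : comNzRingType) (p : set A) (g : {rmorphism A -> L}) d
    (P : nat -> set A) :
  is_prime p -> loc_spec [set a | ~ p a] g ->
  (forall i, (i <= d)%N -> is_prime (P i)) ->
  (forall i, (i < d)%N -> P i `<=` P i.+1 /\ ~ P i.+1 `<=` P i) ->
  P d `<=` p -> has_prime_chain L d.
Proof.
move=> pp gp pP Ps Pdp; exists (fun i => ideal_span (g @` P i)).
have Pp i : (i <= d)%N -> P i `<=` p.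
  by move=> id; apply: subset_trans Pdp; apply: chain_mono Ps _ _ _; rewrite id leqnn.
have H i (id : (i <= d)%N) := loc_prime (prime_mult pp) gp (pP i id)
  (fun a Pa na => na (Pp i id a Pa)).
split=> [i id|i id]; first by case: (H i id).
have [sub nsub] := Ps i id; split.
  by apply: span_mono => _ [a Pa <-]; exists a => //; apply: sub.
move=> sub'; apply: nsub => a Pa.
have [_ /(_ a) <-] := H i (ltnW id); apply: sub'.
by apply: span_sub; exists a.
Qed.

Lemma prime_nonunit (A : comNzRingType) (p : set A) a :
  is_prime p -> p a -> ~ invertible a.
Proof. by move=> pp pa ua; apply: prime_unit pp ua pa. Qed.

(** Induction on the number of generators. Let [p] be maximal among the non-maximal primes above the
    last but one member of the chain, and [x] a generator outside [p]. Only the maximal ideal lies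
    over [p + (x)], so each remaining generator has a power of the form [y + c * x] with [y] in [p].
    By the principal ideal theorem [p] is minimal over these [y], and the localization at [p] has
    one generator fewer and still a chain that is too long. *)
Lemma height_theorem d (L : comNzRingType) (s : seq L) :
  noetherian L -> is_local L -> size s = d -> (forall a, a \in s -> ~ invertible a) ->
  (forall p, is_prime p -> (forall a, a \in s -> p a) ->
     forall a, ~ invertible a -> p a) ->
  ~ has_prime_chain L d.+1.
Proof.
elim: d L s => [|d IH] L s nL lL ss nus sP [P [pP Ps]].
  have [_] := Ps 0%N isT; apply=> a P1a; apply: (sP (P 0%N)) => //.
  - exact: pP.
  - by move=> b; rewrite (size0nil ss).
  - exact: prime_nonunit (pP 1%N isT) P1a.
have [||p [pp Pp [a na pa]] maxp] := @noetherian_max L [set p | [/\ is_prime p,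
    P d.+1 `<=` p & exists2 a, ~ invertible a & ~ p a]] nL.
- by move=> p [/prime_ideal].
- exists (P d.+1); split=> //; first exact: pP.
  have [_] := Ps d.+1 (leqnn _).
  move=> /existsNP[a /not_implyP[Pa na]]; exists a => //.
  exact: prime_nonunit (pP d.+2 (leqnn _)) Pa.
have ip := prime_ideal pp.
have [x xs px] : exists2 x, x \in s & ~ p x.
  apply: contrapT => no; apply: pa; apply: sP => // b bs.
  by apply: contrapT => pb; apply: no; exists b.
have nx := nus x xs.
have overx q : is_prime q -> p `<=` q -> q x -> forall b, ~ invertible b -> q b.
  move=> pq pq' qx b nb; apply: contrapT => qb; apply: px.
  by apply: (maxp q) => //; split=> //; [apply: subset_trans pq'|exists b].
pose s' := rem x s.
have ss' : perm_eq s (x :: s') := perm_to_rem xs.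
have sz' : size s' = d by rewrite size_rem // ss.
pose I := [set a | exists b c, p b /\ a = b + c * x].
have iI : is_ideal I.
  split=> [|_ _ [c [e [Kc ->]]] [c' [e' [Kc' ->]]]|f _ [c [e [Kc ->]]]].
  - by exists 0, 0; rewrite mul0r addr0; split=> //; apply: ideal_0.
  - by exists (c + c'), (e + e'); rewrite mulrDl addrACA; split=> //; apply: idealD.
  - by exists (f * c), (f * e); rewrite mulrDr mulrA; split=> //; apply: idealM_l.
have powI z : ~ invertible z -> exists n, I (z ^+ n).
  move=> nz; apply: rad_pow => // q pq Iq; apply: overx => // [b pb|]; apply: Iq.
    by exists b, 0; rewrite mul0r addr0.
  by exists 0, 1; rewrite mul1r add0r; split=> //; apply: ideal_0.
have Y z : exists y, p y /\ (~ invertible z -> exists n c, z ^+ n = y + c * x).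
  have [uz|nz] := pselect (invertible z).
    by exists 0; split=> //; apply: ideal_0.
  by have [n [y [c [py zE]]]] := powI z nz; exists y; split=> // _; exists n, c.
have [f /all_and2[fp fE]] := choice Y.
have minp q : is_prime q -> q `<=` p -> (forall z, z \in s' -> q (f z)) -> p `<=` q.
  move=> pq qp qs y py; apply: contrapT => qy.
  apply: (principal_ideal_theorem nL lL pq pp qp py qy px nx) => r pr qr rx.
  apply: sP => // z; rewrite (perm_mem ss') inE => /orP[/eqP->//|zs'].
  have [|n [c zn]] := fE z; first by apply: nus; rewrite (perm_mem ss') inE zs' orbT.
  apply: (primeX (n := n) pr); rewrite zn; have ir := prime_ideal pr.
  by apply: idealD => //; [apply: qr; apply: qs|apply: idealM_l].
have [Lp [g gp]] := locp_exists pp.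
apply: (IH Lp (map (g \o f) s')).
- exact: (loc_noetherian gp).
- exact: (locp_local pp gp).
- by rewrite size_map.
- by move=> _ /mapP[z _ ->] /(locp_unit pp gp); apply.
- move=> q pq qs b nb; have : [set x | ~ invertible x] b by [].
  rewrite (locp_nonunits pp gp) => Hb; move: b Hb {nb}.
  apply: span_min; first exact: prime_ideal.
  move=> _ [b pb <-]; apply: (minp (g @^-1` q)) pb; first exact: preim_prime.
    by move=> c qc; apply: contrapT => /(locp_unit pp gp); apply: prime_nonunit pq qc.
  by move=> z zs; apply: qs; apply: (map_f (g \o f)).
- apply: (locp_chain pp gp (P := P)) => [i id|i id|//].
    by apply: pP; apply: leqW.
  by apply: Ps; apply: leqW.
Qed.

(** * Regularity at a prime *)

Definition chain_below (A : comNzRingType) (p : set A) (d : nat) :=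
  exists P : nat -> set A, [/\ forall i, (i <= d)%N -> is_prime (P i),
    forall i, (i < d)%N -> P i `<=` P i.+1 /\ ~ P i.+1 `<=` P i & P d `<=` p].

(* The local ring at p is regular, with a regular system of parameters        *)
(* extending s0.                                                              *)
Definition reg_at (A : comNzRingType) (p : set A) (s0 : seq A) :=
  exists s' : seq A, let s := s0 ++ s' in
    [/\ forall a, a \in s -> p a,
        forall a, p a -> exists2 t, ~ p t & ideal_span [set` s] (t * a)
      & chain_below p (size s)].

Lemma image_seq (A B : comNzRingType) (f : A -> B) (s : seq A) :
  f @` [set` s] = [set` map f s].
Proof.
rewrite eqEsubset; split=> [_ [a /= as_ <-]|_ /mapP[a as_ ->]]; first exact: map_f.
by exists a.
Qed.

(** The chain bounds the dimension from below, and the height theorem bounds it from above by the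
    number of generators of the maximal ideal. *)
Lemma reg_at_local (A L : comNzRingType) (p : set A) (g : {rmorphism A -> L}) s0 :
  noetherian A -> is_prime p -> loc_spec [set a | ~ p a] g -> reg_at p s0 ->
  regular_local L /\ exists s', regular_system (map g s0 ++ s').
Proof.
move=> nA pp gp [s' [sp ps [P [pP Ps Pp]]]].
have nL := loc_noetherian gp nA; have lL := locp_local pp gp.
have RS : regular_system (map g (s0 ++ s')).
  have mE : [set a : L | ~ invertible a] = ideal_span [set` map g (s0 ++ s')].
    rewrite (locp_nonunits pp gp) -image_seq eqEsubset; split.
      apply: span_min; first exact: span_ideal.
      move=> _ [a /ps[t tp sta] <-].
      have /(locp_unit pp gp)[u tu] := tp.
      rewrite -[g a]mul1r -tu mulrAC -rmorphM mulrC.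
      by apply: (idealM_l _ (span_ideal _)); apply: span_image.
    by apply: span_mono => _ [a /sp pa <-]; exists a.
  split=> //; rewrite size_map; split; first exact: (locp_chain pp gp pP Ps Pp).
  apply: (height_theorem (s := map g (s0 ++ s'))) => //; first by rewrite size_map.
    move=> a as_; have : ideal_span [set` map g (s0 ++ s')] a by apply: span_sub.
    by rewrite -mE.
  move=> q pq qs a na; have : [set x | ~ invertible x] a by [].
  by rewrite mE; apply: span_min; first exact: prime_ideal.
split; first by split=> //; exists (map g (s0 ++ s')).
by exists (map g s'); rewrite -map_cat.
Qed.

Lemma regular_ring_reg (A : comNzRingType) : noetherian A ->
  (forall p : set A, is_prime p -> reg_at p [::]) -> regular_ring A.
Proof.
move=> nA rA; split=> // p pp; have [L [g gp]] := locp_exists pp.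
exists L, g; have [rL _] := reg_at_local nA pp gp (rA p pp); split=> //.
Qed.

Section LocReg.
Variables (A B : comNzRingType) (S : set A) (g : {rmorphism A -> B}).
Hypotheses (mS : mult_set S) (gS : loc_spec S g).
Variable P : set B.
Hypothesis pP : is_prime P.
Let p := g @^-1` P.
Let pp : is_prime p := preim_prime g pP.
Let pS a : p a -> ~ S a.
Proof. by case: gS => gu _ _ pa /gu; apply: prime_nonunit pP pa. Qed.

(** Localization does not change the local ring at a prime that avoids [S]: the chains below [p]
    avoid [S] too and extend to [B]. *)
Lemma reg_loc_up s0 : reg_at p s0 -> reg_at P (map g s0).
Proof.
move=> [s' [sp ps [C [pC Cs Cp]]]]; exists (map g s'); rewrite /= -map_cat.
split.
- by move=> _ /mapP[a /sp pa ->].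
- move=> x Px; have [a [u [[v uv] ax]]] := loc_num gS x.
  have [|t tp sta] := ps a; first by rewrite /p /preimage /= ax; apply: (idealM_r _ (prime_ideal pP)).
  exists (g t) => //; have -> : g t * x = v * g (t * a).
    by rewrite rmorphM ax -[LHS]mulr1 -uv; ring.
  by apply: (idealM_l _ (span_ideal _)); rewrite -image_seq; apply: span_image.
have Cip i : (i <= size (s0 ++ s'))%N -> C i `<=` p.
  by move=> id; apply: subset_trans Cp; apply: chain_mono Cs _ _ _; rewrite id leqnn.
have H i (id : (i <= size (s0 ++ s'))%N) :=
  loc_prime mS gS (pC i id) (fun a Ca => pS (Cip i id a Ca)).
rewrite size_map; exists (fun i => ideal_span (g @` C i)); split=> [i id|i id|].
- by case: (H i id).
- have [sub nsub] := Cs i id; split.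
    by apply: span_mono => _ [a Pa <-]; exists a => //; apply: sub.
  move=> sub'; apply: nsub => a Ca.
  have [_ /(_ a) <-] := H i (ltnW id); apply: sub'.
  by apply: span_sub; exists a.
- by apply: span_min; [exact: prime_ideal|move=> _ [a /Cp pa <-]].
Qed.

(** Each generator over [B] is a unit times the image of its numerator [n x], so the numerators
    serve as generators over [A]. *)
Lemma reg_loc_down : reg_at P [::] -> reg_at p [::].
Proof.
move=> [s [/= sP Ps [C [pC Cs CP]]]].
have num x : exists a, exists2 u, invertible u & g a = x * u.
  by have [a [u [iu ax]]] := loc_num gS x; exists a, u.
have [n nP] := choice num; exists (map n s); rewrite /=.
have spanE x : ideal_span [set` s] x -> ideal_span (g @` [set` map n s]) x.
  apply: span_min; first exact: span_ideal.
  move=> b /= bs; have [u [v uv] nb] := nP b.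
  rewrite -[b]mulr1 -uv mulrA -nb mulrC; apply: (idealM_l _ (span_ideal _)).
  by apply: span_sub; exists (n b) => //; apply: map_f.
split.
- move=> _ /mapP[b bs ->]; have [u _ nb] := nP b.
  by rewrite /p /preimage /= nb; apply: (idealM_r _ (prime_ideal pP)); apply: sP.
- move=> a pa; have [x Px /spanE] := Ps (g a) pa.
  have [u uu nx] := nP x.
  move=> H; have : ideal_span (g @` ideal_span [set` map n s]) (g (n x * a)).
    rewrite span_image_span rmorphM nx mulrAC.
    exact: (idealM_r _ (span_ideal _)).
  rewrite (loc_spanP mS gS _ (span_ideal _)) => -[t St H'].
  exists (t * n x); last by rewrite -mulrA.
  apply: (primeM pp); first by move/pS.
  rewrite /p /preimage /= nx; apply: (primeM pP) => //.
  by move=> Pu; apply: prime_nonunit pP Pu uu.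
rewrite size_map; exists (fun i => g @^-1` C i); split=> [i id|i id|a Ca].
- by apply: preim_prime; apply: pC.
- have [sub nsub] := Cs i id; split=> [a|sub']; first exact: sub.
  have iC := prime_ideal (pC i (ltnW id)); have iC1 := prime_ideal (pC i.+1 id).
  apply: nsub => x Cx.
  have [u [v uv] nx] := nP x; rewrite -[x]mulr1 -uv mulrA -nx.
  apply: (idealM_r _ iC); apply: sub'; rewrite /preimage /= nx.
  exact: (idealM_r _ iC1).
- exact: CP.
Qed.

End LocReg.

Section PolyPrime.
Variable A : comNzRingType.
Implicit Types (p : set A) (f h : {poly A}).

Definition polyp p : set {poly A} := [set f | forall i, p f`_i].

Lemma polyp_ideal p : is_ideal p -> is_ideal (polyp p).
Proof.
move=> ip; split=> [i|f h pf ph i|f h ph i].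
- by rewrite coef0; apply: ideal_0.
- by rewrite coefD; apply: (idealD ip); [apply: pf|apply: ph].
- rewrite coefM; apply: (ideal_sum _ ip) => j _.
  by apply: (idealM_l _ ip); apply: ph.
Qed.

Lemma polypC p a : is_ideal p -> polyp p a%:P <-> p a.
Proof.
move=> ip; split=> [/(_ 0%N)|pa i]; first by rewrite coefC.
by rewrite coefC; case: eqP => // _; apply: ideal_0.
Qed.

Lemma polyp_prime p : is_prime p -> is_prime (polyp p).
Proof.
move=> pp; have ip := prime_ideal pp; split; first exact: polyp_ideal.
  by rewrite polypC //; case: pp.
move=> f h pfh; apply: contrapT => /not_orP[/existsNP nf /existsNP nh].
have [m mf mmin] : exists2 m, ~ p f`_m & forall i, (i < m)%N -> p f`_i.
  have exm : exists m, `[< ~ p f`_m >] by case: nf => m ?; exists m; apply/asboolP.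
  case: (ex_minnP exm) => m /asboolP ? mmin; exists m => // i im.
  by apply: contrapT => ni; have := mmin i (asboolT ni); rewrite leqNgt im.
have [n nn nmin] : exists2 n, ~ p h`_n & forall i, (i < n)%N -> p h`_i.
  have exm : exists m, `[< ~ p h`_m >] by case: nh => j ?; exists j; apply/asboolP.
  case: (ex_minnP exm) => j /asboolP ? mm; exists j => // i im.
  by apply: contrapT => ni; have := mm i (asboolT ni); rewrite leqNgt im.
have := pfh (m + n)%N; rewrite coefM.
have lt : (m < (m + n).+1)%N by rewrite ltnS leq_addr.
rewrite (bigD1 (Ordinal lt)) //= addKn => H.
apply: (primeM pp mf nn).
rewrite -[_ * _](addrK (\sum_(i < (m + n).+1 | i != Ordinal lt) f`_i * h`_(m + n - i))).
apply: (idealB ip) => //; apply: (ideal_sum _ ip) => i im.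
have [lti|gti|eqi] := ltngtP i m.
- by apply: (idealM_r _ ip); apply: mmin.
- by apply: (idealM_l _ ip); apply: nmin; rewrite ltn_subLR ?ltn_add2r // -ltnS.
- by case/eqP: im; apply: val_inj.
Qed.

(** With [q] the contraction of [P], either [P] is the extension of [q], or one polynomial [f] of
    least degree with leading coefficient outside [q] generates [P] over that extension after
    localization, by pseudo-division. *)
Lemma reg_poly (P : set {poly A}) s0 : is_prime P ->
  reg_at (polyC @^-1` P) s0 -> reg_at P (map polyC s0).
Proof.
move=> pP [s' [sq qs [C [pC Cs Cq]]]].
set q := polyC @^-1` P in sq qs Cq.
have pq : is_prime q := preim_prime (@polyC A) pP.
have iq := prime_ideal pq; have iP := prime_ideal pP.
set s := s0 ++ s' in sq qs pC Cs Cq.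
have qP : polyp q `<=` P.
  move=> f qf; rewrite -[f]coefK poly_def; apply: (ideal_sum _ iP) => i _.
  by rewrite -mul_polyC; apply: (idealM_r _ iP); apply: qf.
have spanC f : polyp q f ->
    exists2 t, ~ q t & ideal_span [set` map polyC s] (t%:P * f).
  elim/poly_ind: f => [|f c IH] qf.
    exists 1; first by case: pq.
    by rewrite mulr0; apply: (ideal_0 (span_ideal _)).
  have qc : q c by have := qf 0%N; rewrite coefD coefMX coefC add0r.
  have [t tq tf] : exists2 t, ~ q t & ideal_span [set` map polyC s] (t%:P * f).
    by apply: IH => i; have := qf i.+1; rewrite coefD coefMX coefC addr0.
  have [u uq uc] := qs c qc; exists (t * u); first exact: primeM.
  have iS := span_ideal [set` map polyC s].
  rewrite mulrDr; apply: (idealD iS).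
    rewrite polyCM (_ : _ * _ = u%:P * 'X * (t%:P * f)); last by ring.
    exact: (idealM_l _ iS).
  rewrite -polyCM -mulrA polyCM; apply: (idealM_l _ iS).
  by rewrite -image_seq; apply: (@span_image _ _ (@polyC A)).
have chainC : chain_below (polyp q) (size s).
  exists (fun i => polyp (C i)); split=> [i id|i id|f Cf i].
  - by apply: polyp_prime; apply: pC.
  - have [sub nsub] := Cs i id; split=> [f Cf j|sub']; first exact: sub.
    apply: nsub => a Ca; rewrite -polypC; last by apply/prime_ideal/pC/ltnW.
    by apply: sub'; rewrite polypC //; apply/prime_ideal/pC.
  - exact: Cq.
have sP a : a \in map polyC s -> P a by case/mapP=> b /sq qb ->.
(* In the second case there is one generator more, and [P] itself lengthens the chain by one. *)
have [Pq|nPq] := pselect (P `<=` polyp q).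
  exists (map polyC s'); rewrite /= -map_cat; split=> //.
    by move=> f /Pq/spanC[t tq tf]; exists t%:P.
  by rewrite size_map; case: chainC => D [D1 D2 D3]; exists D; split=> //;
    apply: subset_trans qP.
have [n [f [Pf sf lf]] minf] : exists2 n, (exists f, [/\ P f, size f = n & ~ q (lead_coef f)])
    & forall m, (m < n)%N -> ~ exists f, [/\ P f, size f = m & ~ q (lead_coef f)].
  have ex : exists n, `[< exists f, [/\ P f, size f = n & ~ q (lead_coef f)] >].
    move: nPq => /existsNP[f /not_implyP[Pf nf]].
    have [k] := ubnP (size f); elim: k f Pf nf => // k IH f Pf nf fk.
    have [ql|ql] := pselect (q (lead_coef f)); last first.
      by exists (size f); apply/asboolP; exists f.
    have f0 : f != 0.
      by apply: contra_notN nf => /eqP-> i; rewrite coef0; apply: ideal_0.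
    pose h : {poly A} := (lead_coef f)%:P * 'X^((size f).-1).
    have qh : polyp q h.
      by move=> i; rewrite coefCM; apply: (idealM_r _ iq).
    apply: (IH (f - h)); first by apply: (idealB iP) => //; apply: qP.
      move=> qfh; apply: nf; rewrite -(subrK h f).
      exact: (idealD (polyp_ideal iq)).
    rewrite ltnS in fk; apply: leq_trans fk.
    rewrite -(prednK (n := size f)) ?size_poly_gt0 // ltnS.
    apply/leq_sizeP => j; rewrite leq_eqVlt => /orP[/eqP<-|ij].
      by rewrite coefB coefCM coefXn eqxx mulr1 subrr.
    rewrite coefB coefCM coefXn gtn_eqF // mulr0 subr0 nth_default //.
    by rewrite -(prednK (n := size f)) ?size_poly_gt0.
  case: (ex_minnP ex) => n /asboolP exn minn; exists n => // m mn exm.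
  by have := minn m (asboolT exm); rewrite leqNgt mn.
have small h : P h -> (size h < size f)%N -> polyp q h.
  have [k] := ubnP (size h); elim: k h => // k IH h hk Ph hf.
  have [->|h0] := eqVneq h 0; first by move=> i; rewrite coef0; apply: ideal_0.
  have ql : q (lead_coef h).
    apply: contrapT => nl; apply: (minf (size h)); first by rewrite -sf.
    by exists h.
  pose r : {poly A} := (lead_coef h)%:P * 'X^((size h).-1).
  have qr : polyp q r by move=> i; rewrite coefCM; apply: (idealM_r _ iq).
  have sr : (size (h - r)%R < size h)%N.
    rewrite -(prednK (n := size h)) ?size_poly_gt0 // ltnS.
    apply/leq_sizeP => j; rewrite leq_eqVlt => /orP[/eqP<-|ij].
      by rewrite coefB coefCM coefXn eqxx mulr1 subrr.
    rewrite coefB coefCM coefXn gtn_eqF // mulr0 subr0 nth_default //.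
    by rewrite -(prednK (n := size h)) ?size_poly_gt0.
  rewrite -(subrK r h); apply: (idealD (polyp_ideal iq)) => //.
  apply: IH; first by rewrite ltnS in hk; apply: leq_trans sr hk.
    by apply: (idealB iP) => //; apply: qP.
  exact: ltn_trans sr hf.
have nlf : ~ P (lead_coef f)%:P by [].
exists (rcons (map polyC s') f); rewrite /= -rcons_cat -map_cat -/s; split.
- by move=> a; rewrite mem_rcons inE => /orP[/eqP->//|/sP].
- move=> h Ph; have f0 : f != 0.
    by apply: contra_notN lf => /eqP->; rewrite lead_coef0; apply: ideal_0.
  have E := Pdiv.ComRing.rdivp_eq f h.
  set k := Pdiv.CommonRing.rscalp h f in E; set r := Pdiv.CommonRing.rmodp h f in E.
  set d := Pdiv.CommonRing.rdivp h f in E.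
  have Pr : P r.
    have -> : r = (lead_coef f ^+ k)%:P * h - d * f by rewrite mul_polyC E addrAC subrr add0r.
    by apply: (idealB iP); apply: (idealM_l _ iP).
  (* The pseudo-remainder lies in [P] and is shorter than [f], so by minimality all its coefficients
     lie in [q]. *)
  have [t tq tr] := spanC r (small r Pr (Pdiv.CommonRing.ltn_rmodpN0 h f0)).
  have iS := span_ideal [set` rcons (map polyC s) f].
  exists (t%:P * (lead_coef f ^+ k)%:P).
    by apply: (primeM pP) => //; rewrite rmorphXn /=; apply: primeXn.
  rewrite -mulrA (mul_polyC (lead_coef f ^+ k)) E mulrDr; apply: (idealD iS).
    rewrite mulrA; apply: (idealM_l _ iS); apply: span_sub.
    by rewrite /= mem_rcons mem_head.
  apply: span_mono tr => a /= as_; by rewrite mem_rcons inE as_ orbT.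
- rewrite size_rcons size_map; case: chainC => D [D1 D2 D3].
  exists (fun i => if (i <= size s)%N then D i else P); split=> [i|i|].
  + by rewrite leq_eqVlt => /orP[/eqP->|]; rewrite ?ltnn // ltnS => is_; rewrite is_; apply: D1.
  + rewrite ltnS => is_; rewrite is_; have [->|ni] := eqVneq i (size s).
      rewrite ltnn; split; first exact: subset_trans D3 qP.
      by move=> PD; apply: nPq; apply: subset_trans D3.
    have lti : (i < size s)%N by rewrite ltn_neqAle ni.
    by rewrite lti; apply: D2.
  + by rewrite ltnn.
Qed.

End PolyPrime.

(** Parameters of the quotient by [u] lift and are completed by [u]; in a domain the zero ideal
    extends the chain at the bottom, since it does not contain [u]. *)
Lemma reg_quot (A C : comNzRingType) (f : {rmorphism A -> C}) u (q : set C)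
    (s0 : seq A) :
  domain A -> u != 0 -> (forall c, exists a, f a = c) ->
  (forall a, f a = 0 <-> exists b, a = b * u) -> is_prime q ->
  reg_at q (map f s0) -> reg_at (f @^-1` q) (u :: s0).
Proof.
move=> dA u0 fs fk pq [s' [sq qs [D [pD Ds Dq]]]].
have [r fr] := choice fs; exists (map r s'); rewrite /= -/(cat _ _).
have mE : map f (s0 ++ map r s') = map f s0 ++ s'.
  by rewrite map_cat -map_comp (@eq_map _ _ (f \o r) id) ?map_id // => x; apply: fr.
have fu : f u = 0 by apply/fk; exists 1; rewrite mul1r.
split.
- move=> a; rewrite inE => /orP[/eqP->|as_].
    by rewrite /preimage /= fu; apply: (ideal_0 (prime_ideal pq)).
  by rewrite /preimage /=; apply: sq; rewrite -mE; apply: map_f.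
- move=> a /qs[t tq]; have [t' ft] := fs t; rewrite -ft -rmorphM -mE => sa.
  exists t'; first by rewrite /preimage /= ft.
  have : exists2 b, ideal_span [set` s0 ++ map r s'] b & f b = f (t' * a).
    move: sa; rewrite -image_seq; apply: (@span_min _ _ [set c | exists2 b,
      ideal_span [set` s0 ++ map r s'] b & f b = c]); last first.
      by move=> _ [b bs <-]; exists b => //; apply: span_sub.
    have iS := span_ideal [set` s0 ++ map r s'].
    split=> [|_ _ [b sb <-] [c sc <-]|c _ [b sb <-]].
    + by exists 0; rewrite ?rmorph0 //; apply: (ideal_0 iS).
    + by exists (b + c); rewrite ?rmorphD //; apply: (idealD iS).
    + by exists (r c * b); rewrite ?rmorphM ?fr //; apply: (idealM_l _ iS).
  move=> [b sb fb]; have /fk[c cE] : f (t' * a - b) = 0 by rewrite rmorphB fb subrr.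
  apply/ideal_span_cons; exists c, b; split=> //.
  by rewrite -cE subrK.
- have sz : size (map f s0 ++ s') = size (s0 ++ map r s').
    by rewrite -mE size_map.
  rewrite sz in pD Ds Dq.
  exists (fun i => if i is j.+1 then f @^-1` D j else [set 0]); split=> [[|i] id|[|i] id|].
  + exact: dA.
  + by apply: preim_prime; apply: pD.
  + split=> [_ ->|sub].
      by rewrite /preimage /= rmorph0; apply: (ideal_0 (prime_ideal (pD 0%N isT))).
    have /eqP : [set (0 : A)] u.
      by apply: sub; rewrite /preimage /= fu; apply: (ideal_0 (prime_ideal (pD 0%N isT))).
    by rewrite (negPf u0).
  + have [sub nsub] := Ds i id; split=> [a|sub']; first exact: sub.
    by apply: nsub => c; have [a <-] := fs c; apply: sub'.
  + by move=> a; apply: Dq.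
Qed.

(** * Generators, free algebras and presentations *)

Definition ahom_of (O : comNzRingType) (A B : calg O) (g : {rmorphism A -> B})
  (gs : forall a, g (calg_str A a) = calg_str B a) : ahom A B :=
  @AHom O A B g (rmorphB g) (conj (rmorph1 g) (rmorphM g)) gs.

Lemma rmorph_mmap (A B C : comNzRingType) m (h : {rmorphism A -> B}) (b : 'I_m -> B)
    (f : {rmorphism B -> C}) (p : {mpoly A[m]}) :
  f (mmap h b p) = mmap (f \o h) (f \o b) p.
Proof.
rewrite /mmap rmorph_sum; apply: eq_bigr => i _; rewrite rmorphM; congr (_ * _).
by rewrite /mmap1 rmorph_prod; apply: eq_bigr => j _; rewrite rmorphXn.
Qed.

Lemma eq_mmap (A B : comNzRingType) m (h h' : A -> B) (b b' : 'I_m -> B)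
  (p : {mpoly A[m]}) : h =1 h' -> b =1 b' -> mmap h b p = mmap h' b' p.
Proof.
move=> hh bb; rewrite /mmap; apply: eq_bigr => i _; rewrite hh; congr (_ * _).
exact: mmap1_eq.
Qed.

Definition generated (A P : comNzRingType) (h : A -> P) m (X : 'I_m -> P) :=
  forall T : set P, (forall a b, T a -> T b -> T (a + b)) ->
    (forall a b, T a -> T b -> T (a * b)) -> (forall a, T (h a)) ->
    (forall i, T (X i)) -> forall p, T p.

Lemma generated_mmap (A P : comNzRingType) (h : {rmorphism A -> P}) m (X : 'I_m -> P) :
  generated h X -> forall p, exists q, mmap h X q = p.
Proof.
move=> gX; apply: (gX [set p | exists q, mmap h X q = p]) => /=.
- by move=> _ _ [q <-] [r <-]; exists (q + r); rewrite rmorphD.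
- by move=> _ _ [q <-] [r <-]; exists (q * r); rewrite rmorphM.
- by move=> a; exists a%:MP; rewrite mmapC.
- by move=> i; exists 'X_i; rewrite mmapX mmap1U.
Qed.

Lemma mmap_generated (A P : comNzRingType) (h : {rmorphism A -> P}) m (X : 'I_m -> P) :
  (forall p, exists q, mmap h X q = p) -> generated h X.
Proof.
move=> sX T TD TM Th TX p; have [q <-] := sX p.
rewrite /mmap; apply: (big_ind T) => [||r _]; first by rewrite -(rmorph0 h).
  exact: TD.
apply: (TM _ _ (Th _)); apply: (big_ind T) => [||i _]; first by rewrite -(rmorph1 h).
  exact: (TM).
elim: (r i) => [|n IH]; first by rewrite expr0 -(rmorph1 h).
by rewrite exprS; apply: TM.
Qed.

Lemma generated_ext (A P R : comNzRingType) (h : A -> P) m (X : 'I_m -> P)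
    (f g : {rmorphism P -> R}) : generated h X ->
  (forall a, f (h a) = g (h a)) -> (forall i, f (X i) = g (X i)) -> f =1 g.
Proof.
move=> gX fgh fgX; apply: (gX [set p | f p = g p]) => //= a b E F.
  by rewrite !rmorphD E F.
by rewrite !rmorphM E F.
Qed.

Definition free_over (A P : comNzRingType) (h : {rmorphism A -> P}) m (X : 'I_m -> P) :=
  generated h X /\
  forall (R : comNzRingType) (f : {rmorphism A -> R}) (v : 'I_m -> R),
    exists g : {rmorphism P -> R}, (forall a, g (h a) = f a) /\ forall i, g (X i) = v i.

Lemma eq_horner_morph (A R : comNzRingType) (f : {rmorphism A -> R}) (x : R) :
  exists g : {rmorphism {poly A} -> R}, (forall a, g a%:P = f a) /\ g 'X = x.
Proof.
have cfx : commr_rmorph f x by move=> a; apply: mulrC.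
exists (horner_morph cfx); split=> [a|]; first exact: horner_morphC.
exact: horner_morphX.
Qed.

Lemma ideal_zero (A : comNzRingType) : is_ideal [set (0 : A)].
Proof. by split=> //= [a b -> ->|a b ->]; rewrite ?addr0 ?mulr0. Qed.

Lemma poly_domain (A : comNzRingType) : domain A -> domain {poly A}.
Proof.
move=> /polyp_prime; rewrite /domain (_ : polyp _ = [set 0]) // eqEsubset.
split=> [f f0|_ -> i]; last by rewrite coef0.
by apply/polyP => i; rewrite coef0; apply: f0.
Qed.

Lemma domainM (A : comNzRingType) (a b : A) : domain A -> a * b = 0 -> a = 0 \/ b = 0.
Proof. by case=> _ _; apply. Qed.

Lemma loc_domain (A L : comNzRingType) (S : set A) (g : {rmorphism A -> L}) :
  mult_set S -> ~ S 0 -> loc_spec S g -> domain A ->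
  domain L /\ forall a, g a = 0 -> a = 0.
Proof.
move=> mS S0 gS dA; have [gu gs g0] := gS.
have inj a : g a = 0 -> a = 0.
  by move=> /g0[s Ss /(domainM dA)[s0|//]]; case: S0; rewrite -s0.
split=> //; split; first exact: ideal_zero.
  exact/eqP/oner_neq0.
move=> x y xy; have [a [u [uu ax]]] := loc_num gS x; have [b [v [uv bx]]] := loc_num gS y.
have /inj/(domainM dA) : g (a * b) = 0 by rewrite rmorphM ax bx mulrACA xy mul0r.
move=> [a0|b0]; [left|right] => /=.
  by apply: (inv_cancelr uu); rewrite -ax a0 rmorph0 mul0r.
by apply: (inv_cancelr uv); rewrite -bx b0 rmorph0 mul0r.
Qed.

(** Iterating [{poly _}] makes Hilbert's theorem and [reg_poly] available one variable at a time;
    the result is then used only through its universal property. *)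
Lemma free_exists (A : comNzRingType) m : noetherian A -> domain A ->
  exists (P : comNzRingType) (h : {rmorphism A -> P}) (X : 'I_m -> P),
    [/\ free_over h X, noetherian P, domain P
      & forall (p : set P) s0, is_prime p ->
          reg_at (h @^-1` p) s0 -> reg_at p (map h s0)].
Proof.
move=> nA dA; elim: m => [|m [P [h [X [[gX fX] nP dP rP]]]]].
  exists A, idfun, (fun i : 'I_0 => 0); split=> //; last by move=> p s0 _; rewrite map_id.
  split=> [T _ _ Th _ p|R f v]; first exact: Th.
  by exists f; split=> // -[].
pose X' (i : 'I_m.+1) : {poly P} := if unlift ord0 i is Some j then (X j)%:P else 'X.
exists {poly P}, (@polyC P \o h : {rmorphism A -> {poly P}}), X'; split.
- split=> [T TD TM Th TX p|R f v].
    have TC a : T a%:P.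
      apply: (gX [set a | T a%:P]) => //= [b c|b c|i].
      + by rewrite polyCD; apply: TD.
      + by rewrite polyCM; apply: TM.
      + by have := TX (lift ord0 i); rewrite /X' liftK.
    elim/poly_ind: p => [|p a Tp]; first by rewrite -polyC0.
    by apply: TD => //; apply: TM => //; have := TX ord0; rewrite /X' unlift_none.
  have [g [gh gX']] := fX R f (fun i => v (lift ord0 i)).
  have [g' [g'C g'X]] := eq_horner_morph g (v ord0).
  exists g'; split=> [a|i]; first by rewrite /= g'C.
  by rewrite /X'; case: unliftP => [j ->|->//]; rewrite g'C.
- exact: hilbert_basis.
- exact: poly_domain.
- move=> p s0 pp rp; rewrite map_comp; apply: reg_poly => //.
  by apply: rP => //; apply: preim_prime.
Qed.

(** Rings are nonzero here, so a quotient exists only for a proper ideal; the solution [v] of the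
    relations in some algebra ensures this. *)
Lemma presents_exists (O : comNzRingType) m (rels : seq {mpoly O[m]}) (R : calg O)
    (v : 'I_m -> R) : (forall p, p \in rels -> mmap (calg_str R) v p = 0) ->
  exists (B : calg O), presents B rels.
Proof.
move=> vr; have iI := span_ideal [set` rels].
have I1 : ~ ideal_span [set` rels] 1.
  pose e : {rmorphism {mpoly O[m]} -> R} := mmap (calg_str R) v.
  move=> I1; have : (e @^-1` [set 0]) 1.
    by apply: (span_min _ _ I1); [exact/preim_ideal/ideal_zero|exact: vr].
  by rewrite /preimage /= -[mmap _ _ _]/(e 1) rmorph1; apply/eqP/oner_neq0.
have [B [f [fs fk]]] := quotient_exists iI I1.
exists (@Calg O B (f \o @mpolyC m O)), (fun i => f 'X_i) => /=.
have E p : mmap (f \o @mpolyC m O) (fun i => f 'X_i) p = f p.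
  transitivity (f (mmap (@mpolyC m O) (fun i => 'X_i) p)).
    by rewrite rmorph_mmap; apply: eq_mmap.
  congr (f _); have := comp_mpoly_id p; rewrite /comp_mpoly => {2}<-.
  by apply: eq_mmap => // i; rewrite tnth_mktuple.
split=> p; last by rewrite E.
by have [q <-] := fs p; exists q.
Qed.

Lemma presents_lift (O : comNzRingType) (B R : calg O) m (rels : seq {mpoly O[m]})
    (b : 'I_m -> B) (v : 'I_m -> R) :
  (forall y, exists p, mmap (calg_str B) b p = y) ->
  (forall p, mmap (calg_str B) b p = 0 <-> ideal_span [set` rels] p) ->
  (forall p, p \in rels -> mmap (calg_str R) v p = 0) ->
  exists f : ahom B R, forall i, f (b i) = v i.
Proof.
move=> bs bk vr.
have [|f fE] := @quotient_lift _ _ _ (mmap (calg_str B) b : {rmorphism _ -> _})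
  (mmap (calg_str R) v : {rmorphism _ -> _}) bs.
  move=> a /= /bk; apply: (@span_min _ _ ((mmap (calg_str R) v : {rmorphism _ -> _}) @^-1` [set 0])).
    exact/preim_ideal/ideal_zero.
  exact: vr.
have fs a : f (calg_str B a) = calg_str R a.
  by have := fE a%:MP; rewrite /= !mmapC.
exists (ahom_of fs) => i; by have := fE 'X_i; rewrite /= !mmapX !mmap1U.
Qed.

(** The kernel is compared with that of the algebra [C] presented by [rels]: the lifting property
    maps [B] to [C], so a polynomial vanishing on [b] vanishes in [C]. *)
Lemma presents_intro (O : comNzRingType) (B : calg O) m (rels : seq {mpoly O[m]})
    (b : 'I_m -> B) :
  (forall y, exists p, mmap (calg_str B) b p = y) ->
  (forall p, p \in rels -> mmap (calg_str B) b p = 0) ->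
  (forall (R : calg O) (v : 'I_m -> R),
     (forall p, p \in rels -> mmap (calg_str R) v p = 0) ->
     exists f : ahom B R, forall i, f (b i) = v i) ->
  presents B rels.
Proof.
move=> bs br blift; exists b; split=> // p; split; last first.
  apply: (@span_min _ _ ((mmap (calg_str B) b : {rmorphism _ -> _}) @^-1` [set 0])).
    exact/preim_ideal/ideal_zero.
  exact: br.
move=> bp; have [C [c [cs ck]]] := presents_exists br.
have [|f fb] := blift C c; first by move=> q qr; apply/ck; apply: span_sub.
apply/ck; rewrite -(rmorph0 f) -bp rmorph_mmap.
apply/esym/eq_mmap => x; first by rewrite /= ahom_str.
by rewrite /= fb.
Qed.

(** * The algebra O[u,x,y]/(uxy - c) over a discrete valuation ring *)

Lemma reg_field (k : fieldType) (p : set k) : is_prime p -> reg_at p [::].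
Proof.
move=> pp; have p0 a : p a -> a = 0.
  move=> pa; apply/eqP; apply: contraT => /field_isf ua.
  by case: (prime_unit pp ua).
exists [::]; split=> //; last by exists (fun=> p); split.
by move=> a /p0 ->; exists 1; [case: pp|rewrite mulr0; apply: ideal_0 (span_ideal _)].
Qed.

Lemma field_domain (k : fieldType) : domain k.
Proof.
split; first exact: ideal_zero.
  exact/eqP/oner_neq0.
by move=> a b /= /eqP; rewrite mulf_eq0 => /orP[]/eqP; [left|right].
Qed.

(** A prime containing ['X] is pulled back along evaluation at [0], whose kernel is generated by
    ['X], so [reg_quot] applies. *)
Lemma reg_X (A : comNzRingType) (q : set {poly A}) s0 : domain A -> is_prime q ->
  q 'X -> reg_at (polyC @^-1` q) s0 -> reg_at q ('X :: map polyC s0).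
Proof.
move=> dA pq qX rq; have iq := prime_ideal pq.
have [f [fC fX]] := eq_horner_morph (idfun : {rmorphism A -> A}) 0.
have fk p : exists b, p = b * 'X + (f p)%:P.
  elim/poly_ind: p => [|p a _]; first by exists 0; rewrite rmorph0 mul0r addr0.
  by exists p; rewrite rmorphD rmorphM fX mulr0 add0r fC.
have -> : q = f @^-1` (polyC @^-1` q).
  rewrite eqEsubset; split=> p; rewrite /preimage /=; have [b pE] := fk p => H.
    have -> : (f p)%:P = p - b * 'X by rewrite {2}pE addrAC subrr add0r.
    by apply: (idealB iq) => //; apply: (idealM_l _ iq).
  by rewrite pE; apply: (idealD iq) => //; apply: (idealM_l _ iq).
apply: reg_quot => //.
- exact: poly_domain.
- by rewrite polyX_eq0.
- by move=> a; exists a%:P; rewrite fC.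
- move=> p; split=> [fp0|[b ->]]; last by rewrite rmorphM fX mulr0.
  by have [b pE] := fk p; exists b; rewrite pE fp0 polyC0 addr0.
- exact: preim_prime.
- by rewrite -map_comp (@eq_map _ _ (f \o polyC) id) ?map_id // => a; apply: fC.
Qed.

Section UXY.
Variables (O : comNzRingType) (w : O) (k : fieldType) (rho : {rmorphism O -> k}).
Hypotheses (dO : domain O) (nO : noetherian O) (w0 : w != 0)
  (rs : forall c, exists a, rho a = c)
  (rk : forall a, rho a = 0 <-> exists b, a = b * w) (u2 : invertible (2 : O))
  (dvr : forall a : O, a != 0 -> exists n v, invertible v /\ a = v * w ^+ n).
Let c : O := 2 * w.

Let c0 : c != 0.
Proof.
apply: contraNneq w0 => c0; apply/eqP/(inv_cancel u2).
by rewrite -[LHS]/c c0 mulr0.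
Qed.

(** The quotient of [O[u,x,y]] is described by its universal property and its generators. This form
    is symmetric in the three variables, so each computation is needed for one ordering only. *)
Definition uxy_spec (Q : comNzRingType) (h : {rmorphism O -> Q}) (u x y : Q) :=
  [/\ u * x * y = h c,
      forall (R : comNzRingType) (f : {rmorphism O -> R}) a b d, a * b * d = f c ->
        exists g : {rmorphism Q -> R},
          [/\ forall a, g (h a) = f a, g u = a, g x = b & g y = d]
    & forall T : set Q, (forall a b, T a -> T b -> T (a + b)) ->
        (forall a b, T a -> T b -> T (a * b)) -> (forall a, T (h a)) ->
        T u -> T x -> T y -> forall p, T p].

Lemma uxy_rot Q h u x y : @uxy_spec Q h u x y -> uxy_spec h x y u.
Proof.
move=> [uxy up gen]; split=> [|R f a b d abd|T T1 T2 T3 T4 T5 T6].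
- by rewrite -uxy mulrC mulrA.
- have [|g [gh gu gx gy]] := up R f d a b; first by rewrite -abd mulrC mulrA mulrC mulrA mulrC mulrA.
  by exists g.
- exact: gen.
Qed.

Lemma uxy_swap Q h u x y : @uxy_spec Q h u x y -> uxy_spec h u y x.
Proof.
move=> [uxy up gen]; split=> [|R f a b d abd|T T1 T2 T3 T4 T5 T6].
- by rewrite -uxy mulrAC.
- have [|g [gh gu gx gy]] := up R f a d b; first by rewrite -abd mulrAC.
  by exists g.
- exact: gen.
Qed.

Section Spec.
Variables (Q : comNzRingType) (h : {rmorphism O -> Q}) (u x y : Q).
Hypothesis Quxy : uxy_spec h u x y.

Let R1 : comNzRingType := {poly {poly O}}.
Let C1 : {rmorphism O -> R1} := polyC \o polyC.
Let U1 : R1 := 'X%:P.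
Let X1 : R1 := 'X.

Let dR1 : domain R1. Proof. exact/poly_domain/poly_domain. Qed.

(** Membership in the ideal of the monomial [U1 * X1] is the vanishing of certain coefficients, and
    the nonzero constant [c] can be cancelled in each of them. *)
Let UX_div (b : R1) : (exists d, C1 c * b = d * (U1 * X1)) ->
  exists d, b = d * (U1 * X1).
Proof.
move=> [d cb].
have b0 i j : (i == 0%N) || (j == 0%N) -> b`_i`_j = 0.
  move=> ij; have : (C1 c * b)`_i`_j = 0.
    rewrite cb mulrA coefMX; case: i ij => [|i] /= ij; first by rewrite coef0.
    by rewrite coefMC coefMX ij.
  rewrite coefCM coefCM => /(domainM dO)[/eqP|//].
  by rewrite (negPf c0).
pose d' : R1 := \poly_(i < size b) \poly_(j < size b`_i.+1) b`_i.+1`_j.+1.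
exists d'; apply/polyP=> -[|i]; apply/polyP=> j.
  by rewrite mulrA coefMX b0 ?coef0.
rewrite mulrA coefMX /= coefMC coefMX.
case: j => [|j] /=; first by rewrite b0 ?orbT.
rewrite coef_poly; case: ltnP => [_|bi].
  by rewrite coef_poly; case: ltnP => // bj; rewrite nth_default // leqW.
by rewrite [b`_i.+1]nth_default ?coef0 // leqW.
Qed.

(** An element is [e F] with [F] a polynomial in [y] over [O[U,X]]. If its image vanishes, clearing
    [y] with a power of [u * x] shows that the top coefficient of [F] is divisible by [U1 * X1];
    then [u * x * y = c] lowers the degree of [F] without changing [e F]. *)
Lemma uxy_inj (B : comNzRingType) (g1 : {rmorphism R1 -> B}) (f : {rmorphism Q -> B}) :
  (forall a, g1 a = 0 -> a = 0) -> (forall a, f (h a) = g1 (C1 a)) ->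
  f u = g1 U1 -> f x = g1 X1 -> forall a, f a = 0 -> a = 0.
Proof.
move=> g1i fh fu fx; have [uxy _ gen] := Quxy.
have [e0 [e0C e0X]] := eq_horner_morph h u.
have [e1 [e1C e1X]] := eq_horner_morph e0 x.
have [e [eC eX]] := eq_horner_morph e1 y.
have es a : exists F, e F = a.
  apply: (gen [set a | exists F, e F = a]) => //= [_ _ [F <-] [G <-]|_ _ [F <-] [G <-]|b|||].
  - by exists (F + G); rewrite rmorphD.
  - by exists (F * G); rewrite rmorphM.
  - by exists b%:P%:P%:P; rewrite eC e1C e0C.
  - by exists 'X%:P%:P; rewrite eC e1C e0X.
  - by exists 'X%:P; rewrite eC e1X.
  - by exists 'X.
have fe1 F : f (e1 F) = g1 F.
  elim/poly_ind: F => [|F a IH]; first by rewrite !rmorph0.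
  rewrite !rmorphD !rmorphM IH /= e1X fx e1C; congr (_ + _).
  elim/poly_ind: a => [|a b IHa]; first by rewrite polyC0 !rmorph0.
  rewrite polyCD polyCM !rmorphD !rmorphM IHa e0X fu e0C fh //.
have e1c : e1 (C1 c) = h c by rewrite [e1 _]e1C e0C.
have ax : e1 (U1 * X1) = u * x by rewrite rmorphM e1C e0X e1X.
move=> a fa0; have [F Fa] := es a; rewrite -Fa in fa0 *.
have [n] := ubnP (size F); elim: n F fa0 {Fa} => // n IH F fF Fn.
(* Each [u * x] absorbs one [y] and leaves [c], so modulo [U1 * X1] only the top coefficient
   survives, multiplied by [c ^+ d]. *)
have clear : forall (G : {poly R1}) d, (size G <= d.+1)%N ->
    exists r : R1, e1 r = (u * x) ^+ d * e G /\
      exists r', r = G`_d * C1 c ^+ d + r' * (U1 * X1).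
  elim/poly_ind => [|G g0 IHG] d Gd.
    exists 0; rewrite !rmorph0 mulr0; split=> //; exists 0.
    by rewrite coef0 mul0r mul0r addr0.
  case: d Gd => [|d] Gd.
    have G0 : G = 0.
      apply/eqP; apply: contraTT Gd => G0; rewrite size_MXaddC (negPf G0) /= -ltnNge ltnS.
      by rewrite size_poly_gt0.
    exists g0; rewrite G0 mul0r add0r eC expr0 mul1r; split=> //; exists 0.
    by rewrite coefC expr0 mulr1 mul0r addr0.
  have [|r [er [r' rE]]] := IHG d.
    by move: Gd; rewrite size_MXaddC; case: ifP => // /andP[/eqP-> _]; rewrite size_poly0.
  exists (C1 c * r + (U1 * X1) ^+ d.+1 * g0); split.
    rewrite [LHS]rmorphD [e1 (C1 c * r)]rmorphM [e1 (_ * g0)]rmorphM.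
    rewrite [e1 (_ ^+ _)]rmorphXn ax er e1c [e (_ + _)]rmorphD [e (G * 'X)]rmorphM.
    by rewrite eX eC exprS -uxy; ring.
  exists (C1 c * r' + (U1 * X1) ^+ d * g0).
  by rewrite coefD coefMX coefC addr0 rE !exprS; ring.
case: (ltnP 1 (size F)) => [F1|F1]; last first.
  have FE : F = (F`_0)%:P by apply: size1_polyC.
  by move: fF; rewrite FE eC fe1 => /g1i ->; rewrite rmorph0.
have [d sF] : exists d, size F = d.+2 by move: F1; case: (size F) => [|[|d]] // _; exists d.
have [|r [er [r' rE]]] := clear F d.+1; first by rewrite sF.
have /g1i r0 : g1 r = 0 by rewrite -fe1 er rmorphM fF mulr0.
have [G FG] : exists G, F`_d.+1 = G * (U1 * X1).
  have : exists D, C1 c ^+ d.+1 * F`_d.+1 = D * (U1 * X1).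
    by exists (- r'); apply/eqP; rewrite mulNr -addr_eq0 mulrC -rE r0.
  elim: (d.+1) (F`_d.+1) => [|j IHj] b; first by rewrite expr0 mul1r.
  by rewrite exprSr -mulrA => /IHj/UX_div.
pose F' := F - (G%:P * ('X * (U1 * X1)%:P - (C1 c)%:P)) * 'X^d.
have eF : e F = e F'.
  rewrite /F' [RHS]rmorphB [e (_ * 'X^d)]rmorphM [e (G%:P * _)]rmorphM.
  rewrite [e ('X * _ - _)]rmorphB [e ('X * _)]rmorphM !eC eX ax e1c -uxy.
  by rewrite (_ : y * (u * x) - u * x * y = 0) ?mulr0 ?mul0r ?subr0 //; ring.
rewrite eF; apply: IH; first by rewrite -eF.
rewrite ltnS sF in Fn; apply: leq_trans Fn; rewrite ltnS.
apply/leq_sizeP => j; rewrite leq_eqVlt coefB coefMXn => /orP[/eqP<-|dj].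
  rewrite ltnNge leqnSn /= subSnn coefCM coefB coefXM coefC coefC /= subr0.
  by rewrite -FG subrr.
rewrite ltnNge (ltnW (ltnW dj)) /= coefCM coefB coefXM !coefC.
have -> : (j - d == 0)%N = false by rewrite subn_eq0 leqNgt (ltnW dj).
have -> : ((j - d).-1 == 0)%N = false.
  by rewrite -subnS subn_eq0 leqNgt dj.
by rewrite nth_default ?sF // subr0 mulr0 subrr.
Qed.

(** Once [u * x] is inverted, [y] is determined as [c / (u x)]: the localization of [Q] is also one
    of the polynomial ring [O[U,X]], and integrality and regularity are read off there. *)
Lemma uxy_loc : exists (B : comNzRingType) (g1 : {rmorphism R1 -> B})
    (f : {rmorphism Q -> B}),
  [/\ loc_spec [set a | exists n, a = (U1 * X1) ^+ n] g1,
      loc_spec [set a | exists n, a = (u * x) ^+ n] f,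
      forall a, f (h a) = g1 (C1 a), forall a, f a = 0 -> a = 0 & domain B].
Proof.
have [uxy up gen] := Quxy.
have UX0 : U1 * X1 != 0.
  apply/eqP=> /(domainM dR1)[/eqP|/eqP]; last by rewrite polyX_eq0.
  by rewrite polyC_eq0 polyX_eq0.
have S0 : ~ [set a : R1 | exists n, a = (U1 * X1) ^+ n] 0.
  by move=> [n /esym/(primeX dR1)/eqP]; rewrite (negPf UX0).
have [B [g1 g1S]] := localization_exists (pow_mult (U1 * X1)) S0.
have [dB g1i] := loc_domain (pow_mult (U1 * X1)) S0 g1S dR1.
have [v v1] : invertible (g1 (U1 * X1)).
  by case: g1S => + _ _; apply; exists 1%N; rewrite expr1.
have [|f [fh fu fx fy]] := up B (g1 \o C1 : {rmorphism O -> B}) (g1 U1) (g1 X1) (v * g1 (C1 c)).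
  by rewrite mulrA -rmorphM v1 mul1r.
have fi := uxy_inj g1i fh fu fx.
have [e0 [e0C e0X]] := eq_horner_morph h u.
have [e1 [e1C e1X]] := eq_horner_morph e0 x.
have fe1 F : f (e1 F) = g1 F.
  elim/poly_ind: F => [|F a IH]; first by rewrite !rmorph0.
  rewrite !rmorphD !rmorphM IH /= e1X fx e1C; congr (_ + _).
  elim/poly_ind: a => [|a b IHa]; first by rewrite polyC0 !rmorph0.
  rewrite polyCD polyCM !rmorphD !rmorphM IHa e0X fu e0C fh //.
exists B, g1, f; split=> //; split=> [_ [n ->]|b|a /fi->].
- by rewrite rmorphXn rmorphM fu fx -rmorphM; apply: invertibleX; exists v.
- case: g1S => _ /(_ b)[F [_ [[n ->] bE]]] _.
  exists (e1 F), ((u * x) ^+ n); split; first by exists n.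
  by rewrite fe1 -bE rmorphXn !rmorphM fu fx rmorphXn rmorphM.
- by exists 1; [exists 0%N; rewrite expr0|rewrite mulr0].
Qed.

Lemma uxy_domain : domain Q.
Proof.
have [B [g1 [f [_ _ _ fi dB]]]] := uxy_loc.
rewrite /domain; have -> : [set (0 : Q)] = f @^-1` [set 0].
  rewrite eqEsubset; split=> [_ ->|a /fi//]; by rewrite /preimage /= rmorph0.
exact: preim_prime.
Qed.

Lemma uxy_noetherian : noetherian Q.
Proof.
have [_ _ gen] := Quxy.
have [e0 [e0C e0X]] := eq_horner_morph h u.
have [e1 [e1C e1X]] := eq_horner_morph e0 x.
have [e [eC eX]] := eq_horner_morph e1 y.
apply: (surj_noetherian (f := e)); last exact/hilbert_basis/hilbert_basis/hilbert_basis.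
apply: (gen [set a | exists F, e F = a]) => //= [_ _ [F <-] [G <-]|_ _ [F <-] [G <-]|b|||].
- by exists (F + G); rewrite rmorphD.
- by exists (F * G); rewrite rmorphM.
- by exists b%:P%:P%:P; rewrite eC e1C e0C.
- by exists 'X%:P%:P; rewrite eC e1C e0X.
- by exists 'X%:P; rewrite eC e1X.
- by exists 'X.
Qed.

Lemma uxy_hc_neq0 : h c != 0.
Proof.
have [B [g1 [f [g1S _ fh _ _]]]] := uxy_loc.
have UX0 : U1 * X1 != 0.
  apply/eqP=> /(domainM dR1)[/eqP|/eqP]; last by rewrite polyX_eq0.
  by rewrite polyC_eq0 polyX_eq0.
have S0 : ~ [set a : R1 | exists n, a = (U1 * X1) ^+ n] 0.
  by move=> [n /esym/(primeX dR1)/eqP]; rewrite (negPf UX0).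
have [_ g1i] := loc_domain (pow_mult (U1 * X1)) S0 g1S dR1.
apply/eqP=> hc; have := fh c; rewrite hc rmorph0 => /esym/g1i/eqP.
by rewrite !polyC_eq0 (negPf c0).
Qed.

(** As [2] is invertible, a prime without [w] avoids [u * x], so it can be studied in [O[U,X]]. It
    contracts to zero in [O], every nonzero element there being a unit times a power of [w]. *)
Lemma uxy_reg_generic (q : set Q) : is_prime q -> ~ q (h w) -> reg_at q [::].
Proof.
move=> pq qw; have [uxy _ _] := Quxy; have iq := prime_ideal pq.
have [B [g1 [f [g1S fS fh fi dB]]]] := uxy_loc.
have qS a : q a -> ~ [set a | exists n, a = (u * x) ^+ n] a.
  move=> qa [n aE]; apply: qw; rewrite aE in qa; have := primeX pq qa.
  move=> qux; have [v v1] := u2.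
  rewrite -[w]mul1r -v1 mulrAC rmorphM -uxy.
  by apply: (idealM_r _ iq); apply: (idealM_r _ iq).
have [pP PE] := loc_prime (pow_mult (u * x)) fS pq qS.
set P := ideal_span (f @` q) in pP PE.
have -> : q = f @^-1` P.
  by rewrite eqEsubset; split=> a; rewrite /preimage /= PE.
apply: (reg_loc_down (pow_mult (u * x)) fS pP).
apply: (reg_loc_up (pow_mult (U1 * X1)) g1S pP (s0 := [::])).
apply: (reg_poly (s0 := [::])); first exact: preim_prime.
apply: (reg_poly (s0 := [::])).
  by apply: (@preim_prime _ _ (@polyC {poly O})); apply: preim_prime.
set p := _ @^-1` _.
have p0 a : p a -> a = 0.
  rewrite /p /preimage /= -[g1 _]/(g1 (C1 a)) -fh => /PE qa.
  apply/eqP; apply: contra_notT qw => /dvr[n [v [uv aE]]].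
  move: qa; rewrite aE rmorphM rmorphXn => qa; apply: (primeX (n := n) pq).
  by case: (pq) => _ _ /(_ _ _ qa)[/(prime_nonunit pq)|//]; case; apply: rmorph_inv.
have pp : is_prime p.
  by apply: preim_prime; apply: (@preim_prime _ _ (@polyC {poly O})); apply: preim_prime.
exists [::]; split=> //; last by exists (fun=> p); split.
by move=> a /p0 ->; exists 1; [case: pp|rewrite mulr0; apply: ideal_0 (span_ideal _)].
Qed.

(** The quotient by [u] is [k[x,y]]: setting [u = 0] kills [c = 2 w], hence [w], and leaves [x] and
    [y] free. *)
Lemma uxy_special : exists f : {rmorphism Q -> {poly {poly k}}},
  [/\ f u = 0, f x = 'X%:P, f y = 'X, forall b, exists a, f a = b
    & forall a, f a = 0 <-> exists b, a = b * u].
Proof.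
have [uxy up gen] := Quxy.
have rw : rho w = 0 by apply/rk; exists 1; rewrite mul1r.
have [|f [fh fu fx fy]] :=
  up _ (polyC \o polyC \o rho : {rmorphism O -> {poly {poly k}}}) 0 'X%:P 'X.
  by rewrite !mul0r /= /c rmorphM rw mulr0 !polyC0.
exists f; split=> // [b|a].
  have fc (d : {poly k}) : exists a, f a = d%:P.
    elim/poly_ind: d => [|d e [a fa]]; first by exists 0; rewrite rmorph0.
    have [e' ee] := rs e; exists (a * x + h e').
    by rewrite rmorphD rmorphM fa fx fh /= ee polyCD polyCM.
  elim/poly_ind: b => [|b d [a fa]]; first by exists 0; rewrite rmorph0.
  have [e fe] := fc d; exists (a * y + e).
  by rewrite rmorphD rmorphM fa fy fe.
split=> [|[b ->]]; last by rewrite rmorphM fu mulr0.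
have [e0 [e0C e0X]] := eq_horner_morph h x.
have [e [eC eX]] := eq_horner_morph e0 y.
have [F [b ->]] : exists F b, a = e F + b * u.
  apply: (gen [set a | exists F b, a = e F + b * u]) => //= [_ _ [F [b ->]] [G [d ->]]|_ _ [F [b ->]] [G [d ->]]|d|||].
  - by exists (F + G), (b + d); rewrite rmorphD; ring.
  - by exists (F * G), (e F * d + b * e G + b * u * d); rewrite rmorphM; ring.
  - by exists d%:P%:P, 0; rewrite eC e0C mul0r addr0.
  - by exists 0, 1; rewrite rmorph0 mul1r add0r.
  - by exists 'X%:P, 0; rewrite eC e0X mul0r addr0.
  - by exists 'X, 0; rewrite eX mul0r addr0.
rewrite rmorphD rmorphM fu mulr0 addr0.
have fe0 G : f (e0 G) = (map_poly rho G)%:P.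
  elim/poly_ind: G => [|G a' IH]; first by rewrite !rmorph0.
  by rewrite !rmorphD !rmorphM IH e0X fx e0C fh /= map_polyX map_polyC.
have feF : f (e F) = map_poly (map_poly rho) F.
  elim/poly_ind: (F) => [|G a' IH]; first by rewrite !rmorph0.
  by rewrite !rmorphD !rmorphM IH eX fy eC fe0 /= map_polyX map_polyC.
rewrite feF => F0.
have [r rE] : exists r : O -> O, forall a, rho a = 0 -> a = r a * w.
  suff H (a' : O) : exists b', rho a' = 0 -> a' = b' * w by have [r rE] := choice H; exists r.
  by have [/rk[b' ->]|na] := pselect (rho a' = 0); [exists b'|exists 0].
pose F' : {poly {poly O}} := \poly_(i < size F) \poly_(j < size F`_i) r F`_i`_j.
have FE : F = w%:P%:P * F'.
  apply/polyP=> i; apply/polyP=> j; rewrite coefCM coefCM coef_poly.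
  case: ltnP => si; last by rewrite [F`_i]nth_default // !coef0 mulr0.
  rewrite coef_poly; case: ltnP => sj; last by rewrite mulr0 nth_default.
  rewrite mulrC; apply: rE; have := congr1 (fun G : {poly {poly k}} => G`_i`_j) F0.
  by rewrite coef_map coef_map !coef0.
have [v v1] := u2.
(* [v] inverts [2], so [w] equals [v * u * x * y] in [Q] and is a multiple of [u]. *)
exists (h v * x * y * e F' + b); rewrite mulrDl; congr (_ + _).
rewrite FE rmorphM eC e0C.
rewrite (_ : h v * x * y * e F' * u = h v * (u * x * y) * e F'); last by ring.
by rewrite uxy -rmorphM /c mulrA [v * 2]mulrC v1 mul1r.
Qed.

Variable q : set Q.
Hypotheses (pq : is_prime q) (qu : q u).

Let lift_reg (f : {rmorphism Q -> {poly {poly k}}}) (fu : f u = 0)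
    (fs : forall b, exists a, f a = b) (fk : forall a, f a = 0 <-> exists b, a = b * u) :
  exists2 q', is_prime q' & q = f @^-1` q' /\ forall s0, reg_at q' (map f s0) ->
    reg_at q (u :: s0).
Proof.
have iq := prime_ideal pq.
pose q' := [set b | exists2 a, q a & f a = b].
have E : q = f @^-1` q'.
  rewrite eqEsubset; split=> a; first by exists a.
  case=> a' qa' faa; have /fk[b ab] : f (a - a') = 0 by rewrite rmorphB faa subrr.
  by rewrite -(subrK a' a) ab; apply: (idealD iq) => //; apply: (idealM_l _ iq).
have fq a : q' (f a) <-> q a by rewrite E.
have pq' : is_prime q'.
  split.
  - split=> [|_ _ [a qa <-] [b qb <-]|b' _ [a qa <-]].
    + by exists 0; [apply: ideal_0|rewrite rmorph0].
    + by exists (a + b); [apply: idealD|rewrite rmorphD].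
    + have [b <-] := fs b'.
      by exists (b * a); [apply: idealM_l|rewrite rmorphM].
  - by rewrite -(rmorph1 f) fq; case: pq.
  - move=> a' b'; have [a <-] := fs a'; have [b <-] := fs b'.
    by rewrite -rmorphM !fq; case: pq => _ _; apply.
exists q' => //; split=> // s0 r0; rewrite E; apply: reg_quot => //.
  exact: uxy_domain.
apply: contraTneq (uxy_hc_neq0) => u0; have [<- _ _] := Quxy.
by rewrite u0 !mul0r eqxx.
Qed.

Lemma uxy_reg1 : reg_at q [:: u].
Proof.
have [f [fu fx fy fs fk]] := uxy_special.
have [q' pq' [_ H]] := lift_reg fu fs fk; apply: H.
apply: (reg_poly (s0 := [::])) => //; apply: (reg_poly (s0 := [::])).
  exact: preim_prime.
by apply: reg_field; do 2!apply: preim_prime.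
Qed.

Lemma uxy_reg2 : q y -> reg_at q [:: u; y].
Proof.
have [f [fu fx fy fs fk]] := uxy_special.
have [q' pq' [E H]] := lift_reg fu fs fk => qy.
have q'X : q' 'X by move: qy; rewrite E /preimage /= fy.
apply: H; rewrite /= fy; apply: (reg_X (s0 := [::])) => //.
  exact/poly_domain/field_domain.
apply: (reg_poly (s0 := [::])); first exact: preim_prime.
by apply: reg_field; do 2!apply: preim_prime.
Qed.

Lemma uxy_reg3 : q y -> q x -> reg_at q [:: u; y; x].
Proof.
have [f [fu fx fy fs fk]] := uxy_special.
have [q' pq' [E H]] := lift_reg fu fs fk => qy qx.
have q'X : q' 'X by move: qy; rewrite E /preimage /= fy.
have q'Y : q' 'X%:P by move: qx; rewrite E /preimage /= fx.
apply: H; rewrite /= fy fx; apply: (reg_X (s0 := [:: 'X])) => //.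
  exact/poly_domain/field_domain.
apply: (reg_X (s0 := [::])) => //; first exact: field_domain.
  exact: preim_prime.
by apply: reg_field; do 2!apply: preim_prime.
Qed.

End Spec.

(** At least one variable lies in [q] because their product does. Those in [q] are part of a regular
    system of parameters, and the product of the others is [t]. *)
Lemma uxy_reg_special (Q : comNzRingType) (h : {rmorphism O -> Q}) u x y (q : set Q) :
  uxy_spec h u x y -> is_prime q -> q (h w) ->
  exists s0 t, [/\ s0 <> [::], ~ q t, reg_at q s0 & h c = t * \prod_(a <- s0) a].
Proof.
move=> Q1 pq qw; have Q2 := uxy_rot Q1; have Q3 := uxy_rot Q2.
have E := let: And3 e _ _ := Q1 in e; have iq := prime_ideal pq.
have : q u \/ q x \/ q y.
  have : q (u * x * y) by rewrite E rmorphM; apply: (idealM_l _ iq).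
  by case: (pq) => _ _ pM /pM[/pM[]|]; [left|right; left|right; right].
have n1 := let: And3 _ e _ := pq in e.
have pr3 (a b d : Q) : \prod_(e <- [:: a; b; d]) e = a * b * d.
  by rewrite !big_cons big_nil mulr1 mulrA.
have pr2 (a b : Q) : \prod_(e <- [:: a; b]) e = a * b.
  by rewrite !big_cons big_nil mulr1.
have pr1 (a : Q) : \prod_(e <- [:: a]) e = a by rewrite !big_cons big_nil mulr1.
have [qu|nu] := pselect (q u); have [qx|nx] := pselect (q x);
  have [qy|ny] := pselect (q y) => H.
- exists [:: u; y; x], 1; rewrite pr3 mul1r -E; split=> //; last by ring.
  exact: (uxy_reg3 Q1).
- exists [:: u; x], y; rewrite pr2 -E; split=> //; last by ring.
  exact: (uxy_reg2 (uxy_swap Q1)).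
- exists [:: u; y], x; rewrite pr2 -E; split=> //; last by ring.
  exact: (uxy_reg2 Q1).
- exists [:: u], (x * y); rewrite pr1 -E; split=> //; last by ring.
    exact: primeM.
  exact: (uxy_reg1 Q1).
- exists [:: x; y], u; rewrite pr2 -E; split=> //; last by ring.
  exact: (uxy_reg2 (uxy_swap Q2)).
- exists [:: x], (u * y); rewrite pr1 -E; split=> //; last by ring.
    exact: primeM.
  exact: (uxy_reg1 Q2).
- exists [:: y], (u * x); rewrite pr1 -E; split=> //.
    exact: primeM.
  exact: (uxy_reg1 Q3).
- by case: H => [//|[//|//]].
Qed.

End UXY.

(** * Zariski-local statements *)

Section Local.
Variable O : comNzRingType.
Implicit Types (R S T L : calg O).

Lemma ahom_comp_id R S (g : ahom R S) : ahom_comp g (ahom_id R) = g.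
Proof. exact: ahom_eq. Qed.
Lemma ahom_id_comp R S (g : ahom R S) : ahom_comp (ahom_id S) g = g.
Proof. exact: ahom_eq. Qed.
Lemma ahom_compA R S T L (h : ahom T L) (g : ahom S T) (f : ahom R S) :
  ahom_comp h (ahom_comp g f) = ahom_comp (ahom_comp h g) f.
Proof. exact: ahom_eq. Qed.

(** If each prime misses an admissible [f], the admissible elements generate the unit ideal, and
    finitely many of them do. Local statements are thereby proved by exhibiting one [f] for each
    prime. *)
Lemma zar_primes R (P : forall S, ahom R S -> Prop) :
  zariski_locally P <-> forall p : set R, is_prime p -> exists2 f, ~ p f
    & forall S (g : ahom R S), invertible (g f) -> P S g.
Proof.
split=> [[s s1 sP] p pp|H].
  have [f fs pf] : exists2 f, f \in s & ~ p f.
    apply: contrapT => no; case: (pp) => ip p1 _; apply: p1.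
    apply: (span_min ip _ s1) => f fs; apply: contrapT => pf.
    by apply: no; exists f.
  by exists f => // S g; apply: sP.
pose X := [set f | forall S (g : ahom R S), invertible (g f) -> P S g].
have X1 : ideal_span X 1.
  apply: contrapT => nX1; have [p pp Xp] := prime_above (span_ideal X) nX1.
  by have [f pf fX] := H p pp; apply: pf; apply: Xp; apply: span_sub.
by have [s sX s1] := span_fin X1; exists s.
Qed.

Lemma zl_mono R (P P' : forall S, ahom R S -> Prop) :
  (forall S g, P S g -> P' S g) -> zariski_locally P -> zariski_locally P'.
Proof. by move=> PP' [s s1 sP]; exists s => // f fs S g gf; apply/PP'/(sP f fs). Qed.

Lemma zl_all R (P : forall S, ahom R S -> Prop) : (forall S g, P S g) -> zariski_locally P.
Proof.
by move=> allP; exists [:: 1] => [|f _ S g _]; [apply: span_sub; rewrite /= inE|exact: allP].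
Qed.

Lemma zl_and R (P P' : forall S, ahom R S -> Prop) :
  zariski_locally P -> zariski_locally P' ->
  zariski_locally (fun S g => P S g /\ P' S g).
Proof.
move=> /zar_primes H /zar_primes H'; apply/zar_primes => p pp.
have [f pf fP] := H p pp; have [f' pf' fP'] := H' p pp.
exists (f * f'); first exact: primeM.
move=> S g; rewrite rmorphM => gff; split; first exact/fP/invertibleMl/gff.
by apply: fP'; rewrite mulrC in gff; apply: invertibleMl gff.
Qed.

Lemma zl_base R S (h : ahom R S) (P : forall T, ahom R T -> Prop) :
  zariski_locally P -> zariski_locally (fun T (g : ahom S T) => P T (ahom_comp g h)).
Proof. exact: (@zariski_locally_fmap _ _ _ h P). Qed.

Lemma not_nilp R (p : set R) f : is_prime p -> ~ p f -> forall n, f ^+ n != 0.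
Proof.
move=> pp pf n; apply/eqP=> f0; apply: pf; apply: (primeX (n := n) pp).
by rewrite f0; apply: (ideal_0 (prime_ideal pp)).
Qed.

Definition is_locf R L (f : R) (i : ahom R L) :=
  [/\ loc_spec [set b | exists n, b = f ^+ n] i, invertible (i f)
    & forall S (g : ahom R S), invertible (g f) ->
        exists j : ahom L S, ahom_comp j i = g].

Lemma locf_exists R (f : R) : (forall n, f ^+ n != 0) ->
  exists L (i : ahom R L), is_locf f i.
Proof.
move=> fn; have S0 : ~ [set b | exists n, b = f ^+ n] 0.
  by move=> [n /esym/eqP]; apply/negP.
have [L [g gS]] := localization_exists (pow_mult f) S0.
pose L' : calg O := @Calg O L (g \o calg_str R).
have gs a : g (calg_str R a) = calg_str L' a by [].
exists L', (@ahom_of O R L' g gs); split=> [//||S h hf].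
  by case: gS => + _ _; apply; exists 1%N; rewrite expr1.
have [|j jg] := loc_lift (pow_mult f) gS (h := h).
  by move=> _ [n ->]; rewrite rmorphXn; apply: invertibleX.
have js a : j (calg_str L' a) = calg_str S a by rewrite /= jg; apply: (ahom_str h).
by exists (@ahom_of O L' S j js); apply: ahom_eq => a /=; apply: jg.
Qed.

(** A prime [p] missing [f] extends to the localization at [f]; there the second covering provides
    [f'], and [f] times a numerator of [f'] is the neighbourhood of [p] sought. *)
Lemma zl_trans R (P : forall S, ahom R S -> Prop) :
  zariski_locally (fun S (g : ahom R S) =>
    zariski_locally (fun T (h : ahom S T) => P T (ahom_comp h g))) ->
  zariski_locally P.
Proof.
move=> /zar_primes H; apply/zar_primes => p pp.
have [f pf fP] := H p pp.
have [L [i iL]] := locf_exists (not_nilp pp pf); have [iS fi iU] := iL.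
have [pP PE] := loc_prime (pow_mult f) iS pp
  (fun a pa '(ex_intro n E) => primeXn pp pf (eq_ind a p pa _ E)).
have /zar_primes/(_ _ pP)[f' Pf' f'P] := fP L i fi.
have [a [v [uv ia]]] := loc_num iS f'.
exists (f * a).
  apply: primeM => // /PE; rewrite ia => H'; apply: Pf'.
  have [w vw] := uv; rewrite -[f']mulr1 -vw mulrA.
  exact: (idealM_r _ (span_ideal _)).
move=> S g; rewrite rmorphM => gfa.
have [j jE] := iU S g (invertibleMl gfa); rewrite -jE; apply: f'P.
rewrite mulrC in gfa; apply: (@invertibleMl _ _ (j v)).
by rewrite -rmorphM -ia; move: (invertibleMl gfa); rewrite -{1}jE.
Qed.

Lemma zl_eq0 R (a : R) : zariski_locally (fun S (g : ahom R S) => g a = 0) -> a = 0.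
Proof.
move=> /zar_primes H; apply: contrapT => a0.
have [p pp Ip] : exists2 p, is_prime p & [set b | b * a = 0] `<=` p.
  apply: prime_above; last by rewrite /= mul1r.
  exact: (colon_ideal a (ideal_zero R)).
have [f pf fP] := H p pp.
have [L [i [iS fi _]]] := locf_exists (not_nilp pp pf).
case: iS => _ _ /(_ _ (fP L i fi))[_ [n ->] fa].
by apply: (primeXn pp pf (n := n)); apply: Ip.
Qed.

Lemma zl_eq R (a b : R) : zariski_locally (fun S (g : ahom R S) => g a = g b) -> a = b.
Proof.
move=> H; apply/eqP; rewrite -subr_eq0; apply/eqP/zl_eq0.
by apply: zl_mono H => S g E; rewrite rmorphB /= E subrr.
Qed.

Lemma zl_eqmx R N M (a b : 'M[R]_(N, M)) :
  zariski_locally (fun S (g : ahom R S) => map_mx g a = map_mx g b) -> a = b.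
Proof.
move=> H; apply/matrixP=> i j; apply: zl_eq; apply: zl_mono H => S g E.
by have := congr1 (fun A : 'M_(N, M) => A i j) E; rewrite !mxE.
Qed.

Definition local_sub (X : functor O) (U : subfunctor X) :=
  forall R (x : X R), zariski_locally (fun S g => U S (fmap g x)) -> U R x.

(** ** Submodules *)

Section Submodules.
Variable N : nat.

Lemma submodule0 (R : comNzRingType) (M : set 'rV[R]_N) : submodule M -> M 0.
Proof. by case. Qed.
Lemma submoduleD (R : comNzRingType) (M : set 'rV[R]_N) x y :
  submodule M -> M x -> M y -> M (x + y).
Proof. by move=> [_ MD] Mx My; rewrite -[x]scale1r; apply: MD. Qed.
Lemma submoduleZ (R : comNzRingType) (M : set 'rV[R]_N) a x :
  submodule M -> M x -> M (a *: x).
Proof. by move=> [M0 MD] Mx; rewrite -[_ *: _]addr0; apply: MD. Qed.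
Lemma submoduleB (R : comNzRingType) (M : set 'rV[R]_N) x y :
  submodule M -> M x -> M y -> M (x - y).
Proof.
by move=> sM Mx My; apply: submoduleD => //; rewrite -scaleN1r; apply: submoduleZ.
Qed.
Lemma submodule_sum (R : comNzRingType) (M : set 'rV[R]_N) (K : Type) (r : seq K)
    (P : pred K) (F : K -> 'rV[R]_N) :
  submodule M -> (forall i, P i -> M (F i)) -> M (\sum_(i <- r | P i) F i).
Proof.
move=> sM MF; apply: big_ind => // [|x y]; first exact: submodule0.
exact: submoduleD.
Qed.

Lemma submodule_colon (R : comNzRingType) (M : set 'rV[R]_N) x :
  submodule M -> is_ideal [set a | M (a *: x)].
Proof.
move=> sM; split=> [|a b|a b] /=; first by rewrite scale0r; apply: submodule0.
  by rewrite scalerDl; apply: submoduleD.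
by rewrite -scalerA; apply: submoduleZ.
Qed.

Lemma scale_inv (R : comNzRingType) (M : set 'rV[R]_N) a x :
  submodule M -> invertible a -> M (a *: x) -> M x.
Proof.
move=> sM [b ab] Max; rewrite -[x]scale1r -ab mulrC -scalerA.
exact: submoduleZ.
Qed.

Lemma locf_vec R L (f : R) (i : ahom R L) (y : 'rV[L]_N) : is_locf f i ->
  exists n (x : 'rV[R]_N), i f ^+ n *: y = map_mx i x.
Proof.
move=> [[_ is_ _] _ _].
have H (j : 'I_N) : exists n a, y 0 j * i f ^+ n = i a.
  by have [a [_ [[n ->] E]]] := is_ (y 0 j); exists n, a; rewrite -rmorphXn.
have /fin_all_exists[n /fin_all_exists[a aE]] := H.
pose m := (\sum_j n j)%N; exists m, (\row_j (f ^+ (m - n j) * a j)).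
apply/rowP=> j; rewrite !mxE rmorphM /= -aE rmorphXn /=.
have nm : (n j <= m)%N by rewrite /m (bigD1 j) //= leq_addr.
by rewrite -{1}(subnK nm) exprD; ring.
Qed.

Lemma locf_vec0 R L (f : R) (i : ahom R L) (x y : 'rV[R]_N) : is_locf f i ->
  map_mx i x = map_mx i y -> exists n, f ^+ n *: x = f ^+ n *: y.
Proof.
move=> [[_ _ i0] _ _] E.
have H (j : 'I_N) : exists n, f ^+ n * (x 0 j - y 0 j) = 0.
  have [|_ [n ->] nE] := i0 (x 0 j - y 0 j); last by exists n.
  by have := congr1 (fun A : 'rV_N => A 0 j) E; rewrite !mxE rmorphB /= => ->; rewrite subrr.
have /fin_all_exists[n nE] := H.
pose m := (\sum_j n j)%N; exists m.
apply/rowP=> j; rewrite !mxE; apply/eqP; rewrite -subr_eq0 -mulrBr.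
have nm : (n j <= m)%N by rewrite /m (bigD1 j) //= leq_addr.
by rewrite -(subnK nm) exprD -mulrA nE mulr0.
Qed.

Lemma ext_locf R L (f : R) (i : ahom R L) (M : set 'rV[R]_N) (y : 'rV[L]_N) :
  is_locf f i -> submodule M ->
  ext i M y <-> exists n x, M x /\ i f ^+ n *: y = map_mx i x.
Proof.
move=> iL sM; have [iS fi _] := iL; split=> [|[n [x [Mx E]]]]; last first.
  apply: (scale_inv (submodule_ext i M) (invertibleX n fi)).
  by rewrite E; apply: ext_in.
move: y; apply: (ext_ind (K := [set y | exists n x, M x /\ i f ^+ n *: y = map_mx i x])).
  split=> [|a y z [n [x [Mx yE]]] [m [x' [Mx' zE]]]].
    by exists 0%N, 0; rewrite scaler0 map_mx0; split=> //; apply: submodule0.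
  have [_ + _] := iS => /(_ a)[b [_ [[k ->]]]]; rewrite rmorphXn /= => bE.
  exists (k + n + m)%N, ((f ^+ m * b) *: x + f ^+ (k + n) *: x'); split.
    by apply: submoduleD => //; apply: submoduleZ.
  rewrite map_mxD !map_mxZ -yE -zE rmorphM !rmorphXn /= -bE.
  by rewrite scalerDr !scalerA !exprD; congr (_ *: _ + _ *: _); ring.
by move=> x Mx; exists 0%N, x; rewrite expr0 scale1r.
Qed.

Lemma ext_locf_map R L (f : R) (i : ahom R L) (M : set 'rV[R]_N) (x : 'rV[R]_N) :
  is_locf f i -> submodule M -> ext i M (map_mx i x) -> exists n, M (f ^+ n *: x).
Proof.
move=> iL sM /(ext_locf _ iL sM)[n [y [My E]]].
have [|m mE] := @locf_vec0 _ _ _ _ (f ^+ n *: x) y iL.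
  by rewrite map_mxZ rmorphXn.
exists (m + n)%N; rewrite exprD -scalerA mE; exact: submoduleZ.
Qed.

(** The ideal of all [a] with [a *: x] in [M] lies in no prime: near each prime a power of [f]
    brings [x] into [M]. *)
Lemma zl_mem R (M : set 'rV[R]_N) x : submodule M ->
  zariski_locally (fun S (g : ahom R S) => ext g M (map_mx g x)) -> M x.
Proof.
move=> sM /zar_primes H; rewrite -[x]scale1r; apply: contrapT => nM.
have [p pp Ip] := prime_above (submodule_colon x sM) nM.
have [f pf fP] := H p pp.
have [L [i iL]] := locf_exists (not_nilp pp pf); have [_ fi _] := iL.
have [n nM'] := ext_locf_map iL sM (fP L i fi).
by apply: (primeXn pp pf (n := n)); apply: Ip.
Qed.

Lemma zl_sub R (M M' : set 'rV[R]_N) : submodule M' ->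
  zariski_locally (fun S (g : ahom R S) => ext g M `<=` ext g M') -> M `<=` M'.
Proof.
move=> sM' H x Mx; apply: zl_mem => //; apply: zl_mono H => S g; apply.
exact: ext_in.
Qed.

Lemma zl_eqmod R (M M' : set 'rV[R]_N) : submodule M -> submodule M' ->
  zariski_locally (fun S (g : ahom R S) => ext g M = ext g M') -> M = M'.
Proof.
by move=> sM sM' H; rewrite eqEsubset; split; apply: zl_sub => //;
  apply: zl_mono H => S g ->.
Qed.

Lemma submods_eq R (x y : submods O N R) : sval x = sval y -> x = y.
Proof. by case: x y => [M sM] [M' sM'] /= E; apply: eq_exist. Qed.

(** The glued module consists of the vectors whose images lie in every local section. That it is
    large enough comes from clearing denominators with one exponent valid for the whole finite
    covering. *)
Lemma submods_sheaf : is_sheaf (submods O N).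
Proof.
move=> R s s1 cov sec secP.
have sE S g g' c c' : g = g' -> sec S g c = sec S g' c'.
  by move=> E; case: _ / E c' => c'; congr (sec S g _); apply: Prop_irrelevance.
pose Mf := [set x | forall S g (c : cov S g), sval (sec S g c) (map_mx g x)].
have sMf : submodule Mf.
  split=> [S g c|a x y Mx My S g c].
    by rewrite map_mx0; apply: (submodule0 (svalP (sec S g c))).
  by rewrite map_mxD map_mxZ; case: (svalP (sec S g c)) => _; apply;
    [apply: Mx|apply: My].
(* A vector lying in the sections over [D(f)] lies, after multiplication by a power of [f], in the
   section over each [D(f')]; the sum of the exponents works for all [f'] at once. *)
have key f : f \in s -> forall m : 'rV[R]_N,
    (forall S g (c : cov S g), invertible (g f) -> sval (sec S g c) (map_mx g m)) ->
    exists K, Mf (f ^+ K *: m).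
  move=> fs m mP.
  have H f' : exists K, f' \in s -> forall S (g : ahom R S) (c : cov S g),
      invertible (g f') -> sval (sec S g c) (map_mx g (f ^+ K *: m)).
    have [f's|] := boolP (f' \in s); last by exists 0%N.
    (* A nilpotent element has no localization among nonzero rings, but it never becomes invertible
       either. The same case distinction recurs for [f] restricted to [D(f')]. *)
    have [nilp|/forallNP nn] := pselect (exists n, f' ^+ n = 0).
      have [n fn] := nilp; exists 0%N => _ S g c gf.
      have := invertibleX n gf; rewrite -rmorphXn fn rmorph0 => -[b].
      by rewrite mul0r => /eqP; rewrite eq_sym oner_eq0.
    have [|L [i iL]] := @locf_exists R f'; first by move=> n; apply/eqP/nn.
    have [iS fi iU] := iL; have c1 : cov L i by exists f'.
    suff [K KP] : exists K, sval (sec L i c1) (map_mx i (f ^+ K *: m)).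
      exists K => _ S g c gf; have [j ji] := iU S g gf.
      have c' : cov S (ahom_comp j i) by rewrite ji.
      rewrite (sE S g (ahom_comp j i) c c') // -(secP _ _ i j c1 c').
      have -> : map_mx g (f ^+ K *: m) = map_mx j (map_mx i (f ^+ K *: m)).
        by rewrite -ji; apply/rowP=> k; rewrite !mxE.
      exact: ext_in.
    have [[n fn]|/forallNP nf] := pselect (exists n, i f ^+ n = 0).
      exists n; rewrite map_mxZ rmorphXn fn scale0r.
      exact: (submodule0 (svalP (sec L i c1))).
    have [|T [i2 i2T]] := @locf_exists L (i f); first by move=> n; apply/eqP/nf.
    have [_ fi2 _] := i2T.
    have c2 : cov T (ahom_comp i2 i) by exists f' => //; exact: (rmorph_inv i2 fi).
    have := mP _ _ c2 fi2; rewrite -(secP _ _ i i2 c1 c2) /=.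
    have -> : map_mx (ahom_comp i2 i) m = map_mx i2 (map_mx i m).
      by apply/rowP=> k; rewrite !mxE.
    move=> /(ext_locf_map i2T (svalP (sec L i c1)))[K KP]; exists K.
    by rewrite map_mxZ rmorphXn.
  have [K KP] := choice H; pose n := (\sum_(f' <- s) K f')%N; exists n.
  move=> S g c; have [f' f's gf] := c.
  have le : (K f' <= n)%N by rewrite /n (big_rem f') //= leq_addr.
  rewrite -(subnK le) exprD -scalerA map_mxZ; apply: submoduleZ; first exact: (svalP (sec S g c)).
  by apply: KP.
have MfE S g (c : cov S g) : ext g Mf = sval (sec S g c).
  rewrite eqEsubset; split; first by apply: ext_ind => [|x]; [exact: (svalP (sec S g c))|apply].
  have [f fs gf] := c.
  have fn n : f ^+ n != 0.
    apply/eqP=> f0; have := invertibleX n gf; rewrite -rmorphXn f0 rmorph0 => -[b].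
    by rewrite mul0r => /eqP; rewrite eq_sym oner_eq0.
  have [L [i iL]] := locf_exists fn; have [iS fi iU] := iL.
  have c1 : cov L i by exists f.
  have sub1 : sval (sec L i c1) `<=` ext i Mf.
    move=> y secy; have [n [m E]] := locf_vec y iL.
    have [|K KP] := key f fs m.
      move=> S' g' c' gf'; have [j ji] := iU S' g' gf'.
      have c'' : cov S' (ahom_comp j i) by rewrite ji.
      rewrite (sE S' g' (ahom_comp j i) c' c'') // -(secP _ _ i j c1 c'') /=.
      have -> : map_mx g' m = map_mx j (map_mx i m).
        by rewrite -ji; apply/rowP=> k; rewrite !mxE.
      apply: ext_in; rewrite -E; apply: submoduleZ => //.
      exact: (svalP (sec L i c1)).
    apply: (scale_inv (submodule_ext i Mf) (invertibleX (K + n) fi)).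
    by rewrite exprD -scalerA E -rmorphXn -map_mxZ; apply: ext_in.
  have [j ji] := iU S g gf; have c' : cov S (ahom_comp j i) by rewrite ji.
  rewrite (sE S g (ahom_comp j i) c c') // -(secP _ _ i j c1 c') -ji ext_comp /=.
  apply: ext_ind; first exact: submodule_ext.
  by move=> y /sub1 ?; apply: ext_in.
exists (exist _ Mf sMf); split=> [S g c|[M' sM'] M'P].
  by apply: submods_eq; apply: MfE.
apply: submods_eq; apply: zl_eqmod => //=; exists s => // f fs S g gf.
have c : cov S g by exists f.
by rewrite MfE -(M'P S g c).
Qed.

End Submodules.

Lemma prod_sheaf (X Y : functor O) : is_sheaf X -> is_sheaf Y -> is_sheaf (prod_functor X Y).
Proof.
move=> sX sY R s s1 cov sec secP.
have [|x [xP xU]] := sX R s s1 (fun S g c => (sec S g c).1).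
  by move=> S T g h c c'; rewrite -(secP S T g h c c').
have [|y [yP yU]] := sY R s s1 (fun S g c => (sec S g c).2).
  by move=> S T g h c c'; rewrite -(secP S T g h c c').
exists (x, y); split=> [S g c|[x' y'] H].
  by rewrite /= xP yP; case: (sec S g c).
congr pair; first by apply: xU => S g c; rewrite -H.
by apply: yU => S g c; rewrite -H.
Qed.

Lemma sub_sheaf (X : functor O) (U : subfunctor X) :
  is_sheaf X -> local_sub U -> is_sheaf (sub_functor U).
Proof.
move=> sX lU R s s1 cov sec secP.
have [|x [xP xU]] := sX R s s1 (fun S g c => sval (sec S g c)).
  by move=> S T g h c c'; rewrite -(secP S T g h c c').
have Ux : U R x.
  apply: lU; exists s => // f fs S g gf.
  have c : cov S g by exists f.
  by rewrite (xP S g c); apply: (svalP (sec S g c)).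
exists (exist _ x Ux); split=> [S g c|[x' Ux'] H].
  by case: (sec S g c) (xP S g c) => y Uy /= E; apply: eq_exist.
by apply: eq_exist; apply: xU => S g c; rewrite -H.
Qed.

Lemma sheaf_separated (X : functor O) R (x y : X R) : is_sheaf X ->
  zariski_locally (fun S g => fmap g x = fmap g y) -> x = y.
Proof.
move=> sX [s s1 sP].
have [|z [_ zU]] := sX R s s1 (fun S g _ => fmap g x).
  by move=> S T g h c c'; rewrite fmap_comp.
rewrite -(zU x) //; apply: zU => S g [f fs gf]; rewrite -(sP f fs) //.
Qed.

End Local.

(** * Charts smooth over O[u,x,y]/(uxy - 2w) *)

Lemma reg_at_nil (A : comNzRingType) (p : set A) s0 : reg_at p s0 -> reg_at p [::].
Proof. by move=> [s' H]; exists (s0 ++ s'). Qed.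

Lemma square_zero_unit (A : comNzRingType) (C D : calg A) (p : ahom C D) (a : C) :
  square_zero_ext p -> invertible (p a) -> invertible a.
Proof.
move=> [ps p0] [d pad]; have [b pb] := ps d.
have n0 : p (1 - a * b) = 0 by rewrite rmorphB rmorph1 rmorphM /= pb pad subrr.
have := p0 _ _ n0 n0; set n := 1 - a * b => nn.
have ab : a * b = 1 - n by rewrite /n subKr.
exists (b * (1 + n)); rewrite mulrA ab; transitivity (1 - n * n); first by ring.
by rewrite nn subr0.
Qed.

Section Good.
Variables (O : comNzRingType) (w : O) (k : fieldType) (rho : {rmorphism O -> k}).
Hypotheses (dO : domain O) (nO : noetherian O) (w0 : w != 0)
  (rs : forall c, exists a, rho a = c)
  (rk : forall a, rho a = 0 <-> exists b, a = b * w) (u2 : invertible (2 : O))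
  (dvr : forall a : O, a != 0 -> exists n v, invertible v /\ a = v * w ^+ n).
Let c : O := 2 * w.
Variable Q : calg O.
Hypothesis presQ : presents Q [:: \prod_(i < 3) 'X_i - c%:MP].

(** What a chart must satisfy for the claims on the blow-up. By the fourth clause, [c = 2 w] is near
    a point of the special fiber a unit times a product of members of a regular system of
    parameters. *)
Definition good (A : calg O) :=
  [/\ noetherian A, nonzerodivisor (calg_str A w),
      forall p : set A, is_prime p -> reg_at p [::],
      forall p : set A, is_prime p -> p (calg_str A w) ->
        exists s0 t, [/\ s0 <> [::], ~ p t, reg_at p s0
          & calg_str A c = t * \prod_(a <- s0) a]
    & exists h : ahom Q A, smooth_alg (as_alg h)].

Lemma mmap_uxy (R : calg O) (v : 'I_3 -> R) :
  mmap (calg_str R) v (\prod_(i < 3) 'X_i - c%:MP) =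
  v 0 * v 1 * v 2 - calg_str R c.
Proof.
rewrite mmapB mmapC; congr (_ - _).
rewrite [LHS](rmorph_prod (mmap (calg_str R) v)) !big_ord_recl big_ord0 /= mulr1 mulrA.
by rewrite !mmapX !mmap1U; do !congr (_ * _); congr v; apply: val_inj.
Qed.

Lemma presented_uxy : exists u x y : Q, uxy_spec w (calg_str Q) u x y.
Proof.
have [b [bs bk]] := presQ; exists (b 0), (b 1), (b 2).
have E : b 0 * b 1 * b 2 = calg_str Q c.
  apply/eqP; rewrite -subr_eq0 -mmap_uxy; apply/eqP; apply/bk.
  by apply: span_sub; rewrite /= mem_head.
split=> // [R f a x y axy|T TD TM Th T1 T2 T3].
  pose R' : calg O := @Calg O R f.
  pose v (i : 'I_3) : R' := tnth [tuple a; x; y] i.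
  have [|g gv] := presents_lift (R := R') bs bk (v := v).
    move=> p; rewrite inE => /eqP->; rewrite mmap_uxy.
    by apply/eqP; rewrite subr_eq0 /=; apply/eqP; rewrite -axy.
  exists (g : {rmorphism Q -> R'}).
  by split=> [d|||]; [apply: (ahom_str g)|rewrite /= gv..].
apply: (mmap_generated bs) => // i.
case: i => -[|[|[|//]]] i3.
- by have -> : Ordinal i3 = 0 by apply: val_inj.
- by have -> : Ordinal i3 = 1 by apply: val_inj.
- by have -> : Ordinal i3 = 2 by apply: val_inj.
Qed.

(** The algebra is the polynomial ring [Q[V_1, ..., V_m]] localized at [s], representing the
    solutions of [u * x * y = c] with [s] invertible. The function [s] is given naturally on all
    points, and its value at the universal point is what is inverted. *)
Lemma chart_alg m (s : forall R : calg O, R -> R -> R -> ('I_m -> R) -> R) :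
  (forall (R S : calg O) (g : ahom R S) u x y v,
     g (s R u x y v) = s S (g u) (g x) (g y) (g \o v)) ->
  (exists (R : calg O) (u x y : R) v,
     u * x * y = calg_str R c /\ invertible (s R u x y v)) ->
  exists (A : calg O) (U X Y : A) (V : 'I_m -> A),
    [/\ good A, U * X * Y = calg_str A c, invertible (s A U X Y V),
      forall (R : calg O) (u x y : R) v,
        u * x * y = calg_str R c -> invertible (s R u x y v) ->
        exists f : ahom A R, [/\ f U = u, f X = x, f Y = y & forall i, f (V i) = v i]
    & forall (R : calg O) (f g : ahom A R), f U = g U -> f X = g X -> f Y = g Y ->
        (forall i, f (V i) = g (V i)) -> f = g].
Proof.
move=> snat [R0 [u0 [x0 [y0 [v0 [e0 s0]]]]]].
have [u [x [y Quxy]]] := presented_uxy; have [uxy Qup Qgen] := Quxy.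
have dQ := uxy_domain dO w0 u2 Quxy; have nQ := uxy_noetherian nO Quxy.
have [P [h [Z [[Zgen Zup] nP dP regP]]]] := free_exists m nQ dQ.
pose P' : calg O := @Calg O P (h \o calg_str Q).
pose sP : P := s P' (h u) (h x) (h y) Z.
have toP (R : calg O) (a b d : R) (v : 'I_m -> R) : a * b * d = calg_str R c ->
    exists f : ahom P' R, [/\ f (h u) = a, f (h x) = b, f (h y) = d, forall i, f (Z i) = v i
      & f sP = s R a b d v].
  move=> abd; have [g [gO gu gx gy]] := Qup R (calg_str R) a b d abd.
  have [f [fh fZ]] := Zup R g v.
  have fs t : f (calg_str P' t) = calg_str R t by rewrite /= fh gO.
  exists (@ahom_of O P' R f fs); rewrite /= !fh gu gx gy; split=> //.
  apply: (etrans (snat P' R (@ahom_of O P' R f fs) (h u) (h x) (h y) Z)).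
  rewrite /= !fh gu gx gy; congr s.
  by apply/funext => i; rewrite /= fZ.
have Pext (R : calg O) (f g : {rmorphism P -> R}) :
    (forall t, f (h t) = g (h t)) -> (forall i, f (Z i) = g (Z i)) -> f =1 g.
  exact: generated_ext.
(* The assumed solution shows that [sP] is not nilpotent, so that the localization is a nonzero
   ring. *)
have S0 : ~ [set b : P | exists n, b = sP ^+ n] 0.
  move=> [n sn]; have [f [_ _ _ _ fs]] := toP R0 u0 x0 y0 v0 e0.
  have := invertibleX n s0; rewrite -fs -rmorphXn -sn rmorph0 => -[z].
  by rewrite mul0r => /eqP; rewrite eq_sym oner_eq0.
have [L [i iS]] := localization_exists (pow_mult sP) S0.
have [dL ii] := loc_domain (pow_mult sP) S0 iS dP.
pose A : calg O := @Calg O L (i \o h \o calg_str Q).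
have [sg sg1] : invertible (i sP).
  by case: iS => + _ _; apply; exists 1%N; rewrite expr1.
have iA t : i (calg_str P' t) = calg_str A t by [].
pose i' : ahom P' A := @ahom_of O P' A i iA.
have sA : s A (i (h u)) (i (h x)) (i (h y)) (i \o Z) = i sP.
  by rewrite -[RHS]/(i' sP) snat.
have hi a : h a = 0 -> a = 0.
  have [f [fh _]] := Zup Q idfun (fun=> 0).
  by move=> ha; have := fh a; rewrite ha rmorph0.
have nzw : calg_str A w <> 0.
  move=> /= /ii/hi hw; have := uxy_hc_neq0 dO w0 u2 Quxy.
  by rewrite rmorphM hw mulr0 eqxx.
pose hQ : ahom Q A := @ahom_of O Q A (i \o h) (fun=> erefl).
have extL (R : comNzRingType) (f g : {rmorphism L -> R}) :
    (forall t, f (i (h t)) = g (i (h t))) -> (forall j, f (i (Z j)) = g (i (Z j))) -> f =1 g.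
  move=> fgh fgZ; apply: (loc_epi iS).
  exact: (generated_ext Zgen (f := f \o i : {rmorphism P -> R}) (g := g \o i : {rmorphism P -> R})).
have extQ (R : comNzRingType) (f g : {rmorphism Q -> R}) :
    (forall t, f (calg_str Q t) = g (calg_str Q t)) -> f u = g u -> f x = g x -> f y = g y ->
    f =1 g.
  move=> E1 E2 E3 E4; apply: (Qgen [set t | f t = g t]) => //= a b Ea Eb.
    by rewrite !rmorphD Ea Eb.
  by rewrite !rmorphM Ea Eb.
exists A, (i (h u)), (i (h x)), (i (h y)), (i \o Z); split; last 1 first.
- move=> R f g fu fx fy fZ.
  have E1 t : f (i (h t)) = g (i (h t)).
    apply: (extQ R (f \o i \o h) (g \o i \o h)) => //= t'.
    by rewrite [LHS](ahom_str f) [RHS](ahom_str g).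
  apply: ahom_eq; exact: (extL R (f : {rmorphism A -> R}) (g : {rmorphism A -> R}) E1 fZ).
- have regA (p : set A) s1 : is_prime p -> reg_at ((i \o h) @^-1` p) s1 ->
      reg_at p (map (i \o h) s1).
    move=> pp r1; rewrite map_comp; apply: (reg_loc_up (pow_mult sP) iS pp).
    by apply: regP => //; apply: preim_prime.
  have regA' (p : set A) : is_prime p -> p (calg_str A w) ->
      exists s1 t, [/\ s1 <> [::], ~ p t, reg_at p s1
          & calg_str A c = t * \prod_(a <- s1) a].
    move=> pp pw.
    have [||s1 [t [s1n nt r1 E]]] := uxy_reg_special dO w0 rs rk u2 Quxy (q := (i \o h) @^-1` p).
    + exact: (preim_prime (i \o h)).
    + exact: pw.
    exists (map (i \o h) s1), (i (h t)); split=> //.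
    + by case: (s1) s1n.
    + exact: regA.
    + by rewrite /= E !rmorphM !rmorph_prod big_map.
  split=> //.
  + exact: (loc_noetherian iS).
  + move=> b /(domainM dL)[]//.
  + move=> p pp; have [pw|pw] := pselect (p (calg_str A w)).
      by have [s1 [t [_ _ + _]]] := regA' p pp pw; apply: reg_at_nil.
    apply: (regA _ [::]) => //; apply: (uxy_reg_generic dO w0 u2 dvr Quxy) => //.
    exact: (preim_prime (i \o h)).
  exists hQ; split.
    have [q qE] := generated_mmap Zgen sP.
    pose b (j : 'I_m.+1) : as_alg hQ := if unlift ord0 j is Some l then i (Z l) else sg.
    pose q' : {mpoly Q[m.+1]} := mmap (@mpolyC m.+1 Q) (fun l => 'X_(lift ord0 l)) q.
    have q'E (R : calg Q) (v : 'I_m.+1 -> R) :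
        mmap (calg_str R) v ('X_ord0 * q' - 1) =
        v ord0 * mmap (calg_str R) (fun l => v (lift ord0 l)) q - 1.
      pose mv : {rmorphism {mpoly Q[m.+1]} -> R} := mmap (calg_str R) v.
      rewrite -[LHS]/(mv _) rmorphB rmorph1 rmorphM {1}/mv /= mmapX mmap1U; congr (_ * _ - _).
      rewrite -/(mv q') /q' rmorph_mmap; apply: eq_mmap => z /=; first by rewrite mmapC.
      by rewrite mmapX mmap1U.
    (* The additional variable ['X_ord0] stands for the inverse of [sP]. *)
    exists m.+1, [:: 'X_ord0 * q' - 1]; apply: (@presents_intro _ (as_alg hQ) _ _ b).
    - apply: generated_mmap => T TD TM Th TX a.
      have Ti p : T (i p).
        apply: (Zgen [set p | T (i p)]) => //= [p1 p2|p1 p2|l].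
        + by rewrite rmorphD; apply: TD.
        + by rewrite rmorphM; apply: TM.
        + by have := TX (lift ord0 l); rewrite /b liftK.
      have Ts : T sg by have := TX ord0; rewrite /b unlift_none.
      have T1 : T 1 by rewrite -(rmorph1 i).
      have [_ /(_ a)[p [_ [[n ->] ap]]] _] := iS.
      have -> : a = i p * sg ^+ n.
        by rewrite -ap rmorphXn -mulrA -exprMn sg1 expr1n mulr1.
      apply: (TM) => //; elim: n {ap} => [|n IH]; first by rewrite expr0.
      by rewrite exprS; apply: TM.
    - move=> p; rewrite inE => /eqP->; rewrite q'E /b unlift_none.
      rewrite -sg1 mulrC; apply/eqP; rewrite subr_eq0; apply/eqP; congr (_ * _).
      rewrite -qE rmorph_mmap; apply: eq_mmap => l //=; by rewrite liftK.
    - move=> R v vr; have := vr _ (mem_head _ _); rewrite q'E => /eqP.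
      rewrite subr_eq0 => /eqP v1.
      have [f [fh fZ]] := Zup R (calg_str R) (fun l => v (lift ord0 l)).
      have fs : f sP * v ord0 = 1.
        rewrite -v1 mulrC -qE rmorph_mmap; congr (_ * _).
        by apply: eq_mmap => l /=.
      have [|F Fi] := loc_lift (pow_mult sP) iS (h := f).
        by move=> _ [n ->]; rewrite rmorphXn; apply: invertibleX; exists (v ord0).
      have FQ t : F (calg_str (as_alg hQ) t) = calg_str R t by rewrite /= Fi fh.
      exists (@ahom_of Q (as_alg hQ) R F FQ) => j /=; rewrite /b.
      case: unliftP => [l ->|->]; first by rewrite Fi fZ.
      have us : invertible (f sP) by exists (v ord0).
      by apply: (inv_cancel us); rewrite fs -Fi -rmorphM sg1 rmorph1.
  move=> C D p pp v; have [ps _] := pp.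
  have [r rE] := choice (fun l => ps (v (i (Z l)))).
  (* Formal smoothness: the free variables lift arbitrarily, and [sP] stays invertible because units
     lift along square-zero extensions. *)
  have [f [fh fZ]] := Zup C (calg_str C) r.
  have pf : forall t, p (f t) = v (i t).
    apply: (Pext (Calg (calg_str D \o calg_str Q)) (p \o f) (v \o i)) => t /=.
      by rewrite fh [LHS](ahom_str p) -[i (h t)]/(calg_str (as_alg hQ) t) (ahom_str v).
    by rewrite fZ rE.
  have [|F Fi] := loc_lift (pow_mult sP) iS (h := f).
    move=> _ [n ->]; rewrite rmorphXn; apply: invertibleX.
    apply: (square_zero_unit pp); rewrite pf.
    by apply: (rmorph_inv v); exists sg.
  have FQ t : F (calg_str (as_alg hQ) t) = calg_str C t by rewrite /= Fi fh.
  exists (@ahom_of Q (as_alg hQ) C F FQ); apply: ahom_eq.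
  have H t : p (F (i t)) = v (i t) by rewrite Fi pf.
  exact: (loc_epi iS (f1 := p \o F : {rmorphism L -> D}) (f2 := (v : {rmorphism as_alg hQ -> D})) H).
- by rewrite /= -!rmorphM uxy.
- by rewrite sA; exists sg.
- move=> R a b d v abd sv; have [f [fu fx fy fZ fs]] := toP R a b d v abd.
  have [|F Fi] := loc_lift (pow_mult sP) iS (h := (f : {rmorphism P' -> R})).
    by move=> _ [n ->]; rewrite rmorphXn; apply: invertibleX; rewrite /= fs.
  have FO t : F (calg_str A t) = calg_str R t by rewrite /= Fi; apply: (ahom_str f).
  by exists (@ahom_of O A R F FO); split=> [|||j]; [apply: etrans (Fi _) fu|apply: etrans (Fi _) fx|apply: etrans (Fi _) fy|apply: etrans (Fi _) (fZ j)].
Qed.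

Section GoodSchemes.
Variable X : functor O.
Hypotheses (schX : is_scheme X) (goodX : locally_on (fun A (_ : X A) => good A)).

Lemma good_mono (P : forall A, X A -> Prop) : (forall A u, good A -> P A u) ->
  locally_on P.
Proof.
move=> gP L x fL tt; have [A [u [f [au fu gA]]]] := @goodX _ x fL tt.
by exists A, u, f; split=> //; apply: gP.
Qed.

Lemma good_regular_scheme : regular_scheme X.
Proof.
split=> //; apply: (@good_mono (fun A _ => regular_ring A)) => A u [nA _ rA _ _]; exact: regular_ring_reg.
Qed.

Definition mor_id (Y : functor O) : morphism Y Y.
Proof. by exists (fun R (x : Y R) => x). Defined.

Lemma etale_id (A : calg O) : etale_alg (as_alg (ahom_id A)).
Proof.
split.
  exists 0%N, [::]; apply: (@presents_intro _ (as_alg (ahom_id A)) 0 [::] (fun=> 0)) => //.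
    by move=> y; exists y%:MP; rewrite mmapC.
  move=> R v _; exists (@ahom_of _ (as_alg (ahom_id A)) R (calg_str R) (fun=> erefl)).
  by move=> -[].
move=> C D p _ v; exists (@ahom_of _ (as_alg (ahom_id A)) C (calg_str C) (fun=> erefl)).
split=> [|w' E]; apply: ahom_eq => a /=.
  by rewrite [LHS](ahom_str p) -(ahom_str v).
by rewrite -(ahom_str w').
Qed.

Lemma mor_id_etale : etale_morphism (mor_id X).
Proof.
move=> L x fL tt; have [A [u [f [au fu gA]]]] := @goodX _ x fL tt.
exists A, u, f; split=> //; exists A, u, (ahom_id A).
by split; [|rewrite fmap_id|exact: etale_id].
Qed.

Lemma vanishing_cuts (D : subfunctor X) A (u : X A) :
  (forall S x, D S x <-> calg_str S w = 0) ->
  cuts_out D u (ideal_span [set calg_str A w]).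
Proof.
move=> DE; split; first exact: span_ideal.
move=> S g; rewrite DE; split=> [s0 a /span1P[b ->]|H].
  by rewrite rmorphM /= (ahom_str g) s0 mulr0.
by rewrite -(ahom_str g); apply: H; apply: span_sub.
Qed.

Lemma good_strict_nc (D : subfunctor X) : (forall S x, D S x <-> calg_str S w = 0) ->
  strict_normal_crossings D.
Proof.
move=> DE; split.
- by split=> //; apply: (@good_mono (fun A _ => noetherian A)) => A u [].
- apply: (@good_mono (fun A u => exists2 d : A, nonzerodivisor d &
    cuts_out D u (ideal_span [set d]))) => A u [_ nz _ _ _]; exists (calg_str A w) => //.
  exact: vanishing_cuts.
move=> L x fL /DE w0L; have [A [u [f [au fu gA]]]] := @goodX _ x fL I.
have [nA _ _ spA _] := gA.
exists A, u, f; split=> //; split=> //.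
have pp : is_prime [set a | f a = 0] := isf_kernel f fL.
have [|s0 [t [s0n nt rs0 E]]] := spA _ pp; first by rewrite /= (ahom_str f).
have [M [g gp]] := locp_exists pp.
have [regM [s' sys]] := reg_at_local nA pp gp rs0.
exists (ideal_span [set calg_str A w]), M, g, (map g s0 ++ s'), (size s0); split=> //.
- exact: vanishing_cuts.
split; first by rewrite size_cat size_map leq_addr lt0n size_eq0 andbT; apply/eqP.
rewrite span_image_span image_set1 take_size_cat ?size_map // big_map -rmorph_prod.
have [v v1] : invertible (g t) by apply/(locp_unit pp gp).
have [z z1] := u2.
have Eg : g (calg_str A c) = g t * g (\prod_(a <- s0) a) by rewrite E rmorphM.
rewrite eqEsubset; split; apply: span_min; try exact: span_ideal.
  move=> _ ->; apply/span1P; exists (g (calg_str A z) * g t).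
  rewrite -mulrA -Eg -rmorphM -rmorphM /c mulrA [z * 2]mulrC z1 mul1r //.
move=> _ ->; apply/span1P; exists (v * g (calg_str A 2)).
rewrite -mulrA -rmorphM -rmorphM Eg mulrA [v * _]mulrC v1 mul1r //.
Qed.

(** The crossings are already strict, so the identity serves as etale neighbourhood of every
    point. *)
Lemma good_normal_crossings : normal_crossings (vanishing X w).
Proof.
have [lN eC _] : strict_normal_crossings (vanishing X w) by apply: good_strict_nc.
split=> // L x fL xD; exists X, (mor_id X); split; first exact: mor_id_etale.
  by exists L, (ahom_id L), x; rewrite fmap_id.
exact: good_strict_nc.
Qed.

Lemma Spec_affine (B : calg O) : affine_open (ahom_id B : Spec B B).
Proof.
split=> [R f g /= E|].
  by apply: ahom_eq => a; have := congr1 (fun h : ahom B R => h a) E.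
exists (@Subfunctor O (Spec B) (fun _ _ => True) (fun _ _ _ _ _ => I)).
  move=> R x; exists setT; split=> // S g; split=> // _.
  by apply: span_sub; exists 1 => //; rewrite rmorph1.
by move=> R x; split=> // _; exists x; apply: ahom_eq.
Qed.

Lemma good_covered : covered_by_smooth_over X (Spec Q).
Proof.
move=> L x fL; have [A [u [f [au fu gA]]]] := @goodX _ x fL I.
have [_ _ _ _ [hQ sQ]] := gA; have [ui [U oU UE]] := au.
exists U; split=> //; first by apply/UE; exists f.
have fact R (y : sub_functor U R) : exists g : ahom A R, fmap g u = sval y.
  by apply/UE; apply: (svalP y).
pose pick R y := sval (cid (fact R y)).
have pickE R y : fmap (pick R y) u = sval y := svalP (cid (fact R y)).
have nat R S (g : ahom R S) (y : sub_functor U R) :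
    ahom_comp (pick S (fmap g y)) hQ = ahom_comp g (ahom_comp (pick R y) hQ).
  rewrite ahom_compA; congr ahom_comp; apply: ui.
  by rewrite fmap_comp !pickE.
exists (@Morphism O (sub_functor U) (Spec Q) (fun R y => ahom_comp (pick R y) hQ) nat).
move=> M y fM _.
have Uu : U A u by apply/UE; exists (ahom_id A); rewrite fmap_id.
exists A, (exist _ u Uu : sub_functor U A), (pick M y); split.
- split=> [R g g' /(congr1 sval)/= /ui//|].
  exists (@Subfunctor O (sub_functor U) (fun _ _ => True) (fun _ _ _ _ _ => I)).
    move=> R z; exists setT; split=> // S g; split=> // _.
    by apply: span_sub; exists 1 => //; rewrite rmorph1.
  move=> R z; split=> // _; exists (pick R z).
  by case: z (pickE R z) => z Uz /= E; apply: eq_exist.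
- by case: y (pickE M y) => z Uz /= E; apply: eq_exist.
exists Q, (ahom_id Q), hQ; split=> //; first exact: Spec_affine.
rewrite /= ahom_comp_id; have -> : pick A (exist _ u Uu) = ahom_id A.
  by apply: ui; rewrite pickE /= fmap_id.
by rewrite ahom_id_comp.
Qed.

End GoodSchemes.
End Good.

(** * Gluing morphisms *)

Section Functors.
Variable O : comNzRingType.

(** The residue field of [p] defines a point of [X], contained in some affine chart; openness of
    that chart spreads the factorization to a neighbourhood [D(f)] of [p]. *)
Lemma scheme_cover (X : functor O) (P : forall A, X A -> Prop) R (x : X R) (p : set R) :
  locally_on P -> is_prime p ->
  exists2 f, ~ p f & exists (A : calg O) (u : X A), [/\ affine_open u, P A u
    & forall S (g : ahom R S), invertible (g f) ->
        exists h : ahom A S, fmap h u = fmap g x].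
Proof.
move=> lX pp; have [K [h hp]] := residue_field pp.
pose K' : calg O := @Calg O K (h \o calg_str R).
pose h' : ahom R K' := @ahom_of O R K' h (fun=> erefl).
have [A [u [f0 [au fu PA]]]] := lX K' (fmap h' x) (@field_isf K) I.
have [_ [U oU UE]] := au.
have [I0 [iI I0P]] := oU R x.
have : U K' (fmap h' x) by apply/UE; exists f0.
move=> /I0P I1.
have [f If pf] : exists2 f, I0 f & ~ p f.
  apply: contrapT => no; have /eqP := oner_neq0 K; case.
  apply: (span_min (ideal_zero K) _ I1).
  move=> _ [a Ia <-]; apply/hp; apply: contrapT => pa; apply: no; by exists a.
exists f => //; exists A, u; split=> // S g gf; apply/UE/I0P.
apply: (unit_span (span_ideal _) gf); apply: span_sub; by exists f.
Qed.

Lemma open_preim (X Y : functor O) (f : morphism X Y) (U : subfunctor Y) :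
  is_open U -> is_open (preim f U).
Proof.
move=> oU R x; have [I0 [iI IP]] := oU R (f R x); exists I0; split=> // S g.
by rewrite /= mor_nat; apply: IP.
Qed.

Section Iso.
Variables (X Y : functor O) (f : morphism X Y) (g : morphism Y X).
Hypotheses (gf : forall R (x : X R), g R (f R x) = x)
  (fg : forall R (y : Y R), f R (g R y) = y).

Lemma affine_open_iso A (u : X A) : affine_open u -> affine_open (f A u).
Proof.
move=> [ui [U oU UE]]; split=> [R a b E|].
  apply: ui; have := congr1 (g R) E; by rewrite !mor_nat !gf.
exists (preim g U); first exact: open_preim.
move=> R x; split=> [/UE[h hE]|[h <-]].
  by exists h; rewrite -mor_nat hE fg.
by apply/UE; exists h; rewrite mor_nat gf.
Qed.

Lemma locally_on_iso (P : calg O -> Prop) :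
  locally_on (fun A (_ : X A) => P A) -> locally_on (fun A (_ : Y A) => P A).
Proof.
move=> lX L y fL _; have [A [u [h [au hu PA]]]] := lX L (g L y) fL I.
exists A, (f A u), h; split=> //; first exact: affine_open_iso.
by rewrite -mor_nat hu fg.
Qed.

Lemma sheaf_iso : is_sheaf X -> is_sheaf Y.
Proof.
move=> sX R s s1 cov sec secP.
have [|x [xP xU]] := sX R s s1 (fun S h c => g S (sec S h c)).
  by move=> S T h h' c c'; rewrite -mor_nat (secP _ _ _ _ c c').
exists (f R x); split=> [S h c|y H]; first by rewrite -mor_nat xP fg.
rewrite -[RHS]fg; congr (f R _); apply: xU => S h c.
by rewrite -mor_nat H.
Qed.

Lemma scheme_iso : is_scheme X -> is_scheme Y.
Proof.
by move=> [sX lX]; split; [exact: sheaf_iso|apply: (@locally_on_iso (fun=> True))].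
Qed.

End Iso.

Lemma open_meet (X : functor O) (U V : subfunctor X) : is_open U -> is_open V ->
  forall R (x : X R), exists I0 : set R, is_ideal I0 /\
    forall S (g : ahom R S), (U S (fmap g x) /\ V S (fmap g x)) <-> ideal_span (g @` I0) 1.
Proof.
move=> oU oV R x; have [I1 [i1 P1]] := oU R x; have [I2 [i2 P2]] := oV R x.
exists (ideal_span [set c | exists a b, [/\ I1 a, I2 b & c = a * b]]).
split; first exact: span_ideal.
move=> S g; rewrite P1 P2 span_image_span; split=> [[u1 v1]|H]; last first.
  split; apply: (span_min (span_ideal _) _ H) => _ [_ [a [b [Ia Ib ->]]] <-].
    by apply: span_sub; exists (a * b) => //; apply: (idealM_r _ i1).
  by apply: span_sub; exists (a * b) => //; apply: (idealM_l _ i2).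
set K := ideal_span _; have iK : is_ideal K := span_ideal _.
have gab a b : I1 a -> I2 b -> K (g a * g b).
  by move=> Ia Ib; apply: span_sub; exists (a * b); rewrite ?rmorphM //; exists a, b.
have gb b : I2 b -> K (g b).
  move=> Ib; rewrite -[g b]mul1r; apply: (span_min (colon_ideal (g b) iK) _ u1).
  by move=> _ [a Ia <-]; apply: gab.
by apply: (span_min iK _ v1) => _ [b Ib <-]; apply: gb.
Qed.

Definition meet_sub (X : functor O) (U V : subfunctor X) : subfunctor X.
Proof.
exists (fun R x => U R x /\ V R x) => R S g x [Ux Vx].
by split; apply: smem_fmap.
Defined.

Lemma meet_open (X : functor O) (U V : subfunctor X) :
  is_open U -> is_open V -> is_open (meet_sub U V).
Proof. exact: open_meet. Qed.

Lemma open_field (X : functor O) (U : subfunctor X) R S (x : X R) (g : ahom R S) :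
  is_open U -> U S (fmap g x) -> exists2 f : R, g f != 0 &
    forall T (h : ahom R T), invertible (h f) -> U T (fmap h x).
Proof.
move=> oU US; have [I0 [iI IP]] := oU R x; have I1 := (IP S g).1 US.
have [f If gf] : exists2 f, I0 f & g f != 0.
  apply: contrapT => no; have /eqP := oner_neq0 S; case.
  apply: (span_min (ideal_zero S) _ I1) => _ [a Ia <-] /=.
  by apply/eqP; apply: contrapT => /negP ga; apply: no; exists a.
exists f => // T h hf; apply/IP; apply: (unit_span (span_ideal _) hf).
by apply: span_sub; exists f.
Qed.

Definition cartier_point (X : functor O) (Z : subfunctor X) A (x : X A) :=
  exists2 d : A, nonzerodivisor d & cuts_out Z x (ideal_span [set d]).

Lemma cartier_loc (X : functor O) (Z : subfunctor X) A (x : X A) L (a : A)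
    (i : ahom A L) : is_locf a i -> cartier_point Z x -> cartier_point Z (fmap i x).
Proof.
move=> [iS ia _] [d dn [_ dc]]; exists (i d).
  move=> b db; have [_ /(_ b)[c [s [sn bs]]] i0] := iS.
  have : i (d * c) = 0 by rewrite rmorphM /= -bs mulrA db mul0r.
  move=> /i0[t tn tdc]; have tc : t * c = 0 by apply: dn; rewrite mulrCA.
  have us : invertible (i s) by case: sn => n ->; rewrite rmorphXn; apply: invertibleX.
  have ut : invertible (i t) by case: tn => n ->; rewrite rmorphXn; apply: invertibleX.
  apply: (inv_cancelr us); rewrite bs mul0r; apply: (inv_cancel ut).
  by rewrite -rmorphM tc rmorph0 mulr0.
split; first exact: span_ideal.
move=> S g; rewrite -fmap_comp dc; split=> H b /span1P[c ->]; rewrite rmorphM.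
  have := H d; rewrite /= => -> //; first by rewrite mulr0.
  by apply: span_sub.
have := H (i d); rewrite /= => -> //; first by rewrite mulr0.
by apply: span_sub.
Qed.

Section Lift.
Variables (Y B M : functor O) (b : morphism B M) (f : morphism Y M) (Z : subfunctor M).
Hypotheses (sB : is_sheaf B) (sM : is_sheaf M)
  (covY : locally_on (fun A (u : Y A) => cartier_point Z (f A u)))
  (ex : forall A (m : M A), cartier_point Z m -> exists beta, b A beta = m)
  (uq : forall A (m : M A) beta beta', cartier_point Z m ->
     b A beta = m -> b A beta' = m -> beta = beta').

(** Only points factoring through a Cartier chart of [Y] are lifted directly: after an arbitrary
    base change the equation of the center may become a zero divisor, and both [ex] and [uq] need it
    to be none. *)
Let Lft R (y : Y R) (beta : B R) := exists (A : calg O) (u : Y A) (h : ahom A R) (bu : B A),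
  [/\ affine_open u, cartier_point Z (f A u), fmap h u = y, b A bu = f A u & fmap h bu = beta].

Let Lft_fmap R S (g : ahom R S) y beta : Lft y beta -> Lft (fmap g y) (fmap g beta).
Proof.
move=> [A [u [h [bu [au cu <- bbu <-]]]]]; exists A, u, (ahom_comp g h), bu.
by rewrite !fmap_comp.
Qed.

(* Two charts through which y factors agree on the localizations of the first *)
(* chart where the second one is defined; these are Cartier as well.          *)
Let Lft_uniq R (y : Y R) beta beta' : Lft y beta -> Lft y beta' -> beta = beta'.
Proof.
move=> [A1 [u1 [h1 [b1 [a1 c1 y1 bb1 <-]]]]] [A2 [u2 [h2 [b2 [a2 c2 y2 bb2 <-]]]]].
apply: (sheaf_separated sB); apply/zar_primes => p pp.
have pp1 : is_prime (h1 @^-1` p) := preim_prime h1 pp.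
have [u2i [U2 oU2 UE2]] := a2.
have [I1 [iI1 I1P]] := oU2 A1 u1.
have /I1P H1 : U2 R (fmap h1 u1) by apply/UE2; exists h2; rewrite y1 y2.
have [d Id pd] : exists2 d, I1 d & ~ p (h1 d).
  apply: contrapT => no; have ip := prime_ideal pp.
  have : p 1 by apply: (span_min ip _ H1) => _ [a Ia <-]; apply: contrapT => pa;
    apply: no; exists a.
  by case: pp.
exists (h1 d) => // S g gd.
have [T [i iT]] := locf_exists (not_nilp (p := h1 @^-1` p) pp1 pd).
have [iS id iU] := iT.
have /UE2[e eE] : U2 T (fmap i u1).
  by apply/I1P; apply: (unit_span (span_ideal _) id); apply: span_sub; exists d.
have [j jE] := iU S (ahom_comp g h1) gd.
have E : fmap i b1 = fmap e b2.
  apply: (uq (m := f T (fmap i u1))).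
  - by rewrite mor_nat; apply: (cartier_loc iT).
  - by rewrite mor_nat bb1 -mor_nat.
  - by rewrite mor_nat bb2 -mor_nat eE.
rewrite -!fmap_comp -jE fmap_comp E -fmap_comp; congr fmap; apply: u2i.
by rewrite fmap_comp eE -fmap_comp jE !fmap_comp y1 y2.
Qed.

(** The lifts through charts agree by [Lft_uniq] and glue because [B] is a sheaf. Uniqueness of the
    resulting morphism is tested on the charts, where [uq] holds. *)
Lemma lift_exists : exists g : morphism Y B,
  (forall R (y : Y R), b R (g R y) = f R y) /\
  (forall g' : morphism Y B, (forall R (y : Y R), b R (g' R y) = f R y) ->
     forall R (y : Y R), g' R y = g R y).
Proof.
have ex1 R (y : Y R) : exists beta : B R,
    zariski_locally (fun S (g : ahom R S) => Lft (fmap g y) (fmap g beta)).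
  have Hl : zariski_locally (fun S (g : ahom R S) => exists beta, Lft (fmap g y) beta).
    apply/zar_primes => p pp.
    have [d pd [A [u [au cu H]]]] := scheme_cover y covY pp.
    exists d => // S g gd; have [h hE] := H S g gd.
    have [bu bbu] := ex cu; exists (fmap h bu); by exists A, u, h, bu.
  have [s s1 sP] := Hl.
  pose cov S (g : ahom R S) := exists2 d, d \in s & invertible (g d).
  have secx S (g : ahom R S) (c : cov S g) : exists beta, Lft (fmap g y) beta.
    by case: c => d ds gd; apply: sP gd.
  pose sec S g c := sval (cid (secx S g c)).
  have secP S g c : Lft (fmap g y) (sec S g c) := svalP (cid (secx S g c)).
  have [|x [xP _]] := sB s1 (sec := sec).
    move=> S T g h c c'; apply: (Lft_uniq (y := fmap (ahom_comp h g) y)); last exact: secP.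
    by rewrite fmap_comp; apply: Lft_fmap.
  exists x; exists s => // d ds S g gd.
  have c : cov S g by exists d.
  by rewrite (xP S g c).
have uq1 R (y : Y R) beta beta' :
    zariski_locally (fun S (g : ahom R S) => Lft (fmap g y) (fmap g beta)) ->
    zariski_locally (fun S (g : ahom R S) => Lft (fmap g y) (fmap g beta')) -> beta = beta'.
  move=> H H'; apply: (sheaf_separated sB); apply: zl_mono (zl_and H H') => S g [].
  exact: Lft_uniq.
pose gm R y := sval (cid (ex1 R y)).
have gP R y : zariski_locally (fun S (g : ahom R S) => Lft (fmap g y) (fmap g (gm R y))) :=
  svalP (cid (ex1 R y)).
have gN R S (g : ahom R S) (y : Y R) : gm S (fmap g y) = fmap g (gm R y).
  apply: (uq1 S (fmap g y)); first exact: gP.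
  by apply: zl_mono (zl_base g (gP R y)) => T h; rewrite !fmap_comp.
have chart R (y : Y R) : zariski_locally (fun S (g : ahom R S) => exists A (u : Y A) (h : ahom A S),
    [/\ affine_open u, cartier_point Z (f A u) & fmap h u = fmap g y]).
  by apply: zl_mono (gP R y) => S g [A [u [h [bu [au cu hu _ _]]]]]; exists A, u, h.
have gu A (u : Y A) : affine_open u -> cartier_point Z (f A u) -> b A (gm A u) = f A u.
  move=> au cu; have [bu bbu] := ex cu; rewrite -bbu; congr (b A _).
  apply: (uq1 A u); first exact: gP.
  by apply: zl_all => S g; exists A, u, g, bu.
exists (Morphism gN); split=> [R y|g' g'P R y] /=.
  apply: (sheaf_separated sM); apply: zl_mono (chart R y) => S g [A [u [h [au cu hu]]]].
  by rewrite -!mor_nat /= -gN -hu gN !mor_nat gu.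
apply: (sheaf_separated sB); apply: zl_mono (chart R y) => S g [A [u [h [au cu hu]]]].
rewrite -mor_nat -gN -hu mor_nat gN; congr fmap.
exact: (uq cu (g'P A u) (gu A u au cu)).
Qed.

End Lift.
End Functors.

(** * The ring O_F *)

Lemma dvr_noetherian (O : comNzRingType) (w : O) :
  (forall a : O, a != 0 -> exists n v, invertible v /\ a = v * w ^+ n) -> noetherian O.
Proof.
move=> dvr I0 iI; have [[a Ia a0]|no] := pselect (exists2 a, I0 a & a != 0); last first.
  exists [::]; rewrite eqEsubset; split=> a.
    move=> Ia; apply/ideal_span_nil/eqP; apply: contrapT => /negP a0; apply: no; by exists a.
  by move=> /ideal_span_nil->; apply: ideal_0.
have ex : exists n, `[< I0 (w ^+ n) >].
  have [n [v [[u vu] aE]]] := dvr a a0; exists n; apply/asboolP.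
  by rewrite -[w ^+ n]mul1r -vu mulrAC -aE; apply: idealM_r.
case: (ex_minnP ex) => n /asboolP In minn; exists [:: w ^+ n].
rewrite eqEsubset; split; last first.
  by apply: span_min => // b; rewrite /= inE => /eqP->.
move=> b Ib; have [->|b0] := eqVneq b 0; first exact: (ideal_0 (span_ideal _)).
have [m [v [[u vu] bE]]] := dvr b b0.
have nm : (n <= m)%N.
  apply: minn; apply/asboolP; rewrite -[w ^+ m]mul1r -vu mulrAC -bE.
  exact: idealM_r.
rewrite bE -(subnK nm) exprD mulrA; apply: (idealM_l _ (span_ideal _)).
by apply: span_sub; rewrite /= inE.
Qed.

Section Integers.
Variable D : unitary_datum.
Let K : cdvField := ud_F0 D.
Let F := ud_F D.
Let O0 : comNzRingType := integers0 K.
Let p : F := val (ud_pi D).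
Let p0 : K := val (ud_pi0 D).

Let mkO (x : K) (h : x \in val_ring K) : O0 := exist _ x h.

Let p0n : p0 != 0 := (pi0_unif D).1.
Let vp0 : cdv_val p0 = 1 := (pi0_unif D).2.

Lemma cdv_valV (x : K) : x != 0 -> cdv_val x^-1 = - cdv_val x.
Proof.
move=> x0; have := cdv_valM x0 (invr_neq0 x0); rewrite mulfV // cdv_val_1.
by move/esym/eqP; rewrite addrC addr_eq0 => /eqP.
Qed.

Lemma cdv_valX (x : K) n : x != 0 -> cdv_val (x ^+ n) = cdv_val x *+ n.
Proof.
move=> x0; elim: n => [|n IH]; first by rewrite expr0 cdv_val_1.
by rewrite exprS cdv_valM ?expf_neq0 // IH mulrS.
Qed.

Lemma val_ringE (x : K) : (x \in val_ring K) = (x == 0) || (0 <= cdv_val x).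
Proof. by []. Qed.

Lemma O0_val (a : O0) : val a != 0 -> 0 <= cdv_val (val a).
Proof. by move=> a0; have := valP a; rewrite val_ringE (negPf a0). Qed.

Lemma O0_unit (a : O0) : ud_res0 D a != 0 -> exists b : O0, a * b = 1.
Proof.
move=> ra; have a0 : val a != 0.
  by apply: contraNneq ra => a0; rewrite (_ : a = 0) ?rmorph0 //; apply: val_inj.
have va : cdv_val (val a) = 0.
  apply/eqP; rewrite eq_le O0_val // andbT leNgt; apply/negP => va.
  have cP : val a / p0 \in val_ring K.
    rewrite val_ringE cdv_valM ?invr_neq0 // cdv_valV // vp0; apply/orP; right.
    by rewrite subr_ge0 -gtz0_ge1.
  case/eqP: ra; apply/res0_ker; exists (mkO cP); apply: val_inj => /=.
  by rewrite mulrC divfK.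
have bP : (val a)^-1 \in val_ring K by rewrite val_ringE cdv_valV // va oppr0 lexx orbT.
by exists (mkO bP); apply: val_inj; rewrite /= mulfV.
Qed.

Lemma O0_two : exists b : O0, 2 * b = 1.
Proof. by apply: O0_unit; rewrite rmorph_nat; have := k_char D; rewrite inE. Qed.

Lemma F_coords (x : F) : exists a b : K, x = a%:A + b *: p.
Proof.
have fr : free [:: (1 : F); p].
  rewrite free_cons seq1_free val_pi_neq0 andbT span_seq1.
  apply/negP=> /vlineP[a pa].
  have a0 : a != 0 by apply: contraTneq (oner_neq0 F) => a0; rewrite pa a0 scale0r eqxx.
  have /eqP[] := pi_notin (D := D) a^-1.
  by rewrite pa scalerA mulVf // scale1r.
have : x \in span [:: (1 : F); p].
  have /eqP -> : span [:: (1 : F); p] == fullv; last exact: memvf.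
  by rewrite eqEdim subvf (eqnP fr) F_quadratic.
rewrite span_cons span_seq1 => /memv_addP[_ /vlineP[a ->] [_ /vlineP[b ->] ->]].
by exists a, b.
Qed.

Lemma F_coords0 (a b : K) : a%:A + b *: p = 0 -> a = 0 /\ b = 0.
Proof.
have [-> |b0] := eqVneq b 0.
  by rewrite scale0r addr0 => /eqP; rewrite scaler_eq0 oner_eq0 orbF => /eqP.
move=> /eqP; rewrite addrC addr_eq0 => /eqP E.
have /eqP[] := pi_notin (D := D) (- (b^-1 * a)).
by rewrite scaleNr -scalerA -[RHS]scalerN -E scalerA mulVf // scale1r.
Qed.

Lemma conj_coords (a b : K) : ud_conj D (a%:A + b *: p) = a%:A - b *: p.
Proof. by rewrite rmorphD /= !linearZ /= rmorph1 conj_pi scalerN. Qed.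

Lemma pp_alg : p * p = p0%:A. Proof. exact: val_pi_sqr. Qed.

(** If [c] had negative valuation, dividing its monic equation by [c ^+ m] would express [1] as a
    multiple of [e = c^-1] by an integral element, against the positive valuation of [e]. *)
Lemma val_ring_closed (c : K) :
  integralOver (in_alg F \o val : O0 -> F) c%:A -> c \in val_ring K.
Proof.
move=> [q qm]; rewrite map_poly_comp => rq.
have {rq}rq : root (map_poly (val : O0 -> K) q) c by rewrite -(fmorph_root (in_alg F)).
rewrite val_ringE; apply/orP; have [->|c0] := eqVneq c 0; [by left|right].
rewrite leNgt; apply/negP => vc; set e := c^-1.
have e0 : e != 0 by rewrite invr_eq0.
have ve : 0 < cdv_val e by rewrite cdv_valV // oppr_gt0.
have eP : e \in val_ring K by rewrite val_ringE ltW ?orbT.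
pose e' : O0 := mkO eP.
have qs : size (map_poly (val : O0 -> K) q) = (size q).-1.+1.
  rewrite size_map_inj_poly ?prednK ?size_poly_gt0 ?monic_neq0 //; exact: val_inj.
set m := (size q).-1 in qs.
have qlead : (map_poly (val : O0 -> K) q)`_m = 1.
  by rewrite coef_map_id0 //= -/(lead_coef q) (monicP qm).
pose S : O0 := \sum_(i < m) q`_i * e' ^+ (m.-1 - i).
have ES : 1 = - (e * val S).
  have /eqP := rq; rewrite horner_coef qs big_ord_recr /= qlead mul1r.
  move=> /(congr1 (fun z => e ^+ m * z)); rewrite mulr0 mulrDr -exprMn mulVf // expr1n.
  move=> /eqP; rewrite addrC addr_eq0 => /eqP ->; congr (- _).
  rewrite mulr_sumr [val S](rmorph_sum (val : {rmorphism O0 -> K})) mulr_sumr.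
  apply: eq_bigr => i _; rewrite coef_map_id0 //.
  have im : (i <= m.-1)%N by rewrite -ltnS (ltn_predK (ltn_ord i)).
  have mE : m = ((m.-1 - i).+1 + i)%N by rewrite addSn subnK // (ltn_predK (ltn_ord i)).
  have em : e ^+ m * c ^+ i = e * e ^+ (m.-1 - i).
    by rewrite {1}mE exprD exprS -mulrA -exprMn mulVf // expr1n mulr1.
  by rewrite mulrCA em rmorphM rmorphXn mulrCA.
have [S0|S0] := eqVneq (val S) 0.
  by move/eqP: ES; rewrite S0 mulr0 oppr0 oner_eq0.
have := cdv_val_1 K; rewrite ES -mulN1r cdv_valM ?mulf_neq0 ?oppr_eq0 ?oner_neq0 //.
rewrite cdv_val_N1 add0r cdv_valM // => E.
by have := O0_val S0; rewrite -(lerD2l (cdv_val e)) E addr0 leNgt ve.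
Qed.

(** For [x = a + b pi] the trace [2 a] and the norm [a^2 - b^2 pi0] are integral. Since [2] is a
    unit, [a] is integral, hence [b^2 pi0] is; its valuation [2 v(b) + 1] is nonnegative only if
    [v(b)] is. *)
Lemma OF_coords (x : OF D) : exists a b : O0, x = emb F a + ud_pi D * emb F b.
Proof.
have [a [b xE]] := F_coords (val x).
have ix : integralOver (in_alg F \o val : O0 -> F) (val x).
  by apply/asboolP; apply: (valP x).
have icx : integralOver (in_alg F \o val : O0 -> F) (ud_conj D (val x)).
  have [q qm rq] := ix; exists q => //.
  have -> : map_poly (in_alg F \o val : O0 -> F) q =
      map_poly (ud_conj D) (map_poly (in_alg F \o val : O0 -> F) q).
    apply/polyP=> i; rewrite !coef_map_id0 ?rmorph0 //=.
    by rewrite linearZ /= rmorph1.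
  by rewrite fmorph_root.
have [h h2] := O0_two.
have aP : a \in val_ring K.
  have : integralOver (in_alg F \o val : O0 -> F) (2 * a)%:A.
    have -> : (2 * a)%:A = val x + ud_conj D (val x).
      by rewrite xE conj_coords addrACA subrr addr0 -scalerDl mulr2n mulrDl mul1r.
    exact: integral_add.
  move=> /val_ring_closed aP; have -> : a = val h * (2 * a).
    by rewrite mulrA [val h * 2]mulrC -[2 * val h]/(val (2 * h)) h2 mul1r.
  exact: rpredM (valP h) aP.
have bP : b \in val_ring K.
  have : integralOver (in_alg F \o val : O0 -> F) (a * a - b * b * p0)%:A.
    have -> : (a * a - b * b * p0)%:A = val x * ud_conj D (val x).
      rewrite xE conj_coords [RHS]mulrC -subr_sqr !expr2 -!scalerAl -!scalerAr !mul1r pp_alg.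
      by rewrite !scalerA -scalerBl.
    exact: integral_mul.
  move=> /val_ring_closed NP; have : b * b * p0 \in val_ring K.
    rewrite -(_ : a * a - (a * a - b * b * p0) = b * b * p0); last by rewrite subKr.
    by rewrite rpredB // rpredM.
  rewrite !val_ringE; have [->|b0] := eqVneq b 0; first by [].
  rewrite !mulf_eq0 (negPf b0) (negPf p0n) /= !cdv_valM ?mulf_neq0 // vp0.
  lia.
exists (mkO aP), (mkO bP); apply: val_inj; rewrite /= xE.
by rewrite -scalerAr mulr1.
Qed.

Lemma OF_res_surj c : exists a, ud_res D a = c.
Proof. by have [a <-] := res0_surj c; exists (emb F a); rewrite res_emb. Qed.

Lemma OF_emb_pi0 : emb F (ud_pi0 D) = ud_pi D * ud_pi D.
Proof. by rewrite -pi_sqr expr2. Qed.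

Lemma embM (a b : O0) : emb F (a * b) = emb F a * emb F b.
Proof. by apply: val_inj; rewrite /= -scalerAl mul1r scalerA. Qed.
Lemma embD (a b : O0) : emb F (a + b) = emb F a + emb F b.
Proof. by apply: val_inj; rewrite /= scalerDl. Qed.
Lemma emb1 : emb F (1 : O0) = 1.
Proof. by apply: val_inj; rewrite /= scale1r. Qed.
Lemma embN (a : O0) : emb F (- a) = - emb F a.
Proof. by apply: val_inj; rewrite /= scaleNr. Qed.
Lemma emb0 : emb F (0 : O0) = 0.
Proof. by apply: val_inj; rewrite /= scale0r. Qed.

Lemma OF_res_ker (x : OF D) : ud_res D x = 0 <-> exists b, x = b * ud_pi D.
Proof.
split=> [|[b ->]]; last by rewrite rmorphM res_pi mulr0.
have [a [b ->]] := OF_coords x.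
rewrite rmorphD rmorphM res_pi mul0r addr0 res_emb => /res0_ker[c ->].
exists (ud_pi D * emb F c + emb F b); rewrite embM OF_emb_pi0.
by rewrite mulrDl -!mulrA [emb F c * _]mulrC [emb F b * _]mulrC.
Qed.

Lemma OF_unit (x : OF D) : ud_res D x != 0 -> invertible x.
Proof.
have [a [b ->]] := OF_coords x.
rewrite rmorphD rmorphM res_pi mul0r addr0 res_emb => ra.
have [|c cE] := O0_unit (a := a * a - b * b * ud_pi0 D).
  rewrite rmorphB rmorphM [ud_res0 D (_ * ud_pi0 D)]rmorphM.
  rewrite (_ : ud_res0 D (ud_pi0 D) = 0) ?mulr0 ?subr0 ?mulf_neq0 //.
  by apply/res0_ker; exists 1; rewrite mulr1.
exists ((emb F a - ud_pi D * emb F b) * emb F c).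
rewrite mulrA -[RHS]emb1 -cE embM embD embN !embM OF_emb_pi0; congr (_ * _).
by ring.
Qed.

Lemma OF_two : invertible (2 : OF D).
Proof. by apply: OF_unit; rewrite rmorph_nat; have := k_char D; rewrite inE. Qed.

Lemma OF_domain : domain (OF D).
Proof.
split; [exact: ideal_zero|exact/eqP/oner_neq0|].
move=> a b /= /(congr1 val)/eqP; rewrite /= mulf_eq0 => /orP[]/eqP E; [left|right];
  exact: val_inj.
Qed.

Lemma OF_pi_neq0 : ud_pi D != 0.
Proof. by apply: contraNneq (val_pi_neq0 D) => ->. Qed.

(** Dividing by [pi] stops at a unit, for otherwise [x] would be divisible by all powers of [pi],
    and both its coordinates by all powers of [pi0]. *)
Lemma OF_dvr (x : OF D) : x != 0 -> exists n v, invertible v /\ x = v * ud_pi D ^+ n.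
Proof.
move=> x0; apply: contrapT => no.
have div n : exists y, x = y * ud_pi D ^+ n.
  elim: n => [|n [y yE]]; first by exists x; rewrite expr0 mulr1.
  have [/OF_res_ker[z zE]|ry] := eqVneq (ud_res D y) 0.
    by exists z; rewrite exprS mulrA -zE.
  by case: no; exists n, y; split=> //; apply: OF_unit.
have [a [b xE]] := OF_coords x.
have key (c : O0) : (forall n, exists d : O0, val c = p0 ^+ n * val d) -> c = 0.
  move=> H; apply/eqP; apply: contrapT => /negP c0.
  have vc0 : val c != 0 by apply: contraNneq c0 => c0; apply/eqP/val_inj.
  have [d dE] := H (absz (cdv_val (val c))).+1.
  have d0 : val d != 0 by apply: contraNneq vc0 => d0; rewrite dE d0 mulr0.
  have := O0_val d0; have := O0_val vc0.
  have : cdv_val (val c) = cdv_val (p0 ^+ `|cdv_val (val c)|.+1 * val d) by rewrite -dE.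
  rewrite cdv_valM ?expf_neq0 // cdv_valX // vp0.
  by lia.
have coord n : exists c d : O0, val a = p0 ^+ n * val c /\ val b = p0 ^+ n * val d.
  (* The exponent is doubled because [pi ^+ (n + n)] is [pi0 ^+ n], which acts on the two
     coordinates separately. *)
  have [y yE] := div (n + n)%N; have [c [d cd]] := OF_coords y.
  exists c, d; move: yE; rewrite xE cd exprD -exprMn -expr2 pi_sqr.
  move=> /(congr1 val); rewrite /= -!scalerAr !mulr1 => E.
  have : (val a - p0 ^+ n * val c)%:A + (val b - p0 ^+ n * val d) *: p = 0.
    rewrite !scalerBl addrACA -opprD E; apply/eqP; rewrite subr_eq0.
    rewrite (_ : val (emb F (ud_pi0 D) ^+ n) = (p0 ^+ n)%:A).
      by rewrite -scalerAr mulr1 scalerDr !scalerA.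
    elim: n {E} => [|n IH]; first by rewrite !expr0 scale1r.
    by rewrite !exprS /= IH -scalerAl mul1r scalerA.
  by move=> /F_coords0[/eqP + /eqP]; rewrite !subr_eq0 => /eqP ? /eqP ?.
have a0 : a = 0 by apply: key => n; have [c [d [? _]]] := coord n; exists c.
have b0 : b = 0 by apply: key => n; have [c [d [_ ?]]] := coord n; exists d.
by move: x0; rewrite xE a0 b0 emb0 mulr0 addr0 eqxx.
Qed.

Lemma OF_noetherian : noetherian (OF D).
Proof. exact: dvr_noetherian OF_dvr. Qed.

End Integers.

(** * Matrices in the lattice bases *)

Section Matrices.
Variable D : unitary_datum.
Local Notation n := (ud_n D).
Local Notation l := (ud_l D).
Local Notation O0 := (integers0 (ud_F0 D)).
Let F := ud_F D.
Let p : F := val (ud_pi D).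

(* The coordinates on which Lambda_l differs from Lambda_(n-l). *)
Definition midb (i : 'I_n) : bool := (l <= i)%N && (i < n - l)%N.

(** Strong non-speciality in the form used below: there are outer coordinates, and the middle block
    has [n - 2 l >= 3] of them. *)
Lemma l_bounds : (0 < l)%N /\ (l.*2 + 3 <= n)%N.
Proof.
have := @l_le D; have /eqP := @l_neq0 D; have /eqP := @l_neqm D.
have := @l_neqm1 D; have := odd_double_half n.
case: (odd n) => /= [|] E.
  by move=> _ ? ? ?; split; lia.
by move=> /(_ isT)/eqP; move=> ? ? ? ?; split; lia.
Qed.

Lemma midb_rev i : midb (rev_ord i) = midb i.
Proof.
rewrite /midb /=; have [_ ln] := l_bounds; have := ltn_ord i.
by move=> ?; apply/andP/andP; case; lia.
Qed.

Lemma rev_sym (i j : 'I_n) : (i == rev_ord j) = (j == rev_ord i).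
Proof. by rewrite eq_sym (can2_eq (@rev_ordK n) (@rev_ordK n)). Qed.

Section Ring.
Variable A : comNzRingType.
Definition DM : 'M[A]_n := diag_mx (\row_i (midb i)%:R).
Definition DO : 'M[A]_n := diag_mx (\row_i (~~ midb i)%:R).
(** The off-diagonal block of the Gram matrix of the lattices. With this sign pattern it is
    symmetric on the middle coordinates and alternating on the outer ones. *)
Definition Jm : 'M[A]_n :=
  \matrix_(i, j) if j == rev_ord i then (if (i < n - l)%N then -1 else 1) else 0.

Lemma DMO : DM + DO = 1%:M.
Proof.
apply/matrixP=> i j; rewrite !mxE; case: eqVneq => _; last by rewrite addr0.
by case: (midb i); rewrite ?addr0 ?add0r.
Qed.
Lemma DM_DM : DM *m DM = DM.
Proof.
apply/matrixP=> i j; rewrite mul_diag_mx !mxE; case: eqVneq => _; rewrite ?mulr0 //.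
by case: (midb i); rewrite /= ?mul0r ?mul1r.
Qed.
Lemma DM_DO : DM *m DO = 0.
Proof.
apply/matrixP=> i j; rewrite mul_diag_mx !mxE; case: eqVneq => _; rewrite ?mulr0 //.
by case: (midb i); rewrite /= ?mul0r ?mul1r.
Qed.
Lemma DO_DM : DO *m DM = 0.
Proof.
apply/matrixP=> i j; rewrite mul_diag_mx !mxE; case: eqVneq => _; rewrite ?mulr0 //.
by case: (midb i); rewrite /= ?mul0r ?mul1r.
Qed.
Lemma DO_DO : DO *m DO = DO.
Proof.
apply/matrixP=> i j; rewrite mul_diag_mx !mxE; case: eqVneq => _; rewrite ?mulr0 //.
by case: (midb i); rewrite /= ?mul0r ?mul1r.
Qed.

Lemma DM_J : DM *m Jm = Jm *m DM.
Proof.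
apply/matrixP=> i j; rewrite mul_diag_mx mul_mx_diag !mxE.
by case: eqVneq => [->|_]; rewrite ?mulr0 ?mul0r // midb_rev mulrC.
Qed.
Lemma DO_J : DO *m Jm = Jm *m DO.
Proof.
apply/matrixP=> i j; rewrite mul_diag_mx mul_mx_diag !mxE.
by case: eqVneq => [->|_]; rewrite ?mulr0 ?mul0r // midb_rev mulrC.
Qed.
Lemma DM_JT : DM *m Jm^T = DM *m Jm.
Proof.
apply/matrixP=> i j; rewrite !mul_diag_mx !mxE; case mi: (midb i); last by rewrite !mul0r.
congr (_ * _); rewrite rev_sym; case: eqVneq => // ->.
have : midb (rev_ord i) by rewrite midb_rev.
by move: mi => /andP[_ ->] /andP[_ ->].
Qed.
Lemma DO_JT : DO *m Jm^T = - (DO *m Jm).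
Proof.
apply/matrixP=> i j; rewrite !mul_diag_mx !mxE; case mi: (midb i) => /=.
  by rewrite !mul0r oppr0.
rewrite rev_sym; case: eqVneq => [->|_]; last by rewrite !mulr0 oppr0.
have [_ ln] := l_bounds; have := ltn_ord i; move: mi; rewrite /midb /= => mi ni.
rewrite !mul1r; have [il|il] := ltnP i (n - l).
  by rewrite opprK ifF //; move: mi; rewrite il andbT => /negbT; lia.
by rewrite ifT //; lia.
Qed.
Lemma J_JT : Jm *m Jm^T = 1%:M.
Proof.
apply/matrixP=> i j; rewrite !mxE (bigD1 (rev_ord i)) //= big1 => [|k ki].
  rewrite !mxE eqxx addr0 (inj_eq rev_ord_inj); case: eqVneq => [->|_]; last by rewrite mulr0.
  by case: ifP; rewrite ?mulrNN mulr1.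
by rewrite !mxE (negPf ki) mul0r.
Qed.
Lemma JT_J : Jm^T *m Jm = 1%:M.
Proof. exact: mulmx1C J_JT. Qed.

Definition dot (x y : 'rV[A]_n) : A := (x *m y^T) 0 0.
Definition frm (x y : 'rV[A]_n) : A := (x *m Jm *m y^T) 0 0.

Lemma dotC x y : dot x y = dot y x.
Proof. by rewrite /dot -[x *m y^T]trmxK trmx_mul trmxK mxE. Qed.
Lemma dotDl x x' y : dot (x + x') y = dot x y + dot x' y.
Proof. by rewrite /dot mulmxDl mxE. Qed.
Lemma dotZl a x y : dot (a *: x) y = a * dot x y.
Proof. by rewrite /dot -scalemxAl mxE. Qed.
Lemma dotDr x y y' : dot x (y + y') = dot x y + dot x y'.
Proof. by rewrite dotC dotDl !(dotC x). Qed.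
Lemma dotZr a x y : dot x (a *: y) = a * dot x y.
Proof. by rewrite dotC dotZl dotC. Qed.
Lemma dotNl x y : dot (- x) y = - dot x y.
Proof. by rewrite -scaleN1r dotZl mulN1r. Qed.
Lemma dotNr x y : dot x (- y) = - dot x y.
Proof. by rewrite dotC dotNl dotC. Qed.
Lemma dot0l y : dot 0 y = 0.
Proof. by rewrite /dot mul0mx mxE. Qed.
Lemma dot0r x : dot x 0 = 0.
Proof. by rewrite dotC dot0l. Qed.
Lemma dot_mulmx (x y : 'rV[A]_n) (M : 'M[A]_n) : dot (x *m M) y = dot x (y *m M^T).
Proof. by rewrite /dot trmx_mul trmxK mulmxA. Qed.
Lemma dot_delta x i : dot x (delta_mx 0 i) = x 0 i.
Proof.
rewrite /dot mxE (bigD1 i) //= big1 ?addr0 => [|j ji].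
  by rewrite !mxE !eqxx mulr1.
by rewrite !mxE eqxx (negPf ji) mulr0.
Qed.
Lemma dot_ext x x' : (forall y, dot x y = dot x' y) -> x = x'.
Proof. by move=> H; apply/rowP=> i; rewrite -!dot_delta H. Qed.

Lemma frm_dotr x y : frm x y = dot y (x *m Jm).
Proof. by rewrite dotC. Qed.
Lemma frm_dotl x y : frm x y = dot x (y *m Jm^T).
Proof. by rewrite /frm /dot trmx_mul trmxK mulmxA. Qed.
Lemma frmDl x x' y : frm (x + x') y = frm x y + frm x' y.
Proof. by rewrite !frm_dotl dotDl. Qed.
Lemma frmZl a x y : frm (a *: x) y = a * frm x y.
Proof. by rewrite !frm_dotl dotZl. Qed.
Lemma frmDr x y y' : frm x (y + y') = frm x y + frm x y'.
Proof. by rewrite !frm_dotr dotDl. Qed.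
Lemma frmZr a x y : frm x (a *: y) = a * frm x y.
Proof. by rewrite !frm_dotr dotZl. Qed.
Lemma frmNl x y : frm (- x) y = - frm x y.
Proof. by rewrite -scaleN1r frmZl mulN1r. Qed.
Lemma frmNr x y : frm x (- y) = - frm x y.
Proof. by rewrite -scaleN1r frmZr mulN1r. Qed.
Lemma frm0l y : frm 0 y = 0. Proof. by rewrite frm_dotl dot0l. Qed.
Lemma frm0r x : frm x 0 = 0. Proof. by rewrite frm_dotr dot0l. Qed.

Lemma frm_extl x x' : (forall y, frm x y = frm x' y) -> x = x'.
Proof.
move=> H; have E : x *m Jm = x' *m Jm.
  by apply: dot_ext => y; rewrite dotC -frm_dotr H frm_dotr dotC.
by rewrite -[x]mulmx1 -[x']mulmx1 -J_JT !mulmxA E.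
Qed.
Lemma frm_extr x x' : (forall y, frm y x = frm y x') -> x = x'.
Proof.
move=> H; have E : x *m Jm^T = x' *m Jm^T.
  by apply: dot_ext => y; rewrite dotC -frm_dotl H frm_dotl dotC.
by rewrite -[x]mulmx1 -[x']mulmx1 -JT_J !mulmxA E.
Qed.

Lemma DMT : DM^T = DM. Proof. exact: tr_diag_mx. Qed.
Lemma DOT : DO^T = DO. Proof. exact: tr_diag_mx. Qed.
Lemma frm_Ml x y : frm (x *m DM) y = frm x (y *m DM).
Proof. by rewrite /frm trmx_mul DMT -!mulmxA (mulmxA DM) DM_J !mulmxA. Qed.
Lemma frm_Ol x y : frm (x *m DO) y = frm x (y *m DO).
Proof. by rewrite /frm trmx_mul DOT -!mulmxA (mulmxA DO) DO_J !mulmxA. Qed.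
Lemma frm_symM x y : frm (x *m DM) y = frm (y *m DM) x.
Proof.
rewrite [RHS]frm_Ml [RHS]frm_dotl frm_dotr dotC -mulmxA -mulmxA DM_JT dotC.
by rewrite mulmxA.
Qed.
Lemma frm_altO x y : frm (x *m DO) y = - frm (y *m DO) x.
Proof.
rewrite [in RHS]frm_Ol [in RHS]frm_dotl frm_dotr dotC -mulmxA -mulmxA DO_JT.
by rewrite mulmxN dotNr opprK dotC.
Qed.
Lemma rowMO (x : 'rV[A]_n) : x = x *m DM + x *m DO.
Proof. by rewrite -mulmxDr DMO mulmx1. Qed.
End Ring.

Lemma map_DM (A B : comNzRingType) (f : {rmorphism A -> B}) : map_mx f (DM A) = DM B.
Proof. by apply/matrixP=> i j; rewrite !mxE rmorphMn rmorph_nat. Qed.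
Lemma map_DO (A B : comNzRingType) (f : {rmorphism A -> B}) : map_mx f (DO A) = DO B.
Proof. by apply/matrixP=> i j; rewrite !mxE rmorphMn rmorph_nat. Qed.
Lemma map_J (A B : comNzRingType) (f : {rmorphism A -> B}) : map_mx f (Jm A) = Jm B.
Proof.
apply/matrixP=> i j; rewrite !mxE; case: eqP => _; last exact: rmorph0.
by case: ifP; rewrite ?rmorphN rmorph1.
Qed.
Lemma map_dot (A B : comNzRingType) (f : {rmorphism A -> B}) x y :
  f (dot x y) = dot (map_mx f x) (map_mx f y).
Proof. by rewrite /dot map_trmx -map_mxM [in RHS]mxE. Qed.
Lemma map_frm (A B : comNzRingType) (f : {rmorphism A -> B}) x y :
  f (frm x y) = frm (map_mx f x) (map_mx f y).
Proof. by rewrite !frm_dotr map_dot map_mxM map_J. Qed.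

Lemma sum_latB (c : F) j (m : 'rV[O0]_(n + n)) :
  \sum_k val (emb F (m 0 k)) *: (c *: latB j k) =
  \sum_(i < n) (val (emb F (m 0 (lshift _ i))) + val (emb F (m 0 (rshift _ i))) * p)
     *: (c *: lattice_basis j i).
Proof.
rewrite big_split_ord /= -big_split; apply: eq_bigr => i _ /=.
by rewrite latB_l latB_r -/p scalerDl !scalerA; congr (_ + _ *: _); ring.
Qed.

Lemma latB_indep (c : F) j (m : 'rV[O0]_(n + n)) : c != 0 ->
  \sum_k val (emb F (m 0 k)) *: (c *: latB j k) = 0 -> m = 0.
Proof.
move=> c0; rewrite sum_latB => E.
pose d (i : 'I_n) : F := (if (i < j)%N then p^-1 else 1).
have d0 i : d i != 0.
  by rewrite /d; case: ifP => _; rewrite ?invr_eq0 ?val_pi_neq0 ?oner_neq0.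
have fe : free (ud_e D) := basis_free (e_basis D).
have H i : val (m 0 (lshift _ i)) = 0 /\ val (m 0 (rshift _ i)) = 0.
  apply: (@F_coords0 D).
  have H := elimT freeP fe (fun i => (val (emb F (m 0 (lshift _ i)))
     + val (emb F (m 0 (rshift _ i))) * p) * c * d i).
  have /eqP : (val (emb F (m 0 (lshift _ i)))
     + val (emb F (m 0 (rshift _ i))) * p) * c * d i = 0.
    apply: H; rewrite -[RHS]E; apply: eq_bigr => k _.
    by rewrite /lattice_basis -/p -/(d k) (tnth_nth 0) !scalerA.
  by rewrite !mulf_eq0 (negPf c0) (negPf (d0 i)) !orbF -scalerAl mul1r => /eqP.
apply/rowP=> k; rewrite mxE; apply: val_inj.
by case: (split_ordP k) => i ->; case: (H i).
Qed.

(** [mx_of] chooses some matrix of the map; independence of [latB] makes it unique, so it equals the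
    one exhibited. The factor [c] accounts for the basis of [pi^-1 Lambda_l]. *)
Lemma mx_of_block (c : F) j (B : 'I_(n + n) -> ud_V D) f (d1 d2 d3 d4 : 'rV[O0]_n) :
  c != 0 -> let B' k := c *: latB j k in
  (forall i, f (B (lshift _ i)) = val (emb F (d1 0 i)) *: B' (lshift _ i)
     + val (emb F (d2 0 i)) *: B' (rshift _ i)) ->
  (forall i, f (B (rshift _ i)) = val (emb F (d3 0 i)) *: B' (lshift _ i)
     + val (emb F (d4 0 i)) *: B' (rshift _ i)) ->
  mx_of B B' f = block_mx (diag_mx d1) (diag_mx d2) (diag_mx d3) (diag_mx d4).
Proof.
move=> c0 B' fl fr; set M := block_mx _ _ _ _.
have sumd (d : 'rV[O0]_n) i (C : 'I_n -> ud_V D) :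
    \sum_k val (emb F (diag_mx d i k)) *: C k = val (emb F (d 0 i)) *: C i.
  rewrite (bigD1 i) //= big1 => [|k ki]; first by rewrite !mxE eqxx addr0.
  by rewrite !mxE eq_sym (negPf ki) mulr0n /= !scale0r.
have MP : is_mx_of B B' f M.
  move=> i; rewrite big_split_ord /=; case: (split_ordP i) => {}i ->.
    rewrite fl -(sumd d1 i (fun k => B' (lshift _ k))) -(sumd d2 i (fun k => B' (rshift _ k))); congr (_ + _); apply: eq_bigr => k _.
      by rewrite block_mxEul.
    by rewrite block_mxEur.
  rewrite fr -(sumd d3 i (fun k => B' (lshift _ k))) -(sumd d4 i (fun k => B' (rshift _ k))); congr (_ + _); apply: eq_bigr => k _.
    by rewrite block_mxEdl.
  by rewrite block_mxEdr.
have M'P : is_mx_of B B' f (mx_of B B' f) by apply: xgetPex; exists M.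
apply/row_matrixP=> i; apply/eqP; rewrite -subr_eq0; apply/eqP.
apply: (@latB_indep c j) => //.
have E : \sum_k val (emb F (mx_of B B' f i k)) *: B' k = \sum_k val (emb F (M i k)) *: B' k.
  by rewrite -M'P -MP.
move/eqP: E; rewrite -subr_eq0 -sumrB => /eqP E; rewrite -[RHS]E; apply: eq_bigr => k _.
by rewrite !mxE -scalerBl embD embN.
Qed.

Variable R : calg (OF D).
Local Notation pr := (piR R).

Lemma str_pi0 : calg_str R (emb F (ud_pi0 D)) = pr ^+ 2.
Proof. by rewrite -(@pi_sqr D) rmorphXn. Qed.

Lemma mxR_diag (d : 'rV[O0]_n) :
  mxR R (diag_mx d) = diag_mx (\row_i calg_str R (emb F (d 0 i))).
Proof.
apply/matrixP=> i j; rewrite !mxE /=; case: eqP => _ //=.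
by rewrite emb0 rmorph0.
Qed.

Let r1 (f : 'I_n -> O0) : 'rV[O0]_n := \row_i f i.

Lemma str_nat (b : bool) : calg_str R (emb F (b%:R : O0)) = b%:R.
Proof.
have -> : (b%:R : O0) = if b then 1 else 0 by case: b.
by case: b; rewrite ?emb1 ?emb0 ?rmorph1 ?rmorph0.
Qed.

Lemma mxR_block (a b c d : 'M[O0]_n) :
  mxR R (block_mx a b c d) = block_mx (mxR R a) (mxR R b) (mxR R c) (mxR R d).
Proof. by rewrite /mxR map_block_mx. Qed.

Lemma mx_of_tE j : mx_of (@latB D j) (@latB D j) (fun x => p *: x) =
  block_mx (diag_mx (r1 (fun=> 0))) (diag_mx (r1 (fun=> 1)))
    (diag_mx (r1 (fun=> ud_pi0 D))) (diag_mx (r1 (fun=> 0))).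
Proof.
have E : @latB D j = fun k => 1 *: latB j k by apply/funext => k; rewrite scale1r.
rewrite {2}E; apply: mx_of_block; rewrite ?oner_neq0 // => i.
  by rewrite !mxE /= !scale0r add0r latB_l latB_r !scale1r.
by rewrite !mxE /= latB_l latB_r !scale1r !scale0r addr0 scalerA val_pi_sqr.
Qed.

Lemma tR_mul j (x y : 'rV[R]_n) :
  row_mx x y *m tR j R = row_mx (pr ^+ 2 *: y) x.
Proof.
rewrite /tR mx_of_tE mxR_block !mxR_diag mul_row_block.
have d0 : diag_mx (\row_i calg_str R (emb F (r1 (fun=> 0) 0 i))) = 0 :> 'M_n.
  by apply/matrixP=> i k; rewrite !mxE emb0 rmorph0 mul0rn.
have d1 : diag_mx (\row_i calg_str R (emb F (r1 (fun=> 1) 0 i))) = 1%:M :> 'M_n.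
  by apply/matrixP=> i k; rewrite !mxE emb1 rmorph1.
have dp : diag_mx (\row_i calg_str R (emb F (r1 (fun=> ud_pi0 D) 0 i))) = (pr ^+ 2)%:M :> 'M_n.
  by apply/matrixP=> i k; rewrite !mxE str_pi0.
by rewrite d0 d1 dp !mulmx0 mulmx1 add0r addr0 mul_mx_scalar.
Qed.

Let dg (f : 'I_n -> bool) : diag_mx (\row_i calg_str R (emb F (r1 (fun i => (f i)%:R) 0 i)))
   = diag_mx (\row_i (f i)%:R) :> 'M_n.
Proof. by congr diag_mx; apply/rowP=> i; rewrite !mxE str_nat. Qed.
Let dgp (f : 'I_n -> bool) :
  diag_mx (\row_i calg_str R (emb F (r1 (fun i => (f i)%:R * ud_pi0 D) 0 i)))
   = pr ^+ 2 *: diag_mx (\row_i (f i)%:R) :> 'M_n.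
Proof.
by apply/matrixP=> i j; rewrite !mxE embM rmorphM /= str_nat str_pi0 mulrnAr [_%:R * _]mulrC.
Qed.

Let lbl (i : 'I_n) : (i < l)%N || midb i = (i < n - l)%N.
Proof. by rewrite /midb; have [_ ?] := l_bounds; case: (ltnP i l) => /=; lia. Qed.

Lemma incl_up_mul (x y : 'rV[R]_n) : row_mx x y *m incl_up R =
  row_mx (x *m DO R + pr ^+ 2 *: (y *m DM R)) (y *m DO R + x *m DM R).
Proof.
have pn0 : sval (ud_pi D) != 0 := val_pi_neq0 D.
have pp : sval (ud_pi D) * sval (ud_pi D) = (sval (ud_pi0 D))%:A := val_pi_sqr D.
have E : @latB D (n - l) = fun k => 1 *: latB (n - l) k by apply/funext => k; rewrite scale1r.
have -> : incl_up R = mxR R (block_mx (diag_mx (r1 (fun i => (~~ midb i)%:R)))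
    (diag_mx (r1 (fun i => (midb i)%:R)))
    (diag_mx (r1 (fun i => (midb i)%:R * ud_pi0 D))) (diag_mx (r1 (fun i => (~~ midb i)%:R)))).
  rewrite /incl_up E; congr mxR; apply: mx_of_block; rewrite ?oner_neq0 // => i;
    rewrite !mxE ?latB_l ?latB_r /lattice_basis -lbl; case mi: (midb i) => /=;
    rewrite ?mul0r ?mul1r ?scale0r ?scale1r ?addr0 ?add0r ?orbT ?orbF ?scale1r //.
  - have -> : (i < l)%N = false by move/andP: mi => [+ _]; case: ltnP.
    by rewrite !scalerA (mulfV pn0).
  - have -> : (i < l)%N = false by move/andP: mi => [+ _]; case: ltnP.
    by rewrite -pp !scalerA (mulfK pn0) mulr1.
rewrite mxR_block !mxR_diag !dg dgp mul_row_block -!scalemxAr.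
by congr row_mx; rewrite addrC.
Qed.

Lemma incl_down_mul (x y : 'rV[R]_n) : row_mx x y *m incl_down R =
  row_mx (x *m DM R + pr ^+ 2 *: (y *m DO R)) (y *m DM R + x *m DO R).
Proof.
have pn0 : sval (ud_pi D) != 0 := val_pi_neq0 D.
have pp : sval (ud_pi D) * sval (ud_pi D) = (sval (ud_pi0 D))%:A := val_pi_sqr D.
have -> : incl_down R = mxR R (block_mx (diag_mx (r1 (fun i => (midb i)%:R)))
    (diag_mx (r1 (fun i => (~~ midb i)%:R)))
    (diag_mx (r1 (fun i => (~~ midb i)%:R * ud_pi0 D))) (diag_mx (r1 (fun i => (midb i)%:R)))).
  rewrite /incl_down; congr mxR; apply: mx_of_block; rewrite ?invr_eq0 ?val_pi_neq0 // => i;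
    rewrite !mxE ?latB_l ?latB_r /lattice_basis -lbl; case mi: (midb i) => /=;
    rewrite ?mul0r ?mul1r ?scale0r ?scale1r ?addr0 ?add0r ?orbT ?orbF ?scale1r //.
  - have -> : (i < l)%N = false by move/andP: mi => [+ _]; case: ltnP.
    by rewrite scale1r.
  - by rewrite !scalerA (mulVf pn0) mul1r.
  - have -> : (i < l)%N = false by move/andP: mi => [+ _]; case: ltnP.
    by rewrite scale1r !scalerA (mulfV pn0) (mulVf pn0).
  - by rewrite -pp !scalerA (mulfK pn0).
rewrite mxR_block !mxR_diag !dg dgp mul_row_block -!scalemxAr.
by congr row_mx; rewrite addrC.
Qed.

(** Only mutually reversed basis vectors pair nontrivially. Half the trace keeps the values [1] and
    [-1] and kills those with conjugate [- z], whence the zero diagonal blocks. *)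
Lemma gram_block : gram (latB (n - l)) (latB l) =
  block_mx 0 (Jm O0) (- Jm O0) 0.
Proof.
have GP := @pairing_gramP D; set G := gram _ _ in GP *.
have inj (a b : O0) : val (emb F a) = val (emb F b) -> a = b.
  move=> E; apply: val_inj; apply: (fmorph_inj (in_alg F)); exact: E.
have cp := conj_pi D; rewrite -/p in cp; have pn0 : p != 0 := val_pi_neq0 D.
have cpV : ud_conj D p^-1 = - p^-1 by rewrite fmorphV -invrN -cp.
have two : (2 : F) != 0.
  have [b b2] := O0_two D; apply/eqP=> t0; have /eqP := oner_neq0 F; case.
  have := congr1 (fun z : O0 => val (emb F z)) b2; rewrite embM val_emb1 /= => <-.
  by rewrite (_ : (1 + 1)%:A = 0) ?mul0r // scalerDl scale1r.
have pairE (c c' : F) i j : pairing (c *: tnth (ud_e D) i) (c' *: tnth (ud_e D) j) =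
    if j == rev_ord i then 2^-1 * (ud_conj D c * c' + ud_conj D (ud_conj D c * c')) else 0.
  rewrite /pairing -{1 2}[j]rev_ordK e_split rev_sym.
  by case: eqP => _; rewrite ?mulr1 // !mulr0 rmorph0 addr0 mulr0.
have revl (i : 'I_n) : (rev_ord i < l)%N = ~~ (i < n - l)%N.
  by rewrite /=; have := ltn_ord i; have [_ ?] := l_bounds; lia.
have half (z : F) : 2^-1 * (z + z) = z by rewrite -mulr2n -[z *+ 2]mulr_natl mulKf.
have h0 (z : F) : ud_conj D z = - z -> 2^-1 * (z + ud_conj D z) = 0.
  by move=> ->; rewrite subrr mulr0.
apply/matrixP=> i j; apply: inj; rewrite -GP.
case: (split_ordP i) => {}i ->; case: (split_ordP j) => {}j ->;
  rewrite ?block_mxEul ?block_mxEur ?block_mxEdl ?block_mxEdr !mxE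
    ?latB_l ?latB_r /lattice_basis ?scalerA -/p pairE;
  case: eqP => [->|_]; rewrite ?revl ?oppr0 /= ?scale0r //; case: (i < n - l)%N => /=.
- by apply: h0; rewrite mulr1 cpV rmorphN /= cpV.
- by apply: h0; rewrite rmorph1 mul1r /= cpV.
- by rewrite mulr1 cpV mulNr (mulVf pn0) rmorphN rmorph1 half scaleN1r.
- by rewrite (mulfV pn0) rmorph1 mulr1 rmorph1 half scale1r.
- by rewrite (mulfV pn0) rmorph1 mulr1 rmorph1 half opprK scale1r.
- by rewrite mulr1 cp mulNr (mulfV pn0) rmorphN rmorph1 half scaleN1r.
- by apply: h0; rewrite (mulfV pn0) rmorph1 mul1r mulr1 cp.
- by apply: h0; rewrite (mulfV pn0) !mulr1 cp rmorphN /= cp.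
Qed.

Lemma pairR_mul (x y x' y' : 'rV[R]_n) :
  (row_mx x y *m pairR R *m (row_mx x' y')^T) = (frm x y' - frm y x')%:M.
Proof.
rewrite /pairR gram_block mxR_block.
have m0 : mxR R (0 : 'M[O0]_n) = 0.
  by apply/matrixP=> i j; rewrite !mxE /= emb0 rmorph0.
have mJ : mxR R (Jm O0) = Jm R.
  apply/matrixP=> i j; rewrite !mxE /=; case: eqP => _; last by rewrite emb0 rmorph0.
  by case: ifP => _; rewrite ?embN emb1 ?rmorphN rmorph1.
have mN : mxR R (- Jm O0) = - Jm R.
  by rewrite -mJ; apply/matrixP=> i j; rewrite !mxE /= embN rmorphN.
rewrite m0 mJ mN mul_row_block !mulmx0 addr0 add0r tr_row_mx mul_row_col mulmxN mulNmx.
by rewrite [LHS]mx11_scalar; congr (_%:M); rewrite mxE [X in X + _]mxE addrC.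
Qed.

End Matrices.

(** * Direct summands and rank one perturbations of scalars *)

Lemma free_of_rinv (R : comNzRingType) N r (A : 'M[R]_(r, N)) (X : 'M[R]_(N, r))
    (M : set 'rV[R]_N) : A *m X = 1%:M -> M = [set a *m A | a in setT] ->
  free_summand r M setT.
Proof.
move=> AX ME; split.
  by exists A; split=> // a aA; rewrite -[a]mulmx1 -AX mulmxA aA mul0mx.
exists [set x | x *m X = 0]; split.
- split=> [|a x y /= x0 y0] /=; first by rewrite mul0mx.
  by rewrite mulmxDl -scalemxAl x0 y0 scaler0 addr0.
- by move=> x; rewrite ME => -[a _ <-] /=; rewrite -mulmxA AX mulmx1 => ->; rewrite mul0mx.
rewrite eqEsubset; split=> // x _; exists (x *m X *m A).
  by rewrite ME; exists (x *m X).
exists (x - x *m X *m A); last by rewrite addrC subrK.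
by rewrite /= mulmxBl -!mulmxA AX mulmx1 subrr.
Qed.

(** [C] is the matrix of the projection of [M] onto [G] along the complement [K], which turns the
    right inverse of the frame of [M] into one for the frame of [G]. *)
Lemma free_rinv (R : comNzRingType) N r m (G M : set 'rV[R]_N)
    (AM : 'M[R]_(m, N)) (XM : 'M[R]_(N, m)) :
  free_summand r G M -> AM *m XM = 1%:M -> M = [set a *m AM | a in setT] ->
  exists (A : 'M[R]_(r, N)) (X : 'M[R]_(N, r)), is_frame A G /\ A *m X = 1%:M.
Proof.
move=> [[A [Ainj GE]] [K [sK GK MGK]]] AX ME.
have rM i : M (row i AM) by rewrite ME; exists (delta_mx 0 i); rewrite // -rowE.
have H i : exists c : 'rV[R]_r, K (row i AM - c *m A).
  have := rM i; rewrite {1}MGK => -[x Gx [y Ky xy]].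
  move: Gx xy; rewrite GE => -[c _ <-] xy; exists c.
  by rewrite -xy addrAC subrr add0r.
have {H}/fin_all_exists[c cK] := H.
pose C : 'M_(m, r) := \matrix_(i, j) c i 0 j.
have rC i : row i C = c i by apply/rowP=> j; rewrite !mxE.
have K0 : K 0 by case: sK.
have H i : exists b : 'rV[R]_m, row i A = b *m AM.
  have : M (row i A).
    rewrite MGK; exists (row i A); last by exists 0 => //; rewrite addr0.
    by rewrite GE; exists (delta_mx 0 i); rewrite // -rowE.
  by rewrite ME => -[b _ <-]; exists b.
have {H}/fin_all_exists[b bA] := H.
pose B : 'M_(r, m) := \matrix_(i, j) b i 0 j.
have rB i : row i B = b i by apply/rowP=> j; rewrite !mxE.
have AB : A = B *m AM by apply/row_matrixP=> i; rewrite row_mul rB bA.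
have KC (a : 'rV_m) : K (a *m AM - a *m C *m A).
  have -> : a *m AM - a *m C *m A = \sum_i a 0 i *: (row i AM - c i *m A).
    rewrite -mulmxA -mulmxBr mulmx_sum_row; apply: eq_bigr => i _.
    by rewrite -[C *m A]/(C *m A) !linearB /= row_mul rC.
  by apply: submodule_sum => // i _; apply: submoduleZ.
exists A, (XM *m C); split=> //.
rewrite mulmxA AB -[B *m AM *m XM]mulmxA AX mulmx1.
apply/row_matrixP=> i; apply/eqP; rewrite -subr_eq0; apply/eqP/Ainj/GK.
  by rewrite GE; exists (row i (B *m C) - row i 1%:M).
rewrite mulmxBl row_mul rB row1 -rowE bA.
by rewrite -opprB -scaleN1r; apply: submoduleZ.
Qed.

(** Two triangular factorizations of the bordered matrix [M] are compared. The factor [a] on the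
    left replaces a division by [a]. *)
Lemma rank_one_det (P : comNzRingType) m (a : P) (s : 'cV[P]_m) (r : 'rV[P]_m) :
  a * \det (a%:M - s *m r) = a ^+ m * (a - (r *m s) 0 0).
Proof.
pose M := block_mx a%:M s r (1%:M : 'M[P]_1).
have E1 : \det (a%:M - s *m r) = \det M.
  have -> : M = block_mx (a%:M - s *m r) s 0 1%:M *m block_mx 1%:M 0 r 1%:M.
    by rewrite mulmx_block !mulmx1 !mul1mx !mulmx0 ?mul0mx ?add0r ?addr0 subrK.
  by rewrite det_mulmx det_ublock det_lblock !det1 !mulr1.
have E2 : a * \det M = \det (block_mx a%:M s 0 (a%:M - r *m s)).
  have -> : block_mx a%:M s 0 (a%:M - r *m s) = block_mx 1%:M 0 (- r) a%:M *m M.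
    rewrite mulmx_block !mul1mx !mul0mx !addr0 mulmx1 mulNmx mul_mx_scalar mul_scalar_mx addNr.
    by rewrite mulNmx addrC.
  by rewrite det_mulmx det_lblock det1 mul1r det_scalar1.
rewrite E1 E2 det_ublock det_scalar; congr (_ * _).
by rewrite [_ - _]mx11_scalar det_scalar1 !mxE eqxx.
Qed.

Section RankOneFrame.
Variables (S : comNzRingType).

(** [rank_one_det] is applied with [a = 'X + p], which is monic and can be cancelled. *)
Lemma rank_one_char_poly m (p : S) (C : 'M[S]_m) (s : 'cV[S]_m)
    (r : 'rV[S]_m) : (0 < m)%N -> C + p%:M = s *m r -> (r *m s) 0 0 = 2 * p ->
  char_poly C = ('X + p%:P) ^+ m.-1 * ('X - p%:P).
Proof.
case: m C s r => // m C s r _ CE rs.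
pose a : {poly S} := 'X + p%:P.
have am : a \is monic by rewrite monicE lead_coefXaddC.
have areg (u v : {poly S}) : a * u = a * v -> u = v.
  by move=> E; apply: (monic_rreg am); rewrite mulrC E mulrC.
apply: areg; rewrite mulrA -exprS.
have -> : char_poly C = \det (a%:M - map_mx polyC s *m map_mx polyC r).
  rewrite /char_poly /char_poly_mx -map_mxM -CE; congr (\det _).
  by rewrite map_mxD map_scalar_mx /a raddfD /= opprD addrACA subrr addr0.
rewrite rank_one_det -map_mxM [_ 0 0]mxE rs /a rmorphM /= polyCD; congr (_ * _).
by rewrite mulrDl mul1r opprD addrA addrK.
Qed.

Lemma rank_one_wedge m (s : 'cV[S]_m) (r : 'rV[S]_m) : wedge_zero 2 (s *m r).
Proof.
move=> f g; rewrite (expand_det_row _ ord0) !big_ord_recl big_ord0 /cofactor.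
rewrite !det_mx11 !mxE !big_ord1 /= !expr0 expr1 mul1r addr0 mulN1r mulrN.
have -> : lift (lift ord0 ord0 : 'I_2) (0 : 'I_1) = ord0 by apply: val_inj.
have -> : lift (ord0 : 'I_2) (0 : 'I_1) = lift ord0 ord0 by apply: val_inj.
by rewrite mulrACA [r _ _ * _]mulrC mulrACA subrr.
Qed.

Lemma wedge_full m (C : 'M[S]_m) : \det C = 0 -> wedge_zero m C.
Proof.
move=> C0 f g.
have -> : mxsub f g C = rowsub f 1%:M *m C *m colsub g 1%:M.
  by rewrite mulmx_colsub mulmx1 mul_rowsub_mx mul1mx; apply/matrixP=> i j; rewrite !mxE.
by rewrite !det_mulmx C0 mulr0 mul0r.
Qed.
End RankOneFrame.

(** * The modules of the splitting model *)

Section Modules.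
Variable D : unitary_datum.
Local Notation n := (ud_n D).
Local Notation l := (ud_l D).

Section Ring.
Variable R : calg (OF D).
Local Notation pr := (piR R).
Implicit Types (a k g h y : 'rV[R]_n) (c s lam : R).

Definition lin a s y : 'rV[R]_(n + n) := row_mx (s *: a - pr *: y) y.

(* In Lambda (x) R = R^n + R^n, (t + pi)^-1 of the line spanned by (pi a, a)  *)
(* consists of the vectors lin a s y; Sb is the kernel of a linear functional *)
(* on it. *)
Definition Sb a c k : set 'rV[R]_(n + n) :=
  [set v | exists s y, v = lin a s y /\ s * c + dot y k = 0].

Lemma linD a s y s' y' : lin a s y + lin a s' y' = lin a (s + s') (y + y').
Proof. by rewrite /lin add_row_mx scalerDl scalerDr opprD addrACA. Qed.
Lemma linZ a b s y : b *: lin a s y = lin a (b * s) (b *: y).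
Proof. by rewrite /lin scale_row_mx scalerBr !scalerA [b * pr]mulrC. Qed.

Lemma Sb_submodule a c k : submodule (Sb a c k).
Proof.
split=> [|b _ _ [s [y [-> E]]] [s' [y' [-> E']]]].
  exists 0, 0; rewrite /lin scale0r scaler0 subr0 row_mx0 mul0r add0r; split=> //.
  exact: dot0l.
exists (b * s + s'), (b *: y + y'); rewrite linZ linD; split=> //.
rewrite dotDl dotZl; transitivity (b * (s * c + dot y k) + (s' * c + dot y' k)); first by ring.
by rewrite E E' mulr0 addr0.
Qed.

Lemma lin_tR j a s y : lin a s y *m tR j R = row_mx (pr ^+ 2 *: y) (s *: a - pr *: y).
Proof. by rewrite tR_mul. Qed.

Lemma lin_tRp j a s y : lin a s y *m tR j R + pr *: lin a s y = s *: row_mx (pr *: a) a.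
Proof.
rewrite lin_tR /lin scale_row_mx add_row_mx scale_row_mx subrK; congr row_mx.
by rewrite scalerBr !scalerA expr2 addrCA subrr addr0 mulrC.
Qed.

Lemma lin_self a : row_mx (pr *: a) a = lin a (2 * pr) a.
Proof. by rewrite /lin -scalerBl; congr (row_mx (_ *: _) _); ring. Qed.

Lemma lin_z a s y : lsubmx (lin a s y) + pr *: rsubmx (lin a s y) = s *: a.
Proof. by rewrite row_mxKl row_mxKr subrK. Qed.

(** In the coordinates [(s, y)], [Em a] is the map [lin a] and [kap c k] the functional whose kernel
    has image [Sb a c k]. *)
Definition Em a : 'M[R]_(1 + n, n + n) :=
  col_mx (row_mx a 0) (row_mx (- pr)%:M 1%:M).
Definition kap c k : 'cV[R]_(1 + n) := col_mx c%:M k^T.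

Lemma lin_Em a s y : lin a s y = row_mx s%:M y *m Em a.
Proof.
rewrite /Em mul_row_col mul_scalar_mx scale_row_mx mul_mx_row mulmx1 scaler0.
by rewrite mul_mx_scalar add_row_mx add0r scaleNr.
Qed.

Lemma row_kap s y c k : row_mx s%:M y *m kap c k = (s * c + dot y k)%:M.
Proof.
rewrite /kap mul_row_col -scalar_mxM raddfD /=; congr (_ + _).
by rewrite [LHS]mx11_scalar.
Qed.

Lemma row_split (u : 'rV[R]_(1 + n)) : exists s y, u = row_mx s%:M y.
Proof.
exists (lsubmx u 0 0), (rsubmx u); rewrite -[LHS]hsubmxK; congr row_mx.
exact: mx11_scalar.
Qed.

Lemma SbE a c k : Sb a c k = [set u *m Em a | u in [set u | u *m kap c k = 0]].
Proof.
rewrite eqEsubset; split=> [_ [s [y [-> E]]]|_ [u /= uk <-]].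
  by exists (row_mx s%:M y); rewrite /= ?row_kap ?E ?raddf0 // -lin_Em.
have [s [y uE]] := row_split u; exists s, y; split; first by rewrite lin_Em uE.
by move: uk; rewrite uE row_kap => /(congr1 (fun M : 'M_1 => M 0 0)); rewrite !mxE mulr1n.
Qed.

Definition unim c k := exists alpha eta, alpha * c + dot eta k = 1.

Lemma unim_row c k : unim c k -> exists r : 'rV[R]_(1 + n), r *m kap c k = 1%:M.
Proof. by move=> [al [et E]]; exists (row_mx al%:M et); rewrite row_kap E. Qed.
End Ring.

Section BaseChange.
Variables (R S : calg (OF D)) (f : ahom R S).

Lemma map_piR : f (piR R) = piR S. Proof. exact: ahom_str. Qed.

Lemma map_Em a : map_mx f (Em a) = Em (map_mx f a).
Proof.
by rewrite /Em map_col_mx !map_row_mx map_mx0 !map_scalar_mx rmorphN rmorph1 /= map_piR.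
Qed.

Lemma map_kap c k : map_mx f (kap c k) = kap (f c) (map_mx f k).
Proof. by rewrite /kap map_col_mx map_scalar_mx map_trmx. Qed.

Lemma ext_rows N m (L : 'M[R]_(m, N)) (M : set 'rV[R]_N) (u : 'rV[S]_m) :
  (forall i, M (row i L)) -> ext f M (u *m map_mx f L).
Proof.
move=> ML; rewrite mulmx_sum_row; have sM := submodule_ext f M.
apply: (submodule_sum _ sM) => i _; apply: (submoduleZ _ sM).
by rewrite -map_row; apply: ext_in.
Qed.

(** Kernels need not commute with base change, but for unimodular [(c, k)] the matrix
    [1 - kap c k *m r] projects onto the kernel, by a formula that does. *)
Lemma Sb_ext a c k : unim c k -> ext f (Sb a c k) = Sb (map_mx f a) (f c) (map_mx f k).
Proof.
move=> /unim_row[r rE]; rewrite eqEsubset; split.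
  apply: ext_ind; first exact: Sb_submodule.
  rewrite SbE => _ [u /= uk <-]; rewrite SbE; exists (map_mx f u).
    by rewrite /= -map_kap -map_mxM uk map_mx0.
  by rewrite map_mxM map_Em.
rewrite SbE => _ [u /= uk <-].
pose L := (1%:M - kap c k *m r) *m Em a.
have -> : u *m Em (map_mx f a) = u *m map_mx f L.
  rewrite /L map_mxM map_Em map_mxB map_scalar_mx rmorph1 map_mxM map_kap.
  by rewrite mulmxA mulmxBr mulmx1 [u *m (_ *m _)]mulmxA uk mul0mx subr0.
apply: ext_rows => i; rewrite SbE; exists (row i (1%:M - kap c k *m r)).
  by rewrite /= -row_mul mulmxBl mul1mx -mulmxA rE mulmx1 subrr; apply/rowP=> j; rewrite !mxE.
by rewrite -row_mul.
Qed.
End BaseChange.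

Section Frames.
Variables (S : calg (OF D)).
Local Notation pr := (piR S).
Implicit Types (a k y : 'rV[S]_n) (c s : S).

Lemma ker_frame (ka : 'cV[S]_(1 + n)) (idx : 'I_(1 + n)) : invertible (ka idx 0) ->
  exists (Kf : 'M[S]_(n, 1 + n)) (sel : 'M[S]_(1 + n, n)),
    [/\ Kf *m ka = 0, Kf *m sel = 1%:M & forall r : 'rV_(1 + n), r *m ka = 0 -> r = r *m sel *m Kf].
Proof.
move=> [u uE].
pose Kf : 'M[S]_(n, 1 + n) := \matrix_(i, j) ((j == lift idx i)%:R - ka (lift idx i) 0 * u * (j == idx)%:R).
pose sel : 'M[S]_(1 + n, n) := \matrix_(j, i) (j == lift idx i)%:R.
have sumd (F : 'I_(1 + n) -> S) i : \sum_j (j == i)%:R * F j = F i.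
  rewrite (bigD1 i) //= big1 ?addr0 ?eqxx ?mul1r // => j ji.
  by rewrite (negPf ji) mul0r.
exists Kf, sel; split.
- apply/colP=> i; rewrite !mxE.
  transitivity (\sum_j (j == lift idx i)%:R * ka j 0 -
      ka (lift idx i) 0 * u * \sum_j (j == idx)%:R * ka j 0).
    by rewrite mulr_sumr -sumrB; apply: eq_bigr => j _; rewrite !mxE; ring.
  by rewrite !sumd -mulrA [u * _]mulrC uE mulr1 subrr.
- apply/matrixP=> i j; rewrite !mxE.
  transitivity (\sum_m (m == lift idx i)%:R * (m == lift idx j)%:R -
      ka (lift idx i) 0 * u * \sum_m (m == idx)%:R * (m == lift idx j)%:R).
    by rewrite mulr_sumr -sumrB; apply: eq_bigr => m _; rewrite !mxE; ring.
  by rewrite !sumd (negPf (neq_lift _ _)) mulr0 subr0 (inj_eq lift_inj).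
move=> r rk; apply/rowP=> j.
have selE i : (r *m sel) 0 i = r 0 (lift idx i).
  rewrite mxE -[RHS](sumd (fun m => r 0 m)); apply: eq_bigr => m _.
  by rewrite !mxE mulrC.
rewrite mxE.
have -> : \sum_i (r *m sel) 0 i * Kf i j = \sum_(i < n) r 0 (lift idx i) * (j == lift idx i)%:R
    - u * (j == idx)%:R * \sum_(i < n) r 0 (lift idx i) * ka (lift idx i) 0.
  by rewrite mulr_sumr -sumrB; apply: eq_bigr => i _; rewrite selE !mxE; ring.
have sumL : \sum_(i < n) r 0 (lift idx i) * ka (lift idx i) 0 = - (r 0 idx * ka idx 0).
  have /(congr1 (fun M : 'M_1 => M 0 0)) := rk; rewrite !mxE (bigD1_ord idx) //= => E.
  by apply/eqP; rewrite -addr_eq0 addrC E.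
rewrite sumL; case: (unliftP idx j) => [i ->|->].
  rewrite (eq_bigr (fun i' => (i' == i)%:R * r 0 (lift idx i'))); last first.
    by move=> i' _; rewrite (inj_eq lift_inj) mulrC eq_sym.
  rewrite (bigD1 i) //= big1 => [|i' ii]; last by rewrite (negPf ii) mul0r.
  by rewrite eqxx mul1r addr0 eq_sym (negPf (neq_lift _ _)) mulr0 mul0r subr0.
rewrite big1 => [|i _]; last by rewrite (negPf (neq_lift _ _)) mulr0.
by rewrite eqxx sub0r mulr1 mulrN opprK mulrCA [u * _]mulrC uE mulr1.
Qed.

(** On the kernel of the functional [tau] recovers [s], while [y] is the second half of the vector.
    Thus [Em a] is split injective there, although for [a = 0] it is not injective on all of
    [R^(1 + n)]. *)
Lemma Sb_free a c k (tau : 'cV[S]_(n + n)) (idx : 'I_(1 + n)) :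
  invertible (kap c k idx 0) ->
  (forall s y, s * c + dot y k = 0 -> lin a s y *m tau = s%:M) ->
  free_summand n (Sb a c k) setT.
Proof.
move=> ui Ht; have [Kf [sel [Kk Ks Kr]]] := ker_frame ui.
pose Y : 'M[S]_(n + n, 1 + n) := row_mx tau (col_mx 0 1%:M).
have AY : Kf *m Em a *m Y = Kf.
  apply/row_matrixP=> i; rewrite -mulmxA row_mul.
  have [s [y rE]] := row_split (row i Kf).
  have sy : s * c + dot y k = 0.
    have : row i Kf *m kap c k = 0.
      by rewrite -row_mul Kk; apply/rowP=> j; rewrite !mxE.
    by rewrite rE row_kap => /(congr1 (fun M : 'M_1 => M 0 0)); rewrite !mxE mulr1n.
  rewrite mulmxA rE -lin_Em /Y mul_mx_row Ht // /lin mul_row_col mulmx0 add0r.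
  by rewrite mulmx1.
apply: (@free_of_rinv _ _ _ (Kf *m Em a) (Y *m sel)); first by rewrite mulmxA AY.
rewrite SbE eqEsubset; split=> [_ [u /= uk <-]|_ [b _ <-]].
  by exists (u *m sel); rewrite // mulmxA -Kr.
by exists (b *m Kf); rewrite ?mulmxA //= -mulmxA Kk mulmx0.
Qed.

Lemma unim_idx (p : set S) c k : is_prime p -> unim c k -> exists idx, ~ p (kap c k idx 0).
Proof.
move=> pp /unim_row[r rE]; apply: contrapT => no.
have ip := prime_ideal pp; case: (pp) => _ p1 _; apply: p1.
have /(congr1 (fun M : 'M_1 => M 0 0)) := rE; rewrite mxE [in X in _ = X -> _]mxE eqxx => E.
have {}E : _ = 1 :> S := E; rewrite -E; apply: (ideal_sum _ ip) => i _; apply: (idealM_l _ ip).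
by apply: contrapT => pi; apply: no; exists i.
Qed.

(** On [M] the operator [t + pi] has the form [tau] times one vector, with trace [2 pi]: its matrix
    has rank one, which yields the characteristic polynomial and both wedge conditions together. *)
Lemma frame_rank_one j (M : set 'rV[S]_(n + n)) (A : 'M[S]_(n, n + n)) C
    (a : 'rV[S]_n) (tau : 'cV[S]_(n + n)) :
  is_frame A M -> A *m tR j S = C *m A -> M (row_mx (pr *: a) a) ->
  (forall v, M v -> v *m tR j S + pr *: v = (v *m tau) 0 0 *: row_mx (pr *: a) a) ->
  (row_mx (pr *: a) a *m tau) 0 0 = 2 * pr ->
  char_poly C = ('X + pr%:P) ^+ n.-1 * ('X - pr%:P) /\
  (wedge_zero n (C - pr%:M) /\ wedge_zero 2 (C + pr%:M)).
Proof.
move=> [Ainj ME] AT Ma Mt a2.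
have rM i : M (row i A) by rewrite ME; exists (delta_mx 0 i); rewrite // -rowE.
have [r _ rA] : [set r *m A | r in setT] (row_mx (pr *: a) a) by rewrite -ME.
have CE : C + pr%:M = A *m tau *m r.
  apply/row_matrixP=> i; apply/eqP; rewrite -subr_eq0; apply/eqP/Ainj.
  rewrite mulmxBl -!row_mul mulmxDl -AT mul_scalar_mx -(mulmxA (A *m tau)) rA.
  apply/eqP; rewrite subr_eq0; apply/eqP.
  have := Mt _ (rM i); rewrite -row_mul => E.
  have -> : row i (A *m tR j S + pr *: A) = row i (A *m tR j S) + pr *: row i A.
    by rewrite linearD linearZ.
  by rewrite E !row_mul [row i A *m tau in RHS]mx11_scalar mul_scalar_mx.
have rs : (r *m (A *m tau)) 0 0 = 2 * pr by rewrite mulmxA rA a2.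
have n0 : (0 < n)%N by have := n_gt3 D; lia.
have cp := rank_one_char_poly n0 CE rs; split=> //; split.
  apply: wedge_full; have := congr1 (fun q => q.[pr]) cp.
  rewrite hornerM hornerXsubC subrr mulr0 /char_poly => E.
  have : \det (pr%:M - C) = 0.
    rewrite -E -[_.[pr]]/(horner_eval pr (\det (char_poly_mx C))) -det_map_mx.
    congr (\det _); apply/matrixP=> i m; rewrite !mxE -[in RHS]/(horner_eval pr _).
    by rewrite rmorphB rmorphMn /= /horner_eval hornerX hornerC.
  by move=> D0; rewrite (_ : C - _ = -1 *: (pr%:M - C)) ?detZ ?D0 ?mulr0 // scaleN1r opprB.
by rewrite CE; apply: rank_one_wedge.
Qed.
End Frames.
End Modules.

(** * The modules attached to [g], [lam], [h] and the moduli conditions *)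

Section Data.
Variable D : unitary_datum.
Local Notation n := (ud_n D).
Local Notation l := (ud_l D).

Lemma Sb_conds (R : calg (OF D)) (a : 'rV[R]_n) c k j :
  unim c k -> 2 * piR R * c + dot a k = 0 ->
  (forall S (f : ahom R S), exists tau : 'cV[S]_(n + n), forall s y,
     s * f c + dot y (map_mx f k) = 0 -> lin (map_mx f a) s y *m tau = s%:M) ->
  [/\ forall v, Sb a c k v -> Sb a c k (v *m tR j R),
      loc_summand n (Sb a c k) setT
    & forall S (f : ahom R S) A (C : 'M[S]_n), is_frame A (ext f (Sb a c k)) ->
        A *m tR j S = C *m A ->
        char_poly C = ('X + (piR S)%:P) ^+ n.-1 * ('X - (piR S)%:P) /\
        (wedge_zero n (C - (piR S)%:M) /\ wedge_zero 2 (C + (piR S)%:M))].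
Proof.
move=> uck ac Ht; split.
- move=> _ [s [y [-> E]]].
  have -> : lin a s y *m tR j R = s *: row_mx (piR R *: a) a - piR R *: lin a s y.
    by rewrite -(lin_tRp j a s y) addrK.
  have sS := Sb_submodule a c k; apply: (submoduleB sS); apply: (submoduleZ _ sS).
    by exists (2 * piR R), a; rewrite lin_self.
  by exists s, y.
- apply/zar_primes => p pp; have [idx pi] := unim_idx pp uck.
  exists (kap c k idx 0) => // S f fi; rewrite ext_setT (Sb_ext f _ uck).
  have [tau tP] := Ht S f; apply: (Sb_free (idx := idx) _ tP).
  by rewrite -map_kap mxE.
move=> S f A C; rewrite (Sb_ext f _ uck) => fA AC.
have [tau tP] := Ht S f.
have ac' : 2 * piR S * f c + dot (map_mx f a) (map_mx f k) = 0.
  by rewrite -map_dot -(map_piR f) -[2](rmorph_nat f) -!rmorphM -rmorphD ac rmorph0.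
apply: (frame_rank_one (a := map_mx f a) (tau := tau) fA AC) => [|_ [s [y [-> E]]]|].
- by exists (2 * piR S), (map_mx f a); rewrite lin_self.
- by rewrite lin_tRp tP // mxE eqxx.
by rewrite lin_self tP // mxE eqxx.
Qed.

Section Defs.
Variable R : calg (OF D).
Local Notation pr := (piR R).
Implicit Types (g h y xi eta : 'rV[R]_n) (lam s r : R).

(** The factors [Jm] turn the functionals into [s * lam + frm y h] and [frm g y - s * lam]; the
    signs in [Fl] are those that make its orthogonal complement equal to [Fn]. *)
Definition Fn g lam h := Sb g lam (h *m (Jm D R)^T).
Definition Fl g lam h := Sb (- h) (- lam) (g *m Jm D R).
Definition Gg g : set 'rV[R]_(n + n) := [set s *: row_mx (pr *: g) g | s in setT].
Definition unimv g := exists xi, dot xi g = 1.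

(** The vector [(pi g, g)] is [lin g (2 pi) g], so the last equation says that [Gg g] lies in [Fn].
    The same equation puts the corresponding vector of [- h] into [Fl]. *)
Definition core g lam h :=
  [/\ unimv g, unim lam h & 2 * pr * lam + frm g h = 0].

(* In coordinates: the map induced by Lambda_(n-l) in pi^-1 Lambda_l sends Fn *)
(* to Fl (dataV), that induced by Lambda_l in Lambda_(n-l) sends Fl to Fn     *)
(* (dataU).                                                                   *)
Definition dataV g lam h := forall s y, s * lam + frm y h = 0 ->
  exists r, - (r *: h) = s *: (g *m DM D R + pr *: (g *m DO D R)) /\
    r * lam = frm g (s *: (g *m DO D R) - pr *: (y *m DO D R) + y *m DM D R).
Definition dataU g lam h := forall r y, frm g y = r * lam ->
  exists s, s *: g = - (r *: (h *m DO D R + pr *: (h *m DM D R))) /\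
    lam * s + frm (- (r *: (h *m DM D R)) + y *m DO D R - pr *: (y *m DM D R)) h = 0.

Lemma mx_dot x y : x *m y^T = (dot x y)%:M.
Proof. exact: mx11_scalar. Qed.
Lemma frm_JT x y : frm (x *m (Jm D R)^T) y = dot x y.
Proof. by rewrite /frm -[x *m _ *m _]mulmxA JT_J mulmx1. Qed.
Lemma frm_J x y : frm x (y *m Jm D R) = dot x y.
Proof. by rewrite /frm trmx_mul mulmxA -(mulmxA x) J_JT mulmx1. Qed.

Lemma unimv_frm g : unimv g -> exists y, frm g y = 1.
Proof. by move=> [xi E]; exists (xi *m Jm D R); rewrite frm_J dotC. Qed.

Lemma FnP g lam h v : Fn g lam h v <->
  exists s y, v = lin g s y /\ s * lam + frm y h = 0.
Proof. by split=> -[s [y [-> E]]]; exists s, y; move: E; rewrite frm_dotl. Qed.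
Lemma FlP g lam h v : Fl g lam h v <->
  exists s y, v = lin (- h) s y /\ frm g y = s * lam.
Proof.
split=> -[s [y [-> E]]]; exists s, y; split=> //.
  by apply/eqP; rewrite -subr_eq0 frm_dotr addrC -mulrN E.
by rewrite mulrN -frm_dotr E addNr.
Qed.

Lemma unim_n lam h : unim lam h -> unim lam (h *m (Jm D R)^T).
Proof.
by move=> [al [et E]]; exists al, (et *m (Jm D R)^T); rewrite -frm_dotl frm_JT.
Qed.
Lemma unim_l g lam : unimv g -> unim (- lam) (g *m Jm D R).
Proof.
move=> /unimv_frm[y E]; exists 0, y; by rewrite mul0r add0r -frm_dotr.
Qed.

Lemma Gg_submodule g : submodule (Gg g).
Proof.
split=> [|b _ _ [s _ <-] [s' _ <-]]; first by exists 0; rewrite ?scale0r.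
by exists (b * s + s'); rewrite // scalerDl scalerA.
Qed.

(** Pairing with the vectors of [Fl] having [s = 0] forces [x + pi y] to be a multiple [c] of [g];
    one vector with [s = 1] then gives the equation [c * lam + frm y h = 0]. *)
Lemma orth_Fl g lam h : core g lam h -> orthogonal (Fl g lam h) = Fn g lam h.
Proof.
move=> [ug _ _]; rewrite eqEsubset; split=> v.
  rewrite -[v]hsubmxK; set x := lsubmx v; set y := rsubmx v => /= H.
  have {}H s y' : frm g y' = s * lam -> frm (x + pr *: y) y' + s * frm y h = 0.
    move=> E; have /H : Fl g lam h (lin (- h) s y') by apply/FlP; exists s, y'.
    rewrite pairR_mul => /(congr1 (fun M : 'M_1 => M 0 0)); rewrite !mxE mulr1n => <-.
    by rewrite !(frmDl, frmDr, frmZl, frmZr, frmNl, frmNr); ring.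
  have [y0 y0P] := unimv_frm ug; pose c := frm (x + pr *: y) y0.
  have zc : x + pr *: y = c *: g.
    apply: (@frm_extl D) => u; rewrite frmZl.
    have := H 0 (u - frm g u *: y0).
    rewrite !(frmDr, frmNr, frmZr) y0P mulr1 subrr !mul0r addr0 => /(_ erefl)/eqP.
    by rewrite subr_eq0 => /eqP ->; rewrite mulrC.
  apply/FnP; exists c, y; split; first by rewrite /lin -zc addrK.
  have := H 1 (lam *: y0); rewrite !frmZr y0P mulr1 !mul1r => /(_ erefl).
  by rewrite -/c mulrC.
move=> /FnP[s [y [-> E]]] /= _ /FlP[s' [y' [-> E']]].
rewrite /lin pairR_mul; apply/eqP; rewrite raddf_eq0 //; last first.
  by move=> u u' /(congr1 (fun M : 'M_1 => M 0 0)); rewrite !mxE !mulr1n.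
apply/eqP; transitivity (s' * (s * lam + frm y h)); last by rewrite E mulr0.
by rewrite !(frmDl, frmDr, frmZl, frmZr, frmNl, frmNr) E'; ring.
Qed.
End Defs.

Section Maps.
Variables (R S : calg (OF D)) (f : ahom R S).
Implicit Types (g h : 'rV[R]_n) (lam : R).

Lemma unimv_map g : unimv g -> unimv (map_mx f g).
Proof. by move=> [xi E]; exists (map_mx f xi); rewrite -map_dot E rmorph1. Qed.
Lemma unim_map lam h : unim lam h -> unim (f lam) (map_mx f h).
Proof.
move=> [al [et E]]; exists (f al), (map_mx f et).
by rewrite -map_dot -rmorphM -rmorphD E rmorph1.
Qed.
Lemma core_map g lam h : core g lam h -> core (map_mx f g) (f lam) (map_mx f h).
Proof.
move=> [ug uh E]; split; [exact: unimv_map|exact: unim_map|].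
by rewrite -map_frm -(map_piR f) -[2](rmorph_nat f) -!rmorphM -rmorphD E rmorph0.
Qed.
Lemma Fn_map g lam h : core g lam h -> ext f (Fn g lam h) = Fn (map_mx f g) (f lam) (map_mx f h).
Proof.
move=> [_ uh _]; rewrite /Fn (Sb_ext _ _ (unim_n uh)).
by rewrite map_mxM -map_trmx map_J.
Qed.
Lemma Fl_map g lam h : core g lam h -> ext f (Fl g lam h) = Fl (map_mx f g) (f lam) (map_mx f h).
Proof.
move=> [ug _ _]; rewrite /Fl (Sb_ext _ _ (unim_l lam ug)).
by rewrite map_mxM map_J map_mxN rmorphN.
Qed.
Lemma span_map N (v : 'rV[R]_N) :
  ext f [set s *: v | s in setT] = [set s *: map_mx f v | s in setT].
Proof.
have sM (A : comNzRingType) (u : 'rV[A]_N) : submodule [set s *: u | s in setT].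
  split=> [|b _ _ [s _ <-] [s' _ <-]]; first by exists 0; rewrite ?scale0r.
  by exists (b * s + s'); rewrite // scalerDl scalerA.
rewrite eqEsubset; split.
  apply: ext_ind => // _ [s _ <-]; exists (f s) => //; by rewrite map_mxZ.
move=> _ [s _ <-]; apply: (submoduleZ _ (submodule_ext f _)).
by apply: ext_in; exists 1; rewrite ?scale1r.
Qed.
Lemma Gg_map g : ext f (Gg g) = Gg (map_mx f g).
Proof. by rewrite /Gg span_map map_row_mx map_mxZ /= map_piR. Qed.
End Maps.

Section Points.
Variable R : calg (OF D).
Local Notation pr := (piR R).
Variables (g : 'rV[R]_n) (lam : R) (h : 'rV[R]_n).
Hypothesis cgh : core g lam h.

Lemma Fn_tau (S : calg (OF D)) g' lam' h' : @core S g' lam' h' ->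
  exists tau : 'cV[S]_(n + n), forall s y, lin g' s y *m tau = s%:M.
Proof.
move=> [[xi xiE] _ _]; exists (col_mx xi^T (piR S *: xi^T)) => s y.
rewrite /lin mul_row_col -scalemxAr scalemxAl -mulmxDl subrK -scalemxAl.
by rewrite mx_dot dotC xiE scale_scalar_mx mulr1.
Qed.

(** The vector [h] may vanish, so [s] is recovered from [s *: h] and from [s * lam = frm g y]
    together, through a relation [al * lam + dot et h = 1]. *)
Lemma Fl_tau (S : calg (OF D)) g' lam' h' : @core S g' lam' h' ->
  exists tau : 'cV[S]_(n + n), forall s y, s * - lam' + dot y (g' *m Jm D S) = 0 ->
    lin (- h') s y *m tau = s%:M.
Proof.
move=> [_ [al [et ahE]] _].
exists (col_mx (- et^T) (- (piR S *: et^T) + al *: (g' *m Jm D S)^T)) => s y.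
rewrite -frm_dotr mulrN addrC => /eqP; rewrite subr_eq0 => /eqP E.
rewrite /lin mul_row_col mulmxDr addrA mulmxN mulmxN -scalemxAr scalemxAl -opprD -mulmxDl subrK.
rewrite scalerN mulNmx opprK -scalemxAl -scalemxAr !mx_dot -frm_dotr E.
rewrite !scale_scalar_mx -raddfD /=; congr _%:M.
by rewrite dotC -[RHS]mulr1 -ahE; ring.
Qed.

Lemma Fn_conds j : let M := Fn g lam h in
  [/\ forall v, M v -> M (v *m tR j R), loc_summand n M setT
    & forall S (f : ahom R S) A (C : 'M[S]_n), is_frame A (ext f M) -> A *m tR j S = C *m A ->
        char_poly C = ('X + (piR S)%:P) ^+ n.-1 * ('X - (piR S)%:P) /\
        (wedge_zero n (C - (piR S)%:M) /\ wedge_zero 2 (C + (piR S)%:M))].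
Proof.
have [ug uh E0] := cgh; apply: Sb_conds; first exact: unim_n.
  by rewrite -frm_dotl.
move=> S f; have [tau tP] := Fn_tau (core_map f cgh); exists tau => s y _; exact: tP.
Qed.

Lemma Fl_conds j : let M := Fl g lam h in
  [/\ forall v, M v -> M (v *m tR j R), loc_summand n M setT
    & forall S (f : ahom R S) A (C : 'M[S]_n), is_frame A (ext f M) -> A *m tR j S = C *m A ->
        char_poly C = ('X + (piR S)%:P) ^+ n.-1 * ('X - (piR S)%:P) /\
        (wedge_zero n (C - (piR S)%:M) /\ wedge_zero 2 (C + (piR S)%:M))].
Proof.
have [ug uh E0] := cgh; apply: Sb_conds; first exact: unim_l.
  by rewrite -frm_dotr frmNr mulrN -opprD E0 oppr0.
move=> S f; have [tau tP] := Fl_tau (core_map f cgh); exists tau => s y.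
by rewrite map_mxM map_J map_mxN rmorphN; apply: tP.
Qed.

Lemma Gg_summand : loc_summand 1 (Gg g) (Fn g lam h).
Proof.
apply: zl_all => S f; rewrite Gg_map (Fn_map f cgh).
have [[xi xiE] uh E0] := core_map f cgh.
move: (map_mx f g) (f lam) (map_mx f h) xiE uh E0 => g' lam' h' xiE uh E0.
have rowG (a : 'M[S]_1) : a *m row_mx (piR S *: g') g' = a 0 0 *: row_mx (piR S *: g') g'.
  by rewrite [a in LHS]mx11_scalar mul_scalar_mx.
have Ginj c : c *: g' = 0 -> c = 0.
  by move=> cg; rewrite -[c]mulr1 -xiE -dotZr cg dot0r.
split.
  exists (row_mx (piR S *: g') g'); split.
    move=> a; rewrite rowG scale_row_mx => /eqP; rewrite row_mx_eq0 => /andP[_ /eqP/Ginj a0].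
    by rewrite [a]mx11_scalar a0 raddf0.
  rewrite eqEsubset; split=> _ [s _ <-]; first by exists s%:M; rewrite // rowG mxE eqxx.
  by exists (s 0 0); rewrite // rowG.
exists [set v | Fn g' lam' h' v /\ dot xi (rsubmx v) = 0]; split.
- have sF := Sb_submodule g' lam' (h' *m (Jm D S)^T).
  split=> [|b u v [Fu u0] [Fv v0]] /=.
    by split; [exact: (submodule0 sF)|rewrite linear0 dot0r].
  split; first exact: (submoduleD sF (submoduleZ b sF Fu) Fv).
  by rewrite linearD linearZ /= dotDr dotZr u0 v0 mulr0 addr0.
- move=> _ [s _ <-] [_]; rewrite scale_row_mx row_mxKr dotZr xiE mulr1 => ->.
  by rewrite !scale0r row_mx0.
rewrite eqEsubset; split=> v.
  move=> Fv; exists (dot xi (rsubmx v) *: row_mx (piR S *: g') g'); first by exists (dot xi (rsubmx v)).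
  exists (v - dot xi (rsubmx v) *: row_mx (piR S *: g') g'); last by rewrite addrC subrK.
  split; last by rewrite linearB linearZ /= row_mxKr dotDr dotNr dotZr xiE mulr1 subrr.
  have sF := Sb_submodule g' lam' (h' *m (Jm D S)^T).
  apply: (submoduleB sF Fv); apply: (submoduleZ _ sF); apply/FnP.
  by exists (2 * piR S), g'; rewrite lin_self.
move=> [_ [s _ <-]] [v' [Fv' _]] <-.
have sF := Sb_submodule g' lam' (h' *m (Jm D S)^T).
apply: (submoduleD sF) => //; apply: (submoduleZ _ sF); apply/FnP.
by exists (2 * piR S), g'; rewrite lin_self.
Qed.

Lemma core_splitting : splitting_cond (Fn g lam h) (Gg g).
Proof.
have [ug uh E0] := cgh; split; last 3 first.
- exact: Gg_summand.
- by move=> _ /FnP[s [y [-> _]]]; rewrite lin_tRp; exists s.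
- move=> _ [s _ <-]; rewrite -scalemxAl tR_mul !scale_row_mx !scalerA.
  by rewrite opp_row_mx add_row_mx -!scalerBl -[RHS]row_mx0; congr row_mx;
    rewrite (_ : _ - _ = 0) ?scale0r //; ring.
move=> _ [s _ <-]; apply: (submoduleZ _ (Sb_submodule _ _ _)).
by apply/FnP; exists (2 * pr), g; rewrite lin_self.
Qed.

Lemma core_wedge : dataV g lam h -> dataU g lam h ->
  naive_cond (Fl g lam h) (Fn g lam h) /\ wedge_cond (Fl g lam h) (Fn g lam h).
Proof.
move=> V U.
have [tn sn cn] := Fn_conds (n - l); have [tl sl cl] := Fl_conds l.
split; last first.
  split=> S f A C fA AC; first by have [_] := cl S f A C fA AC.
  by have [_] := cn S f A C fA AC.
split=> //; last first.
- split=> S f A C fA AC; first by have [] := cl S f A C fA AC.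
  by have [] := cn S f A C fA AC.
- by move=> S f; rewrite (Fl_map f cgh) (Fn_map f cgh) orth_Fl //; apply: core_map.
split=> v.
    move=> /FlP[r [y [-> E]]]; have [s [sg sE]] := U _ _ E.
    apply/FnP; exists s, (- (r *: (h *m DM D R)) + y *m DO D R - pr *: (y *m DM D R)).
    split; last by rewrite mulrC.
    rewrite /lin incl_up_mul sg; congr row_mx.
      rewrite !(mulmxDl, mulNmx, scalerDr, scalerN, opprD, opprK) -!scalemxAl !scalerA expr2.
      by apply/rowP=> i; rewrite !mxE; ring.
    rewrite !(mulmxDl, mulNmx, scalerDr, scalerN, opprD, opprK) -!scalemxAl.
    by apply/rowP=> i; rewrite !mxE; ring.
  move=> /FnP[s [y [-> E]]]; have [r [rh rE]] := V _ _ E.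
  apply/FlP; exists r, (s *: (g *m DO D R) - pr *: (y *m DO D R) + y *m DM D R).
  split; last by rewrite rE.
  rewrite /lin incl_down_mul scalerN rh; congr row_mx.
    rewrite !(mulmxDl, mulNmx, scalerDr, scalerN, opprD, opprK) -!scalemxAl.
    by apply/rowP=> i; rewrite !mxE; ring.
  rewrite !(mulmxDl, mulNmx, scalerDr, scalerN, opprD, opprK) -!scalemxAl.
  by apply/rowP=> i; rewrite !mxE; ring.
Qed.
End Points.
End Data.

(** * Local structure of the splitting model *)

Lemma det_schur (A : comNzRingType) m p (a : 'M[A]_m) (b : 'M[A]_(m, p)) (c : 'M[A]_(p, m)) :
  \det (block_mx a b c 1%:M) = \det (a - b *m c).
Proof.
have -> : block_mx a b c 1%:M = block_mx (a - b *m c) b 0 1%:M *m block_mx 1%:M 0 c 1%:M.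
  by rewrite mulmx_block !mulmx1 !mul1mx !mulmx0 ?mul0mx ?add0r ?addr0 subrK.
by rewrite det_mulmx det_ublock det_lblock !det1 !mulr1.
Qed.

(* kappa consists of the maximal minors of M, and rho of those of N; their    *)
(* product is the projector 1 - N M by a Schur complement, of trace 1.        *)
Lemma cokernel_unimodular (A : comNzRingType) m (M : 'M[A]_(m, 1 + m)) N :
  M *m N = 1%:M -> exists (kappa : 'cV[A]_(1 + m)) (rho : 'rV[A]_(1 + m)),
    [/\ M *m kappa = 0, rho *m kappa = 1%:M & kappa *m rho + N *m M = 1%:M].
Proof.
move=> MN.
pose kappa : 'cV[A]_(1 + m) := \col_r \det (col_mx (delta_mx 0 r : 'rV_(1 + m)) M).
pose rho : 'rV[A]_(1 + m) := \row_i \det (row_mx (delta_mx i 0 : 'cV_(1 + m)) N).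
have kr : kappa *m rho = 1%:M - N *m M.
  apply/matrixP=> r i; rewrite mxE big_ord1 /kappa /rho !(mxE, mxE) -det_mulmx mul_col_row MN det_schur.
  rewrite (_ : _ - _ = delta_mx 0 r *m (1%:M - N *m M) *m delta_mx i 0); last first.
    by rewrite mulmxBr mulmxBl mulmx1 !mulmxA.
  by rewrite -rowE -colE det_mx11 !mxE.
have rk : rho *m kappa = 1%:M.
  rewrite [LHS]mx11_scalar; congr _%:M.
  have -> : (rho *m kappa) 0 0 = \tr (kappa *m rho) by rewrite mxtrace_mulC /mxtrace big_ord1.
  rewrite kr raddfB /= mxtrace1 mxtrace_mulC MN mxtrace1.
  by rewrite natrD addrK.
exists kappa, rho; split=> //; last by rewrite kr subrK.
rewrite -[LHS]mulmx1 -rk mulmxA -(mulmxA M) kr mulmxBr mulmx1 mulmxA MN mul1mx subrr.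
by rewrite mul0mx.
Qed.

Section Local.
Variable D : unitary_datum.
Local Notation n := (ud_n D).
Local Notation l := (ud_l D).

Section Ring.
Variable R : calg (OF D).
Local Notation pr := (piR R).
Implicit Types (M : set 'rV[R]_(n + n)) (g h : 'rV[R]_n).

(** Every functional is a pairing with some vector. Those vanishing on the image [M] of the
    projector [E] vanish on [M']; applied to the columns of [1 - E], this says that [E] fixes
    [M']. *)
Lemma orth_inj M M' (E : 'M[R]_(n + n)) : (forall v, M (v *m E)) ->
  (forall v, M v -> v *m E = v) -> orthogonal M `<=` orthogonal M' -> M' `<=` M.
Proof.
move=> ME MK sub x M'x.
have EE : E *m E = E.
  by apply/row_matrixP=> i; rewrite row_mul; apply: MK; rewrite rowE.
have rep (w : 'rV[R]_(n + n)) : exists v, forall y : 'rV_(n + n), v *m pairR R *m y^T = w *m y^T.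
  exists (row_mx (rsubmx w *m (Jm D R)^T) (- (lsubmx w *m (Jm D R)^T))) => y.
  rewrite -{1}[y]hsubmxK pairR_mul frmNl opprK !frm_JT -{3}[w]hsubmxK -{3}[y]hsubmxK.
  by rewrite tr_row_mx mul_row_col !mx_dot -raddfD addrC.
have wx (w : 'rV[R]_(n + n)) : w *m E^T = 0 -> w *m x^T = 0.
  move=> w0; have [v vP] := rep w; rewrite -vP; apply: (sub v _ x M'x) => m Mm.
  by rewrite vP -(MK m Mm) trmx_mul mulmxA w0 mul0mx.
have : x^T = E^T *m x^T.
  apply/eqP; rewrite -subr_eq0 -{1}[x^T]mul1mx -mulmxBl; apply/eqP/row_matrixP=> i.
  rewrite row_mul wx; first by apply/rowP=> j; rewrite !mxE.
  by rewrite -row_mul mulmxBl mul1mx -trmx_mul EE subrr; apply/rowP=> j; rewrite !mxE.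
by rewrite -trmx_mul => /trmx_inj ->.
Qed.

Lemma Sb_proj a c k (tau : 'cV[R]_(n + n)) : @unim D R c k ->
  (forall s y, s * c + dot y k = 0 -> lin a s y *m tau = s%:M) ->
  exists E : 'M[R]_(n + n), (forall v, Sb a c k (v *m E)) /\
    (forall v, Sb a c k v -> v *m E = v).
Proof.
move=> /unim_row[r rE] Ht; pose Y : 'M[R]_(n + n, 1 + n) := row_mx tau (col_mx 0 1%:M).
exists (Y *m (1%:M - kap c k *m r) *m Em a); split=> v.
  rewrite SbE; exists (v *m (Y *m (1%:M - kap c k *m r))); last by rewrite !mulmxA.
  by rewrite /= -!mulmxA mulmxBl mul1mx -mulmxA rE mulmx1 subrr !mulmx0.
move=> [s [y [-> E]]].
have -> : lin a s y *m (Y *m (1%:M - kap c k *m r) *m Em a) =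
    (lin a s y *m Y) *m (1%:M - kap c k *m r) *m Em a by rewrite !mulmxA.
have -> : lin a s y *m Y = row_mx s%:M y.
  by rewrite /Y mul_mx_row Ht // /lin mul_row_col mulmx0 add0r mulmx1.
by rewrite mulmxBr mulmx1 mulmxA row_kap E raddf0 mul0mx subr0 -lin_Em.
Qed.

Definition spl g lam h := [/\ core g lam h, dataV g lam h & dataU g lam h].

(** A generator of [G] is [(pi g, g)] because [t - pi] kills it, so a frame of [F_(n-l)] is a matrix
    [M] times [Em g]. As [M] has a right inverse, its cokernel functional is unimodular and supplies
    [lam] and [h]. Then [F_l] is recovered from its orthogonal complement, and the two transition
    maps become [dataV] and [dataU]. *)
Lemma split_data Fl0 Fn0 G0 : naive_cond Fl0 Fn0 -> splitting_cond Fn0 G0 ->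
  submodule Fl0 -> submodule Fn0 ->
  free_summand n Fl0 setT -> free_summand n Fn0 setT -> free_summand 1 G0 Fn0 ->
  exists g lam h, [/\ spl g lam h, Fl0 = Fl g lam h, Fn0 = Fn g lam h & G0 = Gg g].
Proof.
move=> [_ _ [iu id] ort _] [GF _ tF tG] sl sn fl fn fG.
have T1 : (setT : set 'rV[R]_(n + n)) = [set a *m 1%:M | a in setT].
  by rewrite eqEsubset; split=> // v _; exists v; rewrite // mulmx1.
have [A [X [[_ FnE] AX]]] := free_rinv fn (mulmx1 _) T1.
have [A' [X' [[_ FlE] AX']]] := free_rinv fl (mulmx1 _) T1.
have [v [Xv [[_ GE] vX]]] := free_rinv fG AX FnE.
have Gv : G0 v by rewrite GE; exists 1%:M; rewrite ?mul1mx.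
pose g := rsubmx v.
have vE : v = row_mx (pr *: g) g.
  have := tG _ Gv; rewrite -{1 2}[v]hsubmxK tR_mul scale_row_mx opp_row_mx add_row_mx.
  move=> /eqP; rewrite row_mx_eq0 => /andP[_].
  by rewrite subr_eq0 => /eqP E; rewrite -{1}[v]hsubmxK E.
have ug : unimv g.
  exists (pr *: usubmx Xv + dsubmx Xv)^T; rewrite dotC /dot trmxK.
  move: vX; rewrite vE -[Xv]vsubmxK mul_row_col col_mxKu col_mxKd -scalemxAl scalemxAr -mulmxDr.
  by move=> ->; rewrite mxE eqxx.
have G0E : G0 = Gg g.
  rewrite GE vE eqEsubset; split=> _ [s _ <-].
    by exists (s 0 0); rewrite // [s in RHS]mx11_scalar mul_scalar_mx.
  by exists s%:M; rewrite // mul_scalar_mx.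
have Frow w : Fn0 w -> exists s y, w = lin g s y.
  move=> /tF; rewrite G0E => -[s _]; rewrite -{1 2}[w]hsubmxK tR_mul !scale_row_mx add_row_mx.
  move=> /eq_row_mx[_ E]; exists s, (rsubmx w).
  by rewrite /lin E addrK hsubmxK.
have rA i : Fn0 (row i A) by rewrite FnE; exists (delta_mx 0 i); rewrite // -rowE.
have {}Frow i : exists m : 'rV[R]_(1 + n), row i A = m *m Em g.
  by have [s [y ->]] := Frow _ (rA i); exists (row_mx s%:M y); rewrite -lin_Em.
have [m mE] := fin_all_exists Frow.
pose M : 'M[R]_(n, 1 + n) := \matrix_i m i.
have AM : A = M *m Em g by apply/row_matrixP=> i; rewrite row_mul rowK mE.
have [ka [rho [Mk rk kr]]] : exists (ka : 'cV[R]_(1 + n)) (rho : 'rV[R]_(1 + n)),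
   [/\ M *m ka = 0, rho *m ka = 1%:M & ka *m rho + (Em g *m X) *m M = 1%:M].
  by apply: cokernel_unimodular; rewrite mulmxA -AM.
pose lam := ka 0 0; pose k : 'rV[R]_n := (dsubmx ka)^T; pose h := k *m Jm D R.
have kE : ka = kap lam k.
  rewrite /kap -[LHS]vsubmxK trmxK; congr col_mx.
  by rewrite [usubmx ka]mx11_scalar mxE; congr (ka _ _)%:M; apply: val_inj.
have hk : h *m (Jm D R)^T = k by rewrite /h -mulmxA J_JT mulmx1.
have Fn0E : Fn0 = Fn g lam h.
  rewrite /Fn hk SbE -kE FnE eqEsubset; split=> [_ [u _ <-]|_ [u /= u0 <-]].
    by exists (u *m M); rewrite /= -?mulmxA ?Mk ?mulmx0 // AM.
  exists (u *m (Em g *m X)) => //; rewrite AM mulmxA; congr (_ *m _).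
  by rewrite -[RHS]mulmx1 -kr mulmxDr [u *m (ka *m _)]mulmxA u0 mul0mx add0r !mulmxA.
have core_gh : core g lam h.
  split=> //.
    exists (lsubmx rho 0 0), (rsubmx rho *m Jm D R).
    have -> : dot (rsubmx rho *m Jm D R) h = dot (rsubmx rho) k.
      by rewrite /h dot_mulmx -mulmxA J_JT mulmx1.
    have : row_mx (lsubmx rho 0 0)%:M (rsubmx rho) *m kap lam k = 1%:M.
      by rewrite -mx11_scalar hsubmxK -kE.
    by rewrite row_kap => /(congr1 (fun M : 'M_1 => M 0 0)); rewrite !mxE !mulr1n.
  have : Fn0 v by apply: GF.
  rewrite Fn0E => /FnP[s [y []]]; rewrite vE /lin => /eq_row_mx[E gy] E0.
  rewrite -gy in E E0; rewrite -[RHS]E0; congr (_ * _ + _).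
  have [xi xiE] := ug.
  have : dot xi ((2 * pr) *: g) = dot xi (s *: g).
    by congr dot; rewrite -[RHS](subrK (pr *: g)) -E -scalerDl; congr (_ *: _); ring.
  by rewrite !dotZr xiE !mulr1.
have orE : orthogonal Fl0 = orthogonal (Fl g lam h).
  rewrite (orth_Fl core_gh) -Fn0E; have := ort R (ahom_id R).
  by rewrite !ext_id.
have Fl0E : Fl0 = Fl g lam h.
  have [tau tP] := Fl_tau core_gh; have [E [EM EK]] := Sb_proj (unim_l lam ug) tP.
  rewrite eqEsubset; split; first by apply: (orth_inj EM EK); rewrite orE.
  apply: (orth_inj (E := X' *m A')); last by rewrite orE.
    by move=> w; rewrite FlE; exists (w *m X'); rewrite // mulmxA.
  by move=> w; rewrite FlE => -[u _ <-]; rewrite mulmxA -(mulmxA u) AX' mulmx1.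
exists g, lam, h; split=> //; split=> //.
  move=> s y E; have /id : Fn0 (lin g s y) by rewrite Fn0E; apply/FnP; exists s, y.
  rewrite Fl0E /lin incl_down_mul => /FlP[r [y' [/eq_row_mx[E1 E2] E3]]].
  exists r; rewrite -E3 -E2 -scalerN; split; last first.
    by congr frm; rewrite mulmxDl mulNmx -!scalemxAl addrC.
  rewrite -[LHS](subrK (pr *: y')) -E1 -E2 !(mulmxDl, mulNmx) -!scalemxAl.
  by apply/rowP=> i; rewrite !mxE; ring.
move=> r y E; have /iu : Fl0 (lin (- h) r y) by rewrite Fl0E; apply/FlP; exists r, y.
rewrite Fn0E /lin incl_up_mul => /FnP[s [y' [/eq_row_mx[E1 E2] E3]]].
exists s; split; last first.
  rewrite -[RHS]E3 mulrC -E2; congr (_ + frm _ _).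
  by rewrite !(mulmxDl, mulNmx, scalerN) -!scalemxAl; apply/rowP=> i; rewrite !mxE; ring.
rewrite -[LHS](subrK (pr *: y')) -E1 -E2 !(mulmxDl, mulNmx, scalerN) -!scalemxAl.
by apply/rowP=> i; rewrite !mxE; ring.
Qed.
End Ring.

Lemma Mspl_local (R : calg (OF D)) (x : Mspl D R) :
  zariski_locally (fun S (f : ahom R S) => exists g lam h,
    [/\ spl g lam h, ext f (sval (sval x).1.1) = Fl g lam h,
        ext f (sval (sval x).1.2) = Fn g lam h & ext f (sval (sval x).2) = Gg g]).
Proof.
have [[nx _] sx] := svalP x; have [_ [sl sn] _ _ _] := nx; have [_ sG _ _] := sx.
apply: zl_mono (zl_and (zl_and sl sn) sG) => S f [[fl fn] fG].
move: fl fn; rewrite !ext_setT => fl fn.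
have [[nf _] sf] := smem_fmap f (svalP x).
by apply: (split_data nf sf) => //; apply: submodule_ext.
Qed.

(** ** The splitting model is a sheaf *)

(** The rows of a frame may become dependent under a general base change; under localization
    clearing denominators keeps them independent. *)
Lemma frame_locf N r (R L : calg (OF D)) (a : R) (i : ahom R L) (A : 'M[R]_(r, N))
    (M : set 'rV[R]_N) : is_locf a i -> is_frame A M -> is_frame (map_mx i A) (ext i M).
Proof.
move=> li [Ainj ME]; split.
  move=> u u0; have [m [u' uE]] := locf_vec u li.
  have : map_mx i (u' *m A) = map_mx i 0 by rewrite map_mxM -uE -scalemxAl u0 scaler0 map_mx0.
  move=> /(locf_vec0 li)[q]; rewrite scaler0 scalemxAl => /Ainj q0.
  have [_ ui _] := li; have uu := invertibleX (q + m) ui; case: uu => b bE.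
  rewrite -[u]scale1r -bE mulrC -scalerA exprD -scalerA uE -rmorphXn -map_mxZ q0.
  by rewrite map_mx0 scaler0.
rewrite ME eqEsubset; split.
  apply: ext_ind => [|_ [u _ <-]]; last by exists (map_mx i u); rewrite // map_mxM.
  split=> [|b _ _ [u _ <-] [u' _ <-]]; first by exists 0; rewrite // mul0mx.
  by exists (b *: u + u'); rewrite // mulmxDl scalemxAl.
move=> _ [u _ <-]; apply: ext_rows => j.
by exists (delta_mx 0 j); rewrite // -rowE.
Qed.

(** The frame is given over an arbitrary [S], so the covering is pulled back to [S] and the
    hypothesis is applied over localizations of [S], where the frame stays a frame. *)
Lemma zl_frame_cond N r (R : calg (OF D)) (T : forall S : calg (OF D), 'M[S]_N)
    (P : forall S : calg (OF D), 'M[S]_r -> Prop) (M : set 'rV[R]_N) :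
  (forall (S S' : calg (OF D)) (f : ahom S S'), map_mx f (T S) = T S') ->
  (forall (S S' : calg (OF D)) (f : ahom S S') C, P S C -> P S' (map_mx f C)) ->
  (forall (S : calg (OF D)) (C : 'M[S]_r), zariski_locally (fun S' (f : ahom S S') => P S' (map_mx f C)) -> P S C) ->
  zariski_locally (fun S (f : ahom R S) => frame_cond T P (ext f M)) -> frame_cond T P M.
Proof.
move=> Tf Pext Ploc zM S g A C fA AC; apply: Ploc; apply/zar_primes => p pp.
have [a pa aP] := (zar_primes _).1 (zl_base g zM) p pp; exists a => //.
have [L [i li]] := locf_exists (not_nilp pp pa).
move=> S' f fa; have [_ ui /(_ S' f fa)[j jE]] := li.
have H := aP L i ui S' j; rewrite -(ext_comp j) in H.
have fAL := frame_locf li fA.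
have e1 : map_mx i A *m T L = map_mx i C *m map_mx i A by rewrite -(Tf _ _ i) -!map_mxM AC.
have PL : P L (map_mx i C).
  by apply: (aP L i ui L (ahom_id L)) e1; rewrite (ext_id (submodule_ext _ _)) ext_comp.
by rewrite -jE (_ : map_mx _ C = map_mx j (map_mx i C)); [apply: Pext|apply/matrixP=> ? ?; rewrite !mxE].
Qed.
End Local.

Section SplSheaf.
Variable D : unitary_datum.
Local Notation n := (ud_n D).
Local Notation l := (ud_l D).

Lemma zl_stable N P (R : calg (OF D)) (T : forall S : calg (OF D), 'M[S]_(N, P))
    (M : set 'rV[R]_N) (M' : set 'rV[R]_P) :
  (forall S S' (f : ahom S S'), map_mx f (T S) = T S') -> submodule M' ->
  zariski_locally (fun S (f : ahom R S) =>
    forall x, ext f M x -> ext f M' (x *m T S)) -> forall x, M x -> M' (x *m T R).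
Proof.
move=> Tf sM zM x Mx; apply: (zl_mem sM); apply: zl_mono zM => S f H.
by rewrite map_mxM Tf; apply: H; apply: ext_in.
Qed.

Lemma zl_summand r N (R : calg (OF D)) (G M : set 'rV[R]_N) :
  zariski_locally (fun S (f : ahom R S) => loc_summand r (ext f G) (ext f M)) ->
  loc_summand r G M.
Proof.
move=> H; apply: zl_trans; apply: zl_mono H => S f; apply: zl_mono => T h.
by rewrite !(ext_comp h f).
Qed.

Lemma zl_orthogonal (R : calg (OF D)) (Fl Fn : set 'rV[R]_(n + n)) : submodule Fn ->
  zariski_locally (fun S (f : ahom R S) => ext f Fn = orthogonal (ext f Fl)) ->
  Fn = orthogonal Fl.
Proof.
move=> sn H; rewrite eqEsubset; split=> v.
  move=> Fv x Fx; apply/zl_eqmx; apply: zl_mono H => S f E.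
  rewrite map_mx0 !map_mxM -map_trmx /pairR mxR_ext.
  have : orthogonal (ext f Fl) (map_mx f v) by rewrite -E; apply: ext_in.
  by apply; apply: ext_in.
move=> ov; apply: (zl_mem sn); apply: zl_mono H => S f ->.
apply: ext_ind => [|x Fx].
  split=> [|a x y /= x0 y0]; first by rewrite /= trmx0 mulmx0.
  by rewrite linearD linearZ /= mulmxDr -scalemxAr x0 y0 scaler0 addr0.
rewrite /= /pairR -(mxR_ext f) -/(pairR R) map_trmx -!map_mxM.
by have := ov x Fx => ->; rewrite map_mx0.
Qed.

Lemma map_tR j (S S' : calg (OF D)) (f : ahom S S') : map_mx f (tR j S) = tR j S'.
Proof. exact: mxR_ext. Qed.

Lemma wedge_zero_map r m (A B : comNzRingType) (f : {rmorphism A -> B}) (C : 'M[A]_m) :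
  wedge_zero r C -> wedge_zero r (map_mx f C).
Proof.
move=> H i j; have := H i j => /(congr1 f); rewrite -det_map_mx rmorph0 => <-.
by congr (\det _); apply/matrixP=> a b; rewrite !mxE.
Qed.

Lemma zl_wedge_zero r m (R : calg (OF D)) (C : 'M[R]_m) :
  zariski_locally (fun S (f : ahom R S) => wedge_zero r (map_mx f C)) -> wedge_zero r C.
Proof.
move=> H i j; apply: zl_eq0; apply: zl_mono H => S f /(_ i j) <-.
by rewrite -det_map_mx; congr (\det _); apply/matrixP=> a b; rewrite !mxE.
Qed.

Lemma Mspl_sub_local : local_sub (Mspl_sub D).
Proof.
move=> R x H.
have sl : submodule (sval x.1.1) := svalP _.
have sn : submodule (sval x.1.2) := svalP _.
have sG : submodule (sval x.2) := svalP _.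
have HA (S : calg (OF D)) (f : ahom R S) : Mspl_sub D S (fmap f x) ->
   [/\ naive_cond (ext f (sval x.1.1)) (ext f (sval x.1.2)),
      wedge_cond (ext f (sval x.1.1)) (ext f (sval x.1.2)) &
      splitting_cond (ext f (sval x.1.2)) (ext f (sval x.2))] by case=> -[].
have {H} H := zl_mono HA H.
have fr (P : forall S : calg (OF D), 'M[S]_n -> Prop) j (M : set 'rV[R]_(n + n)) :
    (forall (S S' : calg (OF D)) (f : ahom S S') C, P S C -> P S' (map_mx f C)) ->
    (forall (S : calg (OF D)) (C : 'M[S]_n),
      zariski_locally (fun S' (f : ahom S S') => P S' (map_mx f C)) -> P S C) ->
    zariski_locally (fun S (f : ahom R S) => frame_cond (tR j) P (ext f M)) ->
    frame_cond (tR j) P M.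
  by apply: zl_frame_cond => S S' f; apply: map_tR.
have cE (S S' : calg (OF D)) (f : ahom S S') : map_poly f (('X + (piR S)%:P) ^+ n.-1 *
    ('X - (piR S)%:P)) = ('X + (piR S')%:P) ^+ n.-1 * ('X - (piR S')%:P).
  by rewrite rmorphM rmorphXn rmorphB rmorphD /= map_polyX map_polyC /= map_piR.
have c1 (S S' : calg (OF D)) (f : ahom S S') (C : 'M[S]_n) :
    char_poly C = ('X + (piR S)%:P) ^+ n.-1 * ('X - (piR S)%:P) ->
    char_poly (map_mx f C) = ('X + (piR S')%:P) ^+ n.-1 * ('X - (piR S')%:P).
  by move=> E; rewrite -(cE _ _ f) -E map_char_poly.
have c2 (S : calg (OF D)) (C : 'M[S]_n) : zariski_locally (fun S' (f : ahom S S') =>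
      char_poly (map_mx f C) = ('X + (piR S')%:P) ^+ n.-1 * ('X - (piR S')%:P)) ->
    char_poly C = ('X + (piR S)%:P) ^+ n.-1 * ('X - (piR S)%:P).
  move=> zC; apply/polyP=> i; apply: zl_eq; apply: zl_mono zC => S' f.
  by rewrite -map_char_poly -(cE _ _ f) => /(congr1 (fun q : {poly S'} => q`_i)); rewrite !coef_map.
pose W (S : calg (OF D)) (C : 'M[S]_n) :=
  wedge_zero n (C - (piR S)%:M) /\ wedge_zero 2%N (C + (piR S)%:M).
have mB (S S' : calg (OF D)) (f : ahom S S') (C : 'M[S]_n) :
    map_mx f (C - (piR S)%:M) = map_mx f C - (piR S')%:M.
  by rewrite map_mxB map_scalar_mx /= map_piR.
have mD (S S' : calg (OF D)) (f : ahom S S') (C : 'M[S]_n) :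
    map_mx f (C + (piR S)%:M) = map_mx f C + (piR S')%:M.
  by rewrite map_mxD map_scalar_mx /= map_piR.
have w1 (S S' : calg (OF D)) (f : ahom S S') C : W S C -> W S' (map_mx f C).
  by case=> a b; split; rewrite -?mB -?mD; apply: wedge_zero_map.
have w2 (S : calg (OF D)) (C : 'M[S]_n) :
    zariski_locally (fun S' (f : ahom S S') => W S' (map_mx f C)) -> W S C.
  move=> zC; split; apply: zl_wedge_zero; apply: zl_mono zC => S' f [].
    by rewrite -mB.
  by rewrite -mD.
split; last split.
- split; first split.
  + by split; apply: (zl_stable (map_tR _)) => //; apply: zl_mono H => S f [[[]]].
  + by split; apply: zl_summand; apply: zl_mono H => S f [[_ []]]; rewrite ext_setT.
  + split; [apply: (@zl_stable _ _ _ (fun S => incl_up S)) => //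
           |apply: (@zl_stable _ _ _ (fun S => incl_down S)) => //];
      try (by move=> S S' f; apply: mxR_ext); by apply: zl_mono H => S f [[_ _ []]].
  + move=> S g; apply: zl_orthogonal; first exact: submodule_ext.
    apply: zl_mono (zl_base g H) => S' f [[_ _ _ /(_ S' (ahom_id S'))]].
    by rewrite !(ext_id (submodule_ext _ _)) !ext_comp.
  + by split; apply: (fr _ _ _ c1 c2); apply: zl_mono H => S f [[_ _ _ _ []]].
  + by split; apply: (fr _ _ _ w1 w2); apply: zl_mono H => S f [_ []].
- by apply: (zl_sub sn); apply: zl_mono H => S f [_ _ []].
- by apply: zl_summand; apply: zl_mono H => S f [_ _ []].
- move=> y; rewrite -mul_mx_scalar -mulmxDr; move: y.
  apply: (@zl_stable _ _ _ (fun S => tR (n - l) S + (piR S)%:M)) => //.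
    by move=> S S' f; rewrite map_mxD map_scalar_mx map_tR /= map_piR.
  apply: zl_mono H => S f [_ _ [_ _ H _]] y Fy.
  by rewrite mulmxDr mul_mx_scalar; apply: H.
move=> y Gy; apply: zl_eqmx; apply: zl_mono H => S f [_ _ [_ _ _ H]].
rewrite map_mx0 map_mxB map_mxZ map_mxM map_tR /= map_piR.
by apply: H; apply: ext_in.
Qed.

Lemma Mspl_sheaf : is_sheaf (Mspl D).
Proof.
apply: sub_sheaf Mspl_sub_local.
by do !apply: prod_sheaf; apply: submods_sheaf.
Qed.
End SplSheaf.

(** * The blow-up of the splitting model *)

Section Blowup.
Variable D : unitary_datum.
Local Notation n := (ud_n D).
Local Notation l := (ud_l D).

Definition Bamb := prod_functor
  (prod_functor (pairs D) (submods (OF D) (n + n))) (submods (OF D) n).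

(* The vector q packs the middle coordinates of w and the outer coordinates   *)
(* of g; the others are multiples of these.                                   *)
Record tup (R : Type) := Tup { tq : 'rV[R]_n; tnu : R; tgam : R; tlam : R; tmu : R }.

Definition tmap (R S : Type) (f : R -> S) (t : tup R) :=
  Tup (map_mx f (tq t)) (f (tnu t)) (f (tgam t)) (f (tlam t)) (f (tmu t)).

Section Ring.
Variable R : calg (OF D).
Local Notation pr := (piR R).
Implicit Type t : tup R.

Definition qf (v : 'rV[R]_n) : R := frm (v *m DM D R) v.
Definition tg t := tnu t *: (tq t *m DM D R) + tq t *m DO D R.
Definition tw t := tq t *m DM D R + tgam t *: (tq t *m DO D R).
Definition th t := tmu t *: tw t.

Definition Bd t := [/\ tnu t * tgam t = pr, 2 * tgam t * tlam t + tmu t * qf (tq t) = 0,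
  unimv (tg t), unimv (tw t) & exists a b, a * tlam t + b * tmu t = 1].

Definition line N (v : 'rV[R]_N) : set 'rV[R]_N := [set s *: v | s in setT].
Lemma line_submodule N (v : 'rV[R]_N) : submodule (line v).
Proof.
split=> [|b _ _ [s _ <-] [s' _ <-]]; first by exists 0; rewrite ?scale0r.
by exists (b * s + s'); rewrite // scalerDl scalerA.
Qed.

Definition raw3 (g : 'rV[R]_n) lam h : prod_functor (pairs D) (submods (OF D) (n + n)) R :=
  ((exist _ (Fl g lam h) (Sb_submodule _ _ _), exist _ (Fn g lam h) (Sb_submodule _ _ _)),
   exist _ (Gg g) (Gg_submodule g)).
Definition raw t : Bamb R :=
  (raw3 (tg t) (tlam t) (th t), exist _ (line (tw t)) (line_submodule _)).

Lemma DM2 (v : 'rV[R]_n) : v *m DM D R *m DM D R = v *m DM D R.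
Proof. by rewrite -mulmxA DM_DM. Qed.
Lemma DO2 (v : 'rV[R]_n) : v *m DO D R *m DO D R = v *m DO D R.
Proof. by rewrite -mulmxA DO_DO. Qed.
Lemma DMO0 (v : 'rV[R]_n) : v *m DM D R *m DO D R = 0.
Proof. by rewrite -mulmxA DM_DO mulmx0. Qed.
Lemma DOM0 (v : 'rV[R]_n) : v *m DO D R *m DM D R = 0.
Proof. by rewrite -mulmxA DO_DM mulmx0. Qed.
Definition DE := (DM2, DO2, DMO0, DOM0).

Lemma tgM t : tg t *m DM D R = tnu t *: (tq t *m DM D R).
Proof. by rewrite mulmxDl -scalemxAl !DE addr0. Qed.
Lemma tgO t : tg t *m DO D R = tq t *m DO D R.
Proof. by rewrite mulmxDl -scalemxAl !DE scaler0 add0r. Qed.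
Lemma twM t : tw t *m DM D R = tq t *m DM D R.
Proof. by rewrite mulmxDl -scalemxAl !DE scaler0 addr0. Qed.
Lemma twO t : tw t *m DO D R = tgam t *: (tq t *m DO D R).
Proof. by rewrite mulmxDl -scalemxAl !DE add0r. Qed.

Lemma inv2 : invertible (2 : R).
Proof.
have [b bE] := OF_two D; exists (calg_str R b).
by rewrite -(rmorph_nat (calg_str R)) -rmorphM bE rmorph1.
Qed.

Lemma frm_OO x : frm (x *m DO D R) x = 0.
Proof.
apply: (inv_cancel inv2); rewrite mulr0 mulr2n mulrDl mul1r {1}frm_altO addNr.
by [].
Qed.

Lemma frmMO x y : frm (x *m DM D R) (y *m DO D R) = 0.
Proof. by rewrite frm_Ml !DE frm0r. Qed.
Lemma frmOM x y : frm (x *m DO D R) (y *m DM D R) = 0.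
Proof. by rewrite frm_Ol !DE frm0r. Qed.
Lemma qf_w t : qf (tw t) = qf (tq t).
Proof. by rewrite /qf twM /tw frmDr frmZr frmMO mulr0 addr0 -frm_Ml DM2. Qed.

(** A solution of [s * lam + mu * frm y w = 0] is proportional to [(- mu, lam)] since [(lam, mu)] is
    unimodular; the relations between [g] and [h] then reduce to [nu gam = pi] and the quadratic
    equation. *)
Lemma Bd_spl t : Bd t -> spl (tg t) (tlam t) (th t).
Proof.
case: t => q nu gam lam mu; set t := Tup _ _ _ _ _ => -[/= E1 E2 ug uw [a [b ab]]].
have [xi xiE] := uw.
set qM := q *m DM D R; set qO := q *m DO D R.
have frg y : frm (tg t) y = nu * frm qM y + frm qO y.
  by rewrite /tg /= frmDl frmZl.
have frw y : frm y (tw t) = frm y qM + gam * frm y qO.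
  by rewrite /tw /= frmDr frmZr.
have MM y : frm (y *m DM D R) qM = frm qM y.
  by rewrite /qM frm_Ml DM2 -frm_Ml frm_symM.
have OO y : frm (y *m DO D R) qO = - frm qO y.
  by rewrite /qO frm_Ol DO2 -frm_Ol frm_altO.
have MO y : frm (y *m DM D R) qO = 0 by apply: frmMO.
have OM y : frm (y *m DO D R) qM = 0 by apply: frmOM.
have yE (y : 'rV[R]_n) : y = y *m DM D R + y *m DO D R := rowMO y.
split; first split=> //.
- exists a, (b *: xi); rewrite /th /= dotZl dotZr xiE mulr1; exact: ab.
- rewrite /th frmZr frg /= !frw.
  have -> : frm qM qM = qf q by rewrite /qf /qM frm_Ml DM2 -frm_Ml.
  have -> : frm qM qO = 0 by apply: frmMO.
  have -> : frm qO qM = 0 by apply: frmOM.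
  have -> : frm qO qO = 0 by rewrite /qO frm_Ol DO2 -frm_Ol frm_OO.
  transitivity (nu * (2 * gam * lam + mu * qf q)); last by rewrite E2 mulr0.
  by rewrite -E1; ring.
- move=> s y; rewrite /th /= frmZr => E.
  (* [c] is the factor with [s = - (c * mu)] and [frm y w = c * lam], computed from
     [a * lam + b * mu = 1]. *)
  pose c := a * frm y (tw t) - b * s.
  have sE : s = - (c * mu).
    transitivity (a * (s * lam + mu * frm y (tw t)) - c * mu); last by rewrite E mulr0 sub0r.
    rewrite -[LHS]mulr1 -ab /c; ring.
  have fE : frm y (tw t) = c * lam.
    transitivity (c * lam + b * (s * lam + mu * frm y (tw t))); last by rewrite E mulr0 addr0.
    rewrite -[LHS]mulr1 -ab /c; ring.
  exists (c * nu); rewrite tgM tgO -/qM -/qO; split.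
    rewrite sE /tw /= -/qM -/qO -E1; apply/rowP=> i; rewrite !mxE; ring.
  rewrite -mulrA [nu * lam]mulrC mulrA -fE frw !(frmDr, frmNr, frmZr) !frg.
  have q0 : frm qO qO = 0 by rewrite /qO frm_Ol DO2 -frm_Ol frm_OO.
  have q1 : frm qM qO = 0 by apply: frmMO.
  have q2 : frm qM (y *m DO D R) = 0 by apply: frmMO.
  have q3 : frm qO (y *m DM D R) = 0 by apply: frmOM.
  have q4 : frm qM (y *m DM D R) = frm qM y by rewrite -frm_Ml /qM DM2.
  have q5 : frm qO (y *m DO D R) = frm qO y by rewrite -frm_Ol /qO DO2.
  rewrite q0 q1 q2 q3 q4 q5 {1 2}(yE y) !frmDl MM OO MO OM -E1; ring.
(* The witness comes from [w_O + pi w_M = gam g], multiplied by [- r mu]. *)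
move=> r y E; exists (- (r * mu * gam)).
rewrite /th -!scalemxAl twM twO /= -/qM -/qO; split.
  by rewrite /tg /= -/qM -/qO -E1; apply/rowP=> i; rewrite !mxE; ring.
rewrite !(frmDl, frmNl, frmZl, frmZr) !frw MM MO OO OM.
have -> : frm qM qM = qf q by rewrite /qf /qM frm_Ml DM2 -frm_Ml.
have -> : frm qM qO = 0 by apply: frmMO.
transitivity (- (r * mu * (2 * gam * lam + mu * qf q)) + mu * gam * (r * lam - frm (tg t) y)).
  by rewrite frg -E1; ring.
by rewrite E2 E subrr !mulr0 addr0 oppr0.
Qed.
End Ring.

Section Map.
Variables (R S : calg (OF D)) (f : ahom R S).
Lemma tg_map t : map_mx f (tg t) = tg (tmap f t).
Proof. by rewrite /tg map_mxD map_mxZ !map_mxM map_DM map_DO. Qed.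
Lemma tw_map t : map_mx f (tw t) = tw (tmap f t).
Proof. by rewrite /tw map_mxD map_mxZ !map_mxM map_DM map_DO. Qed.
Lemma th_map t : map_mx f (th t) = th (tmap f t).
Proof. by rewrite /th map_mxZ tw_map. Qed.
Lemma qf_map v : f (qf v) = qf (map_mx f v).
Proof. by rewrite /qf map_frm map_mxM map_DM. Qed.

Lemma Bd_map t : Bd t -> Bd (tmap f t).
Proof.
move=> [E1 E2 ug uw [a [b ab]]]; split.
- by rewrite -rmorphM /= E1 map_piR.
- by rewrite /= -qf_map -[2](rmorph_nat f) -!rmorphM -rmorphD E2 rmorph0.
- by rewrite -tg_map; apply: unimv_map.
- by rewrite -tw_map; apply: unimv_map.
by exists (f a), (f b); rewrite -!rmorphM -rmorphD ab rmorph1.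
Qed.

Lemma raw3_map g lam h : core g lam h ->
  fmap f (raw3 g lam h) = raw3 (map_mx f g) (f lam) (map_mx f h).
Proof.
move=> c; congr ((_, _), _); apply: submods_eq; rewrite /=.
- exact: Fl_map.
- exact: Fn_map.
- exact: Gg_map.
Qed.

Lemma raw_map t : Bd t -> fmap f (raw t) = raw (tmap f t).
Proof.
move=> /Bd_spl[c _ _]; rewrite /raw -tg_map -th_map -tw_map; congr (_, _).
  exact: raw3_map.
by apply: submods_eq; apply: span_map.
Qed.
End Map.

Lemma raw3_Mspl (R : calg (OF D)) (g : 'rV[R]_n) lam h :
  spl g lam h -> Mspl_sub D R (raw3 g lam h).
Proof.
move=> [c V U]; have [nc wc] := core_wedge c V U.
by split; [split|apply: core_splitting].
Qed.

Definition Bsub : subfunctor Bamb.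
Proof.
exists (fun R x => zariski_locally (fun S (f : ahom R S) =>
  exists2 t : tup S, Bd t & fmap f x = raw t)) => R S g x H.
apply: zl_mono (zl_base g H) => T f [t tB E]; exists t => //.
by rewrite -fmap_comp.
Defined.

Definition Bf := sub_functor Bsub.

Lemma Bsub_local : local_sub Bsub.
Proof.
move=> R x H; apply: zl_trans; apply: zl_mono H => S f; apply: zl_mono => T h.
by case=> t tB E; exists t; rewrite // fmap_comp.
Qed.

Lemma Bf_sheaf : is_sheaf Bf.
Proof.
apply: sub_sheaf Bsub_local.
by do !apply: prod_sheaf; apply: submods_sheaf.
Qed.

Lemma Bsub_Mspl R (x : Bamb R) : Bsub R x -> Mspl_sub D R x.1.
Proof.
move=> H; apply: Mspl_sub_local; apply: zl_mono H => S f [t tB E].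
have -> : fmap f x.1 = raw3 (tg t) (tlam t) (th t) by have := congr1 fst E.
exact/raw3_Mspl/Bd_spl.
Qed.

Definition bmor : morphism Bf (Mspl D).
Proof.
exists (fun R x => exist _ (sval x).1 (Bsub_Mspl (svalP x))) => R S g x.
exact: eq_exist.
Defined.

Lemma raw_Bsub (R : calg (OF D)) (t : tup R) : Bd t -> Bsub R (raw t).
Proof.
move=> tB; apply: zl_all => S f; exists (tmap f t); first exact: Bd_map.
exact: raw_map.
Qed.
End Blowup.

(** * The center and liftings to the blow-up *)

Section Center.
Variable D : unitary_datum.
Local Notation n := (ud_n D).
Local Notation l := (ud_l D).

Lemma unim_inj (R : calg (OF D)) lam (h : 'rV[R]_n) a b : unim lam h ->
  a * lam = b * lam -> a *: h = b *: h -> a = b.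
Proof.
move=> [al [et E]] e1 e2; rewrite -[a]mulr1 -[b]mulr1 -E !mulrDr !(mulrCA _ al) e1.
by rewrite -!dotZr e2.
Qed.
Lemma unimv_inj (R : calg (OF D)) (g : 'rV[R]_n) a b : unimv g -> a *: g = b *: g -> a = b.
Proof. by move=> [xi E] e; rewrite -[a]mulr1 -[b]mulr1 -E -!dotZr e. Qed.
Lemma unimv_frmr (R : calg (OF D)) (g : 'rV[R]_n) : unimv g -> exists y, frm y g = 1.
Proof. by move=> [xi E]; exists (xi *m (Jm D R)^T); rewrite frm_JT. Qed.

(** [(t + pi) v] is the vector [(pi z, z)] with [z = zc v]. On [F_l] the values of [zc] form the
    line of [h], so [h = 0] becomes a condition free of choices. *)
Definition zc (R : calg (OF D)) (v : 'rV[R]_(n + n)) := lsubmx v + piR R *: rsubmx v.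

Lemma zcD (R : calg (OF D)) a (v w : 'rV[R]_(n + n)) : zc (a *: v + w) = a *: zc v + zc w.
Proof. by rewrite /zc !linearP /=; apply/rowP=> i; rewrite !mxE; ring. Qed.

Lemma zc_submodule (R : calg (OF D)) : submodule [set v : 'rV[R]_(n + n) | zc v = 0].
Proof.
split=> [|a v w /= v0 w0]; first by rewrite /= /zc !linear0 addr0.
by rewrite zcD v0 w0 scaler0 addr0.
Qed.

Lemma zcP (R : calg (OF D)) (g : 'rV[R]_n) lam h z : unimv g ->
  (exists2 v, Fl g lam h v & z = zc v) <-> exists s, z = s *: h.
Proof.
move=> ug; split=> [[_ /FlP[s [y [-> _]]] ->]|[s ->]].
  by exists (- s); rewrite /zc lin_z scalerN scaleNr.
have [y yE] := unimv_frm ug; exists (lin (- h) (- s) ((- s * lam) *: y)).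
  by apply/FlP; exists (- s), ((- s * lam) *: y); rewrite frmZr yE mulr1.
by rewrite /zc lin_z scalerN scaleNr opprK.
Qed.

Section Ring.
Variable R : calg (OF D).
Implicit Types (g h : 'rV[R]_n) (lam : R).

Definition Wst : set 'rV[R]_(n + n) := [set v | lsubmx v = 0].

Lemma F_h0 g lam : piR R = 0 -> core g lam 0 -> Fl g lam 0 = Wst /\ Fn g lam 0 = Wst.
Proof.
move=> p0 [_ [al [et al1]] _]; rewrite dot0r addr0 in al1.
split; rewrite eqEsubset; split=> v.
- by move=> /FlP[s [y [-> _]]]; rewrite /Wst /= row_mxKl p0 scale0r oppr0 scaler0 addr0.
- rewrite /Wst /= => v0; apply/FlP; exists (al * frm g (rsubmx v)), (rsubmx v).
  by rewrite /lin p0 scale0r oppr0 scaler0 addr0 -{1}[v]hsubmxK v0 mulrAC al1 mul1r.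
- move=> /FnP[s [y [-> E]]]; rewrite /Wst /= row_mxKl p0 scale0r subr0.
  by rewrite -[s]mulr1 -al1 mulrCA; move: E; rewrite frm0r addr0 => ->; rewrite mulr0 scale0r.
rewrite /Wst /= => v0; apply/FnP; exists 0, (rsubmx v).
by rewrite /lin p0 !scale0r subr0 frm0r mul0r addr0 -{1}[v]hsubmxK v0.
Qed.

Lemma tR_img j : piR R = 0 -> [set y *m tR j R | y in setT] = Wst.
Proof.
move=> p0; rewrite eqEsubset; split=> [_ [y _ <-]|v v0].
  by rewrite -[y]hsubmxK tR_mul /Wst /= row_mxKl p0 expr0n scale0r.
exists (row_mx (rsubmx v) 0) => //; rewrite tR_mul scaler0.
by rewrite -[RHS]hsubmxK v0.
Qed.

End Ring.

Lemma i0_lt : (0 < n)%N. Proof. by have := n_gt3 D; lia. Qed.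
Let i0 : 'I_n := Ordinal i0_lt.

Lemma pi_k0 : piR (residue_alg D) = 0.
Proof. by apply/OF_res_ker; exists 1; rewrite mul1r. Qed.

Lemma spl_h0 (R : calg (OF D)) (g : 'rV[R]_n) : piR R = 0 -> unimv g -> spl g 1 0.
Proof.
move=> p0 ug; split.
- split=> //; last by rewrite p0 mulr0 mul0r frm0r addr0.
  by exists 1, 0; rewrite dot0r addr0 mulr1.
- move=> s y; rewrite frm0r addr0 mulr1 => ->.
  exists (frm g (y *m DM D R)).
  by rewrite p0 !scale0r scaler0 !(oppr0, addr0, add0r) mulr1.
move=> r y E; exists 0.
by rewrite !mul0mx p0 !(scale0r, scaler0, frm0r, mulr0, addr0, oppr0).
Qed.

Lemma unimv_delta (R : calg (OF D)) i : unimv (delta_mx 0 i : 'rV[R]_n).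
Proof. by exists (delta_mx 0 i); rewrite dot_delta mxE !eqxx. Qed.

(** Any unimodular [g] would do: for [h = 0] and [pi = 0] both modules are the image of [t],
    whatever [g] is. *)
Definition star : Mwedge D (residue_alg D) :=
  exist _ (raw3 (delta_mx 0 i0) 1 0).1
    (raw3_Mspl (spl_h0 pi_k0 (unimv_delta (residue_alg D) i0))).1.

Lemma core_star : core (delta_mx 0 i0 : 'rV[residue_alg D]_n) 1 0.
Proof. by case: (spl_h0 pi_k0 (unimv_delta (residue_alg D) i0)). Qed.

Lemma star_worst : is_worst star.
Proof. by have [e1 e2] := F_h0 pi_k0 core_star; rewrite /is_worst !tR_img /=; [|exact: pi_k0..]. Qed.

Lemma star_ext (R : calg (OF D)) (f : ahom (residue_alg D) R) :
  ext f (sval (sval star).1) = @Wst R /\ ext f (sval (sval star).2) = @Wst R.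
Proof.
have p0 : piR R = 0 by rewrite -(map_piR f) pi_k0 rmorph0.
rewrite /= (Fl_map f core_star) (Fn_map f core_star) map_mx0.
by apply: F_h0 => //; have := core_map f core_star; rewrite map_mx0.
Qed.

Local Notation Z := (fiber (tau D) star).

Lemma residue_hom (R : calg (OF D)) : piR R = 0 -> exists f : ahom (residue_alg D) R, True.
Proof.
move=> p0; have [|g gP] := @quotient_lift _ _ _ (ud_res D) (calg_str R) (@OF_res_surj D).
  by move=> a /OF_res_ker[b ->]; rewrite rmorphM /= -/(piR R) p0 mulr0.
by exists (@ahom_of _ (residue_alg D) R g gP).
Qed.

(** With [h = 0] unimodularity makes [lam] a unit, and the equation of [core] becomes [pi = 0]: the
    center lies in the special fiber. *)
Lemma unim_h0 (R : calg (OF D)) (g : 'rV[R]_n) lam : core g lam 0 -> piR R = 0.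
Proof.
move=> [_ [al [et al1]] E]; rewrite dot0r addr0 in al1; rewrite frm0r addr0 in E.
apply: (inv_cancel (inv2 R)); rewrite mulr0.
transitivity (al * (2 * piR R * lam)); last by rewrite E mulr0.
by rewrite mulrCA al1 mulr1.
Qed.

(** Locally [h] is itself a value of [zc] on [F_l], so the condition says [h = 0]. This forces
    [pi = 0] and both modules to be [Wst]; the map from the residue field exists because [pi]
    vanishes. *)
Lemma Z_iff (R : calg (OF D)) (x : Mspl D R) :
  Z R x <-> forall v, sval (sval x).1.1 v -> zc v = 0.
Proof.
split=> [[f fE] v|H].
  have p0 : piR R = 0 by rewrite -(map_piR f) pi_k0 rmorph0.
  have -> : sval (sval x).1.1 = @Wst R.
    by rewrite -(star_ext f).1 -[RHS]/(sval (sval (fmap f star)).1) -fE.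
  by rewrite /Wst /zc /= => ->; rewrite p0 scale0r addr0.
have {}H : zariski_locally (fun S (f : ahom R S) => piR S = 0 /\
    (ext f (sval (sval x).1.1) = @Wst S /\ ext f (sval (sval x).1.2) = @Wst S)).
  apply: zl_mono (Mspl_local x) => S f [g [lam [h [[c _ _] e1 e2 _]]]].
  have h0 : h = 0.
    have [ug _ _] := c.
    have [v Fv ->] : exists2 v, Fl g lam h v & h = zc v.
      by apply/(zcP lam h _ ug); exists 1; rewrite scale1r.
    move: Fv; rewrite -e1; move: v; apply: ext_ind; first exact: zc_submodule.
    move=> v /H; rewrite /zc /= => /(congr1 (map_mx f)).
    by rewrite map_mxD map_mxZ map_mx0 /= map_piR map_lsubmx map_rsubmx.
  rewrite h0 in c e1 e2; have p0 := unim_h0 c.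
  by split=> //; rewrite e1 e2; apply: F_h0.
have p0 : piR R = 0.
  by apply: zl_eq0; apply: zl_mono H => S f [p0 _]; rewrite /= map_piR.
have [f _] := residue_hom p0; exists f; apply: eq_exist.
rewrite [(sval x).1]surjective_pairing; congr (_, _); apply: submods_eq.
  apply: zl_eqmod; [exact: svalP|exact: svalP|].
  apply: zl_mono H => S h [_ [-> _]].
  by rewrite -[sval _]/(ext f (sval (sval star).1)) -ext_comp (star_ext _).1.
apply: zl_eqmod; [exact: svalP|exact: svalP|].
apply: zl_mono H => S h [_ [_ ->]].
by rewrite -[sval _]/(ext f (sval (sval star).2)) -ext_comp (star_ext _).2.
Qed.

Lemma Z_cuts (R : calg (OF D)) (x : Mspl D R) : cuts_out Z x
  (ideal_span [set c | exists v i, sval (sval x).1.1 v /\ c = zc v 0 i]).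
Proof.
split; first exact: span_ideal.
move=> S f; rewrite Z_iff; split=> H.
  move=> a; apply: (@span_min _ _ [set a | f a = 0]).
    exact: (preim_ideal f (ideal_zero S)).
  move=> _ /= [v [i [Fv ->]]].
  have := H (map_mx f v) (ext_in (g := f) Fv) => /(congr1 (fun z : 'rV_n => z 0 i)).
  by rewrite /zc !mxE => <-; rewrite rmorphD rmorphM /= map_piR.
apply: ext_ind; first exact: zc_submodule.
move=> v Fv; apply/rowP=> i /=.
have : f (zc v 0 i) = 0 by apply: H; apply: span_sub; exists v, i.
by rewrite /zc !mxE rmorphD rmorphM /= map_piR.
Qed.

(** The point obtained over the quotient by [J] lies on [Y], hence kills [I]. *)
Lemma cuts_unique (X : functor (OF D)) (Y : subfunctor X) R (x : X R) I J :
  cuts_out Y x I -> cuts_out Y x J -> I `<=` J.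
Proof.
move=> [iI IP] [iJ JP] a Ia; apply: contrapT => nJ.
have [B [f [fs fk]]] : exists (B : comNzRingType) (f : {rmorphism R -> B}),
    (forall b, exists a, f a = b) /\ (forall a, f a = 0 <-> J a).
  by apply: quotient_exists => // J1; apply: nJ; rewrite -[a]mulr1; apply: (idealM_l _ iJ).
pose BA := @Calg (OF D) B (f \o calg_str R); pose fh := @ahom_of _ R BA f (fun=> erefl).
have /IP : Y BA (fmap fh x) by apply/JP => b /fk.
by move=> /(_ a Ia)/fk.
Qed.

Lemma cuts_h (R : calg (OF D)) (x : Mspl D R) g lam h d : unimv g ->
  sval (sval x).1.1 = Fl g lam h -> cuts_out Z x (ideal_span [set d]) ->
  (forall i, exists c, h 0 i = c * d) /\ exists et, d = dot et h.
Proof.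
move=> ug xE cd; have cz := Z_cuts x; split=> [i|].
  apply/span1P; apply: (cuts_unique cz cd); apply: span_sub.
  have [v Fv hE] : exists2 v, Fl g lam h v & h = zc v.
    by apply/(zcP lam h _ ug); exists 1; rewrite scale1r.
  by exists v, i; rewrite xE -hE.
have iI : is_ideal [set c | exists et, c = dot et h].
  split=> [|_ _ [e1 ->] [e2 ->]|a _ [e ->]].
  - by exists 0; rewrite dot0l.
  - by exists (e1 + e2); rewrite dotDl.
  - by exists (a *: e); rewrite dotZl.
have dI := cuts_unique cd cz (span_sub erefl).
apply: (span_min iI _ dI) => _ [v [i [Fv ->]]]; rewrite xE in Fv.
have [s ->] : exists s, zc v = s *: h by apply/(zcP lam h _ ug); exists v.
by exists (s *: delta_mx 0 i); rewrite dotZl dotC dot_delta mxE.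
Qed.

(** ** Parameters of a point of the splitting model *)

(** The data of a point are unique up to a unit [a] scaling [g] and a unit [c] scaling the
    functional; the factor [a] in [lam'] compensates the change of the coordinate [s]. *)
Lemma raw3_eq (R : calg (OF D)) (g g' : 'rV[R]_n) lam lam' h h' :
  core g lam h -> core g' lam' h' -> Fn g lam h = Fn g' lam' h' -> Gg g = Gg g' ->
  exists a a' c c', [/\ a * a' = 1, c * c' = 1, g' = a *: g, lam' = c * a * lam & h' = c *: h].
Proof.
have line_eq (u u' : 'rV[R]_n) : Gg u = Gg u' -> exists a, u' = a *: u.
  move=> E; have : Gg u' (row_mx (piR R *: u') u') by exists 1; rewrite ?scale1r.
  by rewrite -E => -[s _]; rewrite scale_row_mx => /eq_row_mx[_ <-]; exists s.
have main (u u' : 'rV[R]_n) mu mu' k k' a a' : unimv u -> unim mu k -> a * a' = 1 -> u' = a *: u ->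
    Fn u mu k = Fn u' mu' k' -> exists c, mu' = c * a * mu /\ k' = c *: k.
  move=> uu [al [et E]] aa uE FE.
  have vk s y : s * mu + frm y k = 0 -> a' * s * mu' + frm y k' = 0.
    move=> E'; have /FnP[s' [y' []]] : Fn u' mu' k' (lin u s y).
      by rewrite -FE; apply/FnP; exists s, y.
    move=> /eq_row_mx[e1 ey]; rewrite -ey in e1 *; move/addIr: e1; rewrite uE scalerA.
    by move=> /(unimv_inj uu) -> <-; rewrite mulrCA [a' * _]mulrC aa mulr1.
  (* The first functional takes the value [1] at [(al, y0)]; [c] is the value of the second one
     there. *)
  pose y0 := et *m (Jm D R)^T; pose c := a' * al * mu' + frm y0 k'.
  have tE s y : a' * s * mu' + frm y k' = (s * mu + frm y k) * c.
    pose t := s * mu + frm y k.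
    have := vk (s - t * al) (y - t *: y0).
    rewrite !(frmDl, frmNl, frmZl) /y0 frm_JT => H.
    have {}H := H _; apply/eqP; rewrite -subr_eq0; apply/eqP.
    rewrite -[RHS]H; first by rewrite -/t /c /y0; ring.
    transitivity (t - t * (al * mu + dot et k)); first by rewrite /t; ring.
    by rewrite E mulr1 subrr.
  exists c; split.
    have := tE a 0; rewrite !frm0l !addr0 [a' * a]mulrC aa mul1r => ->; ring.
  apply: (@frm_extr D) => y; rewrite frmZr.
  by have := tE 0 y; rewrite mulr0 !mul0r !add0r mulrC.
move=> [ug uh _] [ug' uh' _] FE GE.
have [a aE] := line_eq _ _ GE; have [a' aE'] := line_eq _ _ (esym GE).
have aa : a * a' = 1.
  by apply: (unimv_inj ug); rewrite scale1r mulrC -scalerA -aE -aE'.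
have [c [cl ch]] := main _ _ _ _ _ _ _ _ ug uh aa aE FE.
have aa' : a' * a = 1 by rewrite mulrC.
have [c' [cl' ch']] := main _ _ _ _ _ _ _ _ ug' uh' aa' aE' (esym FE).
exists a, a', c, c'; split=> //; apply: (unim_inj uh).
  by rewrite mul1r {2}cl' cl; transitivity (c * c' * lam * (a * a')); [rewrite aa mulr1|ring].
by rewrite scale1r {2}ch' ch scalerA mulrC.
Qed.

Lemma nzd_cancel (R : comNzRingType) m (d : R) (u v : 'rV[R]_m) : nonzerodivisor d ->
  d *: u = d *: v -> u = v.
Proof.
move=> nd E; apply/rowP=> i; apply/eqP; rewrite -subr_eq0; apply/eqP/nd.
by have := congr1 (fun z : 'rV_m => z 0 i) E; rewrite !mxE mulrBr => ->; rewrite subrr.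
Qed.

(* Dividing h by the local equation d of the center turns the relations V and *)
(* U between g and h into the equations of the blow-up. *)
Lemma lift_data (R : calg (OF D)) (g w : 'rV[R]_n) lam d : spl g lam (d *: w) ->
  nonzerodivisor d -> unimv w ->
  exists t, [/\ Bd t, tg t = g, tw t = w, tlam t = lam & tmu t = d].
Proof.
move=> [[ug uh E0] V U] nd uw.
have [y0 y0E] := unimv_frmr uw; have [y1 y1E] := unimv_frm ug.
have [xi xiE] := ug.
(* For [s = d] both sides of the relation are multiples of [d]; cancelling it makes [g_M + pi g_O] a
   multiple of [w], with factor [nu = - r]. *)
have [|r [r1 _]] := V d (- (lam *: y0)).
  by rewrite frmNl frmZl frmZr y0E; ring.
have nuE : g *m DM D R + piR R *: (g *m DO D R) = - r *: w.
  by apply: (nzd_cancel nd); rewrite -r1 !scalerA mulrN scaleNr mulrC.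
have [|s [s1 s2]] := U 1 (lam *: y1); first by rewrite frmZr y1E; ring.
pose v := w *m DO D R + piR R *: (w *m DM D R); pose gam := dot xi v.
have sv : s *: g = - (d *: v).
  rewrite s1 scale1r /v -!scalemxAl; congr (- _).
  by apply/rowP=> i; rewrite !mxE; ring.
have sE : s = - (d * gam).
  by rewrite -[s]mulr1 -xiE -dotZr sv dotNr dotZr.
have gamE : v = gam *: g.
  by apply: (nzd_cancel nd); rewrite scalerA -[LHS]opprK -sv sE scaleNr opprK.
have gM : g *m DM D R = - r *: (w *m DM D R).
  have := congr1 (mulmx^~ (DM D R)) nuE.
  by rewrite /= mulmxDl -!scalemxAl !DE scaler0 addr0.
have pgO : piR R *: (g *m DO D R) = - r *: (w *m DO D R).
  have := congr1 (mulmx^~ (DO D R)) nuE.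
  by rewrite /= mulmxDl -!scalemxAl !DE add0r.
have wO : w *m DO D R = gam *: (g *m DO D R).
  have := congr1 (mulmx^~ (DO D R)) gamE.
  by rewrite /= /v mulmxDl -!scalemxAl !DE scaler0 addr0.
have pwM : piR R *: (w *m DM D R) = gam *: (g *m DM D R).
  have := congr1 (mulmx^~ (DM D R)) gamE.
  by rewrite /= /v mulmxDl -!scalemxAl !DE add0r.
have ng : - r * gam = piR R.
  apply: (unimv_inj ug); rewrite {1 2}(rowMO g) !scalerDr pgO wO; congr (_ + _).
    by rewrite -scalerA -pwM scalerA mulrC -scalerA -gM.
  by rewrite scalerA.
pose t := Tup (w *m DM D R + g *m DO D R) (- r) gam lam d.
have tgE : tg t = g by rewrite [RHS]rowMO gM /tg /= !mulmxDl !DE addr0 add0r.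
have twE : tw t = w by rewrite [RHS]rowMO wO /tw /= !mulmxDl !DE addr0 add0r.
exists t; split=> //; split; rewrite ?tgE ?twE //; last first.
  have [al [et E]] := uh; exists al, (dot et w).
  by move: E; rewrite dotZr mulrC [d * _]mulrC mulrC [al * _]mulrC /= mulrC.
(* Multiplied by [d], the equation [2 gam lam + mu Q = 0] is the scalar relation [s2]. *)
rewrite -qf_w twE /= ; apply: (nd).
have f1 : frm (lam *: y1 *m DO D R) w = - (gam * (lam * frm (g *m DO D R) y1)).
  by rewrite frm_Ol wO frmZr frmZl -frm_Ol frm_altO; ring.
have f2 : piR R * frm (lam *: y1 *m DM D R) w = gam * (lam * frm (g *m DM D R) y1).
  by rewrite -frmZr frm_Ml -scalemxAl pwM frmZr frmZl -frm_Ml frm_symM; ring.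
have f3 : frm (g *m DO D R) y1 = 1 - frm (g *m DM D R) y1.
  by rewrite -y1E {2}(rowMO g) frmDl; ring.
have f4 : frm (w *m DM D R) w = qf w by [].
apply: oppr_inj; rewrite oppr0 -[RHS]s2 !(frmDl, frmNl, frmZl, frmZr).
rewrite -!scalemxAl !frmZl -f4 sE.
have := f1; have := f2; rewrite -!scalemxAl !frmZl => f2' f1'.
transitivity (d * (- (2 * gam * lam) - d * frm (w *m DM D R) w)); first by ring.
transitivity (lam * - (d * gam) + (- (d * (d * frm (w *m DM D R) w))
   + d * (lam * frm (y1 *m DO D R) w) - d * (piR R * (lam * frm (y1 *m DM D R) w)))); last by ring.
by rewrite f1' f2' f3; ring.
Qed.
End Center.

Lemma sub_eq (O : comNzRingType) (X : functor O) (U : subfunctor X) R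
  (x y : sub_functor U R) : sval x = sval y -> x = y.
Proof. by case: x y => [x xP] [y yP] /= E; apply: eq_exist. Qed.

Section Lifting.
Variable D : unitary_datum.
Local Notation n := (ud_n D).
Local Notation Z := (fiber (tau D) (star D)).

Lemma Mspl_raw3 (R : calg (OF D)) (x : Mspl D R) :
  zariski_locally (fun S (f : ahom R S) => exists g lam h,
    spl g lam h /\ fmap f (sval x) = raw3 g lam h).
Proof.
apply: zl_mono (Mspl_local x) => S f [g [lam [h [s e1 e2 e3]]]].
exists g, lam, h; split=> //; case: x e1 e2 e3 => [[[Fl0 Fn0] G0] xP] /= e1 e2 e3.
by congr ((_, _), _); apply: submods_eq.
Qed.

Lemma zc_map (R S : calg (OF D)) (f : ahom R S) (v : 'rV[R]_(n + n)) :
  map_mx f (zc v) = zc (map_mx f v).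
Proof. by apply/rowP=> i; rewrite !mxE rmorphD rmorphM /= map_piR. Qed.

Lemma nzd_locf (R L : calg (OF D)) (a : R) (i : ahom R L) (d : R) : is_locf a i ->
  nonzerodivisor d -> nonzerodivisor (i d).
Proof.
move=> [[un num ker] _ _] nd b; have [b0 [_ [[k ->] bE]]] := num b => db.
have : i (d * b0) = 0 by rewrite rmorphM /= -bE mulrA db mul0r.
move=> /ker[_ [q ->]]; rewrite mulrCA => /nd ab0.
have ua : invertible (i (a ^+ k)) by apply: un; exists k.
have uq : invertible (i (a ^+ q)) by apply: un; exists q.
apply: (inv_cancelr ua); rewrite mul0r bE; apply: (inv_cancel uq).
by rewrite -rmorphM ab0 rmorph0 mulr0.
Qed.

Lemma span1_zero (R S : comNzRingType) (f : {rmorphism R -> S}) d :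
  (forall a, ideal_span [set d] a -> f a = 0) <-> f d = 0.
Proof.
split=> [|fd a /span1P[c ->]]; last by rewrite rmorphM fd mulr0.
by apply; apply: span_sub.
Qed.

Lemma cuts_base (X : functor (OF D)) (Y : subfunctor X) R S (x : X R) (f : ahom R S) d :
  cuts_out Y x (ideal_span [set d]) -> cuts_out Y (fmap f x) (ideal_span [set f d]).
Proof.
move=> [_ H]; split=> [|T h]; first exact: span_ideal.
by rewrite -fmap_comp H !span1_zero.
Qed.

(** The line of [w = h / d] is recovered as the module [W] of vectors whose multiple by [d] is a
    value of [zc] on [F_l]. It is defined globally from [m] and [d]; only its description by a tuple
    is local. *)
Lemma lift_ex (A : calg (OF D)) (m : Mspl D A) : cartier_point Z m ->
  exists beta, bmor D A beta = m.
Proof.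
move=> [d nd cd]; have sFl : submodule (sval (sval m).1.1) := svalP _.
pose W := [set w : 'rV[A]_n | exists2 v, sval (sval m).1.1 v & zc v = d *: w].
have sW : submodule W.
  split=> [|a w w' [v Fv vE] [v' Fv' vE']].
    exists 0; first exact: (submodule0 sFl).
    by rewrite scaler0 /zc !linear0 addr0.
  exists (a *: v + v'); first exact: (submoduleD sFl (submoduleZ a sFl Fv) Fv').
  by rewrite zcD vE vE' scalerDr !scalerA mulrC.
pose y : Bamb D A := (sval m, exist _ W sW).
have yB : Bsub D A y.
  apply/zar_primes => p pp; have [f pf Hf] := (zar_primes _).1 (Mspl_raw3 m) p pp.
  exists f => //; have [L [i li]] := locf_exists (not_nilp pp pf).
  have [_ ui jex] := li; have [g [lam [h [sp mE]]]] := Hf L i ui.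
  have nd' := nzd_locf li nd.
  have FE : ext i (sval (sval m).1.1) = Fl g lam h := congr1 (fun z => sval z.1.1) mE.
  have ug : unimv g by case: sp => -[].
  have FE' : sval (sval (fmap i m)).1.1 = Fl g lam h := congr1 (fun z => sval z.1.1) mE.
  have [hd [et etE]] := cuts_h ug FE' (cuts_base i cd).
  have [c cE] := fin_all_exists hd.
  pose w := \row_j c j.
  have hE : h = i d *: w by apply/rowP=> j; rewrite !mxE cE mulrC.
  have uw : unimv w.
    exists et; apply/eqP; rewrite -subr_eq0; apply/eqP/nd'.
    by rewrite mulrBr -dotZr -hE -etE mulr1 subrr.
  rewrite hE in sp; have [t [tB tgE twE tlE tmE]] := lift_data sp nd' uw.
  have WE : ext i W = line w.
    rewrite eqEsubset; split.
      apply: ext_ind; first exact: line_submodule.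
      move=> w0 [v Fv vE]; have Fv' : Fl g lam h (map_mx i v) by rewrite -FE; apply: ext_in.
      have [s sE] : exists s, zc (map_mx i v) = s *: h.
        by apply/(zcP lam h _ ug); exists (map_mx i v).
      exists s => //; apply: (nzd_cancel nd').
      by rewrite scalerA mulrC -scalerA -hE -sE -zc_map vE map_mxZ.
    (* [w] lives over a localization: powers of [f] bring both [w] and the vector of [F_l] above [h]
       back to [A], where membership in [W] makes sense. *)
    have wW : ext i W w.
      have [v Fv hv] : exists2 v, Fl g lam h v & h = zc v.
        by apply/(zcP lam h _ ug); exists 1; rewrite scale1r.
      rewrite -FE in Fv; have [k [x [Fx xE]]] := (ext_locf v li sFl).1 Fv.
      have [k' [w1 w1E]] := locf_vec w li.
      have : map_mx i (f ^+ k' *: zc x) = map_mx i (f ^+ k *: (d *: w1)).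
        rewrite !map_mxZ zc_map -xE -w1E !rmorphXn /=.
        have -> : zc (i f ^+ k *: v) = i f ^+ k *: zc v.
          by rewrite -[_ *: v]addr0 zcD {2}/zc !linear0 !addr0.
        by rewrite -hv hE !scalerA; congr (_ *: _); ring.
      move=> /(locf_vec0 li)[q]; rewrite !scalerA => E.
      have W1 : W (f ^+ (q + k) *: w1).
        exists (f ^+ (q + k') *: x); first exact: (submoduleZ _ sFl).
        rewrite -[_ *: x]addr0 zcD {2}/zc !linear0 !addr0 exprD E scalerA.
        by congr (_ *: _); rewrite exprD; ring.
      have := ext_in (g := i) W1; rewrite map_mxZ -w1E scalerA rmorphXn /= -exprD.
      by apply: scale_inv; [exact: submodule_ext|exact: invertibleX].
    by move=> _ [s _ <-]; apply: submoduleZ wW; apply: submodule_ext.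
  move=> S h' fh; have [j jE] := jex S h' fh; exists (tmap j t); first exact: Bd_map.
  rewrite -raw_map // -jE fmap_comp; congr fmap; congr (_, _).
    by rewrite -[LHS]/(fmap i (sval m)) mE hE /th tgE twE tlE tmE.
  by apply: submods_eq; rewrite /= WE twE.
by exists (exist _ y yB); apply: sub_eq.
Qed.

(** Locally the Cartier equation [d] is a multiple of [mu], so [mu] is a nonzerodivisor and
    [h = mu w] determines the line of [w]. *)
Lemma lift_uq (A : calg (OF D)) (m : Mspl D A) beta beta' : cartier_point Z m ->
  bmor D A beta = m -> bmor D A beta' = m -> beta = beta'.
Proof.
move=> [d nd cd] bE bE'.
have e1 : (sval beta).1 = sval m by rewrite -bE.
have e2 : (sval beta').1 = sval m by rewrite -bE'.
case: beta bE e1 => -[x W] xB /= bE e1; case: beta' bE' e2 => -[x' W'] xB' /= bE' e2.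
apply: eq_exist; rewrite e1 e2; congr (_, _); apply: submods_eq.
apply: zl_eqmod; [exact: svalP|exact: svalP|].
apply/zar_primes => p pp.
have [f pf Hf] := (zar_primes _).1 (zl_and xB xB') p pp.
exists f => //; have [L [i li]] := locf_exists (not_nilp pp pf).
have [_ ui jex] := li; have [[t tB tE] [t' tB' tE']] := Hf L i ui.
have nd' := nzd_locf li nd.
have main (u u' : tup D L) : Bd u -> Bd u' -> raw3 (tg u) (tlam u) (th u) = fmap i (sval m) ->
    raw3 (tg u') (tlam u') (th u') = fmap i (sval m) -> line (tw u') `<=` line (tw u).
  move=> uB uB' uE uE'.
  have [[cu _ _] [cu' _ _]] := (Bd_spl uB, Bd_spl uB').
  have E := etrans uE (esym uE').
  have [a [a' [c [c' [_ _ _ _ hE]]]]] := raw3_eq cu cu'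
    (congr1 (fun z => sval z.1.2) E) (congr1 (fun z => sval z.2) E).
  have ug : unimv (tg u') by case: cu'.
  have [_ [et etE]] := cuts_h (x := fmap i m) ug (esym (congr1 (fun z => sval z.1.1) uE'))
    (cuts_base i cd).
  have nm : nonzerodivisor (tmu u').
    by move=> b bm; apply: nd'; rewrite etE /th dotZr mulrAC bm mul0r.
  have [_ _ _ [xi xiE] _] := uB; have [_ _ _ [xi' xiE'] _] := uB'.
  have cm : c * tmu u = tmu u' * dot xi (tw u').
    by rewrite -dotZr -/(th u') hE !dotZr xiE mulr1.
  have wE : tw u' = dot xi (tw u') *: tw u.
    by apply: (nzd_cancel nm); rewrite scalerA -cm -/(th u') hE /th scalerA.
  by move=> _ [s _ <-]; rewrite wE scalerA; eexists.
have line_eq : line (tw t) = line (tw t').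
  have e3 : raw3 (tg t) (tlam t) (th t) = fmap i (sval m) by rewrite -e1 -[LHS]/(raw t).1 -tE.
  have e4 : raw3 (tg t') (tlam t') (th t') = fmap i (sval m) by rewrite -e2 -[LHS]/(raw t').1 -tE'.
  by rewrite eqEsubset; split; apply: main.
move=> S h fh; have [j jE] := jex S h fh; rewrite -jE !ext_comp; congr ext.
have -> : ext i (sval W) = line (tw t) := congr1 (fun z => sval z.2) tE.
by have -> : ext i (sval W') = line (tw t') := congr1 (fun z => sval z.2) tE'.
Qed.

(** As [w] is unimodular, [h = mu w] vanishes exactly when [mu] does: [mu] is the equation of the
    exceptional divisor. *)
Lemma raw_cartier (A : calg (OF D)) (u : Bf D A) t : Bd t -> sval u = raw t ->
  nonzerodivisor (tmu t) -> cartier_point (preim (bmor D) Z) u.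
Proof.
move=> tB uE nm; exists (tmu t) => //; split=> [|S f]; first exact: span_ideal.
rewrite span1_zero -[preim _ _ _ _]/(Z S (bmor D S (fmap f u))) mor_nat.
have [cu _ _] := Bd_spl tB; have [_ _ _ [xi xiE] _] := tB.
have FE : sval (sval (fmap f (bmor D A u))).1.1 =
    Fl (map_mx f (tg t)) (f (tlam t)) (map_mx f (th t)).
  by rewrite -(Fl_map f cu) /= uE.
have ug : unimv (map_mx f (tg t)) by case: cu => ug _ _; apply: unimv_map.
rewrite Z_iff FE; split=> [H|m0 v Fv].
  have [v Fv hv] : exists2 v, Fl (map_mx f (tg t)) (f (tlam t)) (map_mx f (th t)) v
       & map_mx f (th t) = zc v.
    by apply/(zcP _ _ _ ug); exists 1; rewrite scale1r.
  have := H v Fv; rewrite -hv /th map_mxZ => /(congr1 (dot (map_mx f xi))).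
  by rewrite dotZr -map_dot xiE rmorph1 mulr1 dot0r.
have [s ->] : exists s, zc v = s *: map_mx f (th t) by apply/(zcP (f (tlam t)) _ _ ug); exists v.
by rewrite /th map_mxZ /= m0 scale0r scaler0.
Qed.
End Lifting.

(** * Affine charts of the blow-up *)

Section Glue.
Variables (D : unitary_datum) (R : calg (OF D)) (N : nat).
Variable P : forall S, ahom R S -> 'rV[S]_N -> Prop.
Hypotheses (Pmap : forall S T (f : ahom R S) (h : ahom S T) v,
    P f v -> P (ahom_comp h f) (map_mx h v))
  (Puniq : forall S (f : ahom R S) v v', P f v -> P f v' -> v = v').

(* The graphs, the lines spanned by the (1, v), glue as submodules. *)
Lemma glue_row : zariski_locally (fun S (f : ahom R S) => exists v, P f v) ->
  exists v : 'rV[R]_N, zariski_locally (fun S (f : ahom R S) => P f (map_mx f v)).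
Proof.
move=> [s s1 H].
pose cov S (g : ahom R S) := exists2 f, f \in s & invertible (g f).
have ch S (g : ahom R S) : cov S g -> exists v, P g v by case=> f fs; apply: H.
pose sv S (g : ahom R S) (cg : cov S g) := sval (cid (ch S g cg)).
have svP S g cg : P g (@sv S g cg) by rewrite /sv; case: cid.
pose sec S (g : ahom R S) (cg : cov S g) : submods (OF D) (1 + N) S :=
  exist _ (line (row_mx 1%:M (sv S g cg))) (line_submodule _).
have [S T g h cg chg|x [xP _]] := submods_sheaf s1 (sec := sec).
  apply: submods_eq; rewrite /= span_map map_row_mx map_scalar_mx rmorph1.
  congr (line (row_mx _ _)); apply: Puniq (svP _ _ _).
  by apply: Pmap; apply: svP.
have sM : submodule (sval x) := svalP x.
pose I := [set a : R | exists2 u, sval x u & lsubmx u 0 0 = a].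
have iI : is_ideal I.
  split=> [|_ _ [u Mu <-] [u' Mu' <-]|a _ [u Mu <-]].
  - by exists 0; [exact: (submodule0 sM)|rewrite linear0 mxE].
  - by exists (u + u'); [exact: (submoduleD sM)|rewrite linearD mxE].
  - by exists (a *: u); [exact: (submoduleZ _ sM)|rewrite linearZ mxE].
have xE S g cg : ext g (sval x) = line (row_mx 1%:M (@sv S g cg)).
  by have := xP S g cg => /(congr1 (fun z => sval z)).
have [u Mu u1] : I 1.
  apply: contrapT => I1; have [p pp Ip] := prime_above iI I1.
  have [f fs pf] : exists2 f, f \in s & ~ p f.
    apply: contrapT => no; case: (pp) => ip p1 _; apply: p1.
    apply: (span_min ip _ s1) => f fs; apply: contrapT => pf; apply: no.
    by exists f.
  have [L [i li]] := locf_exists (not_nilp pp pf); have [[_ _ ker] ui _] := li.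
  have cg : cov L i by exists f.
  have : ext i (sval x) (row_mx 1%:M (sv L i cg)).
    by rewrite (xE L i cg); exists 1; rewrite ?scale1r.
  move=> /(ext_locf _ li sM)[k [x0 [Mx0 E]]].
  have : i (f ^+ k - lsubmx x0 0 0) = 0.
    have := congr1 (fun z : 'rV_(1 + N) => lsubmx z 0 0) E.
    rewrite scale_row_mx row_mxKl -map_lsubmx !mxE eqxx mulr1 => e.
    by rewrite rmorphB rmorphXn /= e subrr.
  move=> /ker[_ [q ->]] /eqP; rewrite mulrBr subr_eq0 -exprD => /eqP e.
  apply: (primeXn (n := q + k) pp pf); rewrite e; apply: (idealM_l _ (prime_ideal pp)).
  by apply: Ip; exists x0.
exists (rsubmx u); exists s => // f fs S g gf.
have cg : cov S g by exists f.
have : ext g (sval x) (map_mx g u) by apply: ext_in.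
rewrite (xE S g cg) => -[c _]; rewrite scale_row_mx -[u in RHS]hsubmxK map_row_mx.
move=> /eq_row_mx[e1 e2].
have c1 : c = 1.
  have := congr1 (fun z : 'M_1 => z 0 0) e1; rewrite !mxE eqxx mulr1 => ->.
  by have := congr1 g u1; rewrite mxE rmorph1.
by rewrite -e2 c1 scale1r; apply: svP.
Qed.
End Glue.

(** * Open subfunctors defined by bilinear forms on tautological modules *)

Section Bilinear.
Variables (O : comNzRingType) (X : functor O) (N N' : nat).
Variables (M : forall R, X R -> set 'rV[R]_N) (M' : forall R, X R -> set 'rV[R]_N').
Variable beta : forall R : calg O, 'M[R]_(N, N').
Hypotheses (ME : forall R S (f : ahom R S) x, M (fmap f x) = ext f (M x))
  (ME' : forall R S (f : ahom R S) x, M' (fmap f x) = ext f (M' x))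
  (betaE : forall R S (f : ahom R S), map_mx f (beta R) = beta S).

(** Lines have generators only locally, so a coordinate of a generator is not a function on the
    functor. The ideal of all values of a bilinear form needs no generator and commutes with base
    change; [bil_open] is the locus where it is the unit ideal. *)
Definition bval R (x : X R) := [set c : R | exists v v',
  [/\ M x v, M' x v' & c = (v *m beta R *m v'^T) 0 0]].

Lemma bval_fmap R S (f : ahom R S) (x : X R) :
  ideal_span (bval (fmap f x)) = ideal_span (f @` bval x).
Proof.
rewrite eqEsubset; split; apply: span_min; try exact: span_ideal; last first.
  move=> _ [_ [v [v' [Mv Mv' ->]]] <-]; apply: span_sub.
  exists (map_mx f v), (map_mx f v'); rewrite ME ME'; split; try exact: ext_in.
  by rewrite -(betaE f) map_trmx -!map_mxM [RHS]mxE.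
have iI := span_ideal (f @` bval x); set I := ideal_span _ in iI *.
move=> _ [v [v' [+ + ->]]]; rewrite ME ME' => Mv; move: v'; apply: ext_ind.
  split=> [|a y z /= Iy Iz] /=; first by rewrite trmx0 mulmx0 mxE; apply: (ideal_0 iI).
  by rewrite linearD linearZ /= mulmxDr -scalemxAr !mxE in Iy Iz *; apply: (idealD iI) => //;
    apply: (idealM_l _ iI).
move=> v' Mv' /=; move: v Mv; apply: ext_ind.
  split=> [|a y z /= Iy Iz] /=; first by rewrite !mul0mx mxE; apply: (ideal_0 iI).
  by rewrite !mulmxDl -!scalemxAl !mxE in Iy Iz *; apply: (idealD iI) => //;
    apply: (idealM_l _ iI).
move=> v Mv /=; apply: span_sub; exists ((v *m beta R *m v'^T) 0 0).
  by exists v, v'.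
by rewrite -(betaE f) map_trmx -!map_mxM [RHS]mxE.
Qed.

Definition bil_open : subfunctor X.
Proof.
exists (fun R x => ideal_span (bval x) 1) => R S f x H.
by rewrite bval_fmap -(rmorph1 f); apply: span_image.
Defined.

Lemma bil_openP : is_open bil_open.
Proof.
move=> R x; exists (ideal_span (bval x)); split; first exact: span_ideal.
by move=> S f; rewrite span_image_span /= bval_fmap.
Qed.

Lemma bil_open_val R (x : X R) e : (forall v v', M x v -> M' x v' ->
    exists c, (v *m beta R *m v'^T) 0 0 = c * e) ->
  (exists v v', [/\ M x v, M' x v' & (v *m beta R *m v'^T) 0 0 = e]) ->
  bil_open R x <-> invertible e.
Proof.
move=> H1 [v [v' [Mv Mv' E]]].
have -> : bil_open R x <-> ideal_span [set e] 1.
  rewrite /=; suff -> : ideal_span (bval x) = ideal_span [set e] by [].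
  rewrite eqEsubset; split; apply: span_min; try exact: span_ideal.
    by move=> _ [w [w' [Mw Mw' ->]]]; apply/span1P; apply: H1.
  by move=> _ ->; apply: span_sub; exists v, v'.
by rewrite span1P; split=> -[c cE]; exists c; rewrite ?cE // mulrC -?cE.
Qed.
End Bilinear.

Section Scale.
Variable D : unitary_datum.
Local Notation n := (ud_n D).
Variable R : calg (OF D).
Implicit Types t : tup D R.

Lemma tup_eq t t' : tq t = tq t' -> tnu t = tnu t' -> tgam t = tgam t' ->
  tlam t = tlam t' -> tmu t = tmu t' -> t = t'.
Proof. by case: t t' => [? ? ? ? ?] [? ? ? ? ?] /= -> -> -> -> ->. Qed.

Lemma unimv_unit (g : 'rV[R]_n) a b : unimv g -> a * b = 1 -> unimv (a *: g).
Proof.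
by move=> [xi E] ab; exists (b *: xi); rewrite dotZl dotZr E mulr1 mulrC.
Qed.

(** Units [a], [b], [c] rescale the generators [g], [w] and [h] without moving the point; the
    inverses are explicit because they enter [nu], [gam] and [mu]. *)
Lemma raw_scale t a a' b b' c c' : Bd t -> a * a' = 1 -> b * b' = 1 -> c * c' = 1 ->
  let t' := Tup (b *: (tq t *m DM D R) + a *: (tq t *m DO D R)) (tnu t * a * b')
    (tgam t * b * a') (c * a * tlam t) (c * tmu t * b') in
  [/\ Bd t', raw t' = raw t, tg t' = a *: tg t & tw t' = b *: tw t].
Proof.
move=> [E1 E2 ug uw [al [be ab]]] aa bb cc t'.
have qM : tq t' *m DM D R = b *: (tq t *m DM D R).
  by rewrite /= mulmxDl -!scalemxAl !DE scaler0 addr0.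
have qO : tq t' *m DO D R = a *: (tq t *m DO D R).
  by rewrite /= mulmxDl -!scalemxAl !DE scaler0 add0r.
have gE : tg t' = a *: tg t.
  rewrite /tg qM qO scalerDr !scalerA; congr (_ *: _ + _).
  by rewrite /= -[RHS]mul1r -bb; ring.
have wE : tw t' = b *: tw t.
  rewrite /tw qM qO scalerDr !scalerA; congr (_ + _ *: _).
  by rewrite /= -[RHS]mul1r -aa; ring.
have hE : th t' = c *: th t.
  by rewrite /th wE !scalerA /=; congr (_ *: _); rewrite -[RHS]mul1r -bb; ring.
have qfE : qf (tq t') = b * b * qf (tq t).
  rewrite /qf qM frmZl {2}/tq /= frmDr !frmZr frmMO mulr0 addr0 -frm_Ml DM2; ring.
split=> //.
  split; rewrite ?gE ?wE ?qfE.
  - rewrite /= -E1 -[RHS]mul1r -[in RHS](mulr1 1) -{1}aa -bb; ring.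
  - transitivity (c * b * (2 * tgam t * tlam t * (a * a') + tmu t * qf (tq t) * (b * b'))).
      by rewrite /=; ring.
    by rewrite aa bb !mulr1 E2 mulr0.
  - exact: unimv_unit aa.
  - exact: unimv_unit bb.
  exists (al * a' * c'), (be * b * c'); rewrite /= -ab.
  transitivity ((al * tlam t * (a * a') + be * tmu t * (b * b')) * (c * c')); first by ring.
  by rewrite aa bb cc !mulr1.
have lineZ N (v : 'rV[R]_N) x x' : x * x' = 1 -> line (x *: v) = line v.
  move=> xx; rewrite eqEsubset; split=> _ [s _ <-]; first by exists (s * x); rewrite // scalerA.
  by exists (s * x'); rewrite // scalerA -mulrA [x' * x]mulrC xx mulr1.
rewrite /raw gE wE hE /=; congr (((_, _), _), _); apply: submods_eq => /=.
- rewrite eqEsubset; split=> _ /FlP[s [y [-> E]]]; apply/FlP.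
    exists (s * c), y; split; first by rewrite /lin -[- (c *: _)]scalerN scalerA.
    transitivity (a' * frm (a *: tg t) y).
      by rewrite frmZl mulrA [a' * a]mulrC aa mul1r.
    by rewrite E; transitivity (s * c * tlam t * (a * a')); [rewrite /=; ring|rewrite aa mulr1].
  exists (s * c'), y; split; last first.
    rewrite frmZl E; transitivity (a * s * tlam t * (c * c')); first by rewrite cc mulr1 mulrA.
    by rewrite /=; ring.
  by rewrite /lin -[- (c *: _)]scalerN scalerA -mulrA [c' * c]mulrC cc mulr1.
- rewrite eqEsubset; split=> _ /FnP[s [y [-> E]]]; apply/FnP.
    exists (s * a), y; split; first by rewrite /lin scalerA.
    transitivity (c' * (s * (c * a * tlam t) + frm y (c *: th t))); last by rewrite E mulr0.
    rewrite frmZr; transitivity (c * c' * (s * a * tlam t + frm y (th t))).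
      by rewrite cc mul1r.
    by rewrite /=; ring.
  exists (s * a'), y; split; first by rewrite /lin scalerA -mulrA [a' * a]mulrC aa mulr1.
  rewrite frmZr; transitivity (c * (s * tlam t * (a * a') + frm y (th t))); first by ring.
  by rewrite aa mulr1 E mulr0.
- rewrite /Gg; have -> : row_mx (piR R *: (a *: tg t)) (a *: tg t) = a *: row_mx (piR R *: tg t) (tg t).
    by rewrite scale_row_mx scalerA mulrC -scalerA.
  exact: lineZ aa.
exact: lineZ bb.
Qed.

(** Two tuples of one point differ by such scalars, and agree once a normalization forces all three
    to be [1]. *)
Lemma raw_inj t t' : Bd t -> Bd t' -> raw t = raw t' ->
  exists a b c, [/\ tg t' = a *: tg t, tw t' = b *: tw t, tlam t' = c * a * tlam t,
    tmu t' * b = c * tmu t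
    & a = 1 -> b = 1 -> c = 1 -> t = t'].
Proof.
move=> tB tB' E; have [[ct _ _] [ct' _ _]] := (Bd_spl tB, Bd_spl tB').
have [a [a' [c [c' [aa cc gE lE hE]]]]] := raw3_eq ct ct'
  (congr1 (fun z : Bamb D R => sval z.1.1.2) E) (congr1 (fun z : Bamb D R => sval z.1.2) E).
have [b wE] : exists b, tw t' = b *: tw t.
  have : line (tw t) (tw t').
    have -> : line (tw t) = line (tw t') := congr1 (fun z : Bamb D R => sval z.2) E.
    by exists 1; rewrite ?scale1r.
  by move=> [s _ <-]; exists s.
have [E1 _ ug uw _] := tB; have [E1' _ _ _ _] := tB'.
exists a, b, c; split=> //.
  apply: (unimv_inj uw); rewrite -!scalerA -wE -/(th t') hE.
  by [].
move=> a1 b1 c1; rewrite a1 scale1r in gE; rewrite b1 scale1r in wE.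
rewrite c1 scale1r in hE; rewrite a1 c1 !mul1r in lE.
have qE : tq t = tq t'.
  by rewrite [tq t]rowMO [tq t']rowMO -!twM -!tgO gE wE.
apply: tup_eq => //.
- apply: (unimv_inj uw).
  have e (s : tup D R) : Bd s -> tnu s *: tw s = tg s *m DM D R + piR R *: (tg s *m DO D R).
    by case=> <- _ _ _ _; rewrite tgM tgO /tw scalerDr scalerA.
  by rewrite e // -wE e // gE.
- apply: (unimv_inj ug).
  have e (s : tup D R) : Bd s -> tgam s *: tg s = tw s *m DO D R + piR R *: (tw s *m DM D R).
    by case=> <- _ _ _ _; rewrite twM twO /tg scalerDr scalerA mulrC addrC.
  by rewrite e // -gE e // wE.
by apply: (unimv_inj uw); rewrite -/(th t) -hE /th wE.
Qed.
End Scale.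

Section Chart.
Variable D : unitary_datum.
Local Notation n := (ud_n D).
Local Notation Z := (fiber (tau D) (star D)).
Variable Q : calg (OF D).
Hypothesis presQ : presents Q [:: uxy_rel D].

Definition goodD (A : calg (OF D)) := good (ud_pi D) Q A.

Lemma field_point (L : calg (OF D)) (x : Bf D L) : is_field L ->
  exists2 t, Bd t & sval x = raw t.
Proof.
move=> fL; have p0 : is_prime [set a : L | ahom_id L a = 0] := isf_kernel (ahom_id L) fL.
have [f f0 H] := (zar_primes _).1 (svalP x) _ p0.
have [|t tB tE] := H L (ahom_id L); first by apply: fL; apply/eqP => e; apply: f0.
by exists t; rewrite // -tE fmap_id.
Qed.

Lemma zl_inv (R : calg (OF D)) (a : R) :
  zariski_locally (fun S (f : ahom R S) => invertible (f a)) -> invertible a.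
Proof.
move=> H; have iI := span_ideal [set a].
suff /span1P[b] : ideal_span [set a] 1 by rewrite mulrC; exists b.
apply: contrapT => n1; have [p pp ap] := prime_above iI n1.
have [f pf Hf] := (zar_primes _).1 H p pp.
have [L [i li]] := locf_exists (not_nilp pp pf); have [[_ num ker] ui _] := li.
have [b bE] := Hf L i ui; have [c [_ [[k ->] cE]]] := num b.
have : i (a * c - f ^+ k) = 0 by rewrite rmorphB rmorphM /= -cE mulrA bE mul1r subrr.
move=> /ker[_ [q ->]] /eqP; rewrite mulrBr subr_eq0 -exprD => /eqP e.
apply: (primeXn (n := q + k) pp pf); rewrite -e.
apply: (idealM_l _ (prime_ideal pp)); apply: (idealM_r _ (prime_ideal pp)).
by apply: ap; apply: span_sub.
Qed.

Variables (P : pred 'I_n) (s : forall R : calg (OF D), R -> R -> R -> 'rV[R]_n -> R)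
  (cha : forall R : calg (OF D), R -> R -> R -> 'rV[R]_n -> tup D R)
  (U : subfunctor (Bamb D)).

(** The vector [z] keeps all [n] coordinates, with zeros outside [P], so that the chart formulas
    need no reindexing; only the coordinates in [P] become variables of the chart algebra. *)
Definition sol (R : calg (OF D)) (u x y : R) (z : 'rV[R]_n) :=
  [/\ u * x * y = calg_str R (2 * ud_pi D), invertible (s u x y z)
    & forall a, ~~ P a -> z 0 a = 0].

Hypotheses (Uopen : is_open U)
  (sN : forall (R S : calg (OF D)) (f : ahom R S) u x y z,
    f (s u x y z) = s (f u) (f x) (f y) (map_mx f z))
  (chaN : forall (R S : calg (OF D)) (f : ahom R S) u x y z,
    tmap f (cha u x y z) = cha (f u) (f x) (f y) (map_mx f z))
  (chaB : forall (R : calg (OF D)) (u x y : R) z, sol u x y z ->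
    Bd (cha u x y z) /\ U R (raw (cha u x y z)))
  (chaI : forall (R : calg (OF D)) (u x y : R) z u' x' y' z', sol u x y z ->
    sol u' x' y' z' -> raw (cha u x y z) = raw (cha u' x' y' z') ->
    [/\ u = u', x = x', y = y' & z = z'])
  (chaS : forall (R : calg (OF D)) (t : tup D R), Bd t -> U R (raw t) ->
    exists u x y z, sol u x y z /\ raw (cha u x y z) = raw t)
  (chaM : forall (R : calg (OF D)) (u x y : R) z, sol u x y z ->
    exists e, tmu (cha u x y z) * e = calg_str R (2 * ud_pi D)).

Let m := #|P|.
Let ev (R : calg (OF D)) (v : 'I_m -> R) : 'rV[R]_n :=
  \row_a \sum_(k < m) v k *+ (enum_val k == a).
Let ev_map (R S : calg (OF D)) (f : ahom R S) v : map_mx f (ev v) = ev (f \o v).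
Proof.
by apply/rowP=> a; rewrite !mxE rmorph_sum; apply: eq_bigr => k _; rewrite rmorphMn.
Qed.
Let ev_val (R : calg (OF D)) (v : 'I_m -> R) k : ev v 0 (enum_val k) = v k.
Proof.
rewrite mxE (bigD1 k) //= eqxx mulr1n big1 ?addr0 // => k' kk.
by rewrite (inj_eq enum_val_inj) (negPf kk).
Qed.
Let ev_out (R : calg (OF D)) (v : 'I_m -> R) a : ~~ P a -> ev v 0 a = 0.
Proof.
move=> Pa; rewrite mxE big1 // => k _; case: eqP => // e.
by case/negP: Pa; rewrite -e; apply: (enum_valP k).
Qed.
Let ev_surj (R : calg (OF D)) (z : 'rV[R]_n) : (forall a, ~~ P a -> z 0 a = 0) ->
  z = ev (fun k => z 0 (enum_val k)).
Proof.
move=> z0; apply/rowP=> a; have [Pa|Pa] := boolP (P a); last by rewrite z0 // ev_out.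
by rewrite -(enum_rankK_in Pa Pa) ev_val.
Qed.

Let mk (R : calg (OF D)) (u x y : R) (z : 'rV[R]_n) : 'rV[R]_(1 + (1 + (1 + n))) :=
  row_mx u%:M (row_mx x%:M (row_mx y%:M z)).
Let mk_map (R S : calg (OF D)) (f : ahom R S) u x y z :
  map_mx f (mk u x y z) = mk (f u) (f x) (f y) (map_mx f z).
Proof. by rewrite /mk !map_row_mx !map_scalar_mx. Qed.
Let mk_inj (R : calg (OF D)) (u x y u' x' y' : R) z z' : mk u x y z = mk u' x' y' z' ->
  [/\ u = u', x = x', y = y' & z = z'].
Proof.
have sc (a b : R) : a%:M = b%:M :> 'M_1 -> a = b.
  by move=> /(congr1 (fun M : 'M_1 => M 0 0)); rewrite !mxE eqxx !mulr1n.
by move=> /eq_row_mx[/sc e1 /eq_row_mx[/sc e2 /eq_row_mx[/sc e3 e4]]].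
Qed.
Let mk_surj (R : calg (OF D)) (r : 'rV[R]_(1 + (1 + (1 + n)))) :
  exists u x y z, r = mk u x y z.
Proof.
have mxs (M : 'M[R]_1) : exists a, M = a%:M by exists (M 0 0); apply: mx11_scalar.
have [u uE] := mxs (lsubmx r); have [x xE] := mxs (lsubmx (rsubmx r)).
have [y yE] := mxs (lsubmx (rsubmx (rsubmx r))).
by exists u, x, y, (rsubmx (rsubmx (rsubmx r))); rewrite /mk -uE -xE -yE !hsubmxK.
Qed.

Let solN (R S : calg (OF D)) (f : ahom R S) u x y z : sol u x y z ->
  sol (f u) (f x) (f y) (map_mx f z).
Proof.
move=> [e us z0]; split; first by rewrite -!rmorphM e /= ahom_str.
  by rewrite -sN; apply: rmorph_inv.
by move=> a /z0 e0; rewrite mxE e0 rmorph0.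
Qed.

(** Coordinates exist locally by [chaS] and are unique by [chaI]; packed into one row by [mk], they
    glue by [glue_row]. *)
Let chart_factor (R : calg (OF D)) (b : Bf D R) : U R (sval b) ->
  exists u x y z, sol u x y z /\ sval b = raw (cha u x y z).
Proof.
move=> Ub.
pose PP S (f : ahom R S) (r : 'rV[S]_(1 + (1 + (1 + n)))) := exists u x y z,
  [/\ r = mk u x y z, sol u x y z & raw (cha u x y z) = fmap f (sval b)].
have [|||r rP] := @glue_row D R _ PP.
- move=> S T f h _ [u [x [y [z [-> sz zE]]]]]; exists (h u), (h x), (h y), (map_mx h z).
  split; [exact: mk_map|exact: solN|].
  by rewrite fmap_comp -zE -chaN raw_map //; apply: (chaB sz).1.
- move=> S f _ _ [u [x [y [z [-> sz zE]]]]] [u' [x' [y' [z' [-> sz' zE']]]]].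
  by have [|-> -> -> ->] := chaI sz sz'; rewrite ?zE ?zE'.
- apply: zl_mono (svalP b) => S f [t tB tE].
  have [|u [x [y [z [sz zE]]]]] := chaS tB; first by rewrite -tE; apply: smem_fmap.
  by exists (mk u x y z), u, x, y, z; split=> //; rewrite zE tE.
have [u [x [y [z rE]]]] := mk_surj r.
have {rP} H : zariski_locally (fun S (f : ahom R S) =>
    sol (f u) (f x) (f y) (map_mx f z) /\ raw (cha (f u) (f x) (f y) (map_mx f z)) = fmap f (sval b)).
  apply: zl_mono rP => S f; rewrite rE mk_map.
  by move=> [u' [x' [y' [z' [/mk_inj[-> -> -> ->]]]]]].
have sz : sol u x y z.
  split.
  - apply: zl_eq; apply: zl_mono H => S f [[e _ _] _]; rewrite ahom_str -e.
    by rewrite !rmorphM.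
  - by apply: zl_inv; apply: zl_mono H => S f [[_ e _] _]; rewrite sN.
  move=> a Pa; apply: zl_eq0; apply: zl_mono H => S f [[_ _ e0] _].
  by have := e0 a Pa; rewrite mxE.
exists u, x, y, z; split=> //.
have [tB _] := chaB sz.
pose b' : Bf D R := exist _ (raw (cha u x y z)) (raw_Bsub tB).
have E : b = b'.
  apply: (sheaf_separated (@Bf_sheaf D)); apply: zl_mono H => S f [_ e].
  apply: sub_eq; rewrite -[RHS]/(fmap f (raw (cha u x y z))) -[LHS]/(fmap f (sval b)).
  by rewrite raw_map // chaN e.
by rewrite E.
Qed.

Let inc : morphism (Bf D) (Bamb D).
Proof. by exists (fun R x => sval x). Defined.

Lemma chart_exists (L : calg (OF D)) (x : Bf D L) : is_field L -> U L (sval x) ->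
  exists A (u : Bf D A) (f : ahom A L), [/\ affine_open u, fmap f u = x
    & goodD A /\ cartier_point (preim (bmor D) Z) u].
Proof.
move=> fL Ux.
have [u0 [x0 [y0 [z0 [sz0 xE0]]]]] := chart_factor Ux.
have zE0 := ev_surj (let: And3 _ _ z := sz0 in z).
have [||A [AU [AX [AY [AV [gA AE As Alift Auniq]]]]]] :=
  @chart_alg _ (ud_pi D) _ (ud_res D) (@OF_domain D) (@OF_noetherian D) (@OF_pi_neq0 D)
    (@OF_res_surj D) (@OF_res_ker D) (@OF_two D) (@OF_dvr D) Q presQ m
    (fun R u x y v => s u x y (ev v)).
- by move=> R S g u x1 y v; rewrite sN ev_map.
- by exists L, u0, x0, y0, (fun k => z0 0 (enum_val k)); rewrite -zE0; case: sz0.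
have sA : sol AU AX AY (ev AV) by split=> // a; apply: ev_out.
have [tB tU] := chaB sA; set t := cha _ _ _ _ in tB tU.
pose pt : Bf D A := exist _ (raw t) (raw_Bsub tB).
have ptM R (f : ahom A R) : sval (fmap f pt) = raw (cha (f AU) (f AX) (f AY) (ev (f \o AV))).
  by rewrite -[LHS]/(fmap f (raw t)) raw_map // chaN ev_map.
have fac R (b : Bf D R) : U R (sval b) -> exists f : ahom A R, fmap f pt = b.
  move=> /chart_factor[u [x1 [y [z [sz bE]]]]].
  have zE := ev_surj (let: And3 _ _ z := sz in z).
  have [||f [f1 f2 f3 f4]] := Alift R u x1 y (fun k => z 0 (enum_val k)).
  - by case: sz.
  - by rewrite -zE; case: sz.
  exists f; apply: sub_eq; rewrite ptM f1 f2 f3 bE zE; congr (raw (cha _ _ _ (ev _))).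
  by apply/funext => k; rewrite /= f4.
have [f fE] := fac L x Ux; exists A, pt, f; split=> //.
  split.
    move=> R f' g' /(congr1 sval); rewrite !ptM => E.
    have sf (h : ahom A R) : sol (h AU) (h AX) (h AY) (ev (h \o AV)).
      by rewrite -ev_map; apply: solN.
    have [e1 e2 e3 e4] := chaI (sf f') (sf g') E.
    apply: Auniq => // k.
    by have := congr1 (fun z : 'rV_n => z 0 (enum_val k)) e4; rewrite !ev_val.
  exists (preim inc U); first exact: open_preim.
  move=> R b; split; first exact: fac.
  by move=> [h <-]; exact: (smem_fmap h tU).
split=> //; apply: (raw_cartier tB) => // b bm.
(* [mu] divides [2 pi], a nonzerodivisor on a good chart, so [mu] is one too and the chart is
   Cartier. *)
have [e eE] := chaM sA; have [_ npi _ _ _] := gA.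
apply: npi; apply: (inv_cancel (inv2 A)); rewrite mulr0 mulrA.
have -> : 2 * calg_str A (ud_pi D) = calg_str A (2 * ud_pi D).
  by rewrite rmorphM rmorph_nat.
by rewrite -eE mulrAC -/t bm mul0r.
Qed.
End Chart.

Section Constants.
Variable D : unitary_datum.
Local Notation n := (ud_n D).

Definition cst N (R : calg (OF D)) (r : 'rV[OF D]_N) : 'rV[R]_N := map_mx (calg_str R) r.
Lemma cst_map N (R S : calg (OF D)) (f : ahom R S) (r : 'rV[OF D]_N) :
  map_mx f (cst R r) = cst S r.
Proof. by apply/rowP=> i; rewrite !mxE /= ahom_str. Qed.

Definition half : OF D := sval (cid (OF_two D)).
Lemma halfE : 2 * half = 1.
Proof. by rewrite /half; case: cid. Qed.
Definition hf (R : calg (OF D)) : R := calg_str R half.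
Lemma hfE (R : calg (OF D)) : 2 * hf R = 1.
Proof. by rewrite /hf -(rmorph_nat (calg_str R)) -rmorphM halfE rmorph1. Qed.
Lemma hf_map (R S : calg (OF D)) (f : ahom R S) : f (hf R) = hf S.
Proof. exact: ahom_str. Qed.
Lemma halfK (R : calg (OF D)) (a : R) : 2 * (a * hf R) = a.
Proof. by rewrite mulrCA hfE mulr1. Qed.

Definition beta1 N N' (a : 'rV[OF D]_N) (b : 'rV[OF D]_N') (R : calg (OF D)) : 'M[R]_(N, N') :=
  (cst R a)^T *m cst R b.
Lemma beta1_map N N' (a : 'rV[OF D]_N) (b : 'rV[OF D]_N') (R S : calg (OF D)) (f : ahom R S) :
  map_mx f (beta1 a b R) = beta1 a b S.
Proof. by rewrite /beta1 map_mxM -map_trmx !cst_map. Qed.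
Lemma beta1E N N' (a : 'rV[OF D]_N) (b : 'rV[OF D]_N') (R : calg (OF D)) (v : 'rV[R]_N) (v' : 'rV[R]_N') :
  (v *m beta1 a b R *m v'^T) 0 0 = (v *m (cst R a)^T) 0 0 * (v' *m (cst R b)^T) 0 0.
Proof.
rewrite /beta1 !mulmxA -[v *m _ *m _ *m _]mulmxA mxE big_ord1; congr (_ * _).
by rewrite -[cst R b *m _]trmxK trmx_mul trmxK mxE.
Qed.

Definition cFl (R : calg (OF D)) (x : Bamb D R) : set 'rV[R]_(n + n) := sval x.1.1.1.
Definition cG (R : calg (OF D)) (x : Bamb D R) : set 'rV[R]_(n + n) := sval x.1.2.
Definition cW (R : calg (OF D)) (x : Bamb D R) : set 'rV[R]_n := sval x.2.

Lemma bil_line N N' (M : forall R : calg (OF D), Bamb D R -> set 'rV[R]_N)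
    (M' : forall R : calg (OF D), Bamb D R -> set 'rV[R]_N') beta ME ME' betaE
    (R : calg (OF D)) (x : Bamb D R) v0 v1 e : M R x = line v0 -> M' R x = line v1 ->
  (v0 *m beta R *m v1^T) 0 0 = e -> @bil_open _ _ _ _ M M' beta ME ME' betaE R x <-> invertible e.
Proof.
move=> E E' <-; apply: bil_open_val; last first.
  by exists v0, v1; rewrite E E'; split=> //; exists 1; rewrite ?scale1r.
rewrite E E' => _ _ [s _ <-] [s' _ <-]; exists (s * s').
by rewrite [(s' *: v1)^T]linearZ /= -!scalemxAl -scalemxAr !mxE; ring.
Qed.

Lemma bil_Fl N' (M' : forall R : calg (OF D), Bamb D R -> set 'rV[R]_N') beta ME ME' betaE
    (R : calg (OF D)) (t : tup D R) v1 e : Bd t -> M' R (raw t) = line v1 ->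
  (forall s y, frm (tg t) y = s * tlam t ->
     (lin (- th t) s y *m beta R *m v1^T) 0 0 = s * e) ->
  @bil_open _ _ _ _ cFl M' beta ME ME' betaE R (raw t) <-> invertible e.
Proof.
move=> tB E' H; apply: bil_open_val.
  rewrite E' => _ _ /FlP[s [y [-> Es]]] [s' _ <-]; exists (s' * s).
  by rewrite [(s' *: v1)^T]linearZ /= -scalemxAr mxE H //; ring.
have [_ _ ug _ _] := tB; have [y yE] := unimv_frm ug.
exists (lin (- th t) 1 (tlam t *: y)), v1; split.
- by apply/FlP; exists 1, (tlam t *: y); rewrite frmZr yE mulr1 mul1r.
- by rewrite E'; exists 1; rewrite ?scale1r.
by rewrite H; [rewrite mul1r|rewrite frmZr yE mulr1 mul1r].
Qed.

Lemma inv_sq (R : comNzRingType) (a : R) : invertible (a * a) <-> invertible a.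
Proof. by split=> [/invertibleMl //|ia]; apply: invertibleM. Qed.

Lemma inv_opp (R : comNzRingType) (a : R) : invertible (- a) <-> invertible a.
Proof. by split=> -[b bE]; exists (- b); rewrite ?mulrNN // mulrN -mulNr. Qed.

Lemma delta_mid (R : comNzRingType) i : midb i ->
  (delta_mx 0 i : 'rV[R]_n) *m DM D R = delta_mx 0 i.
Proof.
move=> mi; apply/rowP=> a; rewrite mul_mx_diag !mxE /=.
by case: eqP => [->|_]; rewrite ?mul0r // mi mulr1.
Qed.
Lemma delta_out (R : calg (OF D)) i : ~~ midb i -> (delta_mx 0 i : 'rV[R]_n) *m DM D R = 0.
Proof.
move=> mi; apply/rowP=> a; rewrite mul_mx_diag !mxE /=.
by case: eqP => [->|_]; rewrite ?mul0r // (negPf mi) mulr0.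
Qed.
Lemma DM_out (R : calg (OF D)) (v : 'rV[R]_n) i : ~~ midb i -> (v *m DM D R) 0 i = 0.
Proof. by move=> mi; rewrite mul_mx_diag !mxE (negPf mi) mulr0. Qed.
Lemma DO_out (R : calg (OF D)) (v : 'rV[R]_n) i : ~~ midb i -> (v *m DO D R) 0 i = v 0 i.
Proof. by move=> mi; rewrite mul_mx_diag !mxE mi mulr1. Qed.
Lemma DM_mid (R : calg (OF D)) (v : 'rV[R]_n) i : midb i -> (v *m DM D R) 0 i = v 0 i.
Proof. by move=> mi; rewrite mul_mx_diag !mxE mi mulr1. Qed.
Lemma tg_out (R : calg (OF D)) (t : tup D R) i : ~~ midb i -> tg t 0 i = tq t 0 i.
Proof. by move=> mi; rewrite -(DO_out (tg t) mi) tgO DO_out. Qed.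
Lemma tw_out (R : calg (OF D)) (t : tup D R) i : ~~ midb i -> tw t 0 i = tgam t * tq t 0 i.
Proof. by move=> mi; rewrite -(DO_out (tw t) mi) twO mxE DO_out. Qed.
Lemma tw_mid (R : calg (OF D)) (t : tup D R) i : midb i -> tw t 0 i = tq t 0 i.
Proof. by move=> mi; rewrite -(DM_mid (tw t) mi) twM DM_mid. Qed.
Lemma frm_delta (R : comNzRingType) (v : 'rV[R]_n) i : midb i ->
  frm v (delta_mx 0 i) = - v 0 (rev_ord i).
Proof.
move=> mi; rewrite frm_dotr dotC dot_delta mxE (bigD1 (rev_ord i)) //= big1 => [|a ai].
  rewrite mxE rev_ordK eqxx addr0.
  have : midb (rev_ord i) by rewrite midb_rev.
  by move=> /andP[_ ->]; rewrite mulrN1.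
by rewrite mxE rev_sym (negPf ai) mulr0.
Qed.
Lemma str_2pi (R : calg (OF D)) : calg_str R (2 * ud_pi D) = 2 * piR R.
Proof. by rewrite rmorphM rmorph_nat. Qed.
End Constants.

(** * Charts where [w] has a nonzero middle part *)

Section MainCharts.
Variable D : unitary_datum.
Local Notation n := (ud_n D).
Variables (e0 : 'rV[OF D]_n) (i0 c j : 'I_n) (eps : bool).
Hypotheses (eM : e0 *m DM D _ = e0) (ee : frm e0 e0 = 0) (ei : e0 0 i0 = 1)
  (ec : e0 0 (rev_ord c) = 1) (mc : midb c) (ci : c != i0) (mi : midb i0) (mj : ~~ midb j).

Local Notation eR R := (cst R e0).
Local Notation P := (fun a => [&& a != i0, a != c & a != j]).

Let ji : j != i0. Proof. by apply: contraNneq mj => ->. Qed.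
Let jc : j != c. Proof. by apply: contraNneq mj => ->. Qed.

Section Ring.
Variable R : calg (OF D).
Let e := eR R.
Let eDM : e *m DM D R = e.
Proof. by rewrite /e /cst -(map_DM D (calg_str R)) -map_mxM eM. Qed.
Let qe : frm e e = 0. Proof. by rewrite /e -map_frm ee rmorph0. Qed.
Let e_i : calg_str R (e0 0 i0) = 1. Proof. by rewrite ei rmorph1. Qed.
Let e_j : calg_str R (e0 0 j) = 0.
Proof. by have := DM_out e mj; rewrite eDM mxE. Qed.
Let f_c : frm e (delta_mx 0 c) = -1. Proof. by rewrite frm_delta // mxE ec rmorph1. Qed.
Let f_j : frm e (delta_mx 0 j) = 0.
Proof. by rewrite -eDM frm_Ml delta_out // frm0r. Qed.

Lemma qf_add x a : qf (x + a *: e) = qf x + 2 * a * frm e x.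
Proof.
rewrite /qf mulmxDl -scalemxAl eDM !(frmDl, frmDr, frmZl, frmZr) qe.
by rewrite (frm_symM x) eDM; ring.
Qed.

(** With [e] isotropic, [q] is normalized by [frm e q = -1] and [q_j = 1 - eps nu]. [q1] meets both
    conditions by adjusting the coordinates [c] and [j]. Adding a multiple of [e] preserves them and
    changes [Q] by [-2] times the factor, so in [qb] the value [T = Q(q)] replaces the coordinate at
    [i0]. *)
Definition q1 (nu : R) z := z + (1 + frm e z) *: delta_mx 0 c + (1 - eps%:R * nu) *: delta_mx 0 j.
Definition qb (nu T : R) z := q1 nu z + ((qf (q1 nu z) - T) * hf R) *: e.

Lemma q1_e nu z : frm e (q1 nu z) = -1.
Proof. by rewrite /q1 !frmDr !frmZr f_c f_j; ring. Qed.
Lemma qb_e nu T z : frm e (qb nu T z) = -1.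
Proof. by rewrite /qb frmDr frmZr qe mulr0 addr0 q1_e. Qed.
Lemma qb_qf nu T z : qf (qb nu T z) = T.
Proof.
by rewrite /qb qf_add q1_e halfK; ring.
Qed.
Lemma qb_j nu T (z : 'rV[R]_n) : z 0 j = 0 -> qb nu T z 0 j = 1 - eps%:R * nu.
Proof.
move=> zj; rewrite !(mxE, eqxx) e_j /= (negPf jc) zj mulr0n; ring.
Qed.

Lemma qb_inj nu T T' (z z' : 'rV[R]_n) : (forall a, ~~ P a -> z 0 a = 0) ->
  (forall a, ~~ P a -> z' 0 a = 0) -> qb nu T z = qb nu T' z' -> z = z'.
Proof.
move=> z0 z0' E.
have qi (x : 'rV[R]_n) : (forall a, ~~ P a -> x 0 a = 0) -> q1 nu x 0 i0 = 0.
  by move=> x0; rewrite !(mxE, eqxx) /= [i0 == c]eq_sym [i0 == j]eq_sym (negPf ci) (negPf ji) x0 ?eqxx // !mulr0n; ring.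
have coef : (qf (q1 nu z) - T) * hf R = (qf (q1 nu z') - T') * hf R.
  have := congr1 (fun v : 'rV_n => v 0 i0) E.
  have add0 (u : 'rV[R]_n) a : (u + a *: e) 0 i0 = u 0 i0 + a.
    by rewrite !mxE e_i mulr1.
  by rewrite /qb !add0 !qi // !add0r.
move: E; rewrite /qb coef => /addIr E.
apply/rowP=> a; have [/and3P[ai ac aj]|Pa] := boolP (P a); last by rewrite z0 ?z0'.
have := congr1 (fun v : 'rV_n => v 0 a) E.
by rewrite /q1 !mxE /= (negPf ac) (negPf aj) !mulr0n !mulr0 !addr0.
Qed.

Lemma qb_surj (nu : R) (q : 'rV[R]_n) : frm e q = -1 -> q 0 j = 1 - eps%:R * nu ->
  exists2 z : 'rV[R]_n, (forall a, ~~ P a -> z 0 a = 0) & qb nu (qf q) z = q.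
Proof.
move=> qe1 qj; pose x := q - q 0 i0 *: e.
have xi : x 0 i0 = 0 by rewrite !mxE e_i mulr1 subrr.
have xj : x 0 j = 1 - eps%:R * nu by rewrite !mxE e_j mulr0 subr0.
have xe : frm e x = -1 by rewrite frmDr frmNr frmZr qe mulr0 subr0.
have qE : q = x + q 0 i0 *: e by rewrite subrK.
clearbody x.
pose z := x - x 0 c *: delta_mx 0 c - x 0 j *: delta_mx 0 j.
have zE a : z 0 a = x 0 a - x 0 c * (a == c)%:R - x 0 j * (a == j)%:R.
  by rewrite /z 2!mxE [(- (_ *: delta_mx 0 j)) 0 a]mxE [(- (_ *: delta_mx 0 c)) 0 a]mxE
    [(_ *: delta_mx 0 j) 0 a]mxE [(_ *: delta_mx 0 c) 0 a]mxE [delta_mx 0 j 0 a]mxE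
    [delta_mx 0 c 0 a]mxE.
exists z.
  move=> a; rewrite zE !negb_and !negbK => /or3P[]/eqP->.
  - by rewrite xi [i0 == c]eq_sym [i0 == j]eq_sym (negPf ci) (negPf ji) !mulr0n !mulr0 !subr0.
  - by rewrite eqxx [c == j]eq_sym (negPf jc) mulr1 mulr0n mulr0 subrr subr0.
  - by rewrite eqxx (negPf jc) mulr1 mulr0n mulr0 subr0 subrr.
have ez : 1 + frm e z = x 0 c.
  by rewrite /z !(frmDr, frmNr, frmZr) f_c f_j xe; ring.
have q1E : q1 nu z = x by rewrite /q1 ez -xj /z; apply/rowP=> a; rewrite !mxE; ring.
rewrite /qb q1E [RHS]qE; congr (_ + _ *: _).
rewrite [in qf q]qE qf_add xe; apply: (inv_cancel (inv2 R)); rewrite halfK; ring.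
Qed.

(** The functionals normalizing [g] and [w]. Since [frm e g = nu * frm e q], the condition
    [lf g = 1] reads [q_j = 1 - eps nu] once [mf w = 1]; [eps] is needed at points where all outer
    coordinates of [g] vanish. *)
Definition lf (g : 'rV[R]_n) := g 0 j - eps%:R * frm e g.
Definition mf (w : 'rV[R]_n) := - frm e w.

Lemma lfZ a g : lf (a *: g) = a * lf g.
Proof. by rewrite /lf mxE frmZr; ring. Qed.
Lemma mfZ a g : mf (a *: g) = a * mf g.
Proof. by rewrite /mf frmZr; ring. Qed.

Lemma fe_w (t : tup D R) : frm e (tw t) = frm e (tq t).
Proof. by rewrite -eDM !frm_Ml twM. Qed.
Lemma fe_g (t : tup D R) : frm e (tg t) = tnu t * frm e (tq t).
Proof. by rewrite -eDM !frm_Ml tgM frmZr. Qed.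

Definition nrm (t : tup D R) := frm e (tq t) = -1 /\ tq t 0 j = 1 - eps%:R * tnu t.

Lemma nrm_lm t : nrm t <-> mf (tw t) = 1 /\ lf (tg t) = 1.
Proof.
rewrite /nrm /mf /lf fe_w fe_g tg_out //; split=> -[e1 e2].
  by rewrite e1 e2 opprK; split=> //; ring.
have e3 : frm e (tq t) = -1 by rewrite -[LHS]opprK e1.
split=> //; rewrite e3 in e2; apply: (addIr (eps%:R * tnu t)); rewrite subrK -[RHS]e2; ring.
Qed.

Lemma nrm_unim t : nrm t -> unimv (tg t) /\ unimv (tw t).
Proof.
move=> /nrm_lm[m1 l1]; split.
  exists (delta_mx 0 j - eps%:R *: (e *m Jm D R)).
  by rewrite dotDl dotNl dotZl dotC dot_delta dotC -frm_dotr.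
by exists (- (e *m Jm D R)); rewrite dotNl dotC -frm_dotr.
Qed.

Lemma nrm_inj t t' a b : nrm t -> nrm t' -> tg t' = a *: tg t -> tw t' = b *: tw t ->
  a = 1 /\ b = 1.
Proof.
move=> /nrm_lm[m1 l1] /nrm_lm[m1' l1'] gE wE.
by rewrite gE lfZ l1 mulr1 in l1'; rewrite wE mfZ m1 mulr1 in m1'.
Qed.
End Ring.

Lemma q1_map (R S : calg (OF D)) (f : ahom R S) nu z :
  map_mx f (q1 nu z) = q1 (f nu) (map_mx f z).
Proof.
rewrite /q1 !map_mxD !map_mxZ !map_delta_mx; congr (_ + _ *: _ + _ *: _).
  by rewrite rmorphD rmorph1 /= map_frm cst_map.
by rewrite rmorphB rmorph1 rmorphM rmorph_nat.
Qed.
Lemma qb_map (R S : calg (OF D)) (f : ahom R S) nu T z :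
  map_mx f (qb nu T z) = qb (f nu) (f T) (map_mx f z).
Proof.
by rewrite /qb map_mxD map_mxZ q1_map cst_map rmorphM rmorphB /= qf_map q1_map hf_map.
Qed.

Let lam0 : 'rV[OF D]_n := delta_mx 0 j - eps%:R *: (e0 *m Jm D _).
Let mu0 : 'rV[OF D]_n := - (e0 *m Jm D _).
Let zmu : 'rV[OF D]_(n + n) := row_mx mu0 (ud_pi D *: mu0).

Let cst_J (R : calg (OF D)) : cst R (e0 *m Jm D _) = eR R *m Jm D R.
Proof. by rewrite /cst map_mxM map_J. Qed.
Let lam0E (R : calg (OF D)) (g : 'rV[R]_n) : (g *m (cst R lam0)^T) 0 0 = lf g.
Proof.
rewrite /lam0 /cst map_mxB map_mxZ map_delta_mx rmorph_nat -/(cst R _) cst_J.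
by rewrite -/(dot g _) dotDr dotNr dotZr dot_delta -frm_dotr.
Qed.
Let mu0E (R : calg (OF D)) (w : 'rV[R]_n) : (w *m (cst R mu0)^T) 0 0 = mf w.
Proof.
by rewrite /mu0 /cst map_mxN -/(cst R _) cst_J -/(dot w _) dotNr -frm_dotr.
Qed.
Let zmuE (R : calg (OF D)) (v : 'rV[R]_(n + n)) : (v *m (cst R zmu)^T) 0 0 = mf (zc v).
Proof.
rewrite /zmu /cst map_row_mx map_mxZ -{1}[v]hsubmxK tr_row_mx mul_row_col -/(piR R).
by rewrite linearZ /= -scalemxAr scalemxAl -mulmxDl -/(cst R mu0) mu0E.
Qed.
Let glamE (R : calg (OF D)) (g : 'rV[R]_n) :
  (row_mx (piR R *: g) g *m (cst R (row_mx 0 lam0))^T) 0 0 = lf g.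
Proof.
by rewrite /cst map_row_mx map_mx0 tr_row_mx trmx0 mul_row_col mulmx0 add0r -/(cst R _) lam0E.
Qed.

(** This form reads off [lam]: on [lin (- h) s y] and [(pi g, g)] its value is [frm g y], which
    equals [s * lam] on [F_l]. *)
Let bJ (R : calg (OF D)) : 'M[R]_(n + n, n + n) := block_mx 0 0 0 (Jm D R)^T.
Let bJ_map (R S : calg (OF D)) (f : ahom R S) : map_mx f (bJ R) = bJ S.
Proof. by rewrite /bJ map_block_mx !map_mx0 -map_trmx map_J. Qed.
Let bJE (R : calg (OF D)) (x y g : 'rV[R]_n) g' :
  (row_mx x y *m bJ R *m (row_mx g' g)^T) 0 0 = frm g y.
Proof.
rewrite /bJ mul_row_block !mulmx0 !add0r tr_row_mx mul_row_col mul0mx add0r.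
by rewrite frm_dotr /dot trmx_mul mulmxA.
Qed.

(** On [lin (- h) s y] and [(pi g, g)] the value is [s] times [lam + mu * mf w * lf g]; after
    normalization with [mu = 1] this is [s * (lam + 1)]. *)
Let beL (R : calg (OF D)) := bJ R - beta1 zmu (row_mx 0 lam0) R.
Let beL_map (R S : calg (OF D)) (f : ahom R S) : map_mx f (beL R) = beL S.
Proof. by rewrite /beL map_mxB bJ_map beta1_map. Qed.

Let id1 N (M : forall R : calg (OF D), Bamb D R -> set 'rV[R]_N) :=
  forall (R S : calg (OF D)) (f : ahom R S) x, M S (fmap f x) = ext f (M R x).
Let gid : id1 (@cG D). Proof. by []. Qed.
Let wid : id1 (@cW D). Proof. by []. Qed.
Let fid : id1 (@cFl D). Proof. by []. Qed.

Let UG := bil_open gid gid (@beta1_map D _ _ (row_mx 0 lam0) (row_mx 0 lam0)).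
Let UW := bil_open wid wid (@beta1_map D _ _ mu0 mu0).
Let UL := bil_open fid gid bJ_map.
Let UM := bil_open fid wid (@beta1_map D _ _ zmu mu0).
Let UN := bil_open fid gid beL_map.

Section RawOpen.
Variables (R : calg (OF D)) (t : tup D R).
Hypothesis tB : Bd t.
Let UGE : UG R (raw t) <-> invertible (lf (tg t)).
Proof.
rewrite -inv_sq; apply: bil_line; [reflexivity|reflexivity|].
by rewrite beta1E !glamE.
Qed.
Let UWE : UW R (raw t) <-> invertible (mf (tw t)).
Proof.
rewrite -inv_sq; apply: bil_line; [reflexivity|reflexivity|].
by rewrite beta1E !mu0E.
Qed.
Let ULE : UL R (raw t) <-> invertible (tlam t).
Proof.
by apply: (bil_Fl _ _ _ tB); [reflexivity|move=> s y E; rewrite bJE E].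
Qed.
Let zc_lin s y : zc (lin (- th t) s y) = - s *: th t.
Proof. by rewrite /zc lin_z scalerN scaleNr. Qed.
Let UME : UM R (raw t) <-> invertible (tmu t * (mf (tw t) * mf (tw t))).
Proof.
rewrite -inv_opp; apply: (bil_Fl _ _ _ tB); first reflexivity.
by move=> s y _; rewrite beta1E zmuE mu0E zc_lin /th !mfZ; ring.
Qed.
Let UNE : UN R (raw t) <-> invertible (tlam t + tmu t * mf (tw t) * lf (tg t)).
Proof.
apply: (bil_Fl _ _ _ tB); first reflexivity.
move=> s y E; rewrite /beL mulmxBr mulmxBl mxE bJE E mxE beta1E zmuE glamE zc_lin.
by rewrite /th !mfZ; ring.
Qed.

Definition U1 := meet_sub (meet_sub UG UW) UL.
Definition U3 := meet_sub (meet_sub UG UW) (meet_sub UM UN).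

Lemma U1E : U1 R (raw t) <->
  [/\ invertible (lf (tg t)), invertible (mf (tw t)) & invertible (tlam t)].
Proof.
by rewrite /U1 /=; split=> [[[/UGE a /UWE b] /ULE c']|[/UGE a /UWE b /ULE c']].
Qed.
Lemma U3E : U3 R (raw t) <->
  [/\ invertible (lf (tg t)), invertible (mf (tw t)), invertible (tmu t)
    & invertible (tlam t + tmu t * mf (tw t) * lf (tg t))].
Proof.
rewrite /U3 /=; split=> [[[/UGE a /UWE b] [/UME c' /UNE d]]|[a b c' d]].
  by split=> //; apply: invertibleMl c'.
split; split; [exact/UGE|exact/UWE|apply/UME|exact/UNE].
by apply: invertibleM => //; apply: invertibleM.
Qed.
End RawOpen.

Lemma U1_open : is_open U1.
Proof. by apply: meet_open; [apply: meet_open|]; apply: bil_openP. Qed.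
Lemma U3_open : is_open U3.
Proof. by do !apply: meet_open; apply: bil_openP. Qed.

(** Here [lam = 1]. Setting [u = - Q(q)], [x = mu], [y = nu], the quadratic equation gives
    [gam = x u / 2], and [nu gam = pi] is the relation [uxy = 2 pi]. *)
Definition cha1 (R : calg (OF D)) (u x y : R) z : tup D R :=
  Tup (qb y (- u) z) y (x * u * hf R) 1 x.
Definition s1 (R : calg (OF D)) (u x y : R) (z : 'rV[R]_n) : R := 1.
(** Here [mu = 1]. The coordinate [u = lam + 1] is a unit near [lam = 0], which is why [lam] is
    shifted; with [x = nu] and [y = 2 gam / u] the relation [nu gam = pi] becomes [uxy = 2 pi], and
    [Q(q)] is determined. *)
Definition cha3 (R : calg (OF D)) (u x y : R) z : tup D R :=
  Tup (qb x (- (2 * (u * y * hf R) * (u - 1))) z) x (u * y * hf R) (u - 1) 1.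
Definition s3 (R : calg (OF D)) (u x y : R) (z : 'rV[R]_n) : R := u.

Let half2 (R : calg (OF D)) (a b : R) : a = 2 * b -> a * hf R = b.
Proof. by move=> ->; apply: (inv_cancel (inv2 R)); rewrite halfK. Qed.

Section RingCharts.
Variable R : calg (OF D).
Implicit Types (t : tup D R) (u x y : R) (z : 'rV[R]_n).

Let cha1_nrm u x y z : sol P s1 u x y z -> nrm (cha1 u x y z).
Proof. by move=> [_ _ z0]; split; [apply: qb_e|apply: qb_j; apply: z0; rewrite eqxx !andbF]. Qed.
Let cha3_nrm u x y z : sol P s3 u x y z -> nrm (cha3 u x y z).
Proof. by move=> [_ _ z0]; split; [apply: qb_e|apply: qb_j; apply: z0; rewrite eqxx !andbF]. Qed.

Lemma cha1B u x y z : sol P s1 u x y z ->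
  Bd (cha1 u x y z) /\ U1 R (raw (cha1 u x y z)).
Proof.
move=> sz; have nz := cha1_nrm sz; have [ug uw] := nrm_unim nz.
have [e1 _ _] := sz; rewrite str_2pi in e1.
have tB : Bd (cha1 u x y z).
  split=> //; last by exists 1, 0; rewrite /= mulr1 mul0r addr0.
    by rewrite /= mulrA; apply: half2; rewrite -e1; ring.
  by rewrite /= qb_qf mulr1 halfK; ring.
split=> //; apply/(U1E tB); have [-> ->] := (nrm_lm _).1 nz.
by split; exists 1; rewrite /= mulr1.
Qed.

Lemma cha3B u x y z : sol P s3 u x y z ->
  Bd (cha3 u x y z) /\ U3 R (raw (cha3 u x y z)).
Proof.
move=> sz; have nz := cha3_nrm sz; have [ug uw] := nrm_unim nz.
have [e1 iu _] := sz; rewrite str_2pi in e1.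
have tB : Bd (cha3 u x y z).
  split=> //; last by exists 0, 1; rewrite /= mulr1 mul0r add0r.
    by rewrite /= mulrA; apply: half2; rewrite -e1; ring.
  by rewrite /= qb_qf mul1r subrr.
split=> //; apply/(U3E tB); have [-> ->] := (nrm_lm _).1 nz.
split; try by exists 1; rewrite /= mulr1.
by rewrite /= !mulr1 subrK.
Qed.

Lemma cha1I u x y z u' x' y' z' : sol P s1 u x y z -> sol P s1 u' x' y' z' ->
  raw (cha1 u x y z) = raw (cha1 u' x' y' z') -> [/\ u = u', x = x', y = y' & z = z'].
Proof.
move=> sz sz' E; have [tB _] := cha1B sz; have [tB' _] := cha1B sz'.
have [a [b [c' [gE wE lE mE K]]]] := raw_inj tB tB' E.
have [a1 b1] := nrm_inj (cha1_nrm sz) (cha1_nrm sz') gE wE.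
have {}K := K a1 b1; have c1 : c' = 1 by move: lE; rewrite /= a1 !mulr1.
have {}K := K c1; have ex := congr1 (@tmu _ _) K; have ey := congr1 (@tnu _ _) K.
have eq := congr1 (@tq _ _) K; rewrite /= in ex ey eq.
have eu : u = u'.
  by have := congr1 (@qf D R) eq; rewrite !qb_qf => /oppr_inj.
split=> //; move: eq; rewrite -ey -eu; case: sz sz' => [_ _ z0] [_ _ z0'].
exact: (qb_inj z0 z0').
Qed.

Lemma cha3I u x y z u' x' y' z' : sol P s3 u x y z -> sol P s3 u' x' y' z' ->
  raw (cha3 u x y z) = raw (cha3 u' x' y' z') -> [/\ u = u', x = x', y = y' & z = z'].
Proof.
move=> sz sz' E; have [tB _] := cha3B sz; have [tB' _] := cha3B sz'.
have [a [b [c' [gE wE lE mE K]]]] := raw_inj tB tB' E.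
have [a1 b1] := nrm_inj (cha3_nrm sz) (cha3_nrm sz') gE wE.
have {}K := K a1 b1; have c1 : c' = 1 by move: mE; rewrite /= b1 !mulr1.
have {}K := K c1; have eu := congr1 (@tlam _ _) K; have ex := congr1 (@tnu _ _) K.
have eg := congr1 (@tgam _ _) K.
have eq := congr1 (@tq _ _) K; rewrite /= in ex eu eg eq.
move/addIr: eu => eu; rewrite -eu in eg eq.
have ey : y = y'.
  case: sz => _ iu _; apply: (inv_cancel iu).
  by rewrite -[LHS]halfK -[RHS]halfK /s3 eg.
split=> //; move: eq; rewrite -ey -ex; case: sz sz' => [_ _ z0] [_ _ z0'].
exact: (qb_inj z0 z0').
Qed.

Lemma cha1S t : Bd t -> U1 R (raw t) ->
  exists u x y z, sol P s1 u x y z /\ raw (cha1 u x y z) = raw t.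
Proof.
move=> tB /(U1E tB)[[l' ll] [m' mm] [k' kk]].
have [] := @raw_scale D R t l' (lf (tg t)) m' (mf (tw t)) (lf (tg t) * k') (l' * tlam t) tB.
- by rewrite mulrC. - by rewrite mulrC.
- by transitivity ((lf (tg t) * l') * (tlam t * k')); [ring|rewrite ll kk mulr1].
set t' := Tup _ _ _ _ _ => tB' <- gE wE.
have nt : nrm t' by apply/nrm_lm; rewrite gE wE lfZ mfZ; split; rewrite mulrC.
have l1 : tlam t' = 1.
  by rewrite /=; transitivity ((lf (tg t) * l') * (tlam t * k')); [ring|rewrite ll kk mulr1].
move: t' tB' nt l1 {gE wE} => t' [E1 E2 _ _ _] [n1 n2] l1; rewrite l1 mulr1 in E2.
have [z z0 zE] := qb_surj n1 n2.
have e1 : tmu t' * - qf (tq t') = 2 * tgam t'.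
  by apply/eqP; rewrite -subr_eq0 -[X in _ == X]oppr0 -E2; apply/eqP; ring.
exists (- qf (tq t')), (tmu t'), (tnu t'), z; split.
  split=> //; last by exists 1; rewrite mulr1.
  by rewrite str_2pi -E1 [- _ * _]mulrC e1; ring.
congr raw; apply: tup_eq; rewrite /= ?opprK //; exact: half2.
Qed.

Lemma cha3S t : Bd t -> U3 R (raw t) ->
  exists u x y z, sol P s3 u x y z /\ raw (cha3 u x y z) = raw t.
Proof.
move=> tB /(U3E tB)[[l' ll] [m' mm] [k' kk] [d' dd]].
have [] := @raw_scale D R t l' (lf (tg t)) m' (mf (tw t)) (k' * m') (tmu t * mf (tw t)) tB.
- by rewrite mulrC. - by rewrite mulrC.
- by transitivity ((tmu t * k') * (mf (tw t) * m')); [ring|rewrite kk mm mulr1].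
set t' := Tup _ _ _ _ _ => tB' <- gE wE.
have nt : nrm t' by apply/nrm_lm; rewrite gE wE lfZ mfZ; split; rewrite mulrC.
have m1 : tmu t' = 1.
  by rewrite /=; transitivity ((tmu t * k') * (mf (tw t) * m')); [ring|rewrite kk mm mulr1].
have [w ww] : invertible (tlam t' + 1).
  exists (d' * (tmu t * mf (tw t) * lf (tg t))); rewrite /= -[RHS]dd.
  transitivity (d' * (tlam t * (tmu t * k') * (mf (tw t) * m') * (lf (tg t) * l')
     + tmu t * mf (tw t) * lf (tg t))); first by ring.
  by rewrite kk mm ll !mulr1 mulrC.
move: t' tB' nt m1 w ww {gE wE} => t' [E1 E2 _ _ _] [n1 n2] m1 w ww; rewrite m1 mul1r in E2.
have [z z0 zE] := qb_surj n1 n2.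
have eg : (tlam t' + 1) * (2 * tgam t' * w) * hf R = tgam t'.
  apply: half2; transitivity ((tlam t' + 1) * w * (2 * tgam t')); first by ring.
  by rewrite ww mul1r.
exists (tlam t' + 1), (tnu t'), (2 * tgam t' * w), z; split.
  split=> //; last by exists w.
  rewrite str_2pi -E1; transitivity ((tlam t' + 1) * w * (2 * (tnu t' * tgam t'))); first by ring.
  by rewrite ww mul1r.
congr raw; apply: tup_eq; rewrite /= ?eg ?addrK ?m1 // -[RHS]zE; congr (qb _ _ _).
by apply/eqP; rewrite -subr_eq0 -[X in _ == X]oppr0 -E2; apply/eqP; ring.
Qed.
End RingCharts.

Lemma cha1N (R S : calg (OF D)) (f : ahom R S) u x y z :
  tmap f (cha1 u x y z) = cha1 (f u) (f x) (f y) (map_mx f z).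
Proof.
by apply: tup_eq; rewrite /= ?rmorph1 // ?qb_map ?rmorphN // !rmorphM /= hf_map.
Qed.
Lemma cha3N (R S : calg (OF D)) (f : ahom R S) u x y z :
  tmap f (cha3 u x y z) = cha3 (f u) (f x) (f y) (map_mx f z).
Proof.
have gE : f (u * y * hf R) = f u * f y * hf S by rewrite !rmorphM /= hf_map.
apply: tup_eq; rewrite /= ?rmorph1 ?rmorphB ?rmorph1 ?gE // qb_map; congr (qb _ _ _).
by rewrite rmorphN 2!rmorphM rmorph_nat rmorphB rmorph1 /= gE.
Qed.

Section Apply.
Variable Q : calg (OF D).
Hypothesis presQ : presents Q [:: uxy_rel D].
Local Notation Z := (fiber (tau D) (star D)).

Lemma chart1 (L : calg (OF D)) (x : Bf D L) : is_field L -> U1 L (sval x) ->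
  exists A (u : Bf D A) (f : ahom A L), [/\ affine_open u, fmap f u = x
    & goodD Q A /\ cartier_point (preim (bmor D) Z) u].
Proof.
refine (@chart_exists D Q presQ P s1 cha1 U1 U1_open _ (@cha1N) (@cha1B) (@cha1I)
  (@cha1S) _ L x).
  by move=> R S f u x' y z; rewrite /s1 rmorph1.
by move=> R u x' y z [e1 _ _]; exists (u * y); rewrite -e1; rewrite /cha1 /tmu; ring.
Qed.

Lemma chart3 (L : calg (OF D)) (x : Bf D L) : is_field L -> U3 L (sval x) ->
  exists A (u : Bf D A) (f : ahom A L), [/\ affine_open u, fmap f u = x
    & goodD Q A /\ cartier_point (preim (bmor D) Z) u].
Proof.
refine (@chart_exists D Q presQ P s3 cha3 U3 U3_open _ (@cha3N) (@cha3B) (@cha3I)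
  (@cha3S) _ L x); first by [].
by move=> R u x' y z [e1 _ _]; exists (u * x' * y); rewrite -e1 /cha3 /tmu mul1r.
Qed.
End Apply.
End MainCharts.

(** * The chart around points where the middle part of [w] vanishes *)

Section OuterChart.
Variable D : unitary_datum.
Local Notation n := (ud_n D).
Variables j a b : 'I_n.
Hypotheses (mj : ~~ midb j) (ma : midb a) (mb : midb b) (ab : a != b).
Local Notation P := (fun i => [&& i != j, i != a & i != b]).

Let aj : a != j. Proof. by apply: contraNneq mj => <-. Qed.
Let bj : b != j. Proof. by apply: contraNneq mj => <-. Qed.

Definition q4 (R : calg (OF D)) (u x : R) (z : 'rV[R]_n) : 'rV[R]_n :=
  z + delta_mx 0 j + (u - 1) *: delta_mx 0 a + (x - 1) *: delta_mx 0 b.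
(** Here [w_j] is a unit, hence so is [gam]; normalizing [gam = mu = 1] gives [nu = pi] and
    [lam = - Q(q) / 2], with [q] free apart from [q_j = 1]. The units [u = q_a + 1] and
    [x = q_b + 1] with [y = 2 pi / (u x)] provide the map to [uxy = 2 pi]. *)
Definition cha4 (R : calg (OF D)) (u x y : R) z : tup D R :=
  Tup (q4 u x z) (piR R) 1 (- (qf (q4 u x z) * hf R)) 1.
Definition s4 (R : calg (OF D)) (u x y : R) (z : 'rV[R]_n) : R := u * x.

Let id1 N (M : forall R : calg (OF D), Bamb D R -> set 'rV[R]_N) :=
  forall (R S : calg (OF D)) (f : ahom R S) x, M S (fmap f x) = ext f (M R x).
Let gid : id1 (@cG D). Proof. by []. Qed.
Let wid : id1 (@cW D). Proof. by []. Qed.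

Let dj : 'rV[OF D]_n := delta_mx 0 j.
Let dg : 'rV[OF D]_(n + n) := row_mx 0 dj.
Let UW (r : 'rV[OF D]_n) := bil_open wid wid (@beta1_map D _ _ r r).
Definition U4 := meet_sub (bil_open gid gid (@beta1_map D _ _ dg dg))
  (meet_sub (UW dj) (meet_sub (UW (delta_mx 0 a + dj)) (UW (delta_mx 0 b + dj)))).

Lemma U4_open : is_open U4.
Proof. by do !apply: meet_open; apply: bil_openP. Qed.

Section Ring.
Variable R : calg (OF D).
Implicit Types (t : tup D R) (u x y : R) (z : 'rV[R]_n).

Let djE (w : 'rV[R]_n) i : (w *m (cst R (delta_mx 0 i))^T) 0 0 = w 0 i.
Proof. by rewrite /cst map_delta_mx -/(dot w _) dot_delta. Qed.
Let UWE t r : UW r R (raw t) <-> invertible ((tw t *m (cst R r)^T) 0 0).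
Proof. by rewrite -inv_sq; apply: bil_line; [reflexivity|reflexivity|rewrite beta1E]. Qed.
Let sumE (w : 'rV[R]_n) i : (w *m (cst R (delta_mx 0 i + dj))^T) 0 0 = w 0 i + w 0 j.
Proof. by rewrite /cst map_mxD linearD /= mulmxDr mxE -!/(cst _ _) !djE. Qed.

Lemma U4E t : U4 R (raw t) <-> [/\ invertible (tg t 0 j), invertible (tw t 0 j),
  invertible (tw t 0 a + tw t 0 j) & invertible (tw t 0 b + tw t 0 j)].
Proof.
have GE : bil_open gid gid (@beta1_map D _ _ dg dg) R (raw t) <-> invertible (tg t 0 j).
  rewrite -inv_sq; apply: bil_line; [reflexivity|reflexivity|].
  by rewrite beta1E /dg /cst map_row_mx map_mx0 tr_row_mx trmx0 mul_row_col mulmx0 add0r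
    -/(cst R dj) djE.
rewrite -sumE -sumE -(djE (tw t)) -/dj.
by split=> [[/GE ? [/UWE ? [/UWE ? /UWE ?]]]|[/GE ? /UWE ? /UWE ? /UWE ?]].
Qed.

Let out z : (forall i, ~~ P i -> z 0 i = 0) -> [/\ z 0 j = 0, z 0 a = 0 & z 0 b = 0].
Proof. by move=> z0; rewrite !z0 ?eqxx ?andbF. Qed.
Let q4E u x z i : q4 u x z 0 i = z 0 i + (i == j)%:R + (u - 1) * (i == a)%:R + (x - 1) * (i == b)%:R.
Proof. by rewrite /q4 !(mxE, eqxx). Qed.
Let q4j u x z : (forall i, ~~ P i -> z 0 i = 0) -> q4 u x z 0 j = 1.
Proof.
move=> /out[zj _ _]; rewrite q4E zj eqxx [j == a]eq_sym [j == b]eq_sym (negPf aj) (negPf bj).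
by rewrite !mulr0n !mulr0 add0r !addr0.
Qed.
Let q4a u x z : (forall i, ~~ P i -> z 0 i = 0) -> q4 u x z 0 a = u - 1.
Proof.
move=> /out[_ za _]; rewrite q4E za eqxx (negPf aj) (negPf ab).
by rewrite !mulr0n !mulr0 !add0r mulr1 addr0.
Qed.
Let q4b u x z : (forall i, ~~ P i -> z 0 i = 0) -> q4 u x z 0 b = x - 1.
Proof.
move=> /out[_ _ zb]; rewrite q4E zb eqxx (negPf bj) [b == a]eq_sym (negPf ab).
by rewrite !mulr0n !mulr0 !add0r mulr1.
Qed.

Lemma cha4B u x y z : sol P s4 u x y z -> Bd (cha4 u x y z) /\ U4 R (raw (cha4 u x y z)).
Proof.
move=> [e1 iux z0]; have gj : tg (cha4 u x y z) 0 j = 1 by rewrite tg_out //= q4j.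
have wj : tw (cha4 u x y z) 0 j = 1 by rewrite tw_out //= q4j // mulr1.
split; last first.
  apply/U4E; rewrite gj wj !tw_mid //= q4a // q4b // !subrK.
  split; try by exists 1; rewrite mulr1.
    exact: invertibleMl iux.
  by apply: (@invertibleMl _ x u); rewrite mulrC.
split.
- by rewrite /= mulr1.
- by rewrite /= mulr1 mulrN halfK mul1r addNr.
- by exists (delta_mx 0 j); rewrite dotC dot_delta.
- by exists (delta_mx 0 j); rewrite dotC dot_delta.
by exists 0, 1; rewrite /= mul0r mulr1 add0r.
Qed.

Lemma cha4I u x y z u' x' y' z' : sol P s4 u x y z -> sol P s4 u' x' y' z' ->
  raw (cha4 u x y z) = raw (cha4 u' x' y' z') -> [/\ u = u', x = x', y = y' & z = z'].
Proof.
move=> sz sz' E; have [tB _] := cha4B sz; have [tB' _] := cha4B sz'.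
have [a1 [b1 [c1 [gE wE _ mE K]]]] := raw_inj tB tB' E.
case: sz sz' => [e1 iux z0] [e1' _ z0'].
have ae : a1 = 1.
  have := congr1 (fun v : 'rV_n => v 0 j) gE; rewrite [RHS]mxE !tg_out //= !q4j //.
  by rewrite mulr1.
have be : b1 = 1.
  have := congr1 (fun v : 'rV_n => v 0 j) wE; rewrite [RHS]mxE !tw_out //= !q4j //.
  by rewrite !mulr1.
have ce : c1 = 1 by move: mE; rewrite /= be !mulr1.
have eq := congr1 (@tq _ _) (K ae be ce); rewrite /= in eq.
have eu : u = u'.
  by have := congr1 (fun v : 'rV_n => v 0 a) eq; rewrite !q4a // => /addIr.
have ex : x = x'.
  by have := congr1 (fun v : 'rV_n => v 0 b) eq; rewrite !q4b // => /addIr.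
split=> //; first by apply: (inv_cancel iux); rewrite /s4 e1 eu ex e1'.
by move: eq; rewrite eu ex /q4 => /addIr/addIr/addIr.
Qed.

Lemma cha4S t : Bd t -> U4 R (raw t) ->
  exists u x y z, sol P s4 u x y z /\ raw (cha4 u x y z) = raw t.
Proof.
move=> tB /U4E[[l' ll] [m' mm] ia ib].
(* [gam] is a unit because [w_j = gam q_j] is. Inserting [2 gam lam = - mu Q] into the relation
   between [lam] and [mu] shows that [mu] divides the unit [2 gam]. *)
have [k' kk] : invertible (tmu t).
  have [_ E2 _ _ [al [be E]]] := tB.
  have ig : invertible (2 * tgam t).
    apply: invertibleM; first exact: inv2.
    by exists (tq t 0 j * m'); rewrite mulrA -tw_out.
  apply: (@invertibleMl _ _ (2 * tgam t * be - al * qf (tq t))).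
  have -> : tmu t * (2 * tgam t * be - al * qf (tq t)) = 2 * tgam t; last by [].
  transitivity (2 * tgam t * (al * tlam t + be * tmu t) -
    al * (2 * tgam t * tlam t + tmu t * qf (tq t))); first by ring.
  by rewrite E E2 mulr1 mulr0 subr0.
have [] := @raw_scale D R t l' (tg t 0 j) m' (tw t 0 j) (k' * m') (tmu t * tw t 0 j) tB.
- by rewrite mulrC. - by rewrite mulrC.
- by transitivity ((tmu t * k') * (tw t 0 j * m')); [ring|rewrite kk mm mulr1].
set t' := Tup _ _ _ _ _ => tB' <- gE wE.
have gj : tg t' 0 j = 1 by rewrite gE mxE mulrC.
have wj : tw t' 0 j = 1 by rewrite wE mxE mulrC.
have im : invertible m' by exists (tw t 0 j); rewrite mulrC.
have ia' : invertible (tw t' 0 a + 1).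
  rewrite -wj wE [X in X + _]mxE [X in _ + X]mxE -mulrDr; exact: invertibleM.
have ib' : invertible (tw t' 0 b + 1).
  rewrite -wj wE [X in X + _]mxE [X in _ + X]mxE -mulrDr; exact: invertibleM.
have m1 : tmu t' = 1.
  by rewrite /=; transitivity ((tmu t * k') * (tw t 0 j * m')); [ring|rewrite kk mm mulr1].
move: t' tB' gj wj ia' ib' m1 {gE wE} => t' [E1 E2 _ _ _] gj wj ia' ib' m1.
rewrite tg_out // in gj; rewrite tw_out // gj mulr1 in wj.
rewrite !tw_mid // in ia' ib'; rewrite wj mulr1 in E1; rewrite wj m1 mulr1 mul1r in E2.
pose u := tq t' 0 a + 1; pose x := tq t' 0 b + 1.
have [v vE] := invertibleM ia' ib'; rewrite -/u -/x in vE.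
pose z := tq t' - delta_mx 0 j - (u - 1) *: delta_mx 0 a - (x - 1) *: delta_mx 0 b.
have zE : q4 u x z = tq t' by apply/rowP=> i; rewrite /q4 /z !mxE; ring.
have zC i : z 0 i = tq t' 0 i - (i == j)%:R - (u - 1) * (i == a)%:R - (x - 1) * (i == b)%:R.
  by rewrite -zE q4E; ring.
exists u, x, (2 * piR R * v), z; split.
  split; last 2 first.
  - by exists v.
  - move=> i; rewrite zC !negb_and !negbK => /or3P[]/eqP->.
    + rewrite gj eqxx [j == a]eq_sym [j == b]eq_sym (negPf aj) (negPf bj).
      by rewrite !mulr0n !mulr0 !subr0 subrr.
    + by rewrite eqxx (negPf aj) (negPf ab) !mulr0n mulr0 mulr1 !subr0 addrK subrr.
    + rewrite eqxx (negPf bj) [b == a]eq_sym (negPf ab) !mulr0n mulr0 mulr1 !subr0.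
      by rewrite addrK subrr.
  by rewrite str_2pi; transitivity (2 * piR R * (u * x * v)); [ring|rewrite vE mulr1].
congr raw; apply: tup_eq; rewrite /= ?zE //.
apply: (inv_cancel (inv2 R)); rewrite mulrN halfK.
by apply/eqP; rewrite eq_sym -subr_eq0 opprK E2.
Qed.
End Ring.

Lemma cha4N (R S : calg (OF D)) (f : ahom R S) u x y z :
  tmap f (cha4 u x y z) = cha4 (f u) (f x) (f y) (map_mx f z).
Proof.
have qE : map_mx f (q4 u x z) = q4 (f u) (f x) (map_mx f z).
  by rewrite /q4 !map_mxD !map_mxZ !map_delta_mx !rmorphB !rmorph1.
apply: tup_eq; rewrite /= ?rmorph1 ?map_piR //.
by rewrite rmorphN rmorphM /= qf_map qE hf_map.
Qed.

Lemma chart4 (Q : calg (OF D)) (L : calg (OF D)) (x : Bf D L) :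
  presents Q [:: uxy_rel D] -> is_field L -> U4 L (sval x) ->
  exists A (u : Bf D A) (f : ahom A L), [/\ affine_open u, fmap f u = x
    & goodD Q A /\ cartier_point (preim (bmor D) (fiber (tau D) (star D))) u].
Proof.
move=> presQ; refine (@chart_exists D Q presQ P s4 cha4 U4 U4_open _ (@cha4N) (@cha4B)
  (@cha4I) (@cha4S) _ L x); first by move=> R S f u x' y z; rewrite /s4 rmorphM.
by move=> R u x' y z [e1 _ _]; exists (u * x' * y); rewrite -e1 /cha4 /tmu mul1r.
Qed.
End OuterChart.

(** * The charts cover the blow-up *)

Section Cover.
Variable D : unitary_datum.
Local Notation n := (ud_n D).
Variable Q : calg (OF D).
Hypothesis presQ : presents Q [:: uxy_rel D].

Let ord (i : nat) (h : (i < n)%N) : 'I_n := Ordinal h.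
Let n0 : (0 < n)%N. Proof. by have [] := l_bounds D; lia. Qed.
Let nl : (ud_l D < n)%N. Proof. by have [] := l_bounds D; lia. Qed.
Let nl1 : ((ud_l D).+1 < n)%N. Proof. by have [] := l_bounds D; lia. Qed.
Let m0 : ~~ midb (ord n0). Proof. by have [] := l_bounds D; rewrite /midb /=; lia. Qed.
Let ml : midb (ord nl). Proof. by have [] := l_bounds D; rewrite /midb /=; lia. Qed.
Let ml1 : midb (ord nl1). Proof. by have [] := l_bounds D; rewrite /midb /=; lia. Qed.
Let ll1 : ord nl != ord nl1.
Proof. by apply/negP => /eqP/(congr1 val)/=; lia. Qed.
Let lrev : rev_ord (ord nl) != ord nl.
Proof. by have [] := l_bounds D; move=> ? ?; apply/negP => /eqP/(congr1 val)/=; lia. Qed.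

(** If [w] has a nonzero middle coordinate in a hyperbolic pair, a basis vector works. Otherwise
    only the self-dual coordinate [i] remains, whose basis vector is anisotropic; a hyperbolic pair,
    available because the middle block has at least three coordinates, corrects it. *)
Lemma isotropic (L : calg (OF D)) (w : 'rV[L]_n) i : midb i -> w 0 i != 0 ->
  exists (e0 : 'rV[OF D]_n) (i0 c : 'I_n),
    [/\ e0 *m DM D _ = e0, frm e0 e0 = 0, e0 0 i0 = 1 & e0 0 (rev_ord c) = 1] /\
    [/\ midb c, c != i0, midb i0 & frm (cst L e0) w != 0].
Proof.
move=> mi wi.
have fd (a : 'I_n) : midb a -> frm (delta_mx 0 a) w = - w 0 (rev_ord a).
  move=> ma; rewrite -(delta_mid _ ma) frm_symM frm_delta // DM_mid // midb_rev //.
have [/existsP[a /andP[/andP[ma wa] ra]]|no] :=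
    boolP [exists a, (midb a && (w 0 a != 0)) && (rev_ord a != a)].
  exists (delta_mx 0 (rev_ord a)), (rev_ord a), a.
  have mr : midb (rev_ord a) by rewrite midb_rev.
  split; split=> //; rewrite ?delta_mid ?frm_delta // ?mxE ?rev_ordK ?eqxx //.
  - by rewrite eq_sym (negPf ra) oppr0.
  - by rewrite eq_sym.
  by rewrite /cst map_delta_mx fd // rev_ordK oppr_eq0.
have w0 a : midb a -> rev_ord a != a -> w 0 a = 0.
  by move=> ma ra; apply/eqP; apply: contraNT no => wa; apply/existsP; exists a; rewrite ma wa.
have ri : rev_ord i = i by apply/eqP; apply: contraNT wi => ri; rewrite w0.
pose b := ord nl; have mb : midb b := ml; have mrb : midb (rev_ord b) by rewrite midb_rev.
have bi : b != i by apply: contraNneq lrev => bi; rewrite -/b bi ri.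
have rbi : rev_ord b != i by apply: contraNneq bi => e; rewrite -[b]rev_ordK e ri.
(* The value [1] contributed by the pair with coefficients [1] and [- half] cancels the value [-1]
   of the form at [delta_mx 0 i]. *)
pose e0 : 'rV[OF D]_n := delta_mx 0 b + delta_mx 0 i - half D *: delta_mx 0 (rev_ord b).
have e0E a : e0 0 a = (a == b)%:R + (a == i)%:R - half D * (a == rev_ord b)%:R.
  by rewrite /e0 !(mxE, eqxx).
have eb : e0 0 b = 1.
  by rewrite e0E eqxx (negPf bi) eq_sym (negPf lrev) !mulr0n mulr0 subr0 addr0.
have er : e0 0 (rev_ord b) = - half D.
  by rewrite e0E eqxx (negPf lrev) (negPf rbi) !mulr0n mulr1 !add0r.
have ei : e0 0 i = 1.
  rewrite e0E eqxx [i == b]eq_sym [i == rev_ord b]eq_sym (negPf bi) (negPf rbi).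
  by rewrite !mulr0n mulr0 subr0 add0r.
exists e0, b, i; split; split=> //.
- by rewrite /e0 mulmxBl mulmxDl -scalemxAl !delta_mid.
- rewrite -[frm e0 e0]/(frm e0 (delta_mx 0 b + delta_mx 0 i - half D *: delta_mx 0 (rev_ord b))).
  rewrite !(frmDr, frmNr, frmZr) !frm_delta // rev_ordK eb er ri ei.
  have e : half D + half D = 1 by rewrite -(halfE D); ring.
  apply/eqP; rewrite -subr_eq0; apply/eqP; transitivity (half D + half D - 1); first by ring.
  by rewrite e subrr.
- by rewrite ri.
- by rewrite eq_sym.
have -> : cst L e0 = delta_mx 0 b + delta_mx 0 i - hf L *: delta_mx 0 (rev_ord b).
  by rewrite /cst /e0 map_mxB map_mxD map_mxZ !map_delta_mx.
rewrite !(frmDl, frmNl, frmZl) !fd // rev_ordK ri (w0 b) // (w0 (rev_ord b)) //.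
  by rewrite !oppr0 mulr0 subr0 add0r oppr_eq0.
by rewrite rev_ordK eq_sym.
Qed.

(** At a field point, a nonzero middle part of [w] leads to [U1] or [U3] according to whether [lam]
    is nonzero; if the middle part vanishes, [w] has a nonzero outer coordinate and [U4] applies. *)
Lemma B_charts (L : calg (OF D)) (x : Bf D L) : is_field L ->
  exists A (u : Bf D A) (f : ahom A L), [/\ affine_open u, fmap f u = x
    & goodD Q A /\ cartier_point (preim (bmor D) (fiber (tau D) (star D))) u].
Proof.
move=> fL; have [t tB tE] := field_point x fL.
have domL (a b : L) : a != 0 -> b != 0 -> a * b != 0.
  move=> /fL[a' aE]; apply: contraNneq => e.
  by rewrite -[b]mul1r -aE mulrAC e mul0r.
have nz (v : 'rV[L]_n) : unimv v -> exists i, v 0 i != 0.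
  move=> [xi xiE]; apply/existsP; apply: contraT; rewrite negb_exists => /forallP v0.
  have : v = 0 by apply/rowP=> i; rewrite mxE; apply/eqP; rewrite -[_ == _]negbK v0.
  by move=> ve; move: xiE; rewrite ve dot0r => /eqP; rewrite eq_sym oner_eq0.
have [E1 E2 ug uw [al [be alE]]] := tB.
have [/existsP[i /andP[mi wi]]|nomid] := boolP [exists i, midb i && (tw t 0 i != 0)].
  have [e0 [i0 [c [[eM ee ei ec] [mc ci mi0 ew]]]]] := isotropic mi wi.
  (* [g] is normalized by a nonzero outer coordinate if there is one. Otherwise [g = nu q_M], so
     [nu] is nonzero and [frm e g] does not vanish. *)
  have [j [eps [mj lj]]] : exists (j : 'I_n) (eps : bool), ~~ midb j /\ lf e0 j eps (tg t) != 0.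
    have [/existsP[j /andP[mj gj]]|noout] := boolP [exists j, ~~ midb j && (tg t 0 j != 0)].
      by exists j, false; split=> //; rewrite /lf mulr0n mul0r subr0.
    have g0 k : ~~ midb k -> tg t 0 k = 0.
      by move=> mk; apply/eqP; apply: contraNT noout => gk; apply/existsP; exists k; rewrite mk gk.
    exists (ord n0), true; split=> //; rewrite /lf g0 // sub0r mul1r oppr_eq0 fe_g //.
    rewrite -(fe_w eM); apply: (domL) => //; apply: contraT; rewrite negbK => /eqP nu0.
    have [k gk] := nz _ ug; case/eqP: gk; have [mk|mk] := boolP (midb k); last exact: g0.
    by rewrite -(DM_mid _ mk) tgM nu0 scale0r mxE.
  have iw : invertible (mf e0 (tw t)) by apply: fL; rewrite /mf oppr_eq0.
  have [l0|lam0] := eqVneq (tlam t) 0.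
    have mu0 : tmu t != 0.
      apply: contraTneq (oner_neq0 L) => mu0; move: alE; rewrite l0 mu0 !mulr0 addr0 => <-.
      by rewrite eqxx.
    apply: (chart3 (eps := eps) eM ee ei ec mc ci mi0 mj presQ fL); rewrite tE.
    apply/U3E => //; rewrite l0 add0r; split=> //; try exact: fL.
    apply: fL; apply: (domL) => //; apply: (domL) => //.
    by rewrite /mf oppr_eq0.
  apply: (chart1 (eps := eps) eM ee ei ec mc ci mi0 mj presQ fL); rewrite tE.
  by apply/U1E => //; split=> //; apply: fL.
have w0 k : midb k -> tw t 0 k = 0.
  by move=> mk; apply/eqP; apply: contraNT nomid => gk; apply/existsP; exists k; rewrite mk gk.
have [j wj] := nz _ uw.
have mj : ~~ midb j by apply: contraNN wj => mj; rewrite w0.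
apply: (chart4 mj ml ml1 ll1 presQ fL); rewrite tE; apply/U4E => //.
rewrite (w0 _ ml) (w0 _ ml1) !add0r; split; try exact: fL.
apply: fL; apply: contraNneq wj; rewrite tg_out // tw_out // => ->.
by rewrite mulr0.
Qed.
End Cover.

(** * Projective space *)

Section Projective.
Variable O : comNzRingType.

Definition ray (R : comNzRingType) N (v : 'rV[R]_N) : set 'rV[R]_N := [set s *: v | s in setT].

Lemma ray_submodule (R : comNzRingType) N (v : 'rV[R]_N) : submodule (ray v).
Proof.
split=> [|b _ _ [s _ <-] [s' _ <-]]; first by exists 0; rewrite ?scale0r.
by exists (b * s + s'); rewrite // scalerDl scalerA.
Qed.

Lemma ray_in (R : comNzRingType) N (v : 'rV[R]_N) : ray v v.
Proof. by exists 1; rewrite ?scale1r. Qed.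

Lemma ray_map (R S : calg O) (f : ahom R S) N (v : 'rV[R]_N) : ext f (ray v) = ray (map_mx f v).
Proof.
rewrite eqEsubset; split.
  apply: ext_ind => [|_ [s _ <-]]; first exact: ray_submodule.
  by exists (f s); rewrite // map_mxZ.
move=> _ [s _ <-]; apply: (submoduleZ _ (submodule_ext f _)).
by apply: ext_in; apply: ray_in.
Qed.

Lemma ray_unit (R : comNzRingType) N (v : 'rV[R]_N) a b : a * b = 1 -> ray (a *: v) = ray v.
Proof.
move=> ab; rewrite eqEsubset; split=> _ [s _ <-]; first by exists (s * a); rewrite // scalerA.
by exists (s * b); rewrite // scalerA -mulrA [b * a]mulrC ab mulr1.
Qed.

Lemma ray_summand (R : comNzRingType) N (v : 'rV[R]_N) i : invertible (v 0 i) ->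
  free_summand 1 (ray v) setT.
Proof.
move=> [b vb]; split.
  exists v; split=> [a av|].
    have e : a 0 0 *: v = 0 by rewrite -mul_scalar_mx -mx11_scalar.
    apply/matrixP=> x y; rewrite !ord1 mxE -[LHS]mulr1 -vb mulrA.
    by have := congr1 (fun z : 'rV_N => z 0 i) e; rewrite !mxE => ->; rewrite mul0r.
  rewrite eqEsubset; split=> _ [s _ <-]; first by exists s%:M; rewrite // mul_scalar_mx.
  by exists (s 0 0); rewrite // [s in RHS]mx11_scalar mul_scalar_mx.
exists [set x | x 0 i = 0]; split.
- by split=> [|a x y /= x0 y0]; rewrite /= !mxE // x0 y0 mulr0 addr0.
- move=> _ [s _ <-]; rewrite /= mxE => e.
  by rewrite -[s]mulr1 -vb mulrA e mul0r scale0r.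
rewrite eqEsubset; split=> // x _; exists ((x 0 i * b) *: v); first by exists (x 0 i * b).
exists (x - (x 0 i * b) *: v); last by rewrite addrC subrK.
by rewrite /= !mxE -mulrA [b * _]mulrC vb mulr1 subrr.
Qed.

Lemma field_summand (L : calg O) N (M : set 'rV[L]_N) : is_field L -> submodule M ->
  loc_summand 1 M setT -> exists v i, M = ray v /\ invertible (v 0 i).
Proof.
move=> fL sM lM; have p0 : is_prime [set a : L | ahom_id L a = 0] := isf_kernel (ahom_id L) fL.
have [f f0 H] := (zar_primes _).1 lM _ p0.
have [|[v [vi ME]] _] := H L (ahom_id L); first by apply: fL; apply/eqP => e; apply: f0.
rewrite (ext_id sM) in ME.
have [i vi0] : exists i, v 0 i != 0.
  apply/existsP; apply: contraT; rewrite negb_exists => /forallP v0.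
  have ve : v = 0 by apply/rowP=> j; rewrite mxE; apply/eqP; rewrite -[_ == _]negbK v0.
  have := vi 1%:M; rewrite ve mulmx0 => /(_ erefl)/matrixP/(_ 0 0); rewrite !mxE eqxx.
  by move=> /eqP; rewrite oner_eq0.
exists v, i; split; last exact: fL.
rewrite ME eqEsubset; split=> _ [s _ <-].
  by exists (s 0 0); rewrite // [s in RHS]mx11_scalar mul_scalar_mx.
by exists s%:M; rewrite // mul_scalar_mx.
Qed.

Variable m : nat.
Local Notation PS := (projective_space O m).

Lemma proj_sheaf : is_sheaf PS.
Proof.
apply: sub_sheaf; first exact: submods_sheaf.
move=> R x H; apply: zl_trans; apply: zl_mono H => S f; apply: zl_mono => T h /=.
by rewrite !ext_setT ext_comp.
Qed.

Definition ppt (R : calg O) (v : 'rV[R]_m.+1) i (iv : invertible (v 0 i)) : PS R.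
Proof.
refine (exist _ (exist _ (ray v) (ray_submodule v)) _).
apply: zl_all => S f; rewrite ext_setT /= ray_map; apply: (@ray_summand _ _ _ i).
by rewrite mxE; apply: rmorph_inv.
Defined.

Lemma ppt_map (R S : calg O) (f : ahom R S) (v : 'rV[R]_m.+1) i
    (iv : invertible (v 0 i)) (w : 'rV[S]_m.+1) j (iw : invertible (w 0 j)) : map_mx f v = w -> fmap f (ppt iv) = ppt iw.
Proof. by move=> e; apply: sub_eq; apply: submods_eq; rewrite /= ray_map e. Qed.

Let del (i : 'I_m.+1) (R : calg O) : 'M[R]_m.+1 := delta_mx i i.
Let del_map i (R S : calg O) (f : ahom R S) : map_mx f (del i R) = del i S.
Proof. exact: map_delta_mx. Qed.
Let PM (R : calg O) (x : PS R) : set 'rV[R]_m.+1 := sval (sval x).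
Let PME (R S : calg O) (f : ahom R S) x : PM (fmap f x) = ext f (PM x). Proof. by []. Qed.
Let UP i := bil_open PME PME (del_map i).

Let delE i (R : calg O) (v v' : 'rV[R]_m.+1) : (v *m del i R *m v'^T) 0 0 = v 0 i * v' 0 i.
Proof.
rewrite mxE (bigD1 i) //= big1 => [|a ai].
  rewrite addr0 !mxE; congr (_ * _); rewrite (bigD1 i) //= big1 => [|a ai].
    by rewrite !mxE !eqxx mulr1 addr0.
  by rewrite !mxE (negPf ai) mulr0.
rewrite [X in X * _]mxE big1 ?mul0r // => b _.
by rewrite !mxE (negPf ai) andbF mulr0.
Qed.

Lemma proj_charts : locally_on (fun A (_ : PS A) => smooth_alg A).
Proof.
move=> L x fL _; have [v0 [i [xE iv0]]] := field_summand fL (svalP (sval x)) (svalP x).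
(* Imposing [X_i = 1] instead of dropping this variable keeps the homogeneous coordinates as
   coordinates of the chart. *)
pose rel : {mpoly O[m.+1]} := 'X_i - 1.
have relE (R : calg O) (v : 'I_m.+1 -> R) : mmap (calg_str R) v rel = v i - 1.
  by rewrite rmorphB rmorph1 /= mmapX mmap1U.
pose OO := @Calg O O idfun.
have [|A [b [bs bk]]] := @presents_exists O m.+1 [:: rel] OO (fun=> 1).
  by move=> p; rewrite inE => /eqP ->; rewrite relE subrr.
have bi : b i = 1.
  apply/eqP; rewrite -subr_eq0 -relE; apply/eqP/bk; apply: span_sub.
  by rewrite /= inE.
have lift (R : calg O) (v : 'I_m.+1 -> R) : v i = 1 -> exists f : ahom A R, forall j, f (b j) = v j.
  move=> vi; apply: (presents_lift bs bk) => p; rewrite inE => /eqP ->.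
  by rewrite relE vi subrr.
have uniq (R : calg O) (f g : ahom A R) : (forall j, f (b j) = g (b j)) -> f = g.
  move=> e; apply: ahom_eq; apply: (generated_ext (mmap_generated bs)) => // a.
  exact: (etrans (ahom_str f a) (esym (ahom_str g a))).
have smA : smooth_alg A.
  split; first by exists m.+1, [:: rel], b.
  move=> C D p [ps p2] v.
  have /choice[c cE] : forall j, exists c, p c = v (b j) by move=> j; apply: ps.
  have [|w wE] := lift C (fun j => if j == i then 1 else c j); first by rewrite eqxx.
  exists w; apply: uniq => j; rewrite /= wE; case: eqP => [->|_]; last exact: cE.
  by rewrite bi !rmorph1.
have iv (R : calg O) (f : ahom A R) : invertible ((\row_j f (b j) : 'rV_m.+1) 0 i).
  by rewrite mxE bi rmorph1; exists 1; rewrite mulr1.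
pose pt := ppt (iv A (ahom_id A)).
have ptE (R : calg O) (f : ahom A R) : PM (fmap f pt) = ray (\row_j f (b j)).
  by rewrite /PM /= ray_map; congr ray; apply/rowP=> j; rewrite !mxE.
have ptU (R : calg O) (y : PS R) : UP i R y -> exists f : ahom A R, fmap f pt = y.
  move=> Uy; have sM : submodule (PM y) := svalP (sval y).
  have iI : is_ideal [set a | exists2 w, PM y w & w 0 i = a].
    split=> [|_ _ [u Mu <-] [u' Mu' <-]|a _ [u Mu <-]].
    - by exists 0; [exact: (submodule0 sM)|rewrite mxE].
    - by exists (u + u'); [exact: (submoduleD sM)|rewrite mxE].
    - by exists (a *: u); [exact: (submoduleZ _ sM)|rewrite mxE].
  have [w Mw wi] : exists2 w, PM y w & w 0 i = 1.
    apply: (span_min iI _ Uy) => _ [u [u' [Mu Mu' ->]]]; rewrite delE.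
    by exists (u 0 i *: u'); [exact: (submoduleZ _ sM)|rewrite mxE].
  have [f fE] := lift R (fun j => w 0 j) wi; exists f; apply: sub_eq; apply: submods_eq.
  have -> : sval (sval (fmap f pt)) = ray w.
    by rewrite -/(PM _) ptE; congr ray; apply/rowP=> j; rewrite mxE fE.
  apply: zl_eqmod; [exact: ray_submodule|exact: sM|].
  apply: zl_mono (svalP y) => S g [[a [_ ME]] _]; rewrite ray_map ME.
  have : ext g (PM y) (map_mx g w) by apply: ext_in.
  rewrite /PM ME => -[s _]; rewrite [s]mx11_scalar mul_scalar_mx => e.
  have sa : s 0 0 * a 0 i = 1.
    by have := congr1 (fun z : 'rV_m.+1 => z 0 i) e; rewrite !mxE wi rmorph1.
  rewrite -e (ray_unit _ sa) eqEsubset; split=> _ [r _ <-].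
    by exists r%:M; rewrite // mul_scalar_mx.
  by exists (r 0 0); rewrite // [r in RHS]mx11_scalar mul_scalar_mx.
have Upt : UP i A pt.
  apply: span_sub; exists (\row_j b j), (\row_j b j).
  have pM : PM pt (\row_j b j) by apply: ray_in.
  by split=> //; rewrite delE !mxE bi mulr1.
have [|f fE] := ptU L x.
  have [c cE] := invertibleM iv0 iv0; rewrite /= -cE mulrC.
  apply: (idealM_l _ (span_ideal _)); apply: span_sub; exists v0, v0.
  have Mv : PM x v0 by rewrite /PM xE; apply: ray_in.
  by split=> //; rewrite delE.
exists A, pt, f; split=> //; split.
  move=> R g g' e; apply: uniq => j.
  have := congr1 (@PM R) e; rewrite !ptE => E.
  have [s _ sE] : ray (\row_j g' (b j)) (\row_j g (b j)) by rewrite -E; apply: ray_in.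
  have s1 : s = 1.
    by have := congr1 (fun z : 'rV_m.+1 => z 0 i) sE; rewrite !mxE bi !rmorph1 mulr1.
  by have := congr1 (fun z : 'rV_m.+1 => z 0 j) sE; rewrite !mxE s1 mul1r.
exists (UP i); first exact: bil_openP.
move=> R y; split; first exact: ptU.
by move=> [g <-]; exact: (smem_fmap g Upt).
Qed.

Lemma proj_smooth : smooth_over_base PS.
Proof.
split; last exact: proj_charts.
split; first exact: proj_sheaf.
move=> L x fL _; have [A [u [f [ao fE _]]]] := proj_charts fL (x := x) I.
by exists A, u, f.
Qed.

End Projective.

(* The generic point of projective space lies in every nonempty open subset:  *)
(* it is read off on the cone k[X_0, ..., X_m]. *)
Lemma proj_generic (k : fieldType) (m : nat) :
  exists (K : calg k) (eta : projective_space k m K), is_field K /\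
    forall U : subfunctor (projective_space k m), is_open U ->
      forall (L : calg k) (x : projective_space k m L), is_field L -> U L x -> U K eta.
Proof.
have nk : noetherian k.
  move=> I iI; have [[a Ia a0]|no] := pselect (exists2 a, I a & a != 0).
    by exists [:: 1]; rewrite eqEsubset; split=> b _;
      [rewrite -[b]mulr1; apply: (idealM_l _ (span_ideal _)); apply: span_sub; rewrite /= inE
      |rewrite -[b]mulr1 -(mulVf a0) mulrA; apply: (idealM_l _ iI)].
  exists [::]; rewrite eqEsubset; split=> b.
    move=> Ib; apply/ideal_span_nil; apply: contrapT => b0; apply: no.
    by exists b => //; apply/eqP.
  by move=> /ideal_span_nil ->; apply: (ideal_0 iI).
have [P [h [X [[genX freeX] _ dP _]]]] := @free_exists k m.+1 nk (@field_domain k).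
have [K [phi phi0]] := domain_fraction dP.
pose PA := @Calg k P h; pose KA := @Calg k K (phi \o h).
have fK : is_field KA := @field_isf K.
pose ph := @ahom_of _ PA KA phi (fun=> erefl).
have X0 j : X j <> 0.
  move=> e; have [g [_ gX]] := freeX k idfun (fun=> 1).
  by have := gX j; rewrite e rmorph0 => /eqP; rewrite eq_sym oner_eq0.
have phX j : invertible (phi (X j)).
  by apply: fK; apply/eqP => e; apply: (X0 j); apply: phi0.
have iK : invertible ((\row_j phi (X j) : 'rV[KA]_m.+1) 0 0) by rewrite mxE.
exists KA, (ppt iK); split=> // U oU L x fL Ux.
have [v [i [xE iv]]] := field_summand fL (svalP (sval x)) (svalP x).
have [g [gh gX]] := freeX L (calg_str L) (fun j => v 0 j).
pose gA := @ahom_of _ PA L g gh.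
have nX : forall q, X i ^+ q != 0.
  move=> q; apply/eqP => e; have [_ _ pM] := dP; apply: (X0 i).
  exact: (primeX dP e).
have [A [j lj]] := @locf_exists k PA (X i) nX.
have [_ ui jex] := lj; have [[_ num _] _ _] := lj.
have [f1 f1E] : exists f1 : ahom A L, ahom_comp f1 j = gA.
  by apply: jex; rewrite /= gX.
have [f2 f2E] : exists f2 : ahom A KA, ahom_comp f2 j = ph by apply: jex; apply: phX.
have iA : invertible ((\row_q j (X q) : 'rV[A]_m.+1) 0 i) by rewrite mxE.
have e1 q : f1 (j (X q)) = v 0 q by rewrite -gX -[RHS]/(gA (X q)) -f1E.
have e2 q : f2 (j (X q)) = phi (X q) by rewrite -[RHS]/(ph (X q)) -f2E.
have p1 : fmap f1 (ppt iA) = x.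
  apply: sub_eq; apply: submods_eq; rewrite xE /= ray_map; congr ray.
  by apply/rowP=> q; rewrite !mxE e1.
have p2 : fmap f2 (ppt iA) = ppt iK.
  by apply: ppt_map; apply/rowP=> q; rewrite !mxE e2.
(* On the chart where [X_i] is invertible, [U] contains the locus where some [f] is invertible. As
   [f] does not vanish at [x], it is a nonzero element of a localization of the domain [P], so it is
   nonzero at the generic point. *)
rewrite -p1 in Ux; have [f f0 fU] := open_field oU Ux.
rewrite -p2; apply: fU; apply: fK; apply: contraNneq f0 => f20.
have [a [_ [[q ->] aE]]] := num f.
have a0 : a = 0.
  apply: phi0; rewrite -[phi a]/(ph a) -f2E /= -aE rmorphM /= f20 mul0r.
  by [].
move: aE; rewrite a0 rmorph0 rmorphXn /= => /(congr1 f1); rewrite rmorphM rmorph0 => e.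
apply/eqP; apply: (inv_cancelr (u := f1 (j (X i) ^+ q))); last by rewrite mul0r.
by apply: rmorph_inv; apply: invertibleX.
Qed.

(** * The fiber over the worst point *)

Section Images.

Definition mimg (R : comNzRingType) N P (M : set 'rV[R]_N) (A : 'M[R]_(N, P)) : set 'rV[R]_P :=
  [set v *m A | v in M].

Lemma mimg_submodule (R : comNzRingType) N P (M : set 'rV[R]_N) (A : 'M[R]_(N, P)) :
  submodule M -> submodule (mimg M A).
Proof.
move=> [M0 MD]; split=> [|a _ _ [u Mu <-] [v Mv <-]]; first by exists 0; rewrite // mul0mx.
by exists (a *: u + v); [exact: MD|rewrite mulmxDl scalemxAl].
Qed.

Lemma mimg_ext O (R S : calg O) (f : ahom R S) N P (M : set 'rV[R]_N) (A : 'M[R]_(N, P)) :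
  ext f (mimg M A) = mimg (ext f M) (map_mx f A).
Proof.
rewrite eqEsubset; split.
  apply: ext_ind => [|_ [v Mv <-]]; first exact/mimg_submodule/submodule_ext.
  by exists (map_mx f v); [exact: ext_in|rewrite map_mxM].
move=> _ [v Mv <-]; move: v Mv; apply: ext_mulmx => v Mv.
by exists v.
Qed.

Lemma mimg_summand (R : comNzRingType) N P r (G M : set 'rV[R]_N) (A : 'M[R]_(N, P))
    (B : 'M[R]_(P, N)) : (forall x, M x -> x *m A *m B = x) ->
  free_summand r G M -> free_summand r (mimg G A) (mimg M A).
Proof.
move=> AB [[a [ai GE]] [K [sK GK ME]]].
have K0 : K 0 by case: sK.
have G0 : G 0 by rewrite GE; exists 0; rewrite // mul0mx.
have GM x : G x -> M x by move=> Gx; rewrite ME; exists x => //; exists 0; rewrite // addr0.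
have KM x : K x -> M x by move=> Kx; rewrite ME; exists 0 => //; exists x; rewrite // add0r.
split.
  exists (a *m A); split.
    move=> u; rewrite mulmxA => u0; apply: ai.
    have Gu : G (u *m a) by rewrite GE; exists u.
    by rewrite -(AB _ (GM _ Gu)) u0 mul0mx.
  rewrite eqEsubset; split=> [_ [x Gx <-]|_ [u _ <-]].
    by move: Gx; rewrite GE => -[u _ <-]; exists u; rewrite // mulmxA.
  by exists (u *m a); rewrite ?mulmxA // GE; exists u.
exists (mimg K A); split; first exact: mimg_submodule.
  move=> _ [x Gx <-] [y Ky] e.
  have xy : y = x by rewrite -(AB _ (KM _ Ky)) e (AB _ (GM _ Gx)).
  by rewrite (GK x) ?mul0mx // -xy.
rewrite eqEsubset; split=> [_ [x Mx <-]|_ [_ [x Gx <-]] [_ [y Ky <-]] <-].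
  move: Mx; rewrite {1}ME => -[u Gu [v Kv <-]].
  exists (u *m A); first by exists u.
  by exists (v *m A); [exists v|rewrite mulmxDl].
exists (x + y); last by rewrite mulmxDl.
by rewrite ME; exists x => //; exists y.
Qed.

Lemma mimg_loc O (R : calg O) N P r (G M : set 'rV[R]_N) (A : 'M[R]_(N, P)) (B : 'M[R]_(P, N)) :
  (forall x, M x -> x *m A *m B = x) ->
  loc_summand r G M -> loc_summand r (mimg G A) (mimg M A).
Proof.
move=> AB; apply: zl_mono => S f; rewrite !mimg_ext; apply: mimg_summand (map_mx f B) _.
apply: ext_ind => [|x Mx]; last by rewrite /= -!map_mxM AB.
split=> [|a x y /= xE yE]; first by rewrite /= !mul0mx.
by rewrite !mulmxDl -!scalemxAl xE yE.
Qed.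

Lemma castK (R : comNzRingType) p q (e : p = q) :
  castmx (erefl p, e) (1%:M : 'M[R]_p) *m castmx (e, erefl p) 1%:M = 1%:M /\
  castmx (e, erefl p) (1%:M : 'M[R]_p) *m castmx (erefl p, e) 1%:M = 1%:M.
Proof. by case: _ / e; rewrite !castmx_id mulmx1. Qed.
End Images.

Section Fiber.
Variable D : unitary_datum.
Local Notation n := (ud_n D).
Local Notation k := (ud_k D).
Local Notation N := (n.-1.+1).
Local Notation rho := (ud_res D).
Local Notation X := (base_change rho (Mspl D)).
Local Notation Z := (fiber (tau D) (star D)).
Local Notation Zk := (base_change_sub rho Z).
Local Notation PS := (projective_space k n.-1).

Lemma eN : N = n. Proof. exact/prednK/i0_lt. Qed.

(** On the center both modules are [Wst], the second half of the coordinates; [Ain] and [Bout]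
    identify it with the ambient module of projective space. The casts reflect that [n.-1.+1] and
    [n] are only propositionally equal. *)
Definition Ain (R : comNzRingType) : 'M[R]_(N, n + n) := row_mx 0 (castmx (erefl N, eN) 1%:M).
Definition Bout (R : comNzRingType) : 'M[R]_(n + n, N) := col_mx 0 (castmx (eN, erefl N) 1%:M).

Lemma AB (R : comNzRingType) : Ain R *m Bout R = 1%:M.
Proof. by rewrite mul_row_col mulmx0 add0r (castK R eN).1. Qed.
Lemma WstK (R : calg (OF D)) (v : 'rV[R]_(n + n)) : Wst v -> v *m Bout R *m Ain R = v.
Proof.
rewrite /Wst /= => v0; rewrite -[v]hsubmxK v0 mul_row_col mul0mx add0r mul_mx_row mulmx0.
by rewrite -mulmxA (castK R eN).2 mulmx1.
Qed.
Lemma Ain_Wst (R : calg (OF D)) (v : 'rV[R]_N) : @Wst D R (v *m Ain R).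
Proof. by rewrite /Wst /= mul_mx_row row_mxKl mulmx0. Qed.
Lemma Ain_map (R S : comNzRingType) (f : {rmorphism R -> S}) : map_mx f (Ain R) = Ain S.
Proof. by rewrite /Ain map_row_mx map_mx0 map_castmx map_mx1. Qed.
Lemma Bout_map (R S : comNzRingType) (f : {rmorphism R -> S}) : map_mx f (Bout R) = Bout S.
Proof. by rewrite /Bout map_col_mx map_mx0 map_castmx map_mx1. Qed.
Lemma Wst_img (R : calg (OF D)) : mimg (@Wst D R) (Bout R) = setT.
Proof.
rewrite eqEsubset; split=> // v _; exists (v *m Ain R); first exact: Ain_Wst.
by rewrite -mulmxA AB mulmx1.
Qed.
Lemma Ain_img (R : calg (OF D)) : mimg setT (Ain R) = @Wst D R.
Proof.
rewrite eqEsubset; split=> [_ [v _ <-]|v Wv]; first exact: Ain_Wst.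
by exists (v *m Bout R) => //; apply: WstK.
Qed.

(** An algebra over a [k]-algebra [R] is the same over [k] as over [O_F], so the two notions of
    Zariski localization agree. *)
Lemma loc_summand_restr r P (R : calg k) (G M : set 'rV[R]_P) :
  @loc_summand (OF D) (restr rho R) P r G M <-> loc_summand r G M.
Proof.
split=> -[s s1 H]; exists s => // f fs S g gf.
  exact: (H f fs (restr rho S) (restr_hom rho g) gf).
pose T := @Calg k S (g \o calg_str R).
pose h := @AHom k R T (ahom_fun g) (ahom_zmod g) (ahom_monoid g) (fun=> erefl).
exact: (H f fs T h gf).
Qed.

Lemma pi_restr (R : calg k) : piR (restr rho R) = 0.
Proof.
have r0 : rho (ud_pi D) = 0 by apply/OF_res_ker; exists 1; rewrite mul1r.
by rewrite /piR /= r0 rmorph0.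
Qed.

Lemma Z_Wst (R : calg (OF D)) (x : Mspl D R) : Z R x ->
  sval (sval x).1.1 = @Wst D R /\ sval (sval x).1.2 = @Wst D R.
Proof.
move=> [f fE]; split.
  by rewrite -(star_ext f).1 -[RHS]/(sval (sval (fmap f (star D))).1) -fE.
by rewrite -(star_ext f).2 -[RHS]/(sval (sval (fmap f (star D))).2) -fE.
Qed.

(** When [pi = 0], both [t] and [pi] kill [Wst], so [G] may be any line in it: this is why the whole
    projective space appears. *)
Lemma Wst_splitting (R : calg (OF D)) (G : set 'rV[R]_(n + n)) : piR R = 0 -> submodule G ->
  G `<=` @Wst D R -> loc_summand 1 G (@Wst D R) -> splitting_cond (@Wst D R) G.
Proof.
move=> p0 sG GW lG; have t0 (v : 'rV[R]_(n + n)) : Wst v -> v *m tR (n - ud_l D) R = 0.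
  rewrite /Wst /= => v0; rewrite -[v]hsubmxK v0 tR_mul p0 expr0n /= scale0r row_mx0.
  by [].
split=> // v Wv; first by rewrite t0 // p0 scale0r addr0; apply: (submodule0 sG).
by rewrite t0 ?p0 ?scale0r ?subrr //; apply: GW.
Qed.

Definition res_hom (R : calg k) : ahom (residue_alg D) (restr rho R) :=
  @ahom_of _ (residue_alg D) (restr rho R) (calg_str R) (fun=> erefl).

Lemma toZ_subproof (R : calg k) (L : PS R) : Mspl_sub D (restr rho R)
  (sval (fmap (res_hom R) (star D)), exist _ (mimg (sval (sval L)) (Ain R))
     (mimg_submodule (Ain R) (svalP (sval L)))).
Proof.
split; first exact: (svalP (fmap (res_hom R) (star D))).
suff H : splitting_cond (@Wst D (restr rho R)) (mimg (sval (sval L)) (Ain R)).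
  by rewrite -(star_ext (res_hom R)).2 in H; exact: H.
apply: Wst_splitting; [exact: pi_restr|exact: mimg_submodule (svalP (sval L))| |].
  by move=> _ [v _ <-]; apply: (@Ain_Wst (restr rho R)).
rewrite -(@Ain_img (restr rho R)).
apply: (@mimg_loc (OF D) (restr rho R) _ _ 1 _ setT (Ain (restr rho R)) (Bout (restr rho R))).
  by move=> x _; rewrite -mulmxA AB mulmx1.
by apply/loc_summand_restr; apply: (svalP L).
Qed.

Definition toM (R : calg k) (L : PS R) : X R := exist _ _ (toZ_subproof L).
Lemma toM_Z (R : calg k) (L : PS R) : Zk R (toM L).
Proof. by exists (res_hom R); apply: sub_eq. Qed.

Definition toZ : morphism PS (sub_functor Zk).
Proof.
exists (fun (R : calg k) (L : PS R) => exist _ (toM L) (toM_Z L)) => R S g L.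
apply: sub_eq; apply: sub_eq; congr (_, _).
  rewrite -[RHS]/(sval (fmap (restr_hom rho g) (fmap (res_hom R) (star D)))) -fmap_comp.
  have <- : res_hom S = ahom_comp (restr_hom rho g) (res_hom R).
    by apply: ahom_eq => a; rewrite /= ahom_str.
  by [].
apply: submods_eq; rewrite /= -(Ain_map g) -mimg_ext.
by [].
Defined.

Lemma toP_subproof (R : calg k) (x : sub_functor Zk R) :
  @loc_summand k R N 1 (mimg (sval (sval (sval x)).2) (Bout R)) setT.
Proof.
case: x => x /= /Z_Wst[_ eFn]; have [_ [_ lG _ _]] := svalP x; rewrite /= eFn in lG.
apply/loc_summand_restr; rewrite -(@Wst_img (restr rho R)).
apply: (@mimg_loc (OF D) (restr rho R) _ _ 1 _ (@Wst D (restr rho R)) (Bout (restr rho R))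
  (Ain (restr rho R))) lG => v; exact: WstK.
Qed.

Definition toP : morphism (sub_functor Zk) PS.
Proof.
exists (fun (R : calg k) (x : sub_functor Zk R) =>
  exist _ (exist _ _ (mimg_submodule (Bout R) (svalP (sval (sval x)).2))) (toP_subproof x)) => R S g x.
apply: sub_eq; apply: submods_eq; rewrite /= -(Bout_map g) -mimg_ext.
by [].
Defined.

Lemma toPK (R : calg k) (L : PS R) : toP R (toZ R L) = L.
Proof.
apply: sub_eq; apply: submods_eq; rewrite /= eqEsubset; split.
  by move=> _ [_ [v Lv <-] <-]; rewrite -mulmxA AB mulmx1.
by move=> v Lv; exists (v *m Ain R); [exists v|rewrite -mulmxA AB mulmx1].
Qed.

Lemma toZK (R : calg k) (x : sub_functor Zk R) : toZ R (toP R x) = x.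
Proof.
apply: sub_eq; apply: sub_eq; case: x => -[[[Fl0 Fn0] G0] xM] xZ /=.
have [e1 e2] := Z_Wst xZ; have [_ [GF _ _ _]] := xM; rewrite /= in e1 e2 GF.
have [s1 s2] := star_ext (res_hom R).
congr ((_, _), _); apply: submods_eq => /=.
- by rewrite e1 -s1.
- by rewrite e2 -s2.
have WK v : sval G0 v -> v *m Bout R *m Ain R = v.
  by move=> Gv; apply: (@WstK (restr rho R)); rewrite -e2; apply: GF.
rewrite eqEsubset; split=> [_ [_ [v Gv <-] <-]|v Gv]; first by rewrite WK.
by exists (v *m Bout R); [exists v|rewrite WK].
Qed.

Lemma Zk_smooth : smooth_over_base (sub_functor Zk).
Proof.
have [sP lP] := proj_smooth k n.-1; split; first exact: (scheme_iso toPK toZK sP).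
exact: (locally_on_iso toPK toZK lP).
Qed.

Lemma Zk_iso : isomorphic (sub_functor Zk) PS.
Proof. by exists toP, toZ; split; [exact: toZK|exact: toPK]. Qed.

Lemma Zk_closed : is_closed Zk.
Proof.
move=> R x; have [iI H] := Z_cuts (x : Mspl D (restr rho R)); eexists; split; first exact: iI.
by move=> S g; apply: (H (restr rho S) (restr_hom rho g)).
Qed.

(** The generic point of projective space, moved to the fiber by [toZ], lies in every open set that
    meets the fiber. *)
Lemma Zk_irreducible : irreducible_sub Zk.
Proof.
have [K [eta [fK etaP]]] := proj_generic k n.-1.
have eZ : Zk K (sval (toZ K eta)) := svalP (toZ K eta).
have key (U : subfunctor X) : is_open U -> meets U Zk -> U K (sval (toZ K eta)).
  move=> oU [L [x [fL Ux Zx]]].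
  have oP : is_open (preim toZ (preim (Morphism (X := sub_functor Zk) (Y := X)
      (mor_fun := fun R y => sval y) (fun _ _ _ _ => erefl)) U)).
    by do 2!apply: open_preim.
  apply: (etaP _ oP L (toP L (exist _ x Zx)) fL).
  by rewrite /= -/(toZ L _) -[toM _]/(sval (toZ L (toP L (exist _ x Zx)))) toZK.
by split=> [|U1 U2 o1 o2 m1 m2]; exists K, (sval (toZ K eta)); split=> //; split; apply: key.
Qed.

(** Over [pi = 0], if [h] is nonzero, [dataV] makes [g_M] a multiple of [h], and [core] gives
    [frm g h = 0]; hence [Q(g) = 0]. Off the center, [Q] therefore vanishes on [G] throughout the
    special fiber. *)
Lemma special_q (L : calg (OF D)) (x : Mspl D L) v v' : is_field L -> piR L = 0 ->
  sval (sval x).2 v -> sval (sval x).2 v' ->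
  frm (rsubmx v *m DM D L) (rsubmx v') != 0 -> Z L x.
Proof.
move=> fL p0 Gv Gv' vv.
have pi0 : is_prime [set a : L | ahom_id L a = 0] := isf_kernel (ahom_id L) fL.
have [f f0 H] := (zar_primes _).1 (Mspl_raw3 x) _ pi0.
have [|g [lam [h [[[ug uh E0] V U] xE]]]] := H L (ahom_id L).
  by apply: fL; apply/eqP => e; apply: f0.
rewrite fmap_id in xE.
have qg : qf g != 0.
  have GE : sval (sval x).2 = Gg g by rewrite xE.
  move: Gv Gv' vv; rewrite GE => -[s _ <-] [s' _ <-].
  rewrite !linearZ /= !row_mxKr -scalemxAl frmZl frmZr -/(qf g).
  by apply: contraNneq => ->; rewrite !mulr0.
have h0 : h = 0.
  apply: contrapT => hn.
  have uvh : unimv h.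
    have [i hi] : exists i, h 0 i != 0.
      apply/existsP; apply: contraT; rewrite negb_exists => /forallP h0; case: hn.
      by apply/rowP=> j; rewrite mxE; apply/eqP; rewrite -[_ == _]negbK h0.
    have [c cE] := fL _ hi; exists (c *: delta_mx 0 i).
    by rewrite dotZl dotC dot_delta mulrC.
  have [y1 y1E] := unimv_frm ug; have [y0 y0E] := unimv_frmr uvh.
  have [|s [s1 _]] := U 1 (lam *: y1); first by rewrite frmZr y1E mulr1 mul1r.
  rewrite p0 scale0r addr0 scale1r in s1.
  have sM : s *: (g *m DM D L) = 0.
    have := congr1 (mulmx^~ (DM D L)) s1.
    by rewrite /= mulNmx -!scalemxAl DOM0 oppr0.
  have s0 : s = 0.
    have [c cE] := fL _ qg; apply: (inv_cancelr (u := qf g)); first by exists c.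
    by rewrite mul0r /qf -frmZl sM frm0l.
  have hO : h *m DO D L = 0.
    by move/eqP: s1; rewrite s0 scale0r eq_sym oppr_eq0 => /eqP.
  have [|r [r1 _]] := V 1 (- (lam *: y0)).
    by rewrite mul1r frmNl frmZl y0E mulr1 subrr.
  rewrite p0 scale0r addr0 scale1r in r1.
  case/eqP: qg; rewrite /qf.
  have -> : frm (g *m DM D L) g = frm g (g *m DM D L) by rewrite frm_Ml.
  rewrite -r1 frmNr frmZr; move: E0; rewrite p0 mulr0 mul0r add0r => ->.
  by rewrite mulr0 oppr0.
apply/Z_iff => w; rewrite xE => Fw.
have [s ->] : exists s, zc w = s *: h by apply/(zcP lam h _ ug); exists w.
by rewrite h0 scaler0.
Qed.

(** Non-membership over a single algebra is not stable under base change; avoiding [W] after every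
    base change is. *)
Definition compl O (Y : functor O) (W : subfunctor Y) : subfunctor Y.
Proof.
exists (fun R x => forall S (g : ahom R S), ~ W S (fmap g x)) => R S g x H T h.
by rewrite -fmap_comp; apply: H.
Defined.

Lemma compl_open O (Y : functor O) (W : subfunctor Y) : is_closed W -> is_open (compl W).
Proof.
move=> cW R x; have [I [iI H]] := cW R x; exists I; split=> // S g; split=> [C|J1 T h].
  apply: contrapT => n1.
  have [B [f [fs fk]]] := quotient_exists (span_ideal (g @` I)) n1.
  pose BA := @Calg O B (f \o calg_str S); pose fh := @ahom_of O S BA f (fun=> erefl).
  apply: (C BA fh); rewrite -fmap_comp; apply/H => a Ia /=.
  by apply/fk; apply: span_sub; exists a.
rewrite -fmap_comp => /H hI.
have /= : [set b | h b = 0] 1.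
  apply: (span_min _ _ J1); first exact: (preim_ideal h (ideal_zero T)).
  by move=> _ [a Ia <-]; apply: hI.
by rewrite rmorph1 => /eqP; rewrite oner_eq0.
Qed.

Lemma field_closed O (Y : functor O) (W : subfunctor Y) (L S : calg O) (g : ahom L S) x :
  is_closed W -> is_field L -> W S (fmap g x) -> W L x.
Proof.
move=> cW fL; have [I [iI H]] := cW L x; move=> /H gI.
rewrite -[x]fmap_id; apply/H => a Ia; apply/eqP; apply: contraT => a0.
have [b ab] := fL a a0; have := oner_neq0 S.
by rewrite -(rmorph1 g) -ab rmorphM /= gI // mul0r eqxx.
Qed.

Let bq (R : calg k) : 'M[R]_(n + n) := block_mx 0 0 0 (DM D R *m Jm D R).
Let bq_map (R S : calg k) (f : ahom R S) : map_mx f (bq R) = bq S.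
Proof. by rewrite /bq map_block_mx !map_mx0 map_mxM map_DM map_J. Qed.
Let GM (R : calg k) (x : X R) : set 'rV[R]_(n + n) := sval (sval x).2.
Let GME (R S : calg k) (f : ahom R S) x : GM (fmap f x) = ext f (GM x). Proof. by []. Qed.
Let bqE (R : calg k) (v v' : 'rV[R]_(n + n)) :
  (v *m bq R *m v'^T) 0 0 = frm (rsubmx v *m DM D R) (rsubmx v').
Proof.
rewrite -{1}[v]hsubmxK -{1}[v']hsubmxK /bq mul_row_block !mulmx0 !add0r tr_row_mx mul_row_col.
by rewrite mul0mx add0r mulmxA.
Qed.

(** By [special_q] the complement of the center is disjoint from the open set where [Q] does not
    vanish on [G]. A larger irreducible closed set would meet both, since the center already meets
    the second. *)
Lemma Zk_component : irreducible_component Zk.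
Proof.
split; [exact: Zk_closed|exact: Zk_irreducible|].
move=> Z' cZ' [_ irr] sub L x fL Zx; apply: contrapT => nZ.
pose U := bil_open GME GME bq_map.
have oU : is_open U by apply: bil_openP.
have m1 : meets (compl Zk) Z'.
  by exists L, x; split=> // S g; apply: contra_not nZ; apply: field_closed Zk_closed fL.
have m2 : meets U Z'.
  pose KK := @Calg k k idfun; pose R := restr rho KK.
  have [b [mb rb]] : exists b : 'I_n, midb b /\ rev_ord b != b.
    have [l0 ln] := l_bounds D; have nl : (ud_l D < n)%N by lia.
    exists (Ordinal nl); split; first by rewrite /midb /=; lia.
    by apply/negP => /eqP/(congr1 val)/=; lia.
  (* For the sum of a hyperbolic pair [Q(g) = -2], a unit, so this point of the center lies in
     [U]. *)
  pose g : 'rV[R]_n := delta_mx 0 b + delta_mx 0 (rev_ord b).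
  have mr : midb (rev_ord b) by rewrite midb_rev.
  have gb : g 0 b = 1 by rewrite !mxE !eqxx /= eq_sym (negPf rb) addr0.
  have gr : g 0 (rev_ord b) = 1 by rewrite !mxE !eqxx /= (negPf rb) add0r.
  have ug : unimv g by exists (delta_mx 0 b); rewrite dotC dot_delta.
  have sp := spl_h0 (pi_restr KK) ug.
  pose y : X KK := exist _ (raw3 g 1 0) (raw3_Mspl sp).
  have fk : is_field KK := @field_isf k.
  have Zy : Zk KK y.
    apply/(Z_iff (y : Mspl D R)) => v Fv.
    have [s ->] : exists s, zc v = s *: 0 by apply/(zcP 1 0 _ ug); exists v.
    by rewrite scaler0.
  exists KK, y; split=> //; last exact: sub.
  have qE : frm (g *m DM D R) g = - 2.
    rewrite /g mulmxDl !delta_mid // -/g {2}/g frmDr !frm_delta // rev_ordK gb gr.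
    by ring.
  have Gy : GM y (row_mx (piR R *: g) g) by exists 1; rewrite ?scale1r.
  have [c cE] := inv2 R.
  have /(idealM_l (- c) (span_ideal _)) : ideal_span (bval GM GM bq y) (- 2).
    apply: span_sub; exists (row_mx (piR R *: g) g), (row_mx (piR R *: g) g).
    by split=> //; rewrite bqE row_mxKr -qE.
  by rewrite mulrNN mulrC cE.
have [L' [y [fL' [Cy Uy] _]]] := irr _ _ (compl_open Zk_closed) oU m1 m2.
apply: (Cy L' (ahom_id L')); rewrite fmap_id.
apply: contrapT => nZy; have := oner_neq0 L'; apply/negP; rewrite negbK; apply/eqP.
apply: (span_min (ideal_zero L') _ Uy) => _ [v [v' [Gv Gv' ->]]].
rewrite /= bqE; apply/eqP; apply: contraT => vv; case: nZy.
exact: (special_q (x := y) fL' (pi_restr L') Gv Gv' vv).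
Qed.
End Fiber.

(** * Uniqueness of the blow-up *)

Section Conclusion.
Variable D : unitary_datum.
Local Notation Z := (fiber (tau D) (star D)).

Lemma uxy_exists : exists Q : calg (OF D), presents Q [:: uxy_rel D].
Proof.
pose OO := @Calg (OF D) (OF D) idfun.
(* The solution [(2 pi, 1, 1)] shows that the relation does not define the zero ring. *)
apply: (@presents_exists _ _ _ OO (fun i => if i == 0 then 2 * ud_pi D else 1)) => p.
rewrite inE => /eqP ->; rewrite /uxy_rel mmap_uxy /= !mulr1.
by rewrite subrr.
Qed.

Section WithQ.
Variable Q : calg (OF D).
Hypothesis presQ : presents Q [:: uxy_rel D].

Lemma Bf_scheme : is_scheme (Bf D).
Proof.
split; first exact: Bf_sheaf.
by move=> L x fL _; have [A [u [f [ao fE _]]]] := B_charts presQ x fL; exists A, u, f.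
Qed.

Lemma Bf_good : locally_on (fun A (_ : Bf D A) => goodD Q A).
Proof.
by move=> L x fL _; have [A [u [f [ao fE [gA _]]]]] := B_charts presQ x fL; exists A, u, f.
Qed.

Lemma Bf_blowup : is_blowup Z (bmor D).
Proof.
split; first exact: Bf_scheme.
  by move=> L x fL _; have [A [u [f [ao fE [_ cA]]]]] := B_charts presQ x fL; exists A, u, f.
move=> Y f [shY _] cY; apply: (@lift_exists _ Y (Bf D) (Mspl D) (bmor D) f Z).
- exact: Bf_sheaf.
- exact: Mspl_sheaf.
- move=> L x fL _; have [A [u [h [ao hE [d nd [iI cd]]]]]] := cY L x fL I.
  exists A, u, h; split=> //; exists d => //; split=> // S g.
  by rewrite -mor_nat; apply: cd.
- exact: lift_ex.
exact: lift_uq.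
Qed.
End WithQ.

Definition mcomp O (X Y W : functor O) (g : morphism Y W) (f : morphism X Y) : morphism X W.
Proof. by exists (fun R x => g R (f R x)) => R S h x; rewrite !mor_nat. Defined.

Lemma blowup_unique O (M X1 X2 : functor O) (W : subfunctor M) (b1 : morphism X1 M)
    (b2 : morphism X2 M) : is_blowup W b1 -> is_blowup W b2 ->
  exists (f : morphism X1 X2) (g : morphism X2 X1),
    (forall R (x : X1 R), g R (f R x) = x) /\ (forall R (y : X2 R), f R (g R y) = y).
Proof.
move=> [s1 c1 u1] [s2 c2 u2].
have [f [fE _]] := u2 X1 b1 s1 c1; have [g [gE _]] := u1 X2 b2 s2 c2.
pose idm (Y : functor O) : morphism Y Y := Morphism (mor_fun := fun R (y : Y R) => y)
  (fun _ _ _ _ => erefl).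
exists f, g; split=> R x.
  have [h [_ hU]] := u1 X1 b1 s1 c1.
  have e1 : mcomp g f R x = h R x by apply: hU => S y; rewrite /= gE fE.
  have e2 : idm X1 R x = h R x by apply: hU.
  by rewrite -[LHS]/(mcomp g f R x) e1 -e2.
have [h [_ hU]] := u2 X2 b2 s2 c2.
have e1 : mcomp f g R x = h R x by apply: hU => S y; rewrite /= fE gE.
have e2 : idm X2 R x = h R x by apply: hU.
by rewrite -[LHS]/(mcomp f g R x) e1 -e2.
Qed.
End Conclusion.

Theorem theorem1p4 (D : unitary_datum) :
  exists star : Mwedge D (residue_alg D),
    is_worst star /\
    let Z := fiber (tau D) star in
    let Zk := base_change_sub (ud_res D) Z in
    [/\ smooth_over_base (sub_functor Zk),
        irreducible_component Zk,
        isomorphic (sub_functor Zk) (projective_space (ud_k D) (ud_n D).-1),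
        (exists (Mbl : functor (OF D)) (b : morphism Mbl (Mspl D)), is_blowup Z b)
      & forall (Mbl : functor (OF D)) (b : morphism Mbl (Mspl D)),
          is_blowup Z b ->
          [/\ regular_scheme Mbl,
              normal_crossings (vanishing Mbl (ud_pi D))
            & exists Q : calg (OF D),
                presents Q [:: uxy_rel D] /\ covered_by_smooth_over Mbl (Spec Q)]].
Proof.
exists (star D); split; first exact: star_worst.
have [Q presQ] := uxy_exists D; have bB := Bf_blowup presQ.
split; [exact: Zk_smooth|exact: Zk_component|exact: Zk_iso|by exists (Bf D), (bmor D)|].
(* By its universal property every blow-up is isomorphic to [Bf D], and good charts are carried over
   by the isomorphism. *)
move=> Mbl b bl; have [f [g [gf fg]]] := blowup_unique bB bl.
have gM := locally_on_iso gf fg (Bf_good presQ).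
have sM : is_scheme Mbl by case: bl.
split; [exact: (good_regular_scheme sM gM)|exact: (good_normal_crossings (@OF_two D) sM gM)|].
by exists Q; split=> //; exact: (good_covered gM).
Qed.
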